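(* Let $a,b\in\mathbb R$ with $a<b$. As $q\to\infty$ through primes, $$\mu_{\mathcal W}\bigg(\bigg\{\chi\,(\mathrm{mod}\,q),\ \chi\ne\chi_0:\ \frac{\log|L(\tfrac12,\chi)|}{\sqrt{\tfrac12\log\log q}}\in(a,b)\bigg\}\bigg)=\frac1{\sqrt{2\pi}}\int_a^b e^{-u^2/2}\,du+o(1).$$
   Context: $q$ is a prime tending to infinity, and $\sum^*$ denotes summation over primitive Dirichlet characters $\chi\neq\chi_0$ modulo $q$. $L(s,\chi)$ is the Dirichlet $L$-function; $\log|0|=-\infty$, which lies in no interval. Mollifier. Let $\Omega(n)=\sum_{p^a\| n}a$, let $\lambda(n)=(-1)^{\Omega(n)}$ be the Liouville function, and let $\nu$ be the multiplicative function with $\nu(p^a)=1/a!$. Let $c_0$ be a fixed, sufficiently large constant and let $\eta>0$ be a sufficiently small constant. For $0\le j\le J$ let $\theta_j=\eta\, e^j/(\log\log q)^5$ and $\ell_j=2\lfloor\theta_j^{-3/4}\rfloor$, where the integer $J$ is chosen so that $\eta\le\theta_J\le e\eta$. Let $y=q^{\theta_0}$, $I_0=(c_0,y]$ and $I_j=(q^{\theta_{j-1}},q^{\theta_j}]$ for $1\le j\le J$. Define $$\mathcal M_j(\chi)=\sum_{\substack{p\mid n\Rightarrow p\in I_j\\ \Omega(n)\le\ell_j}}\frac{\lambda(n)\nu(n)\chi(n)}{\sqrt n},\qquad \mathcal M(\chi)=\prod_{j=0}^J\mathcal M_j(\chi).$$ Weighted measure. Let $\mathcal W(\chi)=L(\tfrac12,\chi)\mathcal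 M(\chi)$, $\varphi^\star_{\mathcal W}(q)=\sum^*_{\chi\,(\mathrm{mod}\,q)}\mathcal W(\chi)$, and for a set $S$ of characters modulo $q$ let $\mu_{\mathcal W}(S)=\frac1{\varphi^\star_{\mathcal W}(q)}\sum^*_{\chi\in S}\mathcal W(\chi)$ (a complex measure). *)

(* Defs.v *)
From HB Require Import structures.
From mathcomp Require Import all_boot all_order all_algebra.
From mathcomp Require Import all_classical all_reals all_analysis.
From mathcomp Require Import complex.

Set Implicit Arguments.
Unset Strict Implicit.
Unset Printing Implicit Defensive.

Import Order.TTheory GRing.Theory Num.Theory.
Import numFieldNormedType.Exports.

Local Open Scope classical_set_scope.
Local Open Scope ring_scope.
Local Open Scope complex_scope.

Definition is_dirichlet_character (R : realType) (q : nat) (chi : int -> R[i])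
    : Prop :=
  [/\ chi 1 = 1,
      forall m n : int, chi (m * n) = chi m * chi n,
      forall n : int, chi (n + q%:Z) = chi n
    & forall n : int, chi n != 0 <-> coprimez n q%:Z].

Definition principal_character (R : realType) (q : nat) : int -> R[i] :=
  fun n => (coprimez n q%:Z)%:R.

Definition is_primitive (R : realType) (q : nat) (chi : int -> R[i]) : Prop :=
  is_dirichlet_character q chi /\
  forall (d : nat) (psi : int -> R[i]), (d %| q)%N -> (d < q)%N ->
    is_dirichlet_character d psi ->
    ~ (forall n : int, coprimez n q%:Z -> chi n = psi n).

(* The second clause only matters for [q <= 1]. *)
Definition primitive_characters (R : realType) (q : nat) : set (int -> R[i]) :=
  [set chi | is_primitive q chi /\ chi <> principal_character R q].

(* [n ^ s = exp (s * ln n)] for [0 < n]. *)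
Definition natpowC (R : realType) (n : nat) (s : R[i]) : R[i] :=
  (n%:R `^ complex.Re s)%:C *
  (cos (complex.Im s * ln n%:R) +i* sin (complex.Im s * ln n%:R)).

(* For [chi] nonprincipal the Dirichlet series converges (conditionally if
   [Re s <= 1]) to the L-function on the whole half-plane [Re s > 0]; the value
   of [lim] is not meaningful outside the region of convergence. The cast to
   [R[i]^o] selects the topology of the complex norm. *)
Definition dirichlet_L (R : realType) (s : R[i]) (chi : int -> R[i]) : R[i] :=
  lim ((\sum_(1 <= n < N) chi n%:Z * natpowC n (- s) : R[i]^o) @[N --> \oo]).

Definition prime_Omega (n : nat) : nat := (\sum_(p <- primes n) logn p n)%N.

Definition liouville (R : realType) (n : nat) : R := (-1) ^+ prime_Omega n.

Definition nu (R : realType) (n : nat) : R :=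
  \prod_(p <- primes n) ((logn p n)`!)%:R^-1.

Definition theta (R : realType) (eta : R) (q j : nat) : R :=
  eta * expR j%:R / ln (ln q%:R) ^+ 5.

(* A real power is nonnegative, so [Num.truncn] is the floor. *)
Definition ell (R : realType) (eta : R) (q j : nat) : nat :=
  (2 * Num.truncn (theta eta q j `^ (- (3 / 4))))%N.

Definition prime_range (R : realType) (c0 eta : R) (q j : nat) : set R :=
  if j is i.+1 then [set` `]q%:R `^ theta eta q i, q%:R `^ theta eta q j]]
  else [set` `]c0, q%:R `^ theta eta q 0]].

Definition mollifier_support (R : realType) (c0 eta : R) (q j : nat) : set nat :=
  [set n | [/\ (0 < n)%N,
               forall p, prime p -> (p %| n)%N -> prime_range c0 eta q j p%:R
             & (prime_Omega n <= ell eta q j)%N]].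

(* [mollifier_support] is finite, as is [primitive_characters q] for [0 < q], so
   the finitely supported sums below are genuine sums. *)
Definition mollifier_factor (R : realType) (c0 eta : R) (q j : nat)
    (chi : int -> R[i]) : R[i] :=
  \sum_(n \in mollifier_support c0 eta q j)
    (liouville R n * nu R n / Num.sqrt n%:R)%:C * chi n%:Z.

Definition mollifier (R : realType) (c0 eta : R) (q J : nat)
    (chi : int -> R[i]) : R[i] :=
  \prod_(0 <= j < J.+1) mollifier_factor c0 eta q j chi.

Definition weight (R : realType) (c0 eta : R) (q J : nat) (chi : int -> R[i])
    : R[i] :=
  dirichlet_L 2^-1 chi * mollifier c0 eta q J chi.

Definition total_weight (R : realType) (c0 eta : R) (q J : nat) : R[i] :=
  \sum_(chi \in primitive_characters q) weight c0 eta q J chi.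

Definition weighted_measure (R : realType) (c0 eta : R) (q J : nat)
    (S : set (int -> R[i])) : R[i] :=
  (total_weight c0 eta q J)^-1 *
  \sum_(chi \in primitive_characters q `&` S) weight c0 eta q J chi.

(* [lne 0 = -oo], so a character with [L(1/2, chi) = 0] is excluded. *)
Definition central_value_event (R : realType) (q : nat) (a b : R)
    : set (int -> R[i]) :=
  [set chi | [/\ is_dirichlet_character q chi,
    chi <> principal_character R q
  & let x := (lne (ComplexField.Normc.normc (dirichlet_L 2^-1 chi))%:E *
              ((Num.sqrt (ln (ln q%:R) / 2))^-1)%:E)%E in
    (a%:E < x < b%:E)%E]].

Definition primes_to_infinity : set_system nat :=
  within [set q | prime q] \oo.

(* Main.v *)
(* Write lambda = log log q, sigma^2 = lambda/2 and P(chi) = sum of chi(p)/sqrt p over the primes p in I_0.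
   The weight is nearly independent of P: opening M_0 and using the first moment of L(1/2, chi) twisted by
   short Dirichlet polynomials, the off-diagonal terms telescope against the mollifier, so the moments of
   Re P / sigma weighted by W agree in the limit with the unweighted ones, which are Gaussian by orthogonality.
   Convergence of moments is transferred to intervals by polynomial approximation in the Gaussian L^2 norm; only
   E|W|^2 = O(1) is needed to control the complex weight, and this is the mollified second moment.
   Finally log|L| is close to Re P off a set of small |W|-mass: M_0 is a truncated exponential of -P, so that
   log|M_0| = -Re P + O(1) unless |P| is huge, while |W| and |M_1 ... M_J| lie in [exp(-delta), exp(delta)] off a
   set of mass exp(-delta) lambda^O(1), where delta is a small multiple of sigma.
   The twisted moments are reduced to correlations of the Hurwitz zeta function at 1/2 along residue classes. *)
Require Import Defs.
From HB Require Import structures.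
From mathcomp Require Import all_boot all_order all_algebra.
From mathcomp Require Import all_classical all_reals all_analysis.
From mathcomp Require Import complex.
From mathcomp Require Import measurable_realfun.
From mathcomp Require cyclic finfield separable cyclotomic.
From mathcomp Require Import ring lra zify.
Set Implicit Arguments.
Unset Strict Implicit.
Unset Printing Implicit Defensive.
Import Order.TTheory GRing.Theory Num.Theory.
Import numFieldNormedType.Exports.
Local Open Scope classical_set_scope.
Local Open Scope ring_scope.
Local Open Scope complex_scope.

Local Open Scope complex_scope.

(** For nonprincipal [chi], [L(1/2, chi)] is [q^(-1/2)] times the sum of [chi(a) zeta(1/2, a/q)]
    over residues [a]. Orthogonality then evaluates both twisted moments exactly, without a
    functional equation: the first is one Hurwitz value, the second a correlation of
    [zeta(1/2, {ht/q})] and [zeta(1/2, {kt/q})] over [t]. On the finer grid of [hkq] points the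
    distribution relation gives this correlation in closed form. Returning to [q] points costs a
    total variation, which is [O(q^(-1/2))] for fixed [h], [k], except for the one pair of
    translates with a common singularity; that pair yields [- ln (hk)]. The main term then factors
    over primes, so that bounds for local factors suffice. The off-diagonal of the weighted moments
    is small because the sum of [(-1)^a / a!] over [a <= v] vanishes at [v = 1]: only quotients in
    which every prime occurs at least twice survive. The weight is complex, so its real and
    imaginary parts are treated separately, with limiting total masses 1 and 0. Averages include the
    principal character, where the finite sum still makes sense; the mean square shows its share to
    be negligible. *)

Lemma exists_prim_root (F : closedFieldType) n :
  n%:R != 0 :> F -> exists z : F, n.-primitive_root z.
Proof.
move=> nF; have n0 : (0 < n)%N by case: n nF => [|//]; rewrite eqxx.
have [r rE] := closed_field_poly_normal ('X^n - 1 : {poly F}).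
have mon : ('X^n - 1 : {poly F}) \is monic by rewrite monicXnsubC.
rewrite (monicP mon) scale1r in rE.
have ur : uniq r by rewrite -separable.separable_prod_XsubC -rE cyclotomic.separable_Xn_sub_1.
have sr : size r = n.
  by have := congr1 (fun p : {poly F} => size p) rE; rewrite size_XnsubC // size_prod_XsubC => -[].
have /hasP[z _ zn] : has n.-primitive_root r.
  apply: cyclic.has_prim_root => //; last by rewrite sr.
  by apply/allP => z zr; rewrite /root_of_unity rE root_prod_XsubC.
by exists z.
Qed.

Lemma exists_Fp_prim_root q : prime q -> exists g : 'F_q, q.-1.-primitive_root g.
Proof.
move=> pq; have q1 : (0 < q.-1)%N by have := prime_gt1 pq; lia.
have fermat (x : 'F_q) : x != 0 -> x ^+ q.-1 = 1.
  move=> x0; apply: (mulfI x0); rewrite mulr1 -exprS prednK ?prime_gt0 //.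
  by rewrite -[in X in x ^+ X](card_Fp pq) finfield.expf_card.
have /hasP[z _ zn] : has q.-1.-primitive_root (enum (predC1 (0 : 'F_q))).
  apply: cyclic.has_prim_root => //.
  - by apply/allP => x; rewrite mem_enum inE => /fermat x1; rewrite unity_rootE x1.
  - exact: enum_uniq.
  - by rewrite -cardE cardC1 card_Fp.
by exists z.
Qed.

(** * Dirichlet characters to a prime modulus *)

Section Characters.
Variables (R : realType) (q : nat).
Hypothesis pq : prime q.
Let q1 : (0 < q.-1)%N. Proof. have := prime_gt1 pq; lia. Qed.
Let qF : (q%:R : 'F_q) = 0. Proof. exact: pchar_Fp_0. Qed.

Fact char_root_spec : {z : R[i] | q.-1.-primitive_root z}.
Proof. by apply: cid; apply: exists_prim_root; rewrite pnatr_eq0 -lt0n. Qed.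
Fact unit_root_spec : {g : 'F_q | q.-1.-primitive_root g}.
Proof. by apply: cid; exact: exists_Fp_prim_root. Qed.
Let z := sval char_root_spec.
Let g := sval unit_root_spec.
Let zP : q.-1.-primitive_root z := svalP char_root_spec.
Let gP : q.-1.-primitive_root g := svalP unit_root_spec.

Definition dlog (x : 'F_q) : nat :=
  if [pick i : 'I_q.-1 | g ^+ i == x] is Some i then i else 0.

(** Sends the generator [g] to [z ^+ k]. The characters are thus numbered by [k < q.-1], so that an
    average over characters is a sum over ordinals; [k = 0] is the principal one. *)
Definition fchar (k : nat) (x : 'F_q) : R[i] :=
  if x == 0 then 0 else z ^+ (k * dlog x).

Definition dchar (k : nat) (n : int) : R[i] := fchar k n%:~R.

Let g0 : g != 0. Proof. by rewrite (prim_root_eq0 gP) -lt0n. Qed.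

Lemma dlogK (x : 'F_q) : x != 0 -> g ^+ dlog x = x.
Proof.
move=> x0; rewrite /dlog; case: pickP => [i /eqP //|H].
have [i xi] : exists i : 'I_q.-1, x = g ^+ i.
  have /(prim_rootP gP)[i ->] : x ^+ q.-1 = 1; last by exists i.
  apply: (mulfI x0); rewrite mulr1 -exprS prednK ?prime_gt0 //.
  by rewrite -[in X in x ^+ X](card_Fp pq) finfield.expf_card.
by have := H i; rewrite xi eqxx.
Qed.

Lemma fcharE k i : fchar k (g ^+ i) = z ^+ (k * i).
Proof.
rewrite /fchar expf_eq0 (negbTE g0) andbF.
apply/eqP; rewrite (eq_prim_root_expr zP) -modnMmr -[in X in _ == X]modnMmr; apply/eqP; congr (_ * _ %% _)%N.
by apply/eqP; rewrite -(eq_prim_root_expr gP) dlogK // expf_neq0.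
Qed.

Lemma fchar0 k : fchar k 0 = 0. Proof. by rewrite /fchar eqxx. Qed.

Lemma fchar1 k : fchar k 1 = 1.
Proof. by rewrite -(expr0 g) fcharE muln0 expr0. Qed.

Lemma fcharM k x y : fchar k (x * y) = fchar k x * fchar k y.
Proof.
have [->|x0] := eqVneq x 0; first by rewrite mul0r fchar0 mul0r.
have [->|y0] := eqVneq y 0; first by rewrite mulr0 fchar0 mulr0.
by rewrite -(dlogK x0) -(dlogK y0) -exprD !fcharE mulnDr exprD.
Qed.

Lemma fchar_eq0 k x : (fchar k x == 0) = (x == 0).
Proof.
have [->|x0] := eqVneq x 0; first by rewrite fchar0 eqxx.
by rewrite /fchar (negbTE x0) expf_eq0 (prim_root_eq0 zP) (gtn_eqF q1) andbF.
Qed.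

Lemma fchar_norm k x : x != 0 -> `|fchar k x| = 1.
Proof.
move=> x0; rewrite -(dlogK x0) fcharE normrX.
have : `|z| ^+ q.-1 = 1 by rewrite -normrX (prim_expr_order zP) normr1.
by move/eqP; rewrite pexpr_eq1 // => /eqP ->; rewrite expr1n.
Qed.

Lemma fchar_conj k x : x != 0 -> fchar k x * Num.conj (fchar k x) = 1.
Proof. by move=> x0; rewrite -normCK fchar_norm // expr1n. Qed.

(** Replacing [x] by [g * x] multiplies the sum by [z ^+ k], which differs from 1 for these [k]. *)
Lemma sum_fchar k : (0 < k < q.-1)%N -> \sum_(x : 'F_q) fchar k x = 0.
Proof.
move=> /andP[k0 kq]; have zk : z ^+ k - 1 != 0.
  rewrite subr_eq0 -[1](expr0 z) (eq_prim_root_expr zP) mod0n modn_small //.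
  by rewrite -lt0n.
apply: (mulfI zk); rewrite mulr0 mulrBl mul1r mulr_sumr.
have gi : injective (fun x : 'F_q => g * x) := mulfI g0.
rewrite [X in _ - X](reindex_inj gi) /= -sumrB big1 // => x _.
by rewrite fcharM -[X in fchar k X * _]expr1 fcharE muln1 subrr.
Qed.

(** A geometric sum in [w], a [q.-1]-th root of unity that equals 1 only if the discrete logarithms
    of [x] and [y] agree. *)
Lemma sum_fchar_orth x y : x != 0 -> y != 0 ->
  \sum_(k < q.-1) fchar k x * Num.conj (fchar k y) = (q.-1 * (x == y))%:R.
Proof.
move=> x0 y0; set w := z ^+ dlog x * Num.conj (z ^+ dlog y).
have fE k x' : x' != 0 -> fchar k x' = (z ^+ dlog x') ^+ k.
  by move=> x0'; rewrite -{1}(dlogK x0') fcharE mulnC exprM.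
have nz : `|z ^+ dlog y| = 1 by rewrite -[z ^+ _]expr1 -fE // fchar_norm.
have -> : \sum_(k < q.-1) fchar k x * Num.conj (fchar k y) = \sum_(k < q.-1) w ^+ k.
  by apply: eq_bigr => k _; rewrite !fE // rmorphXn /= /w exprMn.
have [xy|xy] := eqVneq x y.
  rewrite muln1 (eq_bigr (fun=> 1)); first by rewrite sumr_const card_ord.
  by move=> k _; rewrite /w xy -normCK nz !expr1n.
rewrite muln0; have w1 : w - 1 != 0.
  rewrite subr_eq0; apply: contra xy => /eqP w1.
  have e : z ^+ dlog x = z ^+ dlog y.
    have := congr1 (fun t => t * z ^+ dlog y) w1.
    by rewrite /w mul1r -mulrA [X in _ * X]mulrC -normCK nz expr1n mulr1.
  rewrite -(dlogK x0) -(dlogK y0) (eq_prim_root_expr gP).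
  by rewrite -(eq_prim_root_expr zP) e.
apply: (mulfI w1); rewrite mulr0 -subrX1 /w exprMn -rmorphXn /= !(exprAC _ _ q.-1).
by rewrite (prim_expr_order zP) !expr1n rmorph1 mulr1 subrr.
Qed.

Lemma intF_eq0 (n : int) : (n%:~R == 0 :> 'F_q) = (q %| n)%Z.
Proof. by rewrite -(dvdz_pcharf (pchar_Fp pq)). Qed.

Lemma coprimez_prime (n : int) : coprimez n q = (n%:~R != 0 :> 'F_q).
Proof. by rewrite intF_eq0 coprimezE coprime_sym prime_coprime // dvdzE. Qed.

Lemma dchar_character k : is_dirichlet_character q (dchar k).
Proof.
split.
- by rewrite /dchar fchar1.
- by move=> m n; rewrite /dchar rmorphM fcharM.
- by move=> n; rewrite /dchar rmorphD /= -pmulrn qF addr0.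
- by move=> n; rewrite /dchar fchar_eq0 -coprimez_prime.
Qed.

(** A character is determined by its value at [g], which is a [q.-1]-th root of unity and hence a
    power of [z]. *)
Lemma dirichlet_dchar chi : is_dirichlet_character q chi ->
  exists2 k, (k < q.-1)%N & chi = dchar k.
Proof.
move=> [c1 cM cper c0].
have cF (m n : int) : m%:~R = n%:~R :> 'F_q -> chi m = chi n.
  move/eqP; rewrite -subr_eq0 -rmorphB intF_eq0 => /dvdzP[l e].
  have -> : m = n + l * q%:Z by rewrite -e subrKC.
  elim/int_rect: l {e} => [|l IH|l IH]; first by rewrite mul0r addr0.
    by rewrite -addn1 PoszD mulrDl mul1r addrA cper.
  by rewrite -[RHS]IH -[in RHS](subrK 1 (- l%:Z)) -[LHS]cper; congr chi; rewrite -addn1 PoszD; ring.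
pose f (x : 'F_q) := chi (x : nat)%:Z.
have fE n : chi n = f n%:~R by apply: cF; rewrite -pmulrn natr_Zp.
have fM x y : f (x * y) = f x * f y.
  by rewrite /f -cM; apply: cF; rewrite intrM -!pmulrn !natr_Zp.
have f1 : f 1 = 1 by rewrite -[RHS]c1 [RHS]fE.
have fX x i : f (x ^+ i) = f x ^+ i.
  by elim: i => [|i IH]; rewrite ?expr0 // !exprS fM IH.
have /(prim_rootP zP)[k fk] : f g ^+ q.-1 = 1 by rewrite -fX (prim_expr_order gP).
exists k => //; apply/funext => n; rewrite fE /dchar.
have [n0|n0] := eqVneq (n%:~R : 'F_q) 0.
  rewrite n0 fchar0 -n0 -fE; apply/eqP; apply: contraT => /c0.
  by rewrite coprimez_prime n0 eqxx.
by rewrite -(dlogK n0) fX fk fcharE exprM.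
Qed.

Lemma dchar_inj : {in gtn q.-1 &, injective dchar}.
Proof.
move=> k l; rewrite !inE => kq lq /(congr1 (fun f => f (g : nat)%:Z)).
rewrite /dchar -pmulrn natr_Zp -[g]expr1 !fcharE !muln1 => /eqP.
by rewrite (eq_prim_root_expr zP) !modn_small // => /eqP.
Qed.

Lemma dchar0 : dchar 0 = principal_character R q.
Proof.
apply/funext => n; rewrite /dchar /principal_character coprimez_prime /fchar.
by case: eqP => //= _; rewrite expr0.
Qed.

(** The only proper divisor of a prime is 1, and a character modulo 1 is constantly 1; hence only
    the principal character is imprimitive. *)
Lemma primitive_charactersE :
  primitive_characters q = [set dchar k | k in [set k | (0 < k < q.-1)%N]].
Proof.
apply/seteqP; split => [chi [[ch _] np]|chi [k /andP[k0 kq] <-]].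
  have [k kq ck] := dirichlet_dchar ch; exists k => //=.
  by rewrite kq andbT lt0n; apply/eqP => k0; apply: np; rewrite ck k0 dchar0.
have np : dchar k <> principal_character R q.
  rewrite -dchar0 => /dchar_inj; rewrite !inE => /(_ kq q1) k0'.
  by rewrite k0' in k0.
split => //; split; first exact: dchar_character.
move=> d psi dq dltq [p1 pM pper p0] e; apply: np.
have d1 : d = 1%N by have := primeP pq => -[_ /(_ d dq)] /orP[/eqP//|/eqP dq']; rewrite dq' ltnn in dltq.
have psi1 n : psi n = 1.
  elim/int_rect: n => [|n IH|n IH].
  - by rewrite -(pper 0) d1.
  - by rewrite -addn1 PoszD -[X in _ + X]/(1%:Z) -d1 pper.
  - by rewrite -[RHS]IH -[LHS]pper d1 -addn1 PoszD opprD addrNK.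
apply/funext => n; rewrite /principal_character.
case: (boolP (coprimez n q)) => nq; first by rewrite e // psi1.
by apply/eqP; rewrite /dchar fchar_eq0; rewrite coprimez_prime negbK in nq.
Qed.
End Characters.

(** * The Hurwitz zeta function at 1/2 *)

Section Hurwitz.
Variable R : realType.
Implicit Types (x y : R) (n N Q h k : nat).

Definition isq x : R := (Num.sqrt x)^-1.

Lemma isq_ge0 x : 0 <= isq x. Proof. by rewrite invr_ge0 sqrtr_ge0. Qed.

Lemma isq_le x y : 0 < x -> x <= y -> isq y <= isq x.
Proof.
move=> x0 xy; rewrite lef_pV2 ?posrE ?sqrtr_gt0 ?ler_wsqrtr //.
exact: lt_le_trans xy.
Qed.

Lemma isqM x y : 0 <= x -> isq (x * y) = isq x * isq y.
Proof. by move=> x0; rewrite /isq sqrtrM // invfM. Qed.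

Lemma isqV x : 0 <= x -> isq x^-1 = Num.sqrt x.
Proof. by move=> x0; rewrite /isq sqrtrV // invrK. Qed.

Lemma isq_sqr x : 0 <= x -> isq x ^+ 2 = x^-1.
Proof. by move=> x0; rewrite /isq exprVn sqr_sqrtr. Qed.

Lemma sqrtD_le x y : 0 < x -> 0 <= y ->
  Num.sqrt (x + y) - Num.sqrt x <= y / (2 * Num.sqrt x).
Proof.
move=> x0 y0; have s0 : 0 < Num.sqrt x by rewrite sqrtr_gt0.
have q0 : 0 <= y / (2 * Num.sqrt x) by rewrite divr_ge0 ?mulr_ge0 ?(ltW s0).
rewrite lerBlDr -(@ler_pXn2r _ 2) ?nnegrE ?addr_ge0 ?sqrtr_ge0 //.
rewrite sqr_sqrtr ?addr_ge0 ?(ltW x0) // sqrrD sqr_sqrtr ?(ltW x0) //.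
have -> : y / (2 * Num.sqrt x) * Num.sqrt x *+ 2 = y.
  by rewrite -mulr_natr; field; exact: lt0r_neq0.
by have := sqr_ge0 (y / (2 * Num.sqrt x)); lra.
Qed.

Lemma sqrtS_le x : 0 < x -> 2 * (Num.sqrt (x + 1) - Num.sqrt x) <= isq x.
Proof.
move=> x0; have := sqrtD_le x0 ler01; rewrite /isq -(ler_pM2l (ltr0n R 2)).
by move/le_trans; apply; rewrite le_eqVlt; apply/orP; left; apply/eqP; field;
  apply: lt0r_neq0; rewrite sqrtr_gt0.
Qed.

Lemma sqrtS_ge x : 0 <= x -> isq (x + 1) <= 2 * (Num.sqrt (x + 1) - Num.sqrt x).
Proof.
move=> x0; have s1 : 0 < Num.sqrt (x + 1) by rewrite sqrtr_gt0 ltr_wpDl.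
have s0 := sqrtr_ge0 x.
have s01 : Num.sqrt x <= Num.sqrt (x + 1) by rewrite ler_wsqrtr ?lerDl.
rewrite /isq -(ler_pM2r s1) mulVf ?lt0r_neq0 //.
have e1 : Num.sqrt (x + 1) * Num.sqrt (x + 1) = x + 1.
  by rewrite -expr2 sqr_sqrtr // addr_ge0.
have e0 : Num.sqrt x * Num.sqrt x = x by rewrite -expr2 sqr_sqrtr.
nra.
Qed.

(** Euler-Maclaurin at exponent 1/2: once the growth [2 sqrt (N + x)] is removed, the partial sums
    converge to [zeta(1/2, x)]. *)
Definition hz_part x N : R :=
  \sum_(0 <= n < N) isq (n%:R + x) - 2 * Num.sqrt (N%:R + x).

Fact hz_key : unit. Proof. exact: tt. Qed.

Definition hz x : R := locked_with hz_key (limn (hz_part x)).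

(** By concavity of the square root each increment is nonnegative, so [hz] is a monotone limit. *)
Lemma hz_part_nd x : 0 < x -> nondecreasing_seq (hz_part x).
Proof.
move=> x0; apply/nondecreasing_seqP => N.
rewrite /hz_part big_nat_recr //= -[N.+1%:R]natr1.
have -> : N%:R + 1 + x = N%:R + x + 1 by ring.
have /sqrtS_le : 0 < N%:R + x by rewrite ltr_wpDl.
lra.
Qed.

Lemma hz_part_ub x N : 0 < x -> hz_part x N.+1 <= isq x - 2 * Num.sqrt x.
Proof.
move=> x0; elim: N => [|N IH].
  rewrite /hz_part big_nat1 add0r.
  have : Num.sqrt x <= Num.sqrt (1 + x) by rewrite ler_wsqrtr // lerDr.
  lra.
suff : \sum_(0 <= n < N.+2) isq (n%:R + x) <= isq x - 2 * Num.sqrt x + 2 * Num.sqrt (N.+1%:R + x).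
  have : Num.sqrt (N.+1%:R + x) <= Num.sqrt (N.+2%:R + x).
    by rewrite ler_wsqrtr // lerD2r ler_nat.
  rewrite /hz_part; lra.
elim: N.+1 {IH} => [|M IH]; first by rewrite big_nat1 add0r subrK.
rewrite big_nat_recr //=.
have M0 : 0 <= M%:R + x by rewrite addr_ge0 // ltW.
have := sqrtS_ge M0; rewrite -!natr1 in IH *.
have -> : M%:R + x + 1 = M%:R + 1 + x by ring.
lra.
Qed.

Lemma hz_cvg x : 0 < x -> hz_part x @ \oo --> hz x.
Proof.
move=> x0; rewrite /hz unlock; apply: nondecreasing_is_cvgn; first exact: hz_part_nd.
exists (isq x - 2 * Num.sqrt x) => _ [N _ <-].
apply: le_trans (hz_part_ub N x0); apply: hz_part_nd => //; exact: leqnSn.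
Qed.

Lemma hz_le x : 0 < x -> hz x <= isq x - 2 * Num.sqrt x.
Proof.
have hcv : 0 < x -> cvgn (hz_part x) by move=> x0; apply/cvg_ex; exists (hz x); exact: hz_cvg.
move=> x0; rewrite /hz unlock; apply: limr_le; first exact: hcv.
near=> N; apply: le_trans (hz_part_ub N x0); apply: hz_part_nd => //; exact: leqnSn.
Unshelve. all: by end_near. Qed.

Lemma hz_ge x : 0 < x -> isq x - 2 * Num.sqrt (1 + x) <= hz x.
Proof.
move=> x0; have -> : isq x - 2 * Num.sqrt (1 + x) = hz_part x 1.
  by rewrite /hz_part big_nat1 add0r.
have hcv : cvgn (hz_part x) by apply/cvg_ex; exists (hz x); exact: hz_cvg.
by rewrite /hz unlock; apply: nondecreasing_cvgn_le; first exact: hz_part_nd.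
Qed.

Lemma hz_bound x : 0 < x -> x <= 1 -> `|hz x - isq x| <= 3.
Proof.
move=> x0 x1; have := hz_le x0; have := hz_ge x0; have := sqrtr_ge0 x.
have : Num.sqrt (1 + x) <= 3 / 2.
  have -> : 3 / 2 = Num.sqrt ((3 / 2) ^+ 2) :> R by rewrite sqrtr_sqr ger0_norm //; lra.
  by apply: ler_wsqrtr; lra.
rewrite ler_norml => *; apply/andP; split; lra.
Qed.

Lemma hz_part_mono x y N : 0 < x -> x <= y ->
  hz_part y N.+1 - isq y <= hz_part x N.+1 - isq x.
Proof.
move=> x0 xy; rewrite /hz_part !big_nat_recl // !add0r.
have sxy : Num.sqrt (N.+1%:R + x) <= Num.sqrt (N.+1%:R + y) by rewrite ler_wsqrtr // lerD2l.
suff : \sum_(0 <= i < N) isq (i.+1%:R + y) <= \sum_(0 <= i < N) isq (i.+1%:R + x) by lra.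
by apply: ler_sum => i _; apply: isq_le; rewrite ?lerD2l // ltr_wpDl.
Qed.

(** Removing the singular term [n = 0] leaves termwise decreasing partial sums. Together with
    [hz_bound] this makes [hz - isq] a bounded decreasing function on (0, 1], as the variation
    estimates require. *)
Lemma hzB_mono x y : 0 < x -> x <= y -> hz y - isq y <= hz x - isq x.
Proof.
move=> x0 xy.
have y0 : 0 < y by exact: lt_le_trans xy.
have hc z : 0 < z -> (fun n => hz_part z n - isq z) @ \oo --> hz z - isq z.
  by move=> z0; apply: cvgB; [exact: hz_cvg | exact: cvg_cst].
rewrite -(cvg_lim _ (hc _ x0)) // -(cvg_lim _ (hc _ y0)) //.
apply: ler_lim.
- by apply/cvg_ex; exists (hz y - isq y); exact: hc.
- by apply/cvg_ex; exists (hz x - isq x); exact: hc.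
near=> N; have : (0 < N)%N by near: N; exists 1%N.
by move/prednK <-; exact: hz_part_mono.
Unshelve. all: by end_near. Qed.

Lemma hz_mono x y : 0 < x -> x <= y -> hz y <= hz x.
Proof. by move=> x0 xy; have := hzB_mono x0 xy; have := isq_le x0 xy; lra. Qed.

Lemma hz_le_isq x : 0 < x -> x <= 1 -> `|hz x| <= 4 * isq x.
Proof.
move=> x0 x1; have := hz_bound x0 x1.
have : 1 <= isq x by rewrite -[leLHS](_ : isq 1 = 1) ?isq_le // /isq sqrtr1 invr1.
rewrite !ler_norml => ? /andP[? ?]; apply/andP; split; lra.
Qed.

Lemma sqrt_shift_cvg (x y : R) : 0 <= x -> 0 <= y ->
  (fun N => Num.sqrt (N%:R + x) - Num.sqrt (N%:R + y)) @ \oo --> (0 : R).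
Proof.
wlog xy : x y / x <= y.
  move=> H x0 y0; case: (leP x y) => [|/ltW] xy; first exact: H.
  rewrite -oppr0 -[X in X @ _](_ : (fun N => - (Num.sqrt (N%:R + y) - Num.sqrt (N%:R + x))) = _).
    by apply: cvgN; exact: H.
  by apply/funext => N; rewrite opprB.
move=> x0 y0; rewrite -oppr0.
rewrite -[X in X @ _](_ : (fun N => - (Num.sqrt (N%:R + y) - Num.sqrt (N%:R + x))) = _); last first.
  by apply/funext => N; rewrite opprB.
apply: cvgN; apply/cvgrPdist_le => e e0; near=> N.
rewrite sub0r normrN ger0_norm ?subr_ge0 ?ler_wsqrtr ?lerD2l //.
have N0 : (0 < N)%N by near: N; exists 1%N.
have Nx : 0 < N%:R + x by rewrite ltr_pwDl // ltr0n.
have := @sqrtD_le (N%:R + x) (y - x) Nx; rewrite subr_ge0 => /(_ xy).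
rewrite -addrA subrKC => /le_trans; apply.
rewrite ler_pdivrMr; last by rewrite mulr_gt0 // sqrtr_gt0.
have : (y / e) ^+ 2 <= N%:R by near: N; exact: nbhs_infty_ger.
move=> H; have : y / e <= Num.sqrt (N%:R + x).
  by apply: le_trans (ler_norm _) _; rewrite -sqrtr_sqr ler_wsqrtr //; lra.
rewrite ler_pdivrMr // => H2; have : 0 <= Num.sqrt (N%:R + x) := sqrtr_ge0 _; nra.
Unshelve. all: by end_near. Qed.

(** The distribution relation. Sorting the integers below [h * N] by residue modulo [h] proves it
    for partial sums, up to differences of square roots that tend to 0. *)
Lemma hz_distr x h : 0 < x -> (0 < h)%N ->
  \sum_(0 <= i < h) hz ((x + i%:R) / h%:R) = Num.sqrt h%:R * hz x.
Proof.
move=> x0 h0; have hR : 0 < h%:R :> R by rewrite ltr0n.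
have xi i : 0 < (x + i%:R) / h%:R by rewrite divr_gt0 // ltr_wpDr.
have sumE N : \sum_(0 <= i < h) \sum_(0 <= n < N) isq (n%:R + (x + i%:R) / h%:R) =
    Num.sqrt h%:R * \sum_(0 <= m < h * N) isq (m%:R + x).
  elim: N => [|N IH]; first by rewrite muln0 [in RHS]big_geq // mulr0 big1 // => i _; rewrite big_geq.
  under eq_bigr do rewrite big_nat_recr //=.
  rewrite big_split /= IH.
  have -> : (h * N.+1 = h * N + h)%N by lia.
  rewrite (@big_cat_nat _ _ _ (h * N)%N _ (h * N + h)%N) ?leq_addr //=.
  rewrite [in RHS]mulrDr; congr (_ + _).
  rewrite -[X in \sum_(X <= _ < _) isq (_ + x)]add0n big_addn addKn mulr_sumr; apply: eq_bigr => i _.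
  have -> : N%:R + (x + i%:R) / h%:R = h%:R^-1 * ((i + h * N)%:R + x).
    by rewrite natrD natrM; field; exact: lt0r_neq0.
  by rewrite isqM ?invr_ge0 ?ler0n // isqV.
have c1 : (fun N => \sum_(0 <= i < h) hz_part ((x + i%:R) / h%:R) N) @ \oo -->
    \sum_(0 <= i < h) hz ((x + i%:R) / h%:R).
  rewrite -fct_sumE; elim/big_ind2 : _ => [|f u g v fu gv|i _].
  - exact: cvg_cst.
  - exact: cvgD.
  - exact: hz_cvg.
have c2 : (fun N => Num.sqrt h%:R * hz_part x (h * N)) @ \oo --> Num.sqrt h%:R * hz x.
  apply: cvgM; first exact: cvg_cst.
  apply: (cvg_comp (fun N => (h * N)%N) (hz_part x)); last exact: hz_cvg.
  exact: cvg_mulnl.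
have c3 : (fun N => \sum_(0 <= i < h)
    2 * (Num.sqrt (N%:R + x / h%:R) - Num.sqrt (N%:R + (x + i%:R) / h%:R))) @ \oo --> (0 : R).
  rewrite -fct_sumE -[X in _ --> X](_ : \sum_(0 <= i < h) 0 = 0); last by rewrite big1.
  elim/big_ind2 : _ => [|f u g v fu gv|i _].
  - exact: cvg_cst.
  - exact: cvgD.
  - rewrite -[X in _ --> X](mulr0 2); apply: cvgM; first exact: cvg_cst.
    by apply: sqrt_shift_cvg; rewrite divr_ge0 ?addr_ge0 ?ler0n // ltW.
apply: (cvg_unique _ c1) => //=.
have c4 := cvgD c2 c3; rewrite addr0 in c4.
apply: cvg_trans; [|exact: c4]; apply: near_eq_cvg.
apply: nearW => N; apply/esym.
transitivity (Num.sqrt h%:R * hz_part x (h * N) + \sum_(0 <= i < h)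
    2 * (Num.sqrt (N%:R + x / h%:R) - Num.sqrt (N%:R + (x + i%:R) / h%:R))); last by [].
rewrite /hz_part big_split /= sumE mulrBr -addrA; congr (_ + _).
rewrite sumrN -!mulr_sumr sumrB sumr_const_nat subn0.
have -> : Num.sqrt h%:R * (2 * Num.sqrt ((h * N)%:R + x)) = 2 * (Num.sqrt (N%:R + x / h%:R) *+ h).
  have -> : N%:R + x / h%:R = h%:R^-1 * ((h * N)%:R + x).
    by rewrite natrM; field; exact: lt0r_neq0.
  rewrite sqrtrM ?invr_ge0 ?ler0n // sqrtrV ?ler0n // -[(_ * _) *+ h]mulr_natr.
  have hs : Num.sqrt h%:R * Num.sqrt h%:R = h%:R :> R by rewrite -expr2 sqr_sqrtr ?ler0n.
  have : Num.sqrt h%:R != 0 :> R by rewrite lt0r_neq0 ?sqrtr_gt0.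
  by move: (Num.sqrt h%:R) hs => s <- s0; field.
lra.
Qed.
End Hurwitz.

(** * Periodized Hurwitz values and their correlations *)

Section HurwitzPeriodic.
Variable R : realType.
Local Notation hz := (@hz R).
Local Notation isq := (@isq R).
Implicit Types (x y : R) (n N Q h k : nat).

(* Sealed, since unification would otherwise evaluate the residues. *)
Fact hzp_spec : {f : nat -> nat -> R |
  forall Q u, f Q u = hz (((u + Q).-1 %% Q).+1%:R / Q%:R)}.
Proof. by exists (fun Q u => hz (((u + Q).-1 %% Q).+1%:R / Q%:R)). Qed.

(** [zeta(1/2, u/Q)] made periodic in [u]. Residues are represented in [1..Q] and not in [0..Q-1],
    since [hz] is singular at 0; a multiple of [Q] gives [hz 1]. *)
Definition hzp := sval hzp_spec.

Lemma hzpE Q u rho : (0 < rho)%N -> (rho <= Q)%N -> u = rho %[mod Q] ->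
  hzp Q u = hz (rho%:R / Q%:R).
Proof.
move=> r0 rQ e; rewrite /hzp (svalP hzp_spec); suff <- : rho = ((u + Q).-1 %% Q).+1 by [].
have Q0 : (0 < Q)%N := leq_trans r0 rQ.
have -> : ((u + Q).-1 = u + Q.-1)%N by clear e; lia.
rewrite -modnDml e modnDml (_ : rho + Q.-1 = rho.-1 + Q)%N; last by clear e; lia.
by rewrite modnDr modn_small prednK.
Qed.

Lemma hzp_rep Q u : (0 < Q)%N ->
  exists rho, [/\ (0 < rho)%N, (rho <= Q)%N & u = rho %[mod Q]].
Proof.
move=> Q0; case: (posnP (u %% Q)) => [u0|u0].
  by exists Q; split => //; rewrite modnn u0.
by exists (u %% Q)%N; split; rewrite ?modn_mod //; apply: ltnW; rewrite ltn_mod.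
Qed.

Lemma hzp_mod Q u v : (0 < Q)%N -> u = v %[mod Q] -> hzp Q u = hzp Q v.
Proof.
move=> Q0 uv; have [rho [r0 rQ e]] := hzp_rep v Q0.
by rewrite (hzpE r0 rQ e) (hzpE r0 rQ) // uv.
Qed.

Lemma hzp_scale c Q u : (0 < c)%N -> (0 < Q)%N -> hzp (c * Q) (c * u) = hzp Q u.
Proof.
move=> c0 Q0; have [rho [r0 rQ e]] := hzp_rep u Q0.
rewrite (hzpE r0 rQ e) (@hzpE (c * Q) _ (c * rho)) ?muln_gt0 ?c0 ?leq_mul //.
  by rewrite !natrM -mulf_div divff ?mul1r // pnatr_eq0 -lt0n.
by rewrite -!muln_modr e.
Qed.

Lemma hzp_sum_shift h Q c j : (0 < h)%N -> (0 < Q)%N ->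
  \sum_(0 <= i < h) hzp (h * Q) (c + j * Q + i * Q) =
  \sum_(0 <= i < h) hzp (h * Q) (c + i * Q).
Proof.
case: h => // h _ Q0.
elim: j => [|j <-]; first by rewrite mul0n addn0.
rewrite big_nat_recr //= [RHS]big_nat_recl //= addrC; congr (_ + _).
  by apply: hzp_mod; rewrite ?muln_gt0 // mul0n addn0 (_ : c + j.+1 * Q + h * Q = c + j * Q + h.+1 * Q)%N ?modnDr //; lia.
by apply: eq_bigr => i _; apply: (congr1 (hzp _)); lia.
Qed.

(** This is [hz_distr] for the representative [rho]; another representative only rotates the index
    [i], which [hzp_sum_shift] undoes. *)
Lemma hzp_distr h Q v : (0 < h)%N -> (0 < Q)%N ->
  \sum_(0 <= i < h) hzp (h * Q) (v + i * Q) = Num.sqrt h%:R * hzp Q v.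
Proof.
move=> h0 Q0; have [rho [r0 rQ e]] := hzp_rep v Q0.
have QR : Q%:R != 0 :> R by rewrite pnatr_eq0 -lt0n.
have hR : h%:R != 0 :> R by rewrite pnatr_eq0 -lt0n.
rewrite (hzpE r0 rQ e) -hz_distr //; last by rewrite divr_gt0 // ltr0n.
under [RHS]eq_big_nat => i /andP[_ ih].
  have -> : (rho%:R / Q%:R + i%:R) / h%:R = (rho + i * Q)%N%:R / (h * Q)%N%:R :> R.
    by rewrite natrD !natrM; field; rewrite QR.
  rewrite -(@hzpE (h * Q) (rho + i * Q)) //; [over|lia|nia].
have [j1 [j2 ej]] : exists j1 j2, (v + j1 * Q = rho + j2 * Q)%N.
  exists (rho %/ Q)%N, (v %/ Q)%N.
  by rewrite [X in (X + _)%N](divn_eq v Q) e [X in _ = (X + _)%N](divn_eq rho Q); ring.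
by rewrite -(hzp_sum_shift v j1) // -(hzp_sum_shift rho j2) // ej.
Qed.

Definition hz_corr Q h k : R :=
  Q%:R^-1 * \sum_(0 <= t < Q) hzp Q (h * t) * hzp Q (k * t).

Lemma sum_nat_block (V : nmodType) (a b : nat) (G : nat -> V) :
  \sum_(0 <= u < a * b) G u = \sum_(0 <= v < b) \sum_(0 <= i < a) G (v + i * b)%N.
Proof.
elim: a => [|a IH]; first by rewrite mul0n big_geq // big1 // => i _; rewrite big_geq.
under [RHS]eq_bigr do rewrite big_nat_recr //=.
rewrite big_split /= -IH mulSnr (@big_cat_nat _ _ _ (a * b)%N _ (a * b + b)%N) ?leq_addr //=.
congr (_ + _); rewrite -[X in \sum_(X <= _ < _) _]add0n big_addn addKn.
by apply: eq_bigr.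
Qed.

(** Since [k] is invertible modulo [h], the shifts [i * k] run over the same residues modulo [h] as
    [i]. *)
Lemma sum_hzp_coprime h k w Q : (0 < h)%N -> (0 < Q)%N -> coprime h k ->
  \sum_(0 <= i < h) hzp (h * Q) (w + i * k * Q) = Num.sqrt h%:R * hzp Q w.
Proof.
move=> h0 Q0 hk; rewrite -hzp_distr //.
rewrite !big_mkord.
pose f (i : 'I_h) : 'I_h := Ordinal (ltn_pmod (i * k) h0).
have fi : injective f.
  move=> i j /(congr1 val) /= /eqP e; apply/val_inj/eqP => /=.
  wlog ij : i j e / (i <= j)%N.
    by move=> H; case: (leqP i j) => [|/ltnW] ?; [|rewrite eq_sym]; apply: H => //; rewrite eq_sym.
  move: e; rewrite eq_sym eqn_mod_dvd ?leq_mul2r ?ij ?orbT // -mulnBl Gauss_dvdl // => /dvdn_leq.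
  have := ltn_ord j; case: (posnP (j - i)); lia.
rewrite [RHS](reindex_inj fi) /=; apply: eq_bigr => i _; apply: hzp_mod; first by rewrite muln_gt0 h0.
by apply/eqP; rewrite eqn_modDl -!muln_modl modn_mod.
Qed.

(** At modulus [h * k * q] the correlation is exact: the two factors depend on [t] only modulo
    [k * q] and [h * q]. Grouping [t] by its class modulo [k * q], and then modulo [q], applies the
    distribution relation once to each factor. *)
Lemma hz_corr_scale h k q : (0 < h)%N -> (0 < k)%N -> (0 < q)%N -> coprime h k ->
  hz_corr (h * k * q) h k = isq (h * k)%:R * hz_corr q 1 1.
Proof.
move=> h0 k0 q0 hk; rewrite /hz_corr.
have -> : \sum_(0 <= t < h * k * q) hzp (h * k * q) (h * t) * hzp (h * k * q) (k * t) =
    \sum_(0 <= t < h * (k * q)) hzp (k * q) t * hzp (h * q) t.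
  rewrite -mulnA; apply: eq_bigr => t _; rewrite hzp_scale ?muln_gt0 ?k0 //.
  by rewrite (_ : h * (k * q) = k * (h * q))%N ?hzp_scale ?muln_gt0 ?h0 //; lia.
rewrite sum_nat_block.
under eq_bigr => v _.
  under eq_bigr => i _.
    rewrite (@hzp_mod (k * q) _ v) ?muln_gt0 ?k0 //; last by rewrite addnC modnMDl.
    over.
  rewrite -mulr_sumr.
  under eq_bigr do rewrite mulnA.
  rewrite sum_hzp_coprime //.
  over.
rewrite sum_nat_block /=.
under eq_bigr => v _.
  under eq_bigr => i _.
    rewrite (@hzp_mod q (v + i * q) v) //; last by rewrite addnC modnMDl.
    over.
  rewrite -mulr_suml hzp_distr //.
  over.
under [in RHS]eq_bigr do rewrite mul1n.
have -> : isq (h * k)%:R = (h * k)%:R^-1 * (Num.sqrt h%:R * Num.sqrt k%:R).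
  have hk0 : 0 < (h * k)%:R :> R by rewrite ltr0n muln_gt0 h0.
  rewrite /isq -sqrtrM ?ler0n // -natrM -{2}[(h * k)%:R]sqr_sqrtr ?ltW //; field.
  by rewrite lt0r_neq0 ?sqrtr_gt0.
rewrite [in LHS]natrM invfM !mulr_sumr; apply: eq_bigr => v _.
by rewrite !natrM; field; rewrite !pnatr_eq0; lia.
Qed.
End HurwitzPeriodic.

(** * Sampling on coarse and fine grids *)

Section HurwitzCorrelation.
Variable R : realType.
Local Notation hz := (@hz R).
Local Notation hzp := (@hzp R).
Local Notation hz_corr := (@hz_corr R).
Local Notation isq := (@isq R).
Implicit Types (x y : R) (n N Q h k q r : nat).

(** For each offset [v < r] the points [r * t] and [v + t * r] are joined by [v] unit steps, so the
    two sums over [t] differ by at most the total variation; then average over [v]. *)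
Lemma coarse_fine (a : nat -> R) q r : (0 < q)%N -> (0 < r)%N ->
  `|q%:R^-1 * (\sum_(0 <= t < q) a (r * t)%N)
    - (r * q)%:R^-1 * (\sum_(0 <= u < r * q) a u)|
  <= q%:R^-1 * \sum_(0 <= u < r * q) `|a u.+1 - a u|.
Proof.
move=> q0 r0; have qR : 0 < q%:R :> R by rewrite ltr0n.
have rR : 0 < r%:R :> R by rewrite ltr0n.
set TV := \sum_(0 <= u < r * q) `|a u.+1 - a u|.
have step v : (v < r)%N ->
    `|\sum_(0 <= t < q) a (r * t)%N - \sum_(0 <= t < q) a (v + t * r)%N| <= TV.
  move=> vr; rewrite -sumrB; apply: le_trans (ler_norm_sum _ _ _) _.
  rewrite /TV mulnC sum_nat_block exchange_big /=; apply: ler_sum => i _.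
  have : `|a (r * i)%N - a (v + i * r)%N| <= \sum_(0 <= w < v) `|a (w + i * r).+1 - a (w + i * r)%N|.
    elim: v {vr} => [|v IH]; first by rewrite big_geq // add0n mulnC subrr normr0.
    rewrite big_nat_recr //= (_ : v.+1 + i * r = (v + i * r).+1)%N //.
    apply: le_trans (lerD IH (lexx _)); rewrite [X in _ <= _ + X]distrC.
    exact: ler_distD.
  move/le_trans; apply; rewrite [leRHS](@big_cat_nat _ _ _ v) //= ?(ltnW vr) // lerDl.
  exact: sumr_ge0.
have -> : q%:R^-1 * (\sum_(0 <= t < q) a (r * t)%N) - (r * q)%:R^-1 * (\sum_(0 <= u < r * q) a u) =
   (r * q)%:R^-1 * \sum_(0 <= v < r) (\sum_(0 <= t < q) a (r * t)%N - \sum_(0 <= t < q) a (v + t * r)%N).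
  rewrite sumrB sumr_const_nat subn0 -mulr_natr mulrBr; congr (_ - _).
    by rewrite natrM; field; rewrite !lt0r_neq0.
  by rewrite [in LHS](mulnC r q) sum_nat_block mulnC.
rewrite normrM ger0_norm ?invr_ge0 ?ler0n // natrM invfM mulrAC mulrC ler_pM2l ?invr_gt0 //.
rewrite mulrC ler_pdivrMr //.
apply: le_trans (ler_norm_sum _ _ _) _.
rewrite mulr_natr -[X in _ *+ X]subn0 -sumr_const_nat; apply: ler_sum_nat => v /andP[_ vr].
exact: step.
Qed.

Lemma tv_mono (f : nat -> R) s e : (s <= e)%N ->
  (forall u, (s <= u < e)%N -> f u.+1 <= f u) ->
  \sum_(s <= u < e) `|f u.+1 - f u| = f s - f e.
Proof.
move=> se fm; rewrite -[RHS]opprB -telescope_sumr // -sumrN.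
by apply: eq_big_nat => u /fm fu; rewrite ler0_norm ?subr_le0.
Qed.

(** The product rule for differences; a monotone factor has variation at most twice its bound. *)
Lemma tv_prod_mono (f g : nat -> R) s e Mf Mg : (s <= e)%N ->
  (forall u, (s <= u < e)%N -> f u.+1 <= f u) ->
  (forall u, (s <= u < e)%N -> g u.+1 <= g u) ->
  (forall u, (s <= u <= e)%N -> `|f u| <= Mf) ->
  (forall u, (s <= u <= e)%N -> `|g u| <= Mg) ->
  \sum_(s <= u < e) `|f u.+1 * g u.+1 - f u * g u| <= 4 * Mf * Mg.
Proof.
move=> se fm gm fM gM.
have f0 : 0 <= Mf by apply: le_trans (normr_ge0 (f s)) (fM _ _); rewrite leqnn.
have g0 : 0 <= Mg by apply: le_trans (normr_ge0 (g s)) (gM _ _); rewrite leqnn.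
apply: (@le_trans _ _ (\sum_(s <= u < e) (Mg * `|f u.+1 - f u| + Mf * `|g u.+1 - g u|))).
  apply: ler_sum_nat => u /andP[su ue].
  have -> : f u.+1 * g u.+1 - f u * g u = g u.+1 * (f u.+1 - f u) + f u * (g u.+1 - g u) by ring.
  apply: le_trans (ler_normD _ _) _; rewrite !normrM; apply: lerD; apply: ler_wpM2r => //.
    by apply: gM; rewrite ue (leq_trans su).
  by apply: fM; rewrite su ltnW.
rewrite big_split /= -!mulr_sumr !tv_mono //.
have := fM s; have := fM e; have := gM s; have := gM e; rewrite !leqnn !se /=.
move=> /(_ isT) /ler_normlP[? ?] /(_ isT) /ler_normlP[? ?] /(_ isT) /ler_normlP[? ?] /(_ isT) /ler_normlP[? ?].
have -> : 4 * Mf * Mg = Mg * (2 * Mf) + Mf * (2 * Mg) by ring.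
by apply: lerD; apply: ler_wpM2l => //; lra.
Qed.

Lemma isq_nat_le (a b n : nat) : (0 < b)%N -> (0 < n)%N -> (n <= a * b)%N ->
  isq (b%:R / n%:R) <= Num.sqrt a%:R.
Proof.
move=> b0 n0 nab; have bR : 0 < b%:R :> R by rewrite ltr0n.
have nR : 0 < n%:R :> R by rewrite ltr0n.
rewrite -[b%:R / n%:R]invrK isqV ?invr_ge0 ?divr_ge0 // invf_div ler_wsqrtr //.
by rewrite ler_pdivrMr // -natrM ler_nat.
Qed.

Lemma hz_nat_le (a b n : nat) : (0 < b)%N -> (b <= n)%N -> (n <= a * b)%N ->
  `|hz (b%:R / n%:R)| <= 4 * Num.sqrt a%:R.
Proof.
move=> b0 bn nab; have n0 : (0 < n)%N := leq_trans b0 bn.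
have bR : 0 < b%:R :> R by rewrite ltr0n.
have nR : 0 < n%:R :> R by rewrite ltr0n.
apply: le_trans (hz_le_isq _ _) _; rewrite ?divr_gt0 //.
  by rewrite ler_pdivrMr // mul1r ler_nat.
by rewrite ler_pM2l //; exact: isq_nat_le.
Qed.

Lemma hz_nat_mono (b c n : nat) : (0 < b)%N -> (b <= c)%N -> (0 < n)%N ->
  hz (c%:R / n%:R) <= hz (b%:R / n%:R).
Proof.
move=> b0 bc n0; apply: hz_mono; first by rewrite divr_gt0 ?ltr0n.
by rewrite ler_pM2r ?invr_gt0 ?ltr0n // ler_nat.
Qed.

Lemma hzp_small n u : (0 < u)%N -> (u <= n)%N -> hzp n u = hz (u%:R / n%:R).
Proof. by move=> u0 un; exact: hzpE. Qed.

Lemma hzp_wrap n u : (n < u)%N -> (u <= n + n)%N -> hzp n u = hz ((u - n)%:R / n%:R).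
Proof.
move=> nu un; apply: hzpE; rewrite ?subn_gt0 ?leq_subLR //.
by rewrite -[in LHS](subnK (ltnW nu)) modnDr.
Qed.

(** The factors are singular at [u = 0] and at [u = - D] modulo [n], which are at least [q] apart on
    either side. Where one factor may reach [4 sqrt n] the other is at most [4 sqrt r], so the
    variation has order [sqrt (r n)] and not [n]. *)
Lemma tv_cross q r l n D : (0 < q)%N -> (0 < l)%N -> (l < r)%N ->
  n = (r * q)%N -> D = (l * q)%N ->
  \sum_(0 <= u < n) `|hzp n u.+1 * hzp n (u.+1 + D) - hzp n u * hzp n (u + D)|
    <= 192 * Num.sqrt r%:R * Num.sqrt n%:R.
Proof.
move=> q0 l0 lr nE DE.
have n0 : (0 < n)%N by rewrite nE muln_gt0 q0 (leq_trans _ lr).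
have Dn : (D < n)%N by rewrite nE DE ltn_pmul2r.
have qD : (q <= D)%N by rewrite DE leq_pmull.
have qnD : (q <= n - D)%N by rewrite nE DE -mulnBl leq_pmull // subn_gt0.
set s := Num.sqrt r%:R; set m := Num.sqrt n%:R.
clear DE lr l0.
have s1 : 0 <= s := sqrtr_ge0 _.
have m1 : 0 <= m := sqrtr_ge0 _.
have nm u : (0 < u)%N -> (u <= n)%N -> `|hz (u%:R / n%:R)| <= 4 * m.
  by move=> u0 un; apply: hz_nat_le => //; rewrite leq_pmulr.
have rm u : (q <= u)%N -> (u <= n)%N -> `|hz (u%:R / n%:R)| <= 4 * s.
  by move=> qu un; apply: hz_nat_le => //; [exact: leq_trans qu | rewrite nE leq_mul2l qu orbT].
pose a u := hzp n u * hzp n (u + D).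
have a_le u : (u <= n)%N -> `|a u| <= 16 * s * m.
  wlog u0 : u / (0 < u)%N.
    move=> H; case: (posnP u) => [->|]; last exact: H.
    move=> _; have := H n n0 (leqnn n); rewrite /a.
    by rewrite (@hzp_mod _ n n 0) ?modnn ?mod0n // (@hzp_mod _ n (n + D) (0 + D)) ?modnDl ?add0n.
  move=> un; rewrite /a normrM hzp_small //.
  case: (leqP (u + D) n) => uD.
    rewrite hzp_small ?addn_gt0 ?u0 // (_ : 16 * s * m = 4 * m * (4 * s)); last by ring.
    by apply: ler_pM => //; [exact: nm | apply: rm => //; exact: leq_trans qD (leq_addl _ _)].
  rewrite hzp_wrap //; last by rewrite leq_add // ltnW.
  rewrite (_ : 16 * s * m = 4 * s * (4 * m)); last by ring.
  apply: ler_pM => //; first by apply: rm => //; apply: leq_trans qnD _; lia.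
  by apply: nm; lia.
have jump u : (u < n)%N -> `|a u.+1 - a u| <= 32 * s * m.
  move=> un; apply: le_trans (ler_normB _ _) _.
  have := a_le _ un; have := a_le _ (ltnW un); lra.
have arc1 : \sum_(1 <= u < n - D) `|a u.+1 - a u| <= 64 * s * m.
  rewrite (eq_big_nat _ _ (F2 := fun u => `|hz (u.+1%:R / n%:R) * hz ((u.+1 + D)%:R / n%:R)
      - hz (u%:R / n%:R) * hz ((u + D)%:R / n%:R)|)); last first.
    move=> u u12; rewrite /a !hzp_small //; lia.
  rewrite (_ : 64 * s * m = 4 * (4 * m) * (4 * s)); last by ring.
  apply: (tv_prod_mono (f := fun u => hz (u%:R / n%:R)) (g := fun u => hz ((u + D)%:R / n%:R))).
  - by lia.
  - by move=> u ?; apply: hz_nat_mono => //; lia.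
  - by move=> u ?; apply: hz_nat_mono => //; lia.
  - by move=> u ?; apply: nm; lia.
  - by move=> u ?; apply: rm; lia.
have arc2 : \sum_((n - D).+1 <= u < n) `|a u.+1 - a u| <= 64 * s * m.
  rewrite (eq_big_nat _ _ (F2 := fun u => `|hz (u.+1%:R / n%:R) * hz ((u.+1 + D - n)%:R / n%:R)
      - hz (u%:R / n%:R) * hz ((u + D - n)%:R / n%:R)|)); last first.
    move=> u u12; rewrite /a !(@hzp_small n u) ?(@hzp_small n u.+1) ?(@hzp_wrap n (_ + D)) //; lia.
  rewrite (_ : 64 * s * m = 4 * (4 * s) * (4 * m)); last by ring.
  apply: (tv_prod_mono (f := fun u => hz (u%:R / n%:R)) (g := fun u => hz ((u + D - n)%:R / n%:R))).
  - by lia.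
  - by move=> u ?; apply: hz_nat_mono => //; lia.
  - by move=> u ?; apply: hz_nat_mono => //; lia.
  - by move=> u ?; apply: rm; lia.
  - by move=> u ?; apply: nm; lia.
(* The cycle splits into the jumps at [0] and at [n - D], of size at most [32 s m] each, and the two
   arcs between them, on which both factors decrease: [192 = 2 * 32 + 2 * 64]. *)
rewrite -/(a _) big_ltn // (@big_cat_nat _ _ _ (n - D)) //=; [|lia|lia].
rewrite [X in _ + (_ + X)]big_ltn; last by lia.
have := jump 0 n0; have := @jump (n - D)%N; rewrite /a => /(_ ltac:(lia)).
move: arc1 arc2; rewrite /a; lra.
Qed.
End HurwitzCorrelation.

(** * Asymptotics of the twisted correlation *)

Section TwistedCorrelation.
Variable R : realType.
Local Notation hz := (@hz R).
Local Notation hzp := (@hzp R).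
Local Notation hz_corr := (@hz_corr R).
Local Notation isq := (@isq R).
Implicit Types (x y : R) (n N Q h k q r : nat).

Lemma sum_shift_periodic (G : nat -> R) n A :
  (forall u, G (u + n)%N = G u) -> \sum_(0 <= u < n) G (u + A)%N = \sum_(0 <= u < n) G u.
Proof.
move=> Gn; elim: A => [|A IH]; first by under eq_bigr do rewrite addn0.
rewrite -[RHS]IH; case: n Gn {IH} => [|n] Gn; first by rewrite !big_geq.
rewrite big_nat_recr //= [RHS]big_nat_recl //= addrC; congr (_ + _).
  by rewrite -[RHS]Gn; congr G; lia.
by apply: eq_bigr => u _; congr G; lia.
Qed.

Lemma hzp_per n u : (0 < n)%N -> hzp n (u + n) = hzp n u.
Proof. by move=> n0; apply: hzp_mod; rewrite ?modnDr. Qed.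

(** A translation along the cycle reduces two distinct shifts to the single shift [l], the residue
    of [b - a] modulo [r]. *)
Lemma tv_cross_shift q r n a b : (0 < q)%N -> (0 < r)%N -> n = (r * q)%N ->
  (a != b %[mod r])%N ->
  \sum_(0 <= u < n) `|hzp n (u.+1 + a * q) * hzp n (u.+1 + b * q)
                      - hzp n (u + a * q) * hzp n (u + b * q)|
    <= 192 * Num.sqrt r%:R * Num.sqrt n%:R.
Proof.
move=> q0 r0 nE ab; have n0 : (0 < n)%N by rewrite nE muln_gt0 r0.
pose l := ((b + (r - a %% r)) %% r)%N.
have lr : (l < r)%N by rewrite ltn_mod.
have alb : a + l = b %[mod r].
  rewrite /l modnDmr (_ : a + (b + (r - a %% r)) = (a %/ r).+1 * r + b)%N ?modnMDl //.
  rewrite [X in (X + (b + _))%N](divn_eq a r) mulSn.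
  have : (a %% r <= r)%N by rewrite ltnW // ltn_mod.
  move: (a %% r)%N (a %/ r * r)%N => w m wr; clear -wr; lia.
have l0 : (0 < l)%N.
  by rewrite lt0n; apply: contra ab => /eqP l0; move: alb; rewrite l0 addn0 => ->.
pose G u := `|hzp n u.+1 * hzp n (u.+1 + l * q) - hzp n u * hzp n (u + l * q)|.
have e u : hzp n (u + b * q) = hzp n (u + a * q + l * q).
  apply: hzp_mod => //; apply/eqP; rewrite -addnA eqn_modDl -mulnDl nE.
  by rewrite -!muln_modl alb.
rewrite (eq_bigr (fun u => G (u + a * q)%N)); last first.
  by move=> u _; rewrite /G !e !addSn.
rewrite sum_shift_periodic.
  exact: (@tv_cross _ q r l n _ q0 l0 lr nE erefl).
by move=> u; rewrite /G -addSn !(addnAC _ n) !hzp_per.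
Qed.

(** What remains of [hz x ^+ 2] without its singular part [x^-1], kept as a product of two
    decreasing functions, the first of them bounded on (0, 1]. *)
Definition hz_reg x : R := (hz x - isq x) * (hz x + isq x).

Lemma hz_regE x : 0 < x -> hz x ^+ 2 = x^-1 + hz_reg x.
Proof. by move=> x0; rewrite -isq_sqr ?ltW // /hz_reg; ring. Qed.

(** The factors of [hz_reg] are bounded on the fine grid by 3 and [5 sqrt n]. By [tv_prod_mono] the
    arc has variation at most [60 sqrt n], and the jump at the origin adds [30 sqrt n]. *)
Lemma hz_reg_coarse_fine q r : (0 < q)%N -> (0 < r)%N ->
  `|q%:R^-1 * (\sum_(0 <= t < q) hz_reg (t.+1%:R / q%:R)) -
    (r * q)%:R^-1 * (\sum_(0 <= u < r * q) hz_reg (u.+1%:R / (r * q)%:R))| <=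
  90 * Num.sqrt r%:R * isq q%:R.
Proof.
move=> q0 r0; set n := (r * q)%N; have n0 : (0 < n)%N by rewrite muln_gt0 r0.
have nR : 0 < n%:R :> R by rewrite ltr0n.
have qR : 0 < q%:R :> R by rewrite ltr0n.
(* The index 0 is read as [n], which closes the samples up to a cycle. *)
pose a u := hz_reg ((if u == 0%N then n else u)%:R / n%:R).
have an : a n = a 0%N by rewrite /a; case: (n == 0%N).
have sh (b : nat -> R) m : b m = b 0%N ->
    \sum_(0 <= t < m) b t = \sum_(0 <= t < m) b t.+1.
  case: m => [|m] bm; first by rewrite !big_geq.
  by rewrite big_nat_recl //= [RHS]big_nat_recr //= bm addrC.
have -> : \sum_(0 <= u < n) hz_reg (u.+1%:R / n%:R) = \sum_(0 <= u < n) a u.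
  by rewrite (sh a).
have -> : \sum_(0 <= t < q) hz_reg (t.+1%:R / q%:R) = \sum_(0 <= t < q) a (r * t)%N.
  rewrite (sh (fun t => a (r * t)%N)); last by rewrite muln0.
  apply: eq_bigr => t _; rewrite /a muln_eq0 /= (gtn_eqF r0) /n !natrM -mulf_div divff ?mul1r //.
  by rewrite pnatr_eq0 -lt0n.
apply: le_trans (coarse_fine _ q0 r0) _.
have -> : 90 * Num.sqrt r%:R * isq q%:R = q%:R^-1 * (90 * Num.sqrt n%:R).
  rewrite /n natrM sqrtrM ?ler0n // /isq -[X in X^-1 * _]sqr_sqrtr ?ltW //.
  by field; rewrite lt0r_neq0 ?sqrtr_gt0.
rewrite ler_pM2l ?invr_gt0 // -/n.
set m := Num.sqrt n%:R.
have m1 : 1 <= m by rewrite -[leLHS]sqrtr1 ler_wsqrtr // ler1n.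
pose B u := hz (u%:R / n%:R) - isq (u%:R / n%:R).
pose C u := hz (u%:R / n%:R) + isq (u%:R / n%:R).
have Bn u : (0 < u <= n)%N -> `|B u| <= 3.
  move=> /andP[u0 un]; apply: hz_bound; first by rewrite divr_gt0 ?ltr0n.
  by rewrite ler_pdivrMr // mul1r ler_nat.
have Cn u : (0 < u <= n)%N -> `|C u| <= 5 * m.
  move=> /andP[u0 un]; have -> : C u = B u + 2 * isq (u%:R / n%:R) by rewrite /C /B; ring.
  apply: le_trans (ler_normD _ _) _; have := Bn u; rewrite u0 un => /(_ isT).
  have : isq (u%:R / n%:R) <= m by apply: isq_nat_le => //; rewrite leq_pmulr.
  rewrite [`|2 * _|]ger0_norm ?mulr_ge0 ?isq_ge0 //; lra.
have an_le u : (u <= n)%N -> `|a u| <= 15 * m.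
  move=> un; rewrite /a; set v := if _ then _ else _.
  have vn : (0 < v <= n)%N by rewrite /v; case: eqP; lia.
  rewrite /hz_reg normrM (_ : 15 * m = 3 * (5 * m)); last by ring.
  by apply: ler_pM => //; [exact: Bn | exact: Cn].
rewrite big_ltn //.
have j0 : `|a 1%N - a 0%N| <= 30 * m.
  apply: le_trans (ler_normB _ _) _; have := an_le 0%N; have := an_le 1%N n0; rewrite leq0n => ? /(_ isT); lra.
have : \sum_(1 <= u < n) `|a u.+1 - a u| <= 60 * m.
  rewrite (eq_big_nat _ _ (F2 := fun u => `|B u.+1 * C u.+1 - B u * C u|)); last first.
    by move=> [|u].
  rewrite (_ : 60 * m = 4 * 3 * (5 * m)); last by ring.
  have pos u : (0 < u)%N -> 0 < u%:R / n%:R :> R by move=> u0; rewrite divr_gt0 ?ltr0n.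
  have inc u : u%:R / n%:R <= u.+1%:R / n%:R :> R by rewrite ler_pM2r ?invr_gt0 // ler_nat.
  apply: tv_prod_mono => //.
  - by move=> u /andP[u0 _]; apply: hzB_mono; [exact: pos | exact: inc].
  - move=> u /andP[u0 _]; apply: lerD; first by apply: hz_mono; [exact: pos | exact: inc].
    by apply: isq_le; [exact: pos | exact: inc].
lra.
Qed.

Definition harmonic_sum n : R := \sum_(0 <= t < n) (t.+1%:R)^-1.

Lemma harmonic_sum_diff q r : (0 < q)%N -> (0 < r)%N ->
  `|harmonic_sum (r * q) - harmonic_sum q - ln r%:R| <= q%:R^-1.
Proof.
move=> q0 r0; have qR : 0 < q%:R :> R by rewrite ltr0n.
have rR : 0 < r%:R :> R by rewrite ltr0n.
have lnV (y : R) : 0 < y -> 1 - y^-1 <= ln y.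
  move=> y0; have : -1 < y^-1 - 1 by rewrite ltrBDl subrr invr_gt0.
  by move/le_ln1Dx; rewrite subrKC lnV ?posrE //; lra.
have ln1 (y : R) : 0 < y -> ln y <= y - 1.
  move=> y0; have : -1 < y - 1 by lra.
  by move/le_ln1Dx; rewrite subrKC.
have -> : harmonic_sum (r * q) - harmonic_sum q = \sum_(q <= t < r * q) (t.+1%:R)^-1.
  by rewrite /harmonic_sum (@big_cat_nat _ _ _ q 0 (r * q)) ?leq_pmull //= addrAC subrr add0r.
have qrq : (q <= r * q)%N by rewrite leq_pmull.
have up : \sum_(q <= t < r * q) (t.+1%:R)^-1 <= ln r%:R :> R.
  have -> : ln r%:R = ln (r * q)%:R - ln q%:R :> R.
    by rewrite natrM lnM ?posrE // addrK.
  rewrite -(telescope_sumr (fun t => ln t%:R)) //; apply: ler_sum_nat => t /andP[qt _].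
  have t0 : 0 < t%:R :> R by rewrite ltr0n (leq_trans q0).
  have t1 : 0 < t.+1%:R :> R by rewrite ltr0n.
  rewrite -ln_div ?posrE //; apply: le_trans (lnV _ (divr_gt0 t1 t0)).
  rewrite invf_div -natr1 le_eqVlt; apply/orP; left; apply/eqP; field.
  by rewrite natr1 lt0r_neq0.
have lo : ln r%:R - q%:R^-1 <= \sum_(q <= t < r * q) (t.+1%:R)^-1 :> R.
  have : ln (r * q).+1%:R - ln q.+1%:R <= \sum_(q <= t < r * q) (t.+1%:R)^-1 :> R.
    rewrite -(telescope_sumr (fun t => ln t.+1%:R)) //; apply: ler_sum_nat => t /andP[qt _].
    have t1 : 0 < t.+1%:R :> R by rewrite ltr0n.
    have t2 : 0 < t.+2%:R :> R by rewrite ltr0n.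
    rewrite -ln_div ?posrE //; apply: le_trans (ln1 _ (divr_gt0 t2 t1)) _.
    by rewrite -[t.+2%:R]natr1 le_eqVlt; apply/orP; left; apply/eqP; field; rewrite lt0r_neq0.
  apply: le_trans.
  have h1 : ln q.+1%:R <= ln q%:R + q%:R^-1 :> R.
    rewrite -lerBlDl -ln_div ?posrE ?ltr0n //; apply: le_trans (ln1 _ _) _; rewrite ?divr_gt0 ?ltr0n //.
    by rewrite -natr1 le_eqVlt; apply/orP; left; apply/eqP; field; rewrite lt0r_neq0.
  have h2 : ln r%:R + ln q%:R <= ln (r * q).+1%:R :> R.
    by rewrite -lnM ?posrE // -natrM ler_ln ?posrE ?ltr0n ?muln_gt0 ?r0 // ler_nat.
  lra.
by rewrite ler_norml; apply/andP; split; lra.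
Qed.

Lemma hz_corr11E q : (0 < q)%N ->
  hz_corr q 1 1 = harmonic_sum q + q%:R^-1 * \sum_(0 <= t < q) hz_reg (t.+1%:R / q%:R).
Proof.
move=> q0; have qR : 0 < q%:R :> R by rewrite ltr0n.
rewrite /hz_corr; under eq_bigr do rewrite mul1n.
rewrite -(sum_shift_periodic (G := fun u => hzp q u * hzp q u) 1); last by move=> u; rewrite hzp_per.
rewrite (eq_big_nat _ _ (F2 := fun t => q%:R * (t.+1%:R)^-1 + hz_reg (t.+1%:R / q%:R))); last first.
  move=> t /andP[_ tq]; rewrite addn1 hzp_small // -expr2 hz_regE ?divr_gt0 ?ltr0n //.
  by rewrite invf_div.
rewrite big_split /= mulrDr -mulr_sumr mulrA mulVf ?mul1r // lt0r_neq0 //.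
Qed.

(** The singular part [1/x], sampled at the points [t/q], contributes a harmonic sum; the difference
    of two harmonic sums is the origin of [ln r], while the regular part is nearly the same on both
    grids. *)
Lemma hz_corr11_diff q r : (0 < q)%N -> (0 < r)%N ->
  `|hz_corr (r * q) 1 1 - hz_corr q 1 1 - ln r%:R| <= 91 * Num.sqrt r%:R * isq q%:R.
Proof.
move=> q0 r0; rewrite !hz_corr11E ?muln_gt0 ?r0 //.
have := hz_reg_coarse_fine q0 r0; have := harmonic_sum_diff q0 r0.
have : q%:R^-1 <= Num.sqrt r%:R * isq q%:R :> R.
  rewrite -isq_sqr ?ler0n // expr2 ler_pM ?isq_ge0 //.
  apply: (@le_trans _ _ 1).
    by rewrite -[leRHS]invr1 -[X in _ <= X^-1]sqrtr1; apply: isq_le; rewrite ?ler1n.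
  by rewrite -[leLHS]sqrtr1 ler_wsqrtr // ler1n.
by rewrite !ler_norml => ? /andP[? ?] /andP[? ?]; apply/andP; split; lra.
Qed.

(** By the distribution relation both factors are sums of translates on the grid of [n = h * k * q]
    points. The whole fine grid is handled by [hz_corr_scale], and the passage to the coarse grid is
    estimated for each pair of translates. Only the pair [(0, 0)] has coinciding singularities; it
    contributes [ln (h * k)] through [hz_corr11_diff]. *)
Lemma hz_corr_twist h k q : (0 < h)%N -> (0 < k)%N -> (0 < q)%N -> coprime h k ->
  `|hz_corr q h k - isq (h * k)%:R * (hz_corr q 1 1 - ln (h * k)%:R)|
    <= 300 * (h * k)%:R ^+ 2 * isq q%:R.
Proof.
move=> h0 k0 q0 hk; set r := (h * k)%N; have r0 : (0 < r)%N by rewrite muln_gt0 h0.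
have rR : 0 < r%:R :> R by rewrite ltr0n.
have qR : 0 < q%:R :> R by rewrite ltr0n.
set n := (r * q)%N; have n0 : (0 < n)%N by rewrite muln_gt0 r0.
have exph u : hzp n (h * u) = isq h%:R * \sum_(0 <= i < h) hzp n (u + i * k * q).
  have -> : \sum_(0 <= i < h) hzp n (u + i * k * q) =
      \sum_(0 <= i < h) hzp (h * (k * q)) (u + i * (k * q)).
    by apply: eq_bigr => i _; rewrite /n /r !mulnA.
  rewrite hzp_distr ?muln_gt0 ?k0 // mulrA mulVf ?mul1r ?lt0r_neq0 ?sqrtr_gt0 ?ltr0n //.
  by rewrite -(@hzp_scale R h (k * q)) ?muln_gt0 ?k0 // /n /r mulnA.
have expk u : hzp n (k * u) = isq k%:R * \sum_(0 <= j < k) hzp n (u + j * h * q).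
  have nE : n = (k * (h * q))%N by rewrite /n /r; ring.
  have -> : \sum_(0 <= j < k) hzp n (u + j * h * q) =
      \sum_(0 <= j < k) hzp (k * (h * q)) (u + j * (h * q)).
    by apply: eq_bigr => i _; rewrite nE !mulnA.
  rewrite hzp_distr ?muln_gt0 ?h0 // mulrA mulVf ?mul1r ?lt0r_neq0 ?sqrtr_gt0 ?ltr0n //.
  by rewrite -(@hzp_scale R k (h * q)) ?muln_gt0 ?h0 // nE.
pose a i j u := hzp n (u + i * k * q) * hzp n (u + j * h * q).
have expand u : hzp n (h * u) * hzp n (k * u) =
    isq r%:R * \sum_(0 <= i < h) \sum_(0 <= j < k) a i j u.
  rewrite exph expk mulrACA -isqM ?ler0n // -natrM; congr (_ * _).
  by rewrite mulr_suml; apply: eq_bigr => i _; rewrite mulr_sumr.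
pose del i j := q%:R^-1 * (\sum_(0 <= t < q) a i j (r * t)%N) - n%:R^-1 * (\sum_(0 <= u < n) a i j u).
have corr_diff : hz_corr q h k - hz_corr n h k =
    isq r%:R * \sum_(0 <= i < h) \sum_(0 <= j < k) del i j.
  have -> : hz_corr q h k = q%:R^-1 * \sum_(0 <= t < q) hzp n (h * (r * t)) * hzp n (k * (r * t)).
    congr (_ * _); apply: eq_bigr => t _.
    by rewrite (mulnCA h) (mulnCA k) /n !hzp_scale.
  rewrite /hz_corr; under eq_bigr do rewrite expand.
  under [in X in _ - X]eq_bigr do rewrite expand.
  rewrite -!mulr_sumr (mulrCA q%:R^-1) (mulrCA n%:R^-1) -mulrBr; congr (_ * _).
  have sw (F : nat -> nat -> nat -> R) m : \sum_(0 <= t < m) \sum_(0 <= i < h) \sum_(0 <= j < k) F i j t =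
      \sum_(0 <= i < h) \sum_(0 <= j < k) \sum_(0 <= t < m) F i j t.
    by rewrite exchange_big; apply: eq_bigr => i _; rewrite exchange_big.
  rewrite (sw (fun i j t => a i j (r * t)%N)) (sw a) !mulr_sumr -sumrB.
  by apply: eq_bigr => i _; rewrite !mulr_sumr -sumrB.
have del0 : del 0%N 0%N = hz_corr q 1 1 - hz_corr n 1 1.
  rewrite /del /hz_corr; congr (_ * _ - _ * _); apply: eq_bigr => t _; rewrite /a !mul0n addn0 mul1n //.
  by rewrite /n hzp_scale.
have delb i j : (i < h)%N -> (j < k)%N -> (i, j) != (0, 0)%N ->
    `|del i j| <= 192 * r%:R * isq q%:R.
  move=> ih jk ij0.
  (* Chinese remainder theorem: [i * k = j * h] modulo [h * k] forces [h] to divide [i] and [k] to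
     divide [j]. *)
  have ne : (i * k != j * h %[mod r])%N.
    apply: contra ij0; rewrite /r chinese_remainder // !modnMl ?modnMr ?mod0n.
    rewrite xpair_eqE (eq_sym 0%N) -!/(dvdn _ _) !Gauss_dvdl // 1?coprime_sym //.
    move=> /andP[/dvdn_leq hi /dvdn_leq kj].
    by apply/andP; split; rewrite -leqn0 leqNgt; apply/negP; [move=> /hi | move=> /kj]; rewrite leqNgt ?ih ?jk.
  apply: le_trans (coarse_fine _ q0 r0) _.
  apply: (@le_trans _ _ (q%:R^-1 * (192 * Num.sqrt r%:R * Num.sqrt n%:R))).
    by rewrite ler_pM2l ?invr_gt0 //; exact: tv_cross_shift.
  rewrite /n natrM sqrtrM ?ler0n // le_eqVlt; apply/orP; left; apply/eqP.
  rewrite /isq -[X in X^-1 * _ = _]sqr_sqrtr ?ltW // -[X in _ = 192 * X * _]sqr_sqrtr ?ltW //.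
  by field; rewrite lt0r_neq0 ?sqrtr_gt0.
have sum_del : `|\sum_(0 <= i < h) \sum_(0 <= j < k) del i j - del 0%N 0%N| <= 192 * r%:R ^+ 2 * isq q%:R.
  rewrite (big_ltn h0) (big_ltn k0) addrAC [X in X + _]addrAC subrr add0r.
  have c0 : 0 <= 192 * r%:R * isq q%:R by rewrite !mulr_ge0 ?isq_ge0 ?ler0n.
  set c := 192 * r%:R * isq q%:R in c0 delb.
  apply: le_trans (ler_normD _ _) _.
  have b1 : `|\sum_(1 <= j < k) del 0%N j| <= c * (k - 1)%:R.
    apply: le_trans (ler_norm_sum _ _ _) _; rewrite mulr_natr -sumr_const_nat.
    by apply: ler_sum_nat => j /andP[j0 jk]; apply: delb => //; rewrite xpair_eqE /= -lt0n.
  have b2 : `|\sum_(1 <= i < h) \sum_(0 <= j < k) del i j| <= c * ((h - 1) * k)%:R.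
    apply: le_trans (ler_norm_sum _ _ _) _; rewrite natrM mulrCA mulr_natl -sumr_const_nat.
    apply: ler_sum_nat => i /andP[i0 ih].
    apply: le_trans (ler_norm_sum _ _ _) _; rewrite mulr_natr -[k in X in _ <= X]subn0 -sumr_const_nat.
    by apply: ler_sum_nat => j /andP[_ jk]; apply: delb => //; rewrite xpair_eqE negb_and -lt0n i0.
  have -> : 192 * r%:R ^+ 2 * isq q%:R = c * r%:R by rewrite /c; ring.
  apply: le_trans (lerD b1 b2) _; rewrite -mulrDr ler_wpM2l // -natrD ler_nat /r; nia.
have exact_n : hz_corr n h k = isq r%:R * hz_corr q 1 1 by exact: hz_corr_scale.
have dd := hz_corr11_diff q0 r0; rewrite -/n in dd.
have -> : hz_corr q h k - isq r%:R * (hz_corr q 1 1 - ln r%:R) =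
   isq r%:R * ((\sum_(0 <= i < h) \sum_(0 <= j < k) del i j - del 0%N 0%N)
     - (hz_corr n 1 1 - hz_corr q 1 1 - ln r%:R)).
  have -> : hz_corr q h k = hz_corr n h k + isq r%:R * \sum_(0 <= i < h) \sum_(0 <= j < k) del i j.
    by rewrite -corr_diff addrC subrK.
  by rewrite exact_n del0; ring.
rewrite normrM ger0_norm ?isq_ge0 //.
have i1 : isq r%:R <= 1.
  by rewrite -[leRHS]invr1 -[X in _ <= X^-1]sqrtr1; apply: isq_le; rewrite ?ler1n.
apply: (@le_trans _ _ (1 * (192 * r%:R ^+ 2 * isq q%:R + 91 * Num.sqrt r%:R * isq q%:R))).
  apply: ler_pM; rewrite ?isq_ge0 //; apply: le_trans (ler_normB _ _) _; exact: lerD.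
have r1 : 1 <= r%:R :> R by rewrite ler1n.
have : Num.sqrt r%:R <= r%:R ^+ 2 :> R.
  rewrite -[leRHS]ger0_norm ?exprn_ge0 ?ler0n // -sqrtr_sqr ler_wsqrtr // -exprM -[leLHS]expr1.
  exact: ler_weXn2l.
rewrite mul1r -mulrDl; move=> sr; apply: ler_wpM2r; first exact: isq_ge0.
nra.
Qed.

(** The harmonic sum is at most [2 + ln q]. The regular part is at most [9 + 6 * isq x], and the
    average of [isq x] telescopes through [isq x <= 2 sqrt q (sqrt (t+1) - sqrt t)], giving
    [9 + 12 = 21]. *)
Lemma hz_corr11_le q : (0 < q)%N -> hz_corr q 1 1 <= ln q%:R + 23.
Proof.
move=> q0; have qR : 0 < q%:R :> R by rewrite ltr0n.
rewrite hz_corr11E //.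
have : harmonic_sum q <= 2 + ln q%:R.
  have := harmonic_sum_diff (ltn0Sn 0) q0; rewrite muln1 invr1.
  by rewrite {2}/harmonic_sum big_nat1 invr1 => /ler_normlP[_]; lra.
have reg t : (t < q)%N ->
    hz_reg (t.+1%:R / q%:R) <= 9 + 12 * Num.sqrt q%:R * (Num.sqrt t.+1%:R - Num.sqrt t%:R).
  move=> tq; set x := _ / _.
  have x0 : 0 < x by rewrite divr_gt0 ?ltr0n.
  have x1 : x <= 1 by rewrite ler_pdivrMr // mul1r ler_nat.
  have xE : isq x <= 2 * Num.sqrt q%:R * (Num.sqrt t.+1%:R - Num.sqrt t%:R).
    rewrite /x isqM ?ler0n // isqV ?ler0n // [leRHS]mulrAC ler_wpM2r ?sqrtr_ge0 //.
    by rewrite -natr1; apply: sqrtS_ge.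
  have := hz_bound x0 x1; have := isq_ge0 x; rewrite /hz_reg ler_norml => i0 /andP[? ?].
  nra.
have : q%:R^-1 * (\sum_(0 <= t < q) hz_reg (t.+1%:R / q%:R)) <= 21.
  rewrite ler_pdivrMl //.
  apply: (@le_trans _ _ (\sum_(0 <= t < q) (9 + 12 * Num.sqrt q%:R * (Num.sqrt t.+1%:R - Num.sqrt t%:R)))).
    by apply: ler_sum_nat => t /andP[_]; exact: reg.
  rewrite big_split /= sumr_const_nat subn0 -mulr_sumr telescope_sumr // sqrtr0 subr0 -mulr_natr.
  by rewrite -mulrA -expr2 sqr_sqrtr ?ler0n //; lra.
lra.
Qed.

Lemma hz_corr11_ge0 q : 0 <= hz_corr q 1 1.
Proof.
rewrite mulr_ge0 ?invr_ge0 ?ler0n // sumr_ge0 // => t _.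
by rewrite mul1n -expr2 sqr_ge0.
Qed.
End TwistedCorrelation.

(** * Real numbers inside the complex field *)

Section RealComplex.
Variable R : realType.
Implicit Types (x y : R) (u v : R[i]).

Lemma normC_real x : `|x%:C| = `|x|%:C.
Proof. by rewrite normc_def /= expr0n /= addr0 sqrtr_sqr. Qed.

Lemma lecR x y : (x%:C <= y%:C) = (x <= y).
Proof. by rewrite lecE /= eqxx. Qed.

Lemma realCM x y : (x * y)%:C = x%:C * y%:C.
Proof. exact: rmorphM. Qed.

Lemma realCD x y : (x + y)%:C = x%:C + y%:C.
Proof. exact: rmorphD. Qed.

Lemma realC_sum (I : Type) (r : seq I) (P : pred I) (G : I -> R) :
  (\sum_(i <- r | P i) G i)%:C = \sum_(i <- r | P i) (G i)%:C.
Proof. exact: (rmorph_sum (real_complex R)). Qed.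

Lemma realC_ge0 x : (0 <= x%:C) = (0 <= x).
Proof. by rewrite -lecR. Qed.

Lemma normC_nc u : `|u| = (Normc.normc u)%:C.
Proof. by rewrite normc_def; case: u. Qed.

Lemma normc_ge0 u : 0 <= Normc.normc u.
Proof. by rewrite -lecR -normC_nc normr_ge0. Qed.

Lemma cvgC_bound (I : Type) (F : set_system I) (FF : Filter F) (u : I -> R[i]) l (B : I -> R) :
  (\forall i \near F, `|u i - l| <= (B i)%:C) -> B i @[i --> F] --> 0 ->
  (u i : R[i]^o) @[i --> F] --> (l : R[i]^o).
Proof.
move=> uB B0; apply/cvgrPdist_le => e e0.
have eE : e = (complex.Re e)%:C.
  by move: e0; rewrite ltcE /= => /andP[/eqP + _]; case: (e) => a b /= ->.
have re0 : 0 < complex.Re e by move: e0; rewrite ltcE /= => /andP[].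
move/cvgrPdist_le: B0 => /(_ _ re0) B0.
near=> i; rewrite distrC; apply: (@le_trans _ _ (B i)%:C); first by near: i.
rewrite eE lecR; have : `|0 - B i| <= complex.Re e by near: i.
by rewrite sub0r normrN; apply: le_trans; exact: ler_norm.
Unshelve. all: by end_near. Qed.

Lemma natpowC_half n : (0 < n)%N -> natpowC n (- (2^-1 : R[i])) = (isq (n%:R : R))%:C.
Proof.
move=> n0; have -> : (- (2^-1 : R[i])) = (- (2^-1 : R))%:C.
  by rewrite rmorphN /= fmorphV /= rmorph_nat.
rewrite /natpowC /= mul0r cos0 sin0 -[_ +i* _]/(1%:C) mulr1.
by rewrite powRN powR12_sqrt ?ler0n // /isq.
Qed.
End RealComplex.

(** * The central value as a finite character sum *)

Section LFunction.
Variables (R : realType) (q : nat).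
Hypothesis pq : prime q.
Local Notation hzp := (@hzp R).
Local Notation dchar := (@dchar R q pq).
Local Notation fchar := (@fchar R q pq).
Let q0 : (0 < q)%N := prime_gt0 pq.
Let qR : 0 < q%:R :> R. Proof. by rewrite ltr0n. Qed.

Definition hzF (x : 'F_q) : R := hzp q x.

(** Makes sense for every [k], also for [k = 0], where the Dirichlet series diverges; so averages
    may run over all [q.-1] characters. The residue 0 is killed by [fchar]. *)
Definition Lhz (k : nat) : R[i] :=
  (isq (q%:R : R))%:C * \sum_(x : 'F_q) fchar k x * (hzF x)%:C.

Lemma sum_Fp (V : nmodType) (G : 'F_q -> V) :
  \sum_(x : 'F_q) G x = \sum_(0 <= a < q) G a%:R.
Proof.
rewrite -[X in \sum_(0 <= a < X) _](Fp_cast pq) big_mkord.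
by apply: eq_bigr => x _; rewrite natr_Zp.
Qed.

Lemma hzF_nat (a : nat) : hzF a%:R = hzp q a.
Proof.
rewrite /hzF; apply: hzp_mod => //.
by rewrite val_Fp_nat // modn_mod.
Qed.

Lemma dchar_nat k (a : nat) : dchar k a%:Z = fchar k a%:R.
Proof. by rewrite /dchar -pmulrn. Qed.

Let part k K : R[i] := \sum_(0 <= n < K * q) dchar k n%:Z * (isq (n%:R : R))%:C.

(** Write [n = a + i * q]. As the character sums to 0 over a period, the same quantity [2 sqrt K]
    may be subtracted for every residue [a], which turns the divergent inner sums into convergent
    ones. *)
Lemma dchar_part_block k K : (0 < k < q.-1)%N ->
  part k K = (isq (q%:R : R))%:C * \sum_(0 <= a < q) dchar k a%:Z *
    (hz_part (a%:R / q%:R) K + 2 * (Num.sqrt (K%:R + a%:R / q%:R) - Num.sqrt (K%:R)))%:C.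
Proof.
move=> kq; rewrite /part sum_nat_block.
have chi0 : \sum_(0 <= a < q) dchar k a%:Z = 0.
  have := sum_fchar R pq kq; rewrite sum_Fp => {2}<-.
  by apply: eq_bigr => a _; rewrite dchar_nat.
have -> : \sum_(0 <= a < q) dchar k a%:Z *
    (hz_part (a%:R / q%:R) K + 2 * (Num.sqrt (K%:R + a%:R / q%:R) - Num.sqrt (K%:R)))%:C =
    \sum_(0 <= a < q) dchar k a%:Z * (\sum_(0 <= i < K) isq (i%:R + a%:R / q%:R : R))%:C.
  apply/eqP; rewrite -subr_eq0 -sumrB.
  rewrite (eq_bigr (fun a => - (2 * Num.sqrt (K%:R : R))%:C * dchar k a%:Z)); last first.
    move=> a _; rewrite -mulrBr mulrC -rmorphB -rmorphN /=; congr (_%:C * _).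
    by rewrite /hz_part; ring.
  by rewrite -mulr_sumr chi0 mulr0.
rewrite mulr_sumr; apply: eq_bigr => a _; rewrite mulrCA rmorph_sum /= !mulr_sumr.
apply: eq_bigr => i _; rewrite -rmorphM /= -isqM ?ler0n //.
have -> : q%:R * (i%:R + a%:R / q%:R) = (a + i * q)%:R :> R.
  by rewrite natrD natrM; field; exact: lt0r_neq0.
by rewrite !dchar_nat natrD natrM pchar_Fp_0 // mulr0 addr0.
Qed.

Lemma dirichlet_L_cvg k : (0 < k < q.-1)%N ->
  ((\sum_(1 <= n < N) dchar k n%:Z * natpowC n (- 2^-1) : R[i]^o) @[N --> \oo]
    --> (Lhz k : R[i]^o)).
Proof.
move=> kq.
have normd a : `|dchar k a| <= 1.
  rewrite /dchar; have [->|a0] := eqVneq (a%:~R : 'F_q) 0; first by rewrite fchar0 normr0 ler01.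
  by rewrite fchar_norm.
have d0 : dchar k 0%:Z = 0 by rewrite dchar_nat mulr0n fchar0.
(* Three errors: the convergence of [hz_part] at each nonzero residue, the differences of square
   roots, and the incomplete last block of fewer than [q] terms. Residue 0 is left out of [e1],
   since [hz_part] converges to [hz] only at positive arguments; the character vanishes there. *)
pose e1 K : R := \sum_(0 <= a < q) (if a == 0%N then 0 else `|hz_part (a%:R / q%:R) K - hz (a%:R / q%:R)|).
pose e2 K : R := \sum_(0 <= a < q) `|Num.sqrt (K%:R + a%:R / q%:R) - Num.sqrt (K%:R + 0)|.
pose e3 K : R := q%:R * isq (K * q)%:R.
pose B K := isq q%:R * (e1 K + 2 * e2 K) + e3 K.
have e1_0 : e1 @ \oo --> (0 : R).
  rewrite /e1 -fct_sumE -[X in _ --> X](_ : \sum_(0 <= i < q) 0 = 0); last by rewrite big1.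
  elim/big_ind2 : _ => [|f u g v fu gv|a _]; [exact: cvg_cst|exact: cvgD|].
  have [a0|a0] := eqVneq a 0%N; first exact: cvg_cst.
  rewrite -[X in _ --> X](normr0 R); apply: cvg_norm.
  rewrite -(subrr (hz (a%:R / q%:R))); apply: cvgB; last exact: cvg_cst.
  by apply: hz_cvg; rewrite divr_gt0 ?ltr0n // lt0n.
have e2_0 : e2 @ \oo --> (0 : R).
  rewrite /e2 -fct_sumE -[X in _ --> X](_ : \sum_(0 <= i < q) 0 = 0); last by rewrite big1.
  elim/big_ind2 : _ => [|f u g v fu gv|a _]; [exact: cvg_cst|exact: cvgD|].
  rewrite -[X in _ --> X](normr0 R); apply: cvg_norm.
  by apply: sqrt_shift_cvg; rewrite ?divr_ge0 ?ler0n.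
have e3_0 : e3 @ \oo --> (0 : R).
  apply/cvgrPdist_le => e ep; near=> K; rewrite sub0r normrN ger0_norm ?mulr_ge0 ?isq_ge0 ?ler0n //.
  have K0 : (0 < K)%N by near: K; exists 1%N.
  have KR : 0 < (K * q)%:R :> R by rewrite ltr0n muln_gt0 K0.
  rewrite /e3 /isq ler_pdivrMr ?sqrtr_gt0 // -ler_pdivrMl //.
  apply: le_trans (ler_norm _) _; rewrite -sqrtr_sqr ler_wsqrtr //.
  apply: (@le_trans _ _ K%:R); last by rewrite ler_nat leq_pmulr.
  by near: K; exact: nbhs_infty_ger.
have B0 : B @ \oo --> (0 : R).
  rewrite /B -[X in _ --> X]addr0; apply: cvgD => //.
  rewrite -[X in _ --> X](mulr0 (isq q%:R)); apply: cvgM; first exact: cvg_cst.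
  rewrite -[X in _ --> X]addr0; apply: cvgD => //.
  by rewrite -[X in _ --> X](mulr0 2); apply: cvgM => //; exact: cvg_cst.
have Bq : (fun N => B (N %/ q)%N) @ \oo --> (0 : R).
  by apply: (cvg_comp (fun N => (N %/ q)%N) B _ B0); exact: cvg_divnr.
apply: (@cvgC_bound R nat _ _ _ _ _ _ Bq); near=> N.
have Nq : (q <= N)%N by near: N; exact: nbhs_infty_ge.
set K := (N %/ q)%N; have K0 : (0 < K)%N by rewrite divn_gt0.
have KN : (K * q <= N)%N by exact: leq_trunc_div.
have -> : \sum_(1 <= n < N) dchar k n%:Z * natpowC n (- 2^-1) =
    part k K + \sum_(K * q <= n < N) dchar k n%:Z * (isq (n%:R : R))%:C.
  rewrite /part -big_cat_nat //= [in RHS]big_ltn ?(leq_trans q0) // d0 mul0r add0r.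
  by apply: eq_big_nat => n /andP[n0 _]; rewrite natpowC_half.
rewrite dchar_part_block // /Lhz sum_Fp addrAC -mulrBr.
apply: le_trans (ler_normD _ _) _; rewrite /B realCD; apply: lerD.
  rewrite normrM normC_real (ger0_norm (isq_ge0 _)) realCM ler_wpM2l ?realC_ge0 ?isq_ge0 //.
  rewrite -sumrB; apply: le_trans (ler_norm_sum _ _ _) _.
  rewrite /e1 /e2 mulr_sumr -big_split /= realC_sum; apply: ler_sum_nat => a /andP[_ aq].
  rewrite -dchar_nat -mulrBr normrM -rmorphB normC_real.
  case: (posnP a) => [->|a0].
    by rewrite d0 normr0 mul0r realC_ge0 add0r mulr_ge0.
  rewrite hzF_nat hzp_small // ?(ltnW aq) //.
  apply: (@le_trans _ _ (1 * `|hz_part (a%:R / q%:R) K + 2 * (Num.sqrt (K%:R + a%:R / q%:R) -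
       Num.sqrt K%:R) - hz (a%:R / q%:R)|%:C)).
    by rewrite ler_wpM2r // realC_ge0.
  rewrite mul1r lecR addr0 [X in `|X|]addrAC.
  apply: le_trans (ler_normD _ _) _; by rewrite lerD2l normrM (ger0_norm (ler0n R 2)).
apply: le_trans (ler_norm_sum _ _ _) _.
apply: (@le_trans _ _ (\sum_(K * q <= n < N) (isq (K * q)%:R)%:C)).
  apply: ler_sum_nat => n /andP[Kn nN]; rewrite normrM normC_real (ger0_norm (isq_ge0 _)).
  rewrite -[leRHS]mul1r; apply: ler_pM => //; first by rewrite realC_ge0 isq_ge0.
  by rewrite lecR; apply: isq_le; rewrite ?ltr0n ?muln_gt0 ?K0 // ler_nat.
rewrite sumr_const_nat -rmorphMn /= lecR /e3 -mulr_natl ler_wpM2r ?isq_ge0 // ler_nat.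
by rewrite leq_subLR {1}(divn_eq N q) leq_add2l ltnW // ltn_mod.
Unshelve. all: by end_near. Qed.

Lemma dirichlet_LE k : (0 < k < q.-1)%N -> dirichlet_L 2^-1 (dchar k) = Lhz k.
Proof.
by move=> kq; apply: (cvg_lim _ (dirichlet_L_cvg kq)); exact: norm_hausdorff.
Qed.
End LFunction.

Section Conj.
Variable R : realType.

Lemma conjCM (u v : R[i]) : Num.conj (u * v) = Num.conj u * Num.conj v.
Proof. exact: rmorphM. Qed.

Lemma conjC_sum I (s : seq I) (P : pred I) (f : I -> R[i]) :
  Num.conj (\sum_(i <- s | P i) f i) = \sum_(i <- s | P i) Num.conj (f i).
Proof. exact: rmorph_sum. Qed.

Lemma conj_real (c : R) : Num.conj (c%:C) = c%:C.
Proof. by apply/eqP; rewrite eq_complex /= oppr0 !eqxx. Qed.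
End Conj.

(** * First and second twisted moments of the central value *)

Section TwistedMoments.
Variables (R : realType) (q : nat).
Hypothesis pq : prime q.
Local Notation hzp := (@hzp R).
Local Notation dchar := (@dchar R q pq).
Local Notation fchar := (@fchar R q pq).
Local Notation Lhz := (@Lhz R q pq).
Local Notation hzF := (@hzF R q).
Let q0 : (0 < q)%N := prime_gt0 pq.
Let qR : 0 < q%:R :> R. Proof. by rewrite ltr0n. Qed.
Let q1 : (0 < q.-1)%N. Proof. have := prime_gt1 pq; lia. Qed.

Definition avg (f : nat -> R[i]) : R[i] := (q.-1%:R)^-1 * \sum_(k < q.-1) f k.

Lemma avg_sum (I : Type) (s : seq I) (P : pred I) (c : I -> R[i]) (f : I -> nat -> R[i]) :
  avg (fun k => \sum_(i <- s | P i) c i * f i k) = \sum_(i <- s | P i) c i * avg (f i).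
Proof.
rewrite /avg exchange_big mulr_sumr; apply: eq_bigr => i _ /=.
by rewrite -mulr_sumr mulrCA.
Qed.

Lemma eq_avg f g : (forall k, f k = g k) -> avg f = avg g.
Proof. by move=> fg; rewrite /avg; congr (_ * _); apply: eq_bigr. Qed.

Lemma avg_orth x y : x != 0 -> y != 0 ->
  avg (fun k => fchar k x * Num.conj (fchar k y)) = (x == y)%:R.
Proof.
move=> x0 y0; rewrite /avg sum_fchar_orth // natrM mulrA mulVf ?mul1r //.
by rewrite pnatr_eq0 -lt0n.
Qed.

Lemma conj_fchar_real k x (c : R) : Num.conj (fchar k x * c%:C) = Num.conj (fchar k x) * c%:C.
Proof. by rewrite conjCM conj_real. Qed.

(** Orthogonality keeps the single residue with [x * c = d]. *)
Lemma first_moment_Fp c d : c != 0 -> d != 0 ->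
  avg (fun k => Lhz k * fchar k c * Num.conj (fchar k d)) = (isq q%:R * hzF (d / c))%:C.
Proof.
move=> c0 d0; rewrite (eq_avg (g := fun k => \sum_(x : 'F_q)
  ((isq (q%:R : R))%:C * (hzF x)%:C) * (fchar k (x * c) * Num.conj (fchar k d)))); last first.
  move=> k; rewrite /Lhz mulr_sumr !mulr_suml; apply: eq_bigr => x _; rewrite fcharM; ring.
rewrite avg_sum (bigD1 (d / c)) //= big1 => [|x xdc].
  rewrite addr0 avg_orth ?divfK // ?mulf_neq0 ?invr_neq0 // eqxx mulr1.
  by rewrite realCM.
have [->|x0] := eqVneq x 0.
  rewrite mul0r (eq_avg (g := fun=> 0)) ?/avg ?big1 ?mulr0 // => k; by rewrite fchar0 mul0r.
rewrite avg_orth ?mulf_neq0 //; case: eqP => [e|_]; last by rewrite mulr0.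
by rewrite -e mulfK // eqxx in xdc.
Qed.

(** Orthogonality keeps the pairs with [x * c = y * d], parametrized by [x = d * t] and
    [y = c * t]. *)
Lemma second_moment_Fp c d : c != 0 -> d != 0 ->
  avg (fun k => Lhz k * Num.conj (Lhz k) * fchar k c * Num.conj (fchar k d)) =
  (q%:R^-1 * \sum_(t : 'F_q | t != 0) hzF (d * t) * hzF (c * t))%:C.
Proof.
move=> c0 d0.
have LE k : Lhz k = (isq (q%:R : R))%:C * \sum_(x : 'F_q | x != 0) fchar k x * (hzF x)%:C.
  by rewrite /Lhz (bigID (fun x => x == 0)) /= big_pred1_eq fchar0 mul0r add0r.
rewrite (eq_avg (g := fun k => \sum_(x : 'F_q | x != 0) q%:R^-1 * (\sum_(y : 'F_q | y != 0)
  ((hzF x)%:C * (hzF y)%:C) * (fchar k (x * c) * Num.conj (fchar k (y * d)))))); last first.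
  move=> k; rewrite LE conjCM conj_real conjC_sum mulrACA -realCM -expr2 isq_sqr ?ler0n // -[RHS]mulr_sumr.
  have -> : (q%:R^-1 : R)%:C = q%:R^-1 :> R[i] by rewrite fmorphV /= rmorph_nat.
  rewrite -!mulrA; congr (_ * _); rewrite !mulr_suml; apply: eq_bigr => x _.
  rewrite ?mulr_suml ?mulr_sumr; apply: eq_bigr => y _.
  rewrite conj_fchar_real !fcharM conjCM; ring.
rewrite avg_sum -mulr_sumr realCM realC_sum; congr (_ * _).
  by rewrite fmorphV /= rmorph_nat.
have cd : injective (fun t : 'F_q => d * t) := mulfI d0.
rewrite (reindex_inj cd) /=; apply: eq_big => [t|t t0].
  by rewrite mulf_eq0 negb_or d0.
rewrite avg_sum (bigD1 (c * t)) ?mulf_neq0 //=; last by move: t0; rewrite mulf_eq0 negb_or => /andP[].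
move: t0; rewrite mulf_eq0 negb_or => /andP[_ t0].
rewrite big1 => [|y /andP[y0 yct]]; rewrite avg_orth ?mulf_neq0 //.
  by rewrite (_ : d * t * c = c * t * d) ?eqxx ?mulr1 ?addr0 -?realCM //; ring.
case: eqP => [e|_]; last by rewrite mulr0.
by case/eqP: yct; apply: (mulIf d0); rewrite -e; ring.
Qed.

Lemma natF_neq0 m : (0 < m < q)%N -> (m%:R : 'F_q) != 0.
Proof.
move=> /andP[m0 mq]; rewrite -val_eqE /= val_Fp_nat // modn_small // -lt0n //.
Qed.

(** The surviving residue is [x = n / m] in ['F_q]. If [m] divides [n], it is the small integer
    [n %/ m], and [hz (x / q)] is within 3 of [sqrt (q / x)]. Otherwise [x * m] is congruent but not
    equal to [n], so [x * m >= q] and the value is at most [4 sqrt (m / q)]. *)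
Lemma first_moment m n : (0 < m < q)%N -> (0 < n < q)%N ->
  `|avg (fun k => Lhz k * dchar k m%:Z * Num.conj (dchar k n%:Z))
    - (if (m %| n)%N then isq ((n %/ m)%:R : R) else 0)%:C| <= (4 * Num.sqrt m%:R * isq q%:R)%:C.
Proof.
move=> mq nq; have m0 := natF_neq0 mq; have n0 := natF_neq0 nq.
rewrite (eq_avg (g := fun k => Lhz k * fchar k m%:R * Num.conj (fchar k n%:R))); last first.
  by move=> k; rewrite !dchar_nat.
rewrite first_moment_Fp // -rmorphB normC_real lecR.
move: mq nq => /andP[mp mq] /andP[np nq].
set x := (n%:R / m%:R : 'F_q).
have xm : (x : nat) * m = n %[mod q].
  have : ((x : nat) * m)%:R = n%:R :> 'F_q by rewrite natrM natr_Zp /x divfK.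
  by move/(congr1 val); rewrite /= !val_Fp_nat.
have xq : (x < q)%N by rewrite -[X in (_ < X)%N](Fp_cast pq); exact: ltn_ord.
have x0 : (0 < x)%N.
  by rewrite lt0n -[X in X != _]/(val x) (val_eqE x 0) /x mulf_neq0 ?invr_neq0.
have E : hzF x = hz ((x : nat)%:R / q%:R) by rewrite /hzF hzp_small // ltnW.
have xR : 0 < (x : nat)%:R / q%:R :> R by rewrite divr_gt0 // ltr0n.
have x1 : (x : nat)%:R / q%:R <= 1 :> R by rewrite ler_pdivrMr // mul1r ler_nat ltnW.
have sm : 1 <= Num.sqrt m%:R :> R by rewrite -[leLHS]sqrtr1 ler_wsqrtr // ler1n.
have iq := isq_ge0 (q%:R : R).
have iE : isq q%:R * isq ((x : nat)%:R / q%:R) = isq (x : nat)%:R :> R.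
  by rewrite -isqM ?ler0n // mulrC divfK // lt0r_neq0.
case: ifP => mn.
  have -> : (n %/ m = x)%N.
    have xE : (n %/ m)%:R = x :> 'F_q by rewrite /x -[in RHS](divnK mn) natrM mulfK.
    have := congr1 val xE; rewrite /= val_Fp_nat // modn_small //.
    by apply: leq_ltn_trans nq; exact: leq_div.
  rewrite -iE E -mulrBr normrM ger0_norm // mulrC.
  have := hz_bound xR x1; nra.
rewrite subr0 normrM ger0_norm // E.
apply: (@le_trans _ _ (4 * isq (x : nat)%:R)).
  by rewrite -iE mulrCA ler_wpM2l //; exact: hz_le_isq.
rewrite -mulrA ler_pM2l //.
have qxm : (q <= x * m)%N.
  rewrite leqNgt; apply/negP => xmq; move: xm; rewrite !modn_small // => xm.
  by rewrite -xm dvdn_mull in mn.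
have -> : Num.sqrt m%:R * isq q%:R = isq (q%:R / m%:R) :> R.
  by rewrite isqM ?ler0n // isqV ?ler0n // mulrC.
apply: isq_le; first by rewrite divr_gt0 // ltr0n.
by rewrite ler_pdivrMr ?ltr0n // -natrM ler_nat.
Qed.

(** The common factor [g] drops out because the character has modulus 1 there, leaving coprime [h],
    [k] for [hz_corr_twist]. The missing term [t = 0] raises the constant from 300 to 316. *)
Lemma second_moment m n r : (0 < m < q)%N -> (0 < n < q)%N ->
  r = ((m %/ gcdn m n) * (n %/ gcdn m n))%N ->
  `|avg (fun k => Lhz k * Num.conj (Lhz k) * dchar k m%:Z * Num.conj (dchar k n%:Z))
    - (isq r%:R * (hz_corr R q 1 1 - ln r%:R))%:C| <= (316 * (m * n)%:R ^+ 2 * isq q%:R)%:C.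
Proof.
move=> /andP[m0 mq] /andP[n0 nq] ->.
set g := gcdn m n; set h := (m %/ g)%N; set k := (n %/ g)%N.
have g0 : (0 < g)%N by rewrite gcdn_gt0 m0.
have mE : m = (h * g)%N by rewrite divnK // dvdn_gcdl.
have nE : n = (k * g)%N by rewrite divnK // dvdn_gcdr.
have h0 : (0 < h)%N by move: m0; rewrite mE muln_gt0 => /andP[].
have k0 : (0 < k)%N by move: n0; rewrite nE muln_gt0 => /andP[].
have hm : (h <= m)%N by exact: leq_div.
have kn : (k <= n)%N by exact: leq_div.
have hF : (h%:R : 'F_q) != 0 by apply: natF_neq0; rewrite h0 (leq_ltn_trans hm).
have kF : (k%:R : 'F_q) != 0 by apply: natF_neq0; rewrite k0 (leq_ltn_trans kn).
have gF : (g%:R : 'F_q) != 0.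
  by apply: natF_neq0; rewrite g0 (leq_ltn_trans _ mq) // dvdn_leq // dvdn_gcdl.
have hk : coprime h k by rewrite /coprime -(eqn_pmul2r g0) mul1n muln_gcdl -mE -nE.
rewrite (eq_avg (g := fun l => Lhz l * Num.conj (Lhz l) * fchar l h%:R * Num.conj (fchar l k%:R))); last first.
  move=> l; rewrite !dchar_nat mE nE !natrM !fcharM conjCM -!mulrA; congr (_ * (_ * (_ * _))).
  by rewrite [X in _ * X]mulrCA fchar_conj // mulr1.
rewrite second_moment_Fp // -rmorphB normC_real lecR.
have -> : q%:R^-1 * (\sum_(t : 'F_q | t != 0) hzF (k%:R * t) * hzF (h%:R * t)) =
    hz_corr R q h k - q%:R^-1 * hz 1 ^+ 2.
  apply/eqP; rewrite -subr_eq opprK -mulrDr; apply/eqP; congr (_ * _).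
  have -> : \sum_(0 <= t < q) hzp q (h * t) * hzp q (k * t) =
      \sum_(t : 'F_q) hzF (k%:R * t) * hzF (h%:R * t).
    rewrite sum_Fp //; apply: eq_bigr => t _.
    by rewrite -!natrM !hzF_nat // mulrC.
  rewrite [RHS](bigID (fun t => t == 0)) /= big_pred1_eq addrC !mulr0; congr (_ + _).
  by rewrite -(mulr0n 1) hzF_nat // (@hzpE _ q 0 q) ?modnn ?mod0n // divff ?lt0r_neq0 // expr2.
have tw := hz_corr_twist R h0 k0 q0 hk.
rewrite addrAC; apply: le_trans (ler_normB _ _) _.
have iq : q%:R^-1 <= isq q%:R :> R.
  rewrite -isq_sqr ?ler0n // expr2 ler_piMl ?isq_ge0 //.
  by rewrite -[leRHS]invr1 -[X in _ <= X^-1]sqrtr1; apply: isq_le; rewrite ?ler1n.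
have h16 : `|q%:R^-1 * hz 1 ^+ 2| <= 16 * isq q%:R :> R.
  have h2 : 0 <= (hz 1 : R) ^+ 2 := sqr_ge0 _.
  have qi : 0 <= q%:R^-1 :> R by rewrite invr_ge0.
  rewrite (ger0_norm (mulr_ge0 qi h2)) mulrC; apply: ler_pM => //.
  have := @hz_le_isq R 1 ltr01 (lexx _); rewrite /isq sqrtr1 invr1 mulr1 => /ler_normlP[? ?]; nra.
have rmn : (h * k)%:R <= (m * n)%:R :> R by rewrite ler_nat leq_mul.
have r1 : 1 <= (h * k)%:R :> R by rewrite ler1n muln_gt0 h0.
have rr : (h * k)%:R ^+ 2 <= (m * n)%:R ^+ 2 :> R by rewrite ler_sqr ?nnegrE ?ler0n.
have ii := isq_ge0 (q%:R : R).
apply: le_trans (lerD tw h16) _.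
rewrite -mulrDl ler_wpM2r //; nra.
Qed.
End TwistedMoments.

(** * Finite lists of smooth integers *)

Definition prodl (D1 D2 : seq nat) : seq nat := [seq (m * n)%N | m <- D1, n <- D2].

Definition powl (B p : nat) : seq nat := [seq (p ^ a)%N | a <- iota 0 B.+1].

(** The cap [B] on the exponents keeps the list finite; it loses no integer with at most [B] prime
    factors. *)
Definition smooth (B : nat) (ps : seq nat) : seq nat :=
  foldr (fun p D => prodl (powl B p) D) [:: 1%N] ps.

Definition coprimel (D1 D2 : seq nat) : Prop :=
  forall m n, m \in D1 -> n \in D2 -> coprime m n.

Definition posl (D : seq nat) : Prop := forall n, n \in D -> (0 < n)%N.

Lemma sum_prodl (V : nmodType) (D1 D2 : seq nat) (F : nat -> V) :
  \sum_(n <- prodl D1 D2) F n = \sum_(m <- D1) \sum_(n <- D2) F (m * n)%N.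
Proof. by rewrite /prodl big_allpairs_dep. Qed.

Lemma prodlP D1 D2 n :
  reflect (exists m1 m2, [/\ m1 \in D1, m2 \in D2 & n = (m1 * m2)%N]) (n \in prodl D1 D2).
Proof.
apply: (iffP allpairsP) => [[[m1 m2] /= [h1 h2 ->]]|[m1 [m2 [h1 h2 ->]]]]; first by exists m1, m2.
by exists (m1, m2).
Qed.

Lemma posl_prodl D1 D2 : posl D1 -> posl D2 -> posl (prodl D1 D2).
Proof. by move=> p1 p2 n /prodlP[m1 [m2 [/p1 h1 /p2 h2 ->]]]; rewrite muln_gt0 h1. Qed.

Lemma coprimel_prodlr D D1 D2 : coprimel D D1 -> coprimel D D2 -> coprimel D (prodl D1 D2).
Proof.
move=> c1 c2 m n mD /prodlP[m1 [m2 [h1 h2 ->]]].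
by rewrite coprimeMr c1 // c2.
Qed.

Lemma powlP B p n : reflect (exists2 a, (a <= B)%N & n = (p ^ a)%N) (n \in powl B p).
Proof.
apply: (iffP mapP) => [[a]|[a aB ->]]; first by rewrite mem_iota add0n ltnS => aB ->; exists a.
by exists a; rewrite // mem_iota add0n ltnS.
Qed.

Lemma sum_powl (V : nmodType) B p (F : nat -> V) :
  \sum_(n <- powl B p) F n = \sum_(0 <= a < B.+1) F (p ^ a)%N.
Proof. by rewrite /powl big_map /index_iota subn0. Qed.

Lemma posl_powl B p : prime p -> posl (powl B p).
Proof. by move=> /prime_gt0 p0 n /powlP[a _ ->]; rewrite expn_gt0 p0. Qed.

Lemma posl_smooth B ps : all prime ps -> posl (smooth B ps).
Proof.
elim: ps => [_ n|p ps IH /= /andP[pp aps]]; first by rewrite inE => /eqP ->.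
by apply: posl_prodl; [exact: posl_powl | exact: IH].
Qed.

Lemma mem_smooth B ps n : all prime ps -> uniq ps ->
  (n \in smooth B ps) =
  [&& (0 < n)%N, all [in ps] (primes n) & all (fun p => logn p n <= B)%N ps].
Proof.
elim: ps n => [n _ _|p ps IH n /= /andP[pp aps] /andP[pps ups]].
  rewrite inE andbT; apply/eqP/andP => [->//|[n0 /allP h]].
  apply/eqP; rewrite eqn_leq n0 andbT leqNgt; apply/negP => n1.
  by have := h (pdiv n); rewrite mem_primes pdiv_prime // n0 pdiv_dvd inE => /(_ isT).
apply/prodlP/and3P => [[_ [m [/powlP[a aB ->]]]]|[n0 /allP pn /andP[npB /allP nB]]].
  rewrite IH // => /and3P[m0 /allP pm /allP mB] ->.
  have pm0 : ~~ (p %| m)%N.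
    by apply: contra pps => pm0; apply: pm; rewrite mem_primes pp m0.
  have cpm : coprime p m by rewrite prime_coprime.
  have pa0 : (0 < p ^ a)%N by rewrite expn_gt0 prime_gt0.
  split; first by rewrite muln_gt0 pa0.
    apply/allP => r; rewrite primesM // inE => /orP[|/pm ->]; last by rewrite orbT.
    by rewrite mem_primes => /and3P[rp _]; rewrite Euclid_dvdX // dvdn_prime2 // => /andP[->].
  apply/andP; split; first by rewrite mulnC logn_Gauss // pfactorK.
  apply/allP => r rps; rewrite logn_Gauss; first exact: mB.
  have rp : prime r := allP aps r rps.
  apply: coprimeXr; rewrite prime_coprime ?dvdn_prime2 //.
  by apply: contra pps => /eqP e; rewrite -e.
have [m pm nE] := pfactor_coprime pp n0.
have m0 : (0 < m)%N by move: n0; rewrite {1}nE muln_gt0 => /andP[].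
exists (p ^ logn p n)%N, m; split; last by rewrite mulnC.
  by apply/powlP; exists (logn p n).
rewrite IH // m0 /=; apply/andP; split; apply/allP => r.
  rewrite mem_primes => /and3P[rp _ rm].
  have : r \in p :: ps by apply: pn; rewrite mem_primes rp n0 nE dvdn_mulr.
  rewrite inE => /orP[/eqP rE|//]; move: pm; rewrite prime_coprime // -rE rm //.
move=> rps; apply: leq_trans (nB r rps); rewrite {1}nE lognM ?leq_addr // expn_gt0 prime_gt0 //.
Qed.

Lemma coprimel_powl_smooth B p ps : prime p -> all prime ps -> p \notin ps ->
  coprimel (powl B p) (smooth B ps).
Proof.
move=> pp; elim: ps => [_ _ m n _|r ps IH /= /andP[rp aps]].
  by rewrite inE => /eqP ->; rewrite coprimen1.
rewrite inE negb_or => /andP[pr pps]; apply: coprimel_prodlr; last exact: IH.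
move=> m n /powlP[a _ ->] /powlP[b _ ->]; apply: coprimeXl; apply: coprimeXr.
by rewrite prime_coprime // dvdn_prime2.
Qed.

Lemma uniq_smooth B ps : all prime ps -> uniq ps -> uniq (smooth B ps).
Proof.
elim: ps => [//|p ps IH /= /andP[pp aps] /andP[pps ups]].
have p1 := prime_gt1 pp.
have cpm m : m \in smooth B ps -> logn p m = 0%N.
  move=> mS; apply: logn_coprime.
  have := @coprimel_powl_smooth B.+1 p ps pp aps pps.
  move=> /(_ p m); rewrite -{1}(expn1 p); apply; first by apply/powlP; exists 1%N.
  by move: mS; rewrite !mem_smooth // => /and3P[-> -> /allP h] /=; apply/allP => r /h /leqW.
apply: allpairs_uniq; [|exact: IH|].
  rewrite map_inj_in_uniq ?iota_uniq // => a b _ _ /eqP.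
  by rewrite eqn_exp2l // => /eqP.
move=> u v uD vD; move/allpairsP: uD => [[x m] [/= xP mS ->]].
move/allpairsP: vD => [[y n] [/= yP nS ->]] /= e.
move: xP yP e => /powlP[a _ ->] /powlP[b _ ->] e.
have pos := posl_smooth aps.
have pX c : (0 < p ^ c)%N by rewrite expn_gt0 prime_gt0.
have m0 := pos B m mS; have n0 := pos B n nS.
have ab : a = b.
  have := congr1 (logn p) e; rewrite !lognM ?pX //.
  by rewrite !pfactorK // (cpm _ mS) (cpm _ nS) !addn0.
move: e; rewrite ab => /eqP; rewrite eqn_pmul2l ?pX // => /eqP -> //.
Qed.

(** * Multiplicative double sums *)

Section Kernels.
Variable R : realType.
Implicit Types (u : nat -> R) (g L : nat -> nat -> R).

Definition multiplicative u := forall m n, (0 < m)%N -> (0 < n)%N -> coprime m n ->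
  u (m * n)%N = u m * u n.

Definition bimultiplicative g := forall m1 n1 m2 n2,
  (0 < m1)%N -> (0 < n1)%N -> (0 < m2)%N -> (0 < n2)%N -> coprime (m1 * n1) (m2 * n2) ->
  g (m1 * m2)%N (n1 * n2)%N = g m1 n1 * g m2 n2.

Definition biadditive L := forall m1 n1 m2 n2,
  (0 < m1)%N -> (0 < n1)%N -> (0 < m2)%N -> (0 < n2)%N -> coprime (m1 * n1) (m2 * n2) ->
  L (m1 * m2)%N (n1 * n2)%N = L m1 n1 + L m2 n2.

Definition ksum (D : seq nat) g := \sum_(m <- D) \sum_(n <- D) g m n.

Lemma sum_prodl_mult D1 D2 u : multiplicative u -> posl D1 -> posl D2 -> coprimel D1 D2 ->
  \sum_(n <- prodl D1 D2) u n = (\sum_(n <- D1) u n) * \sum_(n <- D2) u n.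
Proof.
move=> um p1 p2 c; rewrite sum_prodl mulr_suml; apply: eq_big_seq => m mD.
rewrite mulr_sumr; apply: eq_big_seq => n nD.
by apply: um; [exact: p1 | exact: p2 | exact: c].
Qed.

Lemma coprimel4 D1 D2 m1 n1 m2 n2 : coprimel D1 D2 ->
  m1 \in D1 -> n1 \in D1 -> m2 \in D2 -> n2 \in D2 -> coprime (m1 * n1) (m2 * n2).
Proof. by move=> c *; rewrite coprimeMl !coprimeMr !c. Qed.

Lemma ksum_prodl D1 D2 g : posl D1 -> posl D2 -> coprimel D1 D2 -> bimultiplicative g ->
  ksum (prodl D1 D2) g = ksum D1 g * ksum D2 g.
Proof.
move=> p1 p2 c gm; rewrite /ksum sum_prodl mulr_suml; apply: eq_big_seq => m1 m1D.
under eq_bigr do rewrite sum_prodl.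
rewrite exchange_big /= mulr_suml; apply: eq_big_seq => n1 n1D.
rewrite mulr_sumr; apply: eq_big_seq => m2 m2D.
rewrite mulr_sumr; apply: eq_big_seq => n2 n2D.
by rewrite (gm _ _ _ _ (p1 _ m1D) (p1 _ n1D) (p2 _ m2D) (p2 _ n2D)) //; exact: (coprimel4 c).
Qed.

(** Leibniz rule: inserting an additive weight acts like a derivation on the product of
    [ksum_prodl]. *)
Lemma ksumL_prodl D1 D2 g L : posl D1 -> posl D2 -> coprimel D1 D2 ->
  bimultiplicative g -> biadditive L ->
  ksum (prodl D1 D2) (fun m n => g m n * L m n) =
  ksum D1 (fun m n => g m n * L m n) * ksum D2 g + ksum D1 g * ksum D2 (fun m n => g m n * L m n).
Proof.
move=> p1 p2 c gm La; rewrite /ksum sum_prodl !mulr_suml -big_split /=.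
apply: eq_big_seq => m1 m1D; under eq_bigr do rewrite sum_prodl.
rewrite exchange_big /= !mulr_suml -big_split /=; apply: eq_big_seq => n1 n1D.
rewrite !mulr_sumr -big_split /=; apply: eq_big_seq => m2 m2D.
rewrite !mulr_sumr -big_split /=; apply: eq_big_seq => n2 n2D.
have c4 := coprimel4 c m1D n1D m2D n2D.
rewrite (gm _ _ _ _ (p1 _ m1D) (p1 _ n1D) (p2 _ m2D) (p2 _ n2D) c4).
rewrite (La _ _ _ _ (p1 _ m1D) (p1 _ n1D) (p2 _ m2D) (p2 _ n2D) c4); ring.
Qed.

Lemma sum_smooth B ps u : all prime ps -> uniq ps -> multiplicative u -> u 1%N = 1 ->
  \sum_(n <- smooth B ps) u n = \prod_(p <- ps) \sum_(0 <= a < B.+1) u (p ^ a)%N.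
Proof.
move=> + + um u1; elim: ps => [_ _|p ps IH /= /andP[pp aps] /andP[pps ups]].
  by rewrite big_seq1 big_nil u1.
rewrite big_cons sum_prodl_mult ?sum_powl ?IH //; [exact: posl_powl|exact: posl_smooth|].
exact: coprimel_powl_smooth.
Qed.

(** Bounds [e] for the sums multiply, and relative bounds [t] for the weighted sums add, as for a
    logarithmic derivative. In this form the estimate passes through the inductions over primes and
    over blocks. *)
Lemma ksum_prodl_bounds D1 D2 g L e1 e2 t1 t2 : posl D1 -> posl D2 -> coprimel D1 D2 ->
  bimultiplicative g -> biadditive L ->
  `|ksum D1 g| <= e1 -> `|ksum D1 (fun m n => g m n * L m n)| <= t1 * e1 ->
  `|ksum D2 g| <= e2 -> `|ksum D2 (fun m n => g m n * L m n)| <= t2 * e2 ->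
  `|ksum (prodl D1 D2) g| <= e1 * e2 /\
  `|ksum (prodl D1 D2) (fun m n => g m n * L m n)| <= (t1 + t2) * (e1 * e2).
Proof.
move=> p1 p2 c gm La s1 a1 s2 a2; split.
  by rewrite ksum_prodl // normrM ler_pM.
rewrite ksumL_prodl //; apply: le_trans (ler_normD _ _) _; rewrite !normrM.
have -> : (t1 + t2) * (e1 * e2) = (t1 * e1) * e2 + e1 * (t2 * e2) by ring.
by apply: lerD; apply: ler_pM.
Qed.

Lemma ksum_smooth_bounds B ps g L (e t : nat -> R) : all prime ps -> uniq ps ->
  bimultiplicative g -> biadditive L -> g 1%N 1%N = 1 -> L 1%N 1%N = 0 ->
  (forall p, p \in ps -> `|ksum (powl B p) g| <= e p) ->
  (forall p, p \in ps -> `|ksum (powl B p) (fun m n => g m n * L m n)| <= t p * e p) ->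
  `|ksum (smooth B ps) g| <= \prod_(p <- ps) e p /\
  `|ksum (smooth B ps) (fun m n => g m n * L m n)| <= (\sum_(p <- ps) t p) * \prod_(p <- ps) e p.
Proof.
move=> + + gm La g1 L1; elim: ps => [_ _ _ _|p ps IH /= /andP[pp aps] /andP[pps ups] eP tP].
  by rewrite /ksum !big_seq1 !big_nil g1 L1 mulr0 mul0r normr0 normr1.
rewrite !big_cons.
have [||IH1 IH2] := IH aps ups; [by move=> r rps; apply: eP; rewrite inE rps orbT|
  by move=> r rps; apply: tP; rewrite inE rps orbT|].
apply: ksum_prodl_bounds => //; [exact: posl_powl|exact: posl_smooth|exact: coprimel_powl_smooth| |].
- by apply: eP; rewrite inE eqxx.
- by apply: tP; rewrite inE eqxx.
Qed.

(* Rankin's trick: a pair with [2 ^ l < 2 ^ w m] or [2 ^ l < 2 ^ w n] is weighted up. *)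
Lemma ksum_filter_le D g (w : nat -> nat) l :
  `|ksum [seq n <- D | (w n <= l)%N] g| <=
  `|ksum D g| + 2 ^- l * ksum D (fun m n => `|g m n| * (2 ^+ w m * 2 ^+ w n)).
Proof.
have -> : ksum D g = ksum [seq n <- D | (w n <= l)%N] g + \sum_(m <- D) \sum_(n <- D)
    (if (w m <= l)%N && (w n <= l)%N then 0 else g m n).
  rewrite /ksum big_filter [X in _ = X + _]big_mkcond -big_split /=; apply: eq_bigr => m _.
  rewrite big_filter; case: ifP => _ /=; last by rewrite add0r.
  rewrite [X in _ = X + _]big_mkcond -big_split /=; apply: eq_bigr => n _.
  by case: ifP => _ /=; rewrite ?add0r ?addr0.
set S := ksum _ _; set T := \sum_(m <- D) _.
have : `|T| <= 2 ^- l * ksum D (fun m n => `|g m n| * (2 ^+ w m * 2 ^+ w n)).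
  rewrite mulr_sumr; apply: le_trans (ler_norm_sum _ _ _) _; apply: ler_sum => m _.
  rewrite mulr_sumr; apply: le_trans (ler_norm_sum _ _ _) _; apply: ler_sum => n _.
  case: ifP => h; first by rewrite normr0 mulr_ge0 ?invr_ge0 ?exprn_ge0 ?mulr_ge0 ?exprn_ge0.
  rewrite mulrCA ler_peMr // ler_pdivlMl ?exprn_gt0 // mulr1 -exprD.
  by rewrite ler_weXn2l ?ler1n //; lia.
have : `|S| <= `|S + T| + `|T| by rewrite -{1}[S](addrK T); exact: ler_normB.
lra.
Qed.
End Kernels.

Lemma prime_OmegaE n N : (0 < n)%N -> (n <= N)%N ->
  prime_Omega n = (\sum_(0 <= p < N.+1) logn p n)%N.
Proof.
move=> n0 nN; rewrite /prime_Omega [RHS](bigID (mem (primes n))) /= [X in (_ + X)%N]big1 ?addn0; last first.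
  by move=> p pn; apply/eqP; rewrite -leqn0 leqNgt logn_gt0.
rewrite -[RHS]big_filter; apply: perm_big; apply: uniq_perm; rewrite ?primes_uniq ?filter_uniq ?iota_uniq //.
move=> p; rewrite mem_filter mem_index_iota /=; case: (boolP (p \in primes n)) => //=.
by rewrite mem_primes n0 => /andP[_ /(dvdn_leq n0)]; lia.
Qed.

Lemma ler_sum_seq (K : numDomainType) (I : eqType) (s : seq I) (F G : I -> K) :
  (forall i, i \in s -> F i <= G i) -> \sum_(i <- s) F i <= \sum_(i <- s) G i.
Proof. by move=> FG; rewrite big_seq [leRHS]big_seq; apply: ler_sum. Qed.

(** * Mollifier coefficients and local factors *)

Section MollifierCoefficients.
Variable R : realType.
Local Notation nu := (@nu R).
Local Notation liouville := (@liouville R).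

Lemma nuE n N : (0 < n)%N -> (n <= N)%N ->
  nu n = \prod_(0 <= p < N.+1) ((logn p n)`!%:R)^-1.
Proof.
move=> n0 nN; rewrite /nu [RHS](bigID (mem (primes n))) /= [X in _ * X]big1 ?mulr1; last first.
  move=> p pn; have -> : logn p n = 0%N by apply/eqP; rewrite -leqn0 leqNgt logn_gt0.
  by rewrite fact0 invr1.
rewrite -[RHS]big_filter; apply: perm_big; apply: uniq_perm; rewrite ?primes_uniq ?filter_uniq ?iota_uniq //.
move=> p; rewrite mem_filter mem_index_iota /=; case: (boolP (p \in primes n)) => //=.
by rewrite mem_primes n0 => /andP[_ /(dvdn_leq n0)]; lia.
Qed.

Lemma prime_OmegaM m n : (0 < m)%N -> (0 < n)%N ->
  prime_Omega (m * n) = (prime_Omega m + prime_Omega n)%N.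
Proof.
move=> m0 n0; have mn0 : (0 < m * n)%N by rewrite muln_gt0 m0.
rewrite (prime_OmegaE mn0 (leqnn _)) (@prime_OmegaE m (m * n)) ?leq_pmulr //.
rewrite (@prime_OmegaE n (m * n)) ?leq_pmull // -big_split /=.
by apply: eq_bigr => p _; rewrite lognM.
Qed.

Lemma prime_Omega1 : prime_Omega 1 = 0%N.
Proof. by rewrite /prime_Omega big_nil. Qed.

Lemma prime_Omega_prime p : prime p -> prime_Omega p = 1%N.
Proof. by move=> pp; rewrite /prime_Omega primes_prime // big_seq1 logn_prime // eqxx. Qed.

Lemma prime_OmegaX p a : prime p -> prime_Omega (p ^ a) = a.
Proof.
move=> pp; elim: a => [|a IH]; first by rewrite expn0 prime_Omega1.
by rewrite expnS prime_OmegaM ?expn_gt0 ?(prime_gt0 pp) // IH prime_Omega_prime.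
Qed.

Lemma coprime_logn0 m n p : (0 < m)%N -> (0 < n)%N -> coprime m n ->
  (logn p m == 0%N) || (logn p n == 0%N).
Proof.
move=> m0 n0 c; apply/negPn; rewrite negb_or -!lt0n !logn_gt0 !mem_primes m0 n0.
apply/negP => /andP[/and3P[pp _ pm] /and3P[_ _ pn]].
have : (p %| gcdn m n)%N by rewrite dvdn_gcd pm.
by rewrite (eqP c) dvdn1 => /eqP p1; rewrite p1 in pp.
Qed.

Lemma nuM : multiplicative nu.
Proof.
move=> m n m0 n0 c; have mn0 : (0 < m * n)%N by rewrite muln_gt0 m0.
rewrite (nuE mn0 (leqnn _)) (@nuE m (m * n)) ?leq_pmulr //.
rewrite (@nuE n (m * n)) ?leq_pmull // -big_split /=.
apply: eq_bigr => p _; rewrite lognM // -invfM -natrM.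
by case/orP: (coprime_logn0 p m0 n0 c) => /eqP ->; rewrite fact0 ?addn0 ?muln1 ?mul1n.
Qed.

Lemma nu1 : nu 1%N = 1. Proof. by rewrite /nu big_nil. Qed.

Lemma nuX p a : prime p -> nu (p ^ a)%N = (a`!%:R)^-1.
Proof.
move=> pp; case: a => [|a]; first by rewrite expn0 nu1 fact0 invr1.
by rewrite /nu primesX // primes_prime // big_seq1 pfactorK.
Qed.

Lemma nu_ge0 n : 0 <= nu n.
Proof. by apply: prodr_ge0 => p _; rewrite invr_ge0 ler0n. Qed.

Lemma nu_le1 n : nu n <= 1.
Proof.
rewrite /nu; elim/big_rec : _ => // p x _ x1.
rewrite -[leRHS]mul1r; apply: le_trans (ler_wpM2l _ x1) _; first by rewrite invr_ge0.
by rewrite ler_wpM2r // invf_le1 ?ltr0n ?fact_gt0 // ler1n fact_gt0.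
Qed.

Lemma liouvilleM m n : (0 < m)%N -> (0 < n)%N -> liouville (m * n) = liouville m * liouville n.
Proof. by move=> m0 n0; rewrite /liouville prime_OmegaM // exprD. Qed.

Definition mcoef n : R := liouville n * nu n.

Lemma mcoefM : multiplicative mcoef.
Proof. by move=> m n m0 n0 c; rewrite /mcoef liouvilleM // nuM // mulrACA. Qed.

Lemma mcoef1 : mcoef 1 = 1.
Proof. by rewrite /mcoef nu1 /liouville prime_Omega1 expr0 mulr1. Qed.

Lemma mcoefX p a : prime p -> mcoef (p ^ a)%N = (-1) ^+ a / a`!%:R.
Proof. by move=> pp; rewrite /mcoef nuX // /liouville prime_OmegaX. Qed.

Lemma normr_mcoef n : `|mcoef n| = nu n.
Proof. by rewrite normrM normrX normrN1 expr1n mul1r ger0_norm // nu_ge0. Qed.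

(** Coefficient of the leading term of the mollified second moment: with [h], [k] the quotients of
    [m], [n] by their gcd, [1 / sqrt (m n)] times [1 / sqrt (h k)] is [1 / lcm] ([gkerE]). *)
Definition gker m n : R := mcoef m * mcoef n / (lcmn m n)%:R.

(** The logarithm [ln (h k)] of [hz_corr_twist] ([LkerE]), in a form where additivity is visible. *)
Definition Lker m n : R := ln (lcmn m n)%:R - ln (gcdn m n)%:R.

(** The majorant that [ksum_filter_le] requires for the truncation by [prime_Omega]. *)
Definition gker2 m n : R := `|gker m n| * (2 ^+ prime_Omega m * 2 ^+ prime_Omega n).

Section Coprime.
Variables m1 n1 m2 n2 : nat.
Hypotheses (m10 : (0 < m1)%N) (n10 : (0 < n1)%N) (m20 : (0 < m2)%N) (n20 : (0 < n2)%N).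
Hypothesis c : coprime (m1 * n1) (m2 * n2).

Lemma coprime4_m : coprime m1 m2.
Proof. by move: c; rewrite coprimeMl !coprimeMr => /andP[/andP[]]. Qed.

Lemma coprime4_n : coprime n1 n2.
Proof. by move: c; rewrite coprimeMl !coprimeMr => /andP[_ /andP[]]. Qed.

Let log0 p : (logn p m1 = 0 /\ logn p n1 = 0 \/ logn p m2 = 0 /\ logn p n2 = 0)%N.
Proof.
have := @coprime_logn0 (m1 * n1) (m2 * n2) p; rewrite !muln_gt0 m10 n10 m20 n20.
move=> /(_ isT isT c); rewrite !lognM // !addn_eq0.
by case/orP => /andP[/eqP -> /eqP ->]; [left|right].
Qed.

Lemma gcdn_coprimeM : gcdn (m1 * m2) (n1 * n2) = (gcdn m1 n1 * gcdn m2 n2)%N.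
Proof.
apply: eqn_from_log; rewrite ?muln_gt0 ?gcdn_gt0 ?muln_gt0 ?m10 ?m20 //.
move=> p; rewrite lognM ?gcdn_gt0 ?m10 ?m20 // !logn_gcd ?muln_gt0 ?m10 ?m20 ?n10 ?n20 //.
by rewrite !lognM //; case: (log0 p) => -[-> ->]; rewrite ?addn0 ?add0n.
Qed.

Lemma lcmn_coprimeM : lcmn (m1 * m2) (n1 * n2) = (lcmn m1 n1 * lcmn m2 n2)%N.
Proof.
apply: eqn_from_log; rewrite ?muln_gt0 ?lcmn_gt0 ?muln_gt0 ?m10 ?m20 ?n10 ?n20 //.
move=> p; rewrite lognM ?lcmn_gt0 ?m10 ?m20 ?n10 ?n20 // !logn_lcm ?muln_gt0 ?m10 ?m20 ?n10 ?n20 //.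
by rewrite !lognM //; case: (log0 p) => -[-> ->]; rewrite ?addn0 ?add0n.
Qed.
End Coprime.

Lemma gker_bimult : bimultiplicative gker.
Proof.
move=> m1 n1 m2 n2 m10 n10 m20 n20 c.
rewrite /gker lcmn_coprimeM // natrM invfM.
rewrite mcoefM ?(coprime4_m c) // mcoefM ?(coprime4_n c) //; ring.
Qed.

Lemma Lker_biadd : biadditive Lker.
Proof.
move=> m1 n1 m2 n2 m10 n10 m20 n20 c.
rewrite /Lker lcmn_coprimeM // gcdn_coprimeM // !natrM !lnM ?posrE ?ltr0n ?lcmn_gt0 ?gcdn_gt0 ?m10 ?m20 ?n10 ?n20 //.
ring.
Qed.

Lemma gker2_bimult : bimultiplicative gker2.
Proof.
move=> m1 n1 m2 n2 m10 n10 m20 n20 c.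
rewrite /gker2 gker_bimult // !prime_OmegaM // normrM !exprD; ring.
Qed.

Lemma gker11 : gker 1 1 = 1. Proof. by rewrite /gker mcoef1 mulr1 invr1 mulr1. Qed.
Lemma Lker11 : Lker 1 1 = 0. Proof. by rewrite /Lker subrr. Qed.
Lemma gker211 : gker2 1 1 = 1.
Proof. by rewrite /gker2 gker11 prime_Omega1 expr0 mulr1 normr1 mulr1. Qed.

Lemma Lker_ge0 m n : (0 < m)%N -> (0 < n)%N -> 0 <= Lker m n.
Proof.
move=> m0 n0; rewrite subr_ge0 ler_ln ?posrE ?ltr0n ?lcmn_gt0 ?gcdn_gt0 ?m0 ?n0 // ler_nat.
by apply: (@leq_trans m); rewrite dvdn_leq ?dvdn_gcdl ?dvdn_lcml // lcmn_gt0 m0.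
Qed.

Lemma sum_exp_le x N : 0 <= x -> \sum_(0 <= a < N) x ^+ a / a`!%:R <= expR x :> R.
Proof.
move=> x0; have : series (exp_coeff x) N <= limn (series (exp_coeff x)).
  apply: nondecreasing_cvgn_le; last exact: is_cvg_series_exp_coeff.
  apply/nondecreasing_seqP => n; rewrite -subr_ge0 seriesSB /exp_coeff /=.
  by rewrite divr_ge0 // exprn_ge0.
by [].
Qed.

(** [8 = 4 + 4]: [gkerL_le] meets a double exponential series in [4 ^+ a / a!] and [4 ^+ b / b!];
    the other local bounds need smaller exponents. *)
Definition Cc : R := expR 8.

Lemma Cc_ge1 : 1 <= Cc. Proof. by rewrite -expR0 ler_expR. Qed.

Section LocalFactor.
Variables (p B : nat).
Hypotheses (pp : prime p) (B1 : (0 < B)%N).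
Let p0 : 0 < p%:R :> R. Proof. by rewrite ltr0n prime_gt0. Qed.
Let p2 : 2 <= p%:R :> R. Proof. by rewrite ler_nat prime_gt1. Qed.
Let x : R := p%:R^-1.
Let x0 : 0 < x. Proof. by rewrite invr_gt0. Qed.
Let x12 : x <= 2^-1. Proof. by rewrite lef_pV2 ?posrE. Qed.

Lemma gkerX a b : gker (p ^ a) (p ^ b) =
  (-1) ^+ a / a`!%:R * ((-1) ^+ b / b`!%:R) * x ^+ maxn a b.
Proof. by rewrite /gker !mcoefX // -expn_max natrX exprVn. Qed.

Lemma normr_gkerX a b : `|gker (p ^ a) (p ^ b)| = (a`!%:R)^-1 * (b`!%:R)^-1 * x ^+ maxn a b.
Proof.
by rewrite gkerX !normrM !normrX normrN1 !expr1n !mul1r !normfV !normr_nat.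
Qed.

Lemma LkerX a b : Lker (p ^ a) (p ^ b) = (maxn a b - minn a b)%:R * ln p%:R.
Proof.
rewrite /Lker -expn_max -expn_min !natrX !lnXn // -mulrnBr ?mulr_natl //.
by rewrite (leq_trans (geq_minl a b)) // leq_maxl.
Qed.

Lemma sum2_exp_le (y : R) N : 0 <= y ->
  \sum_(0 <= a < N) \sum_(0 <= b < N) (y ^+ a / a`!%:R) * (y ^+ b / b`!%:R) <= expR (y + y).
Proof.
move=> y0; under eq_bigr do rewrite -mulr_sumr.
rewrite -mulr_suml expRD ler_pM ?sum_exp_le // sumr_ge0 // => a _.
  by rewrite divr_ge0 // exprn_ge0.
by rewrite divr_ge0 // exprn_ge0.
Qed.

Lemma ksum_powlE (g : nat -> nat -> R) : ksum (powl B p) g =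
  \sum_(0 <= a < B.+1) \sum_(0 <= b < B.+1) g (p ^ a)%N (p ^ b)%N.
Proof. by rewrite /ksum sum_powl; apply: eq_bigr => a _; rewrite sum_powl. Qed.

(** The pairs of exponents at most 1 give [1 - 2 x + x = 1 - x], and all others carry at least
    [x ^+ 2]. The sign of [- x] is the saving that the mollifier achieves in the second moment. *)
Lemma gker_local : `|ksum (powl B p) gker| <= expR (- x + Cc * x ^+ 2).
Proof.
pose w (a b : nat) : R := if maxn a b is k.+1 then (if k == 0%N then x else 0) else 1.
pose s (a b : nat) : R := (-1) ^+ a / a`!%:R * ((-1) ^+ b / b`!%:R).
have dw a b : `|gker (p ^ a) (p ^ b) - s a b * w a b| <= (1 ^+ a / a`!%:R) * (1 ^+ b / b`!%:R) * x ^+ 2.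
  have ns : `|s a b| = (1 ^+ a / a`!%:R) * (1 ^+ b / b`!%:R).
    by rewrite /s !normrM !normrX normrN1 !normfV !normr_nat.
  rewrite gkerX -/(s a b) -mulrBr normrM ns.
  apply: ler_wpM2l; first by rewrite mulr_ge0 ?divr_ge0 ?expr1n.
  rewrite /w; case: (maxn a b) => [|[|k]] /=; rewrite ?expr0 ?expr1 ?subrr ?normr0 ?sqr_ge0 //.
  rewrite subr0 ger0_norm ?exprn_ge0 ?(ltW x0) //; apply: ler_wiXn2l; rewrite ?(ltW x0) //.
  by apply: le_trans x12 _; rewrite invf_le1 // ler1n.
have sw : \sum_(0 <= a < B.+1) \sum_(0 <= b < B.+1) s a b * w a b = 1 - x.
  case: B B1 => [//|B' _].
  have z1 : \sum_(2 <= a < B'.+2) \sum_(0 <= b < B'.+2) s a b * w a b = 0.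
    apply: big1_seq => a; rewrite mem_index_iota => /and3P[_ a2 _].
    apply: big1_seq => b _; rewrite /w; have : (2 <= maxn a b)%N by rewrite leq_max a2.
    by case: (maxn a b) => [|[|k]] //= _; rewrite mulr0.
  have z2 c : \sum_(2 <= b < B'.+2) s c b * w c b = 0.
    apply: big1_seq => b; rewrite mem_index_iota => /and3P[_ b2 _].
    rewrite /w; have : (2 <= maxn c b)%N by rewrite leq_max b2 orbT.
    by case: (maxn c b) => [|[|k]] //= _; rewrite mulr0.
  rewrite big_ltn // big_ltn // z1 !(big_ltn (isT : (0 < B'.+2)%N)) !(big_ltn (isT : (1 < B'.+2)%N)) !z2.
  by rewrite /s /w /= !expr0 !expr1 !factS fact0 !muln1 !invr1; ring.
rewrite ksum_powlE.
have d2 : `|\sum_(0 <= a < B.+1) \sum_(0 <= b < B.+1) gker (p ^ a) (p ^ b) - (1 - x)| <= Cc * x ^+ 2.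
  rewrite -sw -sumrB; apply: le_trans (ler_norm_sum _ _ _) _.
  apply: (@le_trans _ _ (\sum_(0 <= a < B.+1) \sum_(0 <= b < B.+1) (1 ^+ a / a`!%:R) * (1 ^+ b / b`!%:R) * x ^+ 2)).
    apply: ler_sum => a _; rewrite -sumrB; apply: le_trans (ler_norm_sum _ _ _) _.
    by apply: ler_sum => b _; exact: dw.
  under eq_bigr do rewrite -mulr_suml.
  rewrite -mulr_suml ler_wpM2r ?sqr_ge0 //; apply: le_trans (sum2_exp_le _ _) _ => //.
  by rewrite ler_expR; lra.
have : `|\sum_(0 <= a < B.+1) \sum_(0 <= b < B.+1) gker (p ^ a) (p ^ b)| <= 1 + (- x + Cc * x ^+ 2).
  set S := \sum_(0 <= a < B.+1) _ in d2 *.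
  have x1 : `|1 - x| = 1 - x.
    by rewrite ger0_norm // subr_ge0 (le_trans x12) // invf_le1 // ler1n.
  have := ler_normD (S - (1 - x)) (1 - x); rewrite subrK x1 => /le_trans; apply.
  by rewrite addrC -addrA lerD2l lerD2l.
by move/le_trans; apply; exact: expR_ge1Dx.
Qed.

Lemma xmax_le a b : (0 < maxn a b)%N -> x ^+ maxn a b <= x.
Proof.
move=> ab; rewrite -[leRHS]expr1; apply: ler_wiXn2l; rewrite ?(ltW x0) //.
by apply: le_trans x12 _; rewrite invf_le1 // ler1n.
Qed.

(** [Lker] vanishes at [a = b = 0], so every remaining term has a factor [x]. Both [y ^+ (a + b)]
    and the difference of the exponents are at most [2 ^+ (a + b)], which produces the base 4. *)
Lemma gkerL_le (y : R) : 1 <= y -> y <= 2 ->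
  ksum (powl B p) (fun m n => `|gker m n| * (y ^+ prime_Omega m * y ^+ prime_Omega n) * Lker m n)
    <= Cc * ln p%:R * x.
Proof.
move=> y1 y2; have y0 : 0 <= y by lra.
have lp : 0 <= ln p%:R :> R by rewrite ln_ge0 // ler1n prime_gt0.
rewrite ksum_powlE; apply: (@le_trans _ _ (\sum_(0 <= a < B.+1) \sum_(0 <= b < B.+1)
    (4 ^+ a / a`!%:R) * (4 ^+ b / b`!%:R) * (ln p%:R * x))).
  apply: ler_sum => a _; apply: ler_sum => b _.
  rewrite normr_gkerX LkerX !prime_OmegaX //.
  have [ab0|ab0] := posnP (maxn a b).
    have h c : 0 <= 4 ^+ c / c`!%:R :> R by rewrite divr_ge0 // exprn_ge0.
    by rewrite ab0 sub0n mul0r mulr0 (mulr_ge0 (mulr_ge0 (h a) (h b)) (mulr_ge0 lp (ltW x0))).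
  have d : (maxn a b - minn a b)%:R <= 2 ^+ a * 2 ^+ b :> R.
    rewrite -natrX -natrX -natrM ler_nat -expnD; apply: leq_trans (ltnW (ltn_expl (a + b) (ltnSn 1))).
    by rewrite leq_subLR; lia.
  have -> : (a`!%:R)^-1 * (b`!%:R)^-1 * x ^+ maxn a b * (y ^+ a * y ^+ b) * ((maxn a b - minn a b)%:R * ln p%:R) =
     ((a`!%:R)^-1 * (b`!%:R)^-1) * ((y ^+ a * y ^+ b) * (maxn a b - minn a b)%:R) * (ln p%:R * x ^+ maxn a b) :> R by ring.
  have -> : 4 ^+ a / a`!%:R * (4 ^+ b / b`!%:R) = ((a`!%:R)^-1 * (b`!%:R)^-1) * ((2 ^+ a * 2 ^+ b) * (2 ^+ a * 2 ^+ b)) :> R.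
    have -> : 4 = 2 * 2 :> R by lra.
    rewrite !exprMn; ring.
  have f0 : 0 <= (a`!%:R)^-1 * (b`!%:R)^-1 :> R by rewrite mulr_ge0.
  apply: ler_pM.
  - by rewrite !mulr_ge0 ?exprn_ge0.
  - by rewrite mulr_ge0 // exprn_ge0 // ltW.
  - apply: ler_wpM2l => //; apply: ler_pM => //; first by rewrite mulr_ge0 ?exprn_ge0.
    by apply: ler_pM; rewrite ?exprn_ge0 // lerXn2r ?nnegrE.
  - by apply: ler_wpM2l => //; exact: xmax_le.
under eq_bigr do rewrite -mulr_suml.
rewrite -mulr_suml -[leRHS]mulrA ler_wpM2r ?mulr_ge0 ?(ltW x0) //.
apply: le_trans (sum2_exp_le _ _) _ => //; rewrite /Cc ler_expR; lra.
Qed.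

Lemma gker2_local : `|ksum (powl B p) gker2| <= expR (Cc * x).
Proof.
rewrite ger0_norm; last first.
  by rewrite /ksum !sumr_ge0 // => a _; rewrite sumr_ge0 // => b _; rewrite !mulr_ge0 ?exprn_ge0.
apply: le_trans (expR_ge1Dx _); rewrite ksum_powlE.
rewrite (big_ltn (isT : (0 < B.+1)%N)) [X in X + _](big_ltn (isT : (0 < B.+1)%N)) -addrA expn0 gker211 lerD2l.
apply: (@le_trans _ _ (\sum_(0 <= a < B.+1) \sum_(0 <= b < B.+1) (2 ^+ a / a`!%:R) * (2 ^+ b / b`!%:R) * x)); last first.
  under eq_bigr do rewrite -mulr_suml.
  rewrite -mulr_suml ler_wpM2r ?(ltW x0) //; apply: le_trans (sum2_exp_le _ _) _ => //.
  by rewrite ler_expR; lra.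
have tb a b : (0 < maxn a b)%N -> gker2 (p ^ a) (p ^ b) <= (2 ^+ a / a`!%:R) * (2 ^+ b / b`!%:R) * x.
  move=> ab; rewrite /gker2 normr_gkerX !prime_OmegaX //.
  rewrite [leLHS](_ : _ = (2 ^+ a / a`!%:R) * (2 ^+ b / b`!%:R) * x ^+ maxn a b); last by ring.
  by apply: ler_wpM2l; [rewrite mulr_ge0 ?divr_ge0 ?exprn_ge0 | exact: xmax_le].
have t0 a b : 0 <= (2 ^+ a / a`!%:R) * (2 ^+ b / b`!%:R) * x.
  by rewrite !mulr_ge0 ?exprn_ge0 // ltW.
rewrite [leRHS](big_ltn (isT : (0 < B.+1)%N)) [X in _ <= X + _](big_ltn (isT : (0 < B.+1)%N)) -addrA.
rewrite -[leLHS]add0r; apply: lerD => //; apply: lerD.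
  by apply: ler_sum_nat => b /andP[b0 _]; apply: (tb 0%N b); rewrite leq_max b0 orbT.
apply: ler_sum_nat => a /andP[a0 _]; apply: ler_sum => b _; apply: tb; by rewrite leq_max a0.
Qed.
End LocalFactor.

Definition s1 (ps : seq nat) : R := \sum_(p <- ps) p%:R^-1.
Definition s2 (ps : seq nat) : R := \sum_(p <- ps) p%:R^-1 ^+ 2.
Definition slog (ps : seq nat) : R := \sum_(p <- ps) ln p%:R / p%:R.

(** A bound for the Euler product over the block, plus the loss from cutting off at [l] prime
    factors. *)
Definition Eblock (l : nat) ps : R :=
  expR (- s1 ps + Cc * s2 ps) + 2 ^- l * expR (Cc * s1 ps).

Definition block (l : nat) ps : seq nat := [seq n <- smooth l ps | (prime_Omega n <= l)%N].

Lemma block_bounds l ps : all prime ps -> uniq ps -> (0 < l)%N ->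
  `|ksum (block l ps) gker| <= Eblock l ps /\
  `|ksum (block l ps) (fun m n => gker m n * Lker m n)| <= 4 * Cc * slog ps * Eblock l ps.
Proof.
move=> aps ups l0.
pose t (p : nat) : R := 4 * Cc * (ln p%:R / p%:R).
pose e (p : nat) : R := expR (- p%:R^-1 + Cc * p%:R^-1 ^+ 2).
pose e' (p : nat) : R := expR (Cc * p%:R^-1).
have C0 : 0 < Cc by exact: expR_gt0.
have tE : \sum_(p <- ps) t p = 4 * Cc * slog ps by rewrite /slog mulr_sumr.
have eE : \prod_(p <- ps) e p = expR (- s1 ps + Cc * s2 ps).
  by rewrite -expR_sum big_split /= sumrN -mulr_sumr.
have e'E : \prod_(p <- ps) e' p = expR (Cc * s1 ps) by rewrite -expR_sum -mulr_sumr.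
have pos := @posl_smooth l ps aps.
(* The factor 4 in [t] allows the weighted bound to be written relative to [e p], which may be as
   small as [expR (-1)]. *)
have e13 : 1 <= 4 * expR (-1) :> R.
  have h : 2^-1 <= expR (- 2^-1) :> R by apply: le_trans (expR_ge1Dx _); lra.
  have -> : (-1 : R) = - 2^-1 + - 2^-1 by lra.
  rewrite expRD; nra.
have tp p : p \in ps -> 0 < p%:R^-1 :> R /\ p%:R^-1 <= 1 :> R.
  move=> /(allP aps) pp; rewrite invr_gt0 ltr0n prime_gt0 // invf_le1 ?ler1n ?ltr0n prime_gt0 //.
have lnp p : p \in ps -> 0 <= ln p%:R :> R by move=> /(allP aps) pp; rewrite ln_ge0 // ler1n prime_gt0.
have [S1 A1] : `|ksum (smooth l ps) gker| <= \prod_(p <- ps) e p /\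
  `|ksum (smooth l ps) (fun m n => gker m n * Lker m n)| <= (\sum_(p <- ps) t p) * \prod_(p <- ps) e p.
  apply: ksum_smooth_bounds => //; [exact: gker_bimult|exact: Lker_biadd|exact: gker11|exact: Lker11| |].
    by move=> p /(allP aps) pp; exact: gker_local.
  move=> p pps; have pp := allP aps p pps; have [x0 x1] := tp p pps.
  apply: (@le_trans _ _ (Cc * ln p%:R * p%:R^-1)).
    have h12 : (1 : R) <= 2 by lra.
    have := @gkerL_le p l pp l0 1 (lexx _) h12; apply: le_trans.
    apply: le_trans (ler_norm_sum _ _ _) _; apply: ler_sum_seq => m mD.
    apply: le_trans (ler_norm_sum _ _ _) _; apply: ler_sum_seq => n nD.
    by rewrite !expr1n !mulr1 normrM (ger0_norm (Lker_ge0 (posl_powl pp mD) (posl_powl pp nD))).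
  rewrite /t /e (_ : 4 * Cc * _ * _ = (Cc * ln p%:R * p%:R^-1) * (4 * expR (- p%:R^-1 + Cc * p%:R^-1 ^+ 2))); last by ring.
  rewrite ler_peMr ?mulr_ge0 ?(ltW C0) ?lnp ?(ltW x0) //; apply: le_trans e13 _.
  rewrite ler_pM2l // ler_expR; have : 0 <= Cc * p%:R^-1 ^+ 2 by rewrite mulr_ge0 ?sqr_ge0 ?ltW.
  lra.
have [S2 A2] : `|ksum (smooth l ps) gker2| <= \prod_(p <- ps) e' p /\
  `|ksum (smooth l ps) (fun m n => gker2 m n * Lker m n)| <= (\sum_(p <- ps) t p) * \prod_(p <- ps) e' p.
  apply: ksum_smooth_bounds => //; [exact: gker2_bimult|exact: Lker_biadd|exact: gker211|exact: Lker11| |].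
    by move=> p /(allP aps) pp; exact: gker2_local.
  move=> p pps; have pp := allP aps p pps; have [x0 x1] := tp p pps.
  apply: (@le_trans _ _ (Cc * ln p%:R * p%:R^-1)).
    rewrite ger0_norm; first by apply: (@gkerL_le p l pp l0); lra.
    rewrite /ksum big_seq sumr_ge0 // => m mD; rewrite big_seq sumr_ge0 // => n nD.
    by rewrite !mulr_ge0 ?exprn_ge0 // Lker_ge0 // (posl_powl pp mD, posl_powl pp nD).
  rewrite /t /e' (_ : 4 * Cc * _ * _ = (Cc * ln p%:R * p%:R^-1) * (4 * expR (Cc * p%:R^-1))); last by ring.
  rewrite ler_peMr ?mulr_ge0 ?(ltW C0) ?lnp ?(ltW x0) //.
  have : 1 <= expR (Cc * p%:R^-1) by rewrite -[leLHS]expR0 ler_expR (mulr_ge0 (ltW C0) (ltW x0)).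
  lra.
rewrite tE eE e'E in S1 A1 S2 A2 *.
have two0 : 0 <= 2 ^- l :> R by rewrite invr_ge0 exprn_ge0.
split.
  apply: le_trans (ksum_filter_le _ _ prime_Omega l) _; rewrite /Eblock lerD // ler_wpM2l //.
  exact: le_trans (ler_norm _) S2.
apply: le_trans (ksum_filter_le _ _ prime_Omega l) _; rewrite /Eblock mulrDr lerD // mulrCA ler_wpM2l //.
apply: le_trans A2; apply: le_trans (ler_norm _); rewrite /ksum.
rewrite big_seq [leRHS]big_seq; apply: ler_sum => m mD; rewrite big_seq [leRHS]big_seq; apply: ler_sum => n nD.
by rewrite /gker2 normrM (ger0_norm (Lker_ge0 (pos _ mD) (pos _ nD))) mulrAC.
Qed.
End MollifierCoefficients.

(** * The support of the full mollifier as a product of blocks *)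

Lemma coprimel_primes (D1 D2 ps1 ps2 : seq nat) : posl D1 -> posl D2 ->
  (forall m, m \in D1 -> {subset primes m <= ps1}) ->
  (forall n, n \in D2 -> {subset primes n <= ps2}) ->
  (forall p, p \in ps1 -> p \in ps2 -> False) -> coprimel D1 D2.
Proof.
move=> p1 p2 s1 s2 dis m n mD nD.
rewrite coprime_has_primes ?(p1 m mD) ?(p2 n nD) //; apply/hasPn => p pn.
by apply/negP => pm; exact: (dis p (s1 m mD p pm) (s2 n nD p pn)).
Qed.

Lemma uniq_prodl D1 D2 : posl D1 -> posl D2 -> coprimel D1 D2 ->
  uniq D1 -> uniq D2 -> uniq (prodl D1 D2).
Proof.
move=> p1 p2 c u1 u2; apply: allpairs_uniq => // u v uD vD.
move/allpairsP: uD => [[m1 m2] [/= m1D m2D ->]]; move/allpairsP: vD => [[n1 n2] [/= n1D n2D ->]] /= e.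
have d1 : (m1 %| n1)%N by rewrite -(Gauss_dvdl _ (c _ _ m1D n2D)) -e dvdn_mulr.
have d2 : (n1 %| m1)%N by rewrite -(Gauss_dvdl _ (c _ _ n1D m2D)) e dvdn_mulr.
have mn : m1 = n1 by apply/eqP; rewrite eqn_dvd d1.
by move: e; rewrite mn => /eqP; rewrite eqn_pmul2l ?(p1 _ n1D) // => /eqP ->.
Qed.

Definition mollD (js : seq (nat * seq nat)) : seq nat :=
  foldr (fun b D => prodl (block b.1 b.2) D) [:: 1%N] js.

Definition wf_blocks (js : seq (nat * seq nat)) : Prop :=
  [/\ all prime (flatten (map snd js)), uniq (flatten (map snd js)) & all (fun b => 0 < b.1)%N js].

Lemma wf_blocks_cons b js : wf_blocks (b :: js) ->
  [/\ all prime b.2, uniq b.2, (0 < b.1)%N, wf_blocks js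
    & forall p, p \in b.2 -> p \in flatten (map snd js) -> False].
Proof.
rewrite /wf_blocks /= all_cat cat_uniq => -[/andP[h1 h2] /and3P[h3 h4 h5] /andP[h6 h7]]; split=> //.
by move=> p pb pj; move/hasPn: h4 => /(_ p pj); rewrite pb.
Qed.

Lemma block_primes l ps n : all prime ps -> uniq ps -> n \in block l ps -> {subset primes n <= ps}.
Proof.
move=> aps ups; rewrite mem_filter mem_smooth // => /andP[_ /and3P[_ /allP h _]] p pn.
exact: h.
Qed.

Lemma posl_block l ps : all prime ps -> posl (block l ps).
Proof. by move=> aps n; rewrite mem_filter => /andP[_]; exact: posl_smooth. Qed.

Lemma uniq_block l ps : all prime ps -> uniq ps -> uniq (block l ps).
Proof. by move=> aps ups; rewrite filter_uniq // uniq_smooth. Qed.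

Lemma posl_mollD js : wf_blocks js -> posl (mollD js).
Proof.
elim: js => [_ n|b js IH /wf_blocks_cons[h1 h2 h3 h4 h5]]; first by rewrite inE => /eqP ->.
by apply: posl_prodl; [exact: posl_block | exact: IH].
Qed.

Lemma mollD_primes js n : wf_blocks js -> n \in mollD js ->
  {subset primes n <= flatten (map snd js)}.
Proof.
elim: js n => [n _|b js IH n /wf_blocks_cons[h1 h2 h3 h4 h5]].
  by rewrite inE => /eqP ->.
move=> /prodlP[m1 [m2 [m1D m2D ->]]] p.
rewrite primesM ?(posl_block h1 m1D) ?(posl_mollD h4 m2D) //= mem_cat.
case/orP => [pm|pm]; first by rewrite (block_primes h1 h2 m1D pm).
by rewrite (IH _ h4 m2D _ pm) orbT.
Qed.

Lemma coprimel_block_mollD b js : wf_blocks (b :: js) -> coprimel (block b.1 b.2) (mollD js).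
Proof.
move=> /wf_blocks_cons[h1 h2 h3 h4 h5].
apply: (@coprimel_primes _ _ b.2 (flatten (map snd js))) => //.
- exact: posl_block.
- exact: posl_mollD.
- by move=> m mD; exact: block_primes mD.
- by move=> n nD; exact: mollD_primes.
Qed.

Lemma uniq_mollD js : wf_blocks js -> uniq (mollD js).
Proof.
elim: js => [//|b js IH h]; have [h1 h2 h3 h4 h5] := wf_blocks_cons h.
apply: uniq_prodl; [exact: posl_block|exact: posl_mollD|exact: coprimel_block_mollD|exact: uniq_block|exact: IH].
Qed.

Section MollifierSums.
Variable R : realType.
Local Notation gker := (@gker R).
Local Notation Lker := (@Lker R).
Local Notation slog := (@slog R).
Local Notation Eblock := (@Eblock R).
Local Notation Cc := (Cc R).

Lemma mollD_bounds js : wf_blocks js ->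
  `|ksum (mollD js) gker| <= \prod_(b <- js) Eblock b.1 b.2 /\
  `|ksum (mollD js) (fun m n => gker m n * Lker m n)| <=
     (\sum_(b <- js) 4 * Cc * slog b.2) * \prod_(b <- js) Eblock b.1 b.2.
Proof.
elim: js => [_|b js IH h].
  by rewrite /ksum !big_seq1 !big_nil gker11 Lker11 mulr0 mul0r normr0 normr1.
have [h1 h2 h3 h4 h5] := wf_blocks_cons h.
have [IH1 IH2] := IH h4; have [b1 b2] := block_bounds R h1 h2 h3.
rewrite !big_cons; apply: ksum_prodl_bounds => //.
- exact: posl_block.
- exact: posl_mollD.
- exact: coprimel_block_mollD.
- exact: gker_bimult.
- exact: Lker_biadd.
Qed.

Lemma smooth_le B ps (Y : R) n : all prime ps -> 1 <= Y -> (forall p, p \in ps -> p%:R <= Y) ->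
  n \in smooth B ps -> n%:R <= Y ^+ prime_Omega n.
Proof.
move=> + Y1; elim: ps n => [n _ _|p ps IH n /= /andP[pp aps] Yp].
  by rewrite inE => /eqP ->; rewrite prime_Omega1.
move=> /prodlP[_ [m [/powlP[a _ ->] mD ->]]].
have m0 := posl_smooth aps mD.
rewrite prime_OmegaM ?expn_gt0 ?(prime_gt0 pp) // prime_OmegaX // natrM exprD ler_pM //.
  rewrite natrX lerXn2r ?nnegrE ?(le_trans ler01 Y1) //; by apply: Yp; rewrite inE eqxx.
by apply: IH => // r rps; apply: Yp; rewrite inE rps orbT.
Qed.

Lemma block_le l ps (Y : R) n : all prime ps -> 1 <= Y -> (forall p, p \in ps -> p%:R <= Y) ->
  n \in block l ps -> n%:R <= Y ^+ l.
Proof.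
move=> aps Y1 Yp; rewrite mem_filter => /andP[nl /(smooth_le aps Y1 Yp)/le_trans]; apply.
exact: ler_weXn2l.
Qed.

Lemma mollD_le js (Y : nat * seq nat -> R) n : wf_blocks js ->
  (forall b, b \in js -> 1 <= Y b) -> (forall b p, b \in js -> p \in b.2 -> p%:R <= Y b) ->
  n \in mollD js -> n%:R <= \prod_(b <- js) Y b ^+ b.1.
Proof.
elim: js n => [n _ _ _|b js IH n /wf_blocks_cons[h1 h2 h3 h4 h5] Y1 Yp].
  by rewrite inE big_nil => /eqP ->.
move=> /prodlP[m1 [m2 [m1D m2D ->]]]; rewrite big_cons natrM ler_pM //.
  apply: block_le m1D => //; first by apply: Y1; rewrite inE eqxx.
  by move=> p pb; apply: Yp => //; rewrite inE eqxx.
apply: IH => //; first by move=> c cj; apply: Y1; rewrite inE cj orbT.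
by move=> c p cj; apply: Yp; rewrite inE cj orbT.
Qed.

Lemma gkerE m n : (0 < m)%N -> (0 < n)%N ->
  gker m n = mcoef R m * isq m%:R * (mcoef R n * isq n%:R) *
     isq ((m %/ gcdn m n) * (n %/ gcdn m n))%:R.
Proof.
move=> m0 n0; set g := gcdn m n; set h := (m %/ g)%N; set k := (n %/ g)%N.
have g0 : (0 < g)%N by rewrite gcdn_gt0 m0.
have mE : m = (h * g)%N by rewrite divnK // dvdn_gcdl.
have nE : n = (k * g)%N by rewrite divnK // dvdn_gcdr.
have lE : lcmn m n = (h * k * g)%N.
  apply/eqP; rewrite -(eqn_pmul2r g0) muln_lcm_gcd {1}mE {1}nE; apply/eqP; ring.
rewrite /gker lE.
rewrite -[X in _ = X](_ : mcoef R m * mcoef R n * (isq m%:R * isq n%:R * isq (h * k)%:R) = _); last by ring.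
congr (_ * _); rewrite -!isqM ?mulr_ge0 // -!natrM.
have -> : (m * n * (h * k) = (h * k * g) ^ 2)%N by rewrite mE nE; ring.
by rewrite /isq natrX sqrtr_sqr normr_nat.
Qed.

Lemma LkerE m n : (0 < m)%N -> (0 < n)%N ->
  Lker m n = ln ((m %/ gcdn m n) * (n %/ gcdn m n))%:R.
Proof.
move=> m0 n0; set g := gcdn m n; set h := (m %/ g)%N; set k := (n %/ g)%N.
have g0 : (0 < g)%N by rewrite gcdn_gt0 m0.
have mE : m = (h * g)%N by rewrite divnK // dvdn_gcdl.
have nE : n = (k * g)%N by rewrite divnK // dvdn_gcdr.
have h0 : (0 < h)%N by move: m0; rewrite mE muln_gt0 => /andP[].
have k0 : (0 < k)%N by move: n0; rewrite nE muln_gt0 => /andP[].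
have lE : lcmn m n = (h * k * g)%N.
  apply/eqP; rewrite -(eqn_pmul2r g0) muln_lcm_gcd {1}mE {1}nE; apply/eqP; ring.
rewrite /Lker lE -/g [(h * k * g)%:R]natrM lnM ?posrE ?ltr0n ?muln_gt0 ?h0 //; ring.
Qed.

Lemma mcoef_isq_le1 n : (0 < n)%N -> `|mcoef R n * isq n%:R| <= 1.
Proof.
move=> n0; rewrite normrM normr_mcoef (ger0_norm (isq_ge0 _)) -[leRHS]mulr1.
apply: ler_pM; rewrite ?nu_ge0 ?isq_ge0 ?nu_le1 //.
by rewrite -[leRHS]invr1 -[X in _ <= X^-1]sqrtr1; apply: isq_le; rewrite ?ler1n.
Qed.

Lemma size_le (D : seq nat) (X : R) : uniq D -> posl D -> (forall n, n \in D -> n%:R <= X) ->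
  (size D)%:R <= X \/ D = [::].
Proof.
case: D => [|d D] uD pD DX; [by right|left].
set E := d :: D in uD pD DX *.
have X0 : 0 <= X by apply: le_trans (ler0n _ d) (DX d _); rewrite inE eqxx.
have sub : {subset E <= iota 1 (Num.truncn X)}.
  move=> n nE; rewrite mem_iota pD //= add1n ltnS truncn_ge_nat //; exact: DX.
have := uniq_leq_size uD sub; rewrite size_iota => sz.
apply: le_trans (_ : (Num.truncn X)%:R <= X); last by rewrite truncn_le.
by rewrite ler_nat.
Qed.
End MollifierSums.

Lemma realCB (R : realType) (x y : R) : (x - y)%:C = x%:C - y%:C.
Proof. exact: rmorphB. Qed.

(** * The mollified second moment *)

Section MollifiedSecondMoment.
Variables (R : realType) (q : nat).
Hypothesis pq : prime q.
Local Notation dchar := (@dchar R q pq).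
Local Notation Lhz := (@Lhz R q pq).
Local Notation nc := Normc.normc.
Let q0 : (0 < q)%N := prime_gt0 pq.

Definition ravg (f : nat -> R) : R := (q.-1%:R)^-1 * \sum_(k < q.-1) f k.

Lemma ravgC f : (ravg f)%:C = avg q (fun k => (f k)%:C).
Proof. by rewrite /ravg /avg realCM realC_sum fmorphV /= rmorph_nat. Qed.

Lemma nc_sqr (u : R[i]) : (nc u ^+ 2)%:C = u * Num.conj u.
Proof. by rewrite -normCK normC_nc rmorphXn. Qed.

Definition mpoly (D : seq nat) (k : nat) : R[i] :=
  \sum_(n <- D) (mcoef R n * isq n%:R)%:C * dchar k n%:Z.

Lemma dcharM k m n : dchar k (m * n)%N%:Z = dchar k m%:Z * dchar k n%:Z.
Proof. by rewrite PoszM; have [_ -> _ _] := dchar_character R pq k. Qed.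

Lemma mpoly_prodl D1 D2 k : posl D1 -> posl D2 -> coprimel D1 D2 ->
  mpoly (prodl D1 D2) k = mpoly D1 k * mpoly D2 k.
Proof.
move=> p1 p2 c; rewrite /mpoly sum_prodl mulr_suml; apply: eq_big_seq => m mD.
rewrite mulr_sumr; apply: eq_big_seq => n nD.
rewrite dcharM ((@mcoefM R) m n (p1 m mD) (p2 n nD) (c m n mD nD)) natrM isqM ?ler0n // !realCM; ring.
Qed.

Lemma avg_quadratic (D : seq nat) (c : nat -> R) (T : nat -> R[i]) :
  avg q (fun k => T k * ((\sum_(n <- D) (c n)%:C * dchar k n%:Z) *
      Num.conj (\sum_(n <- D) (c n)%:C * dchar k n%:Z))) =
  \sum_(m <- D) \sum_(n <- D) (c m * c n)%:C *
    avg q (fun k => T k * dchar k m%:Z * Num.conj (dchar k n%:Z)).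
Proof.
rewrite (@eq_avg R q _ (fun k => \sum_(m <- D) (1 : R[i]) * \sum_(n <- D) (c m * c n)%:C *
    (T k * dchar k m%:Z * Num.conj (dchar k n%:Z)))); last first.
  move=> k; rewrite conjC_sum mulr_suml mulr_sumr; apply: eq_bigr => m _.
  rewrite mul1r !mulr_sumr; apply: eq_bigr => n _.
  rewrite conjCM conj_real realCM; ring.
by rewrite avg_sum; apply: eq_bigr => m _; rewrite mul1r avg_sum.
Qed.

(** Open the square and apply [second_moment] to each pair. Each error is at most
    [316 X^4 / sqrt q], and there are at most [X^2] pairs. Only an upper bound is wanted, so the two
    main terms are taken in absolute value. *)
Lemma mollified_second_moment (D : seq nat) (X : R) : uniq D -> posl D ->
  (forall n, n \in D -> n%:R <= X) -> X < q%:R -> 1 <= X ->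
  ravg (fun k => nc (Lhz k * mpoly D k) ^+ 2) <=
  hz_corr R q 1 1 * `|ksum D (@gker R)| + `|ksum D (fun m n => gker R m n * Lker R m n)|
    + 316 * X ^+ 6 * isq q%:R.
Proof.
move=> uD pD DX Xq X1; set f := (fun k => nc (Lhz k * mpoly D k) ^+ 2).
have := ravgC f.
rewrite (@eq_avg R q _ (fun k => Lhz k * Num.conj (Lhz k) * (mpoly D k * Num.conj (mpoly D k)))); last first.
  by move=> k; rewrite nc_sqr conjCM mulrACA.
rewrite (avg_quadratic D (fun n => mcoef R n * isq n%:R) (fun k => Lhz k * Num.conj (Lhz k))).
set V := hz_corr R q 1 1; pose c (n : nat) : R := mcoef R n * isq n%:R.
have X0 : 0 <= X := le_trans ler01 X1.
have V0 : 0 <= V := hz_corr11_ge0 _ _.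
pose main m n := (gker R m n * V - gker R m n * Lker R m n).
have main_sum : \sum_(m <- D) \sum_(n <- D) main m n = V * ksum D (@gker R) - ksum D (fun m n => gker R m n * Lker R m n).
  rewrite /ksum mulr_sumr -sumrB; apply: eq_bigr => m _.
  by rewrite mulr_sumr -sumrB; apply: eq_bigr => n _; rewrite /main [V * _]mulrC.
have nq n : n \in D -> (0 < n < q)%N.
  by move=> nD; rewrite pD // -(ltr_nat R) (le_lt_trans (DX n nD)).
have term m n : m \in D -> n \in D ->
   `|(c m * c n)%:C * avg q (fun k => Lhz k * Num.conj (Lhz k) * dchar k m%:Z * Num.conj (dchar k n%:Z))
      - (main m n)%:C| <= (316 * X ^+ 4 * isq q%:R)%:C.
  move=> mD nD; have m0 := pD m mD; have n0 := pD n nD.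
  have -> : main m n = c m * c n * (isq ((m %/ gcdn m n) * (n %/ gcdn m n))%:R *
      (V - ln ((m %/ gcdn m n) * (n %/ gcdn m n))%:R)).
    by rewrite /main (gkerE R m0 n0) (LkerE R m0 n0) /c; ring.
  rewrite [X in _ - X]realCM -mulrBr normrM normC_real.
  apply: (@le_trans _ _ (1 * (316 * (m * n)%:R ^+ 2 * isq q%:R)%:C)).
    apply: ler_pM => //; first by rewrite realC_ge0.
      rewrite -[1]/(1%:C) lecR normrM -[leRHS]mulr1; apply: ler_pM => //; exact: mcoef_isq_le1.
    exact: (second_moment R pq (nq m mD) (nq n nD) erefl).
  rewrite mul1r lecR; apply: ler_wpM2r; first exact: isq_ge0.
  apply: ler_wpM2l; first exact: ler0n.
  rewrite natrM exprMn.
  have -> : X ^+ 4 = X ^+ 2 * X ^+ 2 by rewrite -exprD.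
  by apply: ler_pM; rewrite ?exprn_ge0 ?ler0n // lerXn2r ?nnegrE ?ler0n ?X0 ?DX.
have err0 : 0 <= 316 * X ^+ 4 * isq q%:R.
  by rewrite (mulr_ge0 (mulr_ge0 (ler0n R 316) (exprn_ge0 4 X0)) (isq_ge0 _)).
move=> fE; have : `|ravg f - \sum_(m <- D) \sum_(n <- D) main m n| <= 316 * X ^+ 6 * isq q%:R.
  rewrite -lecR -normC_real realCB fE.
  apply: (@le_trans _ _ (\sum_(m <- D) \sum_(n <- D) 316 * X ^+ 4 * isq q%:R)%:C).
    rewrite !realC_sum -sumrB; apply: le_trans (ler_norm_sum _ _ _) _; apply: ler_sum_seq => m mD.
    rewrite !realC_sum -sumrB; apply: le_trans (ler_norm_sum _ _ _) _; apply: ler_sum_seq => n nD.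
    exact: term.
  rewrite lecR big_const_seq count_predT iter_addr_0 big_const_seq count_predT iter_addr_0.
  rewrite (_ : forall z : R, z *+ size D *+ size D = z * ((size D)%:R * (size D)%:R)); last first.
    by move=> z; rewrite mulrA !mulr_natr.
  have -> : 316 * X ^+ 6 * isq q%:R = 316 * X ^+ 4 * isq q%:R * (X * X) by ring.
  apply: ler_wpM2l => //; case: (size_le uD pD DX) => [sz|->]; last by rewrite mulr0 mulr_ge0.
  by apply: ler_pM.
rewrite main_sum => /ler_normlP[_]; rewrite lerBlDl => /le_trans; apply.
rewrite lerD2r; apply: le_trans (ler_norm _) _; apply: le_trans (ler_normB _ _) _.
by rewrite lerD2r normrM (ger0_norm V0).
Qed.
End MollifiedSecondMoment.

(** * Taylor polynomials of the cosine *)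

Section TaylorTrig.
Variable R : realType.
Implicit Types x : R.

Fixpoint trig_rem2 (n : nat) : (R -> R) * (R -> R) :=
  if n is m.+1 then
    ((trig_rem2 m).2,
     fun x => x ^+ m / m`!%:R - (trig_rem2 m).1 x)
  else (cos, sin).

(* Up to sign, the remainders of the Taylor polynomials of cos and sin at 0. *)
Definition trig_rem n := (trig_rem2 n).1.

Lemma trig_rem0 : trig_rem 0 = cos. Proof. by []. Qed.
Lemma trig_rem1 : trig_rem 1 = sin. Proof. by []. Qed.
Lemma trig_remSS n x : trig_rem n.+2 x = x ^+ n / n`!%:R - trig_rem n x.
Proof. by []. Qed.

Lemma trig_rem_derive n x : is_derive x 1 (trig_rem n.+1) (trig_rem n x).
Proof.
suff : is_derive x 1 (trig_rem n.+1) (trig_rem n x) /\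
       is_derive x 1 (trig_rem n.+2) (trig_rem n.+1 x) by case.
elim: n => [|n [IH1 IH2]]; split => //.
- by rewrite trig_rem1; exact: is_derive_sin.
- rewrite (_ : trig_rem 2 = cst 1 - cos); last by apply/funext => y; rewrite trig_remSS expr0 fact0 divr1.
  by apply: is_derive_eq; rewrite sub0r opprK.
rewrite (_ : trig_rem n.+3 = (n.+1)`!%:R^-1 *: (@id R ^+ n.+1) - trig_rem n.+1); last first.
  by apply/funext => y; rewrite trig_remSS mulrC; rewrite !fctE.
apply: is_derive_eq; rewrite trig_remSS; congr (_ - _).
rewrite /GRing.scale /= mulr1 factS natrM invfM; field.
by rewrite pnatr_eq0 -lt0n fact_gt0 nat1r pnatr_eq0.
Qed.

Lemma trig_rem_at0 n : trig_rem n.+1 0 = 0.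
Proof.
suff : trig_rem n.+1 0 = 0 /\ trig_rem n.+2 0 = 0 by case.
elim: n => [|n [IH1 IH2]]; split => //.
- by rewrite trig_rem1 sin0.
- by rewrite trig_remSS trig_rem0 cos0 expr0 fact0 divr1 subrr.
by rewrite trig_remSS IH1 expr0n mul0r subr0.
Qed.

Lemma trig_remN n x : trig_rem n (- x) = (-1) ^+ n * trig_rem n x.
Proof.
suff : trig_rem n (- x) = (-1) ^+ n * trig_rem n x /\
       trig_rem n.+1 (- x) = (-1) ^+ n.+1 * trig_rem n.+1 x by case.
elim: n => [|n [IH1 IH2]]; split => //.
- by rewrite trig_rem0 cosN expr0 mul1r.
- by rewrite trig_rem1 sinN expr1 mulN1r.
by rewrite !trig_remSS IH1 (exprNn x) !exprS !mulN1r opprK mulrBr mulrA.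
Qed.

(** Induction by the mean value theorem: the derivative of [x^(n+1) / (n+1)!] plus or minus the next
    remainder is nonnegative on the positive axis, and parity covers the negative one. *)
Lemma trig_rem_le n x : `|trig_rem n x| <= `|x| ^+ n / n`!%:R.
Proof.
wlog x0 : x / 0 <= x.
  move=> H; case: (leP 0 x) => [|/ltW x0]; first exact: H.
  have := H (- x); rewrite oppr_ge0 => /(_ x0).
  by rewrite trig_remN normrM normrX normrN1 expr1n mul1r normrN.
rewrite (ger0_norm x0); elim: n x x0 => [|n IH] x x0.
  by rewrite trig_rem0 expr0 fact0 divr1 cos_max.
have [->|xn0] := eqVneq x 0; first by rewrite trig_rem_at0 normr0 expr0n mul0r.
have {xn0}xp : 0 < x by rewrite lt0r xn0.
pose g : R -> R := (n.+1)`!%:R^-1 *: (@id R ^+ n.+1).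
have gE t : g t = t ^+ n.+1 / (n.+1)`!%:R by rewrite /g !fctE mulrC.
have dg (t : R) : is_derive t 1 g (t ^+ n / n`!%:R).
  apply: is_derive_eq; rewrite /GRing.scale /= mulr1 factS natrM invfM; field.
  by rewrite pnatr_eq0 -lt0n fact_gt0 nat1r pnatr_eq0.
have pos (s : R) : (s = 1 \/ s = -1) -> 0 <= g x + s * trig_rem n.+1 x.
  move=> s1; pose f := g + s *: trig_rem n.+1.
  have df (t : R) : is_derive t 1 f (t ^+ n / n`!%:R + s *: trig_rem n t).
    by have h1 := dg t; have h2 := trig_rem_derive n t; apply: is_deriveD.
  have cf : {within `[0, x], continuous f}.
    apply: continuous_subspaceT => t; apply: differentiable_continuous.
    by apply/derivable1_diffP; exact: ex_derive.
  have [c cx fE] := MVT xp (fun t _ => df t) cf.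
  have f0 : f 0 = 0 by rewrite /f !fctE gE trig_rem_at0 expr0n mul0r scaler0 addr0.
  have -> : g x + s * trig_rem n.+1 x = f x by [].
  move: fE; rewrite f0 !subr0 => ->; rewrite mulr_ge0 //.
  have c0 : 0 <= c by move: cx; rewrite in_itv /= => /andP[/ltW].
  have := IH c c0; rewrite /GRing.scale /= ler_norml => /andP[? ?].
  by case: s1 => ->; rewrite ?mul1r ?mulN1r; lra.
have := pos 1 (or_introl erefl); have := pos (-1) (or_intror erefl).
by rewrite gE mul1r mulN1r ler_norml => *; apply/andP; split; lra.
Qed.

Lemma trig_rem_poly n : exists (p : {poly R}) (s : R),
  (forall x, trig_rem n.*2 x = s * cos x + p.[x]) /\ `|s| = 1.
Proof.
elim: n => [|n [p [s [pE s1]]]].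
  by exists 0, 1; split => [x|]; rewrite ?normr1 // horner0 addr0 mul1r.
exists (((n.*2)`!%:R^-1)%:P * 'X^(n.*2) - p), (- s); split=> [x|]; last by rewrite normrN.
rewrite doubleS trig_remSS pE hornerD hornerN hornerM hornerC hornerXn.
by move: (_^-1) (x ^+ _) (cos x) (p.[x]) => d e u v; ring.
Qed.

Lemma cos_taylor n : exists p : {poly R}, forall x,
  `|cos x - p.[x]| <= x ^+ n.*2 / (n.*2)`!%:R.
Proof.
have [p [s [pE s1]]] := trig_rem_poly n; exists (- s *: p) => x.
have ss : s * s = 1 by rewrite -expr2 -[s ^+ 2]ger0_norm ?sqr_ge0 // normrX s1 expr1n.
rewrite (_ : cos x - _ = s * trig_rem n.*2 x); last first.
  by rewrite pE mulrDr mulrA ss mul1r hornerZ mulNr opprK.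
rewrite normrM s1 mul1r (le_trans (trig_rem_le _ _)) //.
by rewrite -!mul2n !exprM real_normK ?num_real.
Qed.
End TaylorTrig.

(** * Integration against the Gaussian density *)

Section GaussianIntegral.
Variable R : realType.
Implicit Types (f g : R -> R) (x : R) (p r : {poly R}).
Local Notation leb := (@lebesgue_measure R).

Definition gdens x : R := (Num.sqrt (2 * pi))^-1 * expR (- (x ^+ 2 / 2)).

Lemma gdens_ge0 x : 0 <= gdens x.
Proof. by rewrite mulr_ge0 ?expR_ge0 // invr_ge0 sqrtr_ge0. Qed.

Lemma gdens_derive x : is_derive x 1 gdens (- x * gdens x).
Proof.
pose h : R -> R := (2^-1 : R) *: (@id R ^+ 2).
have dh : is_derive x 1 h x.
  by apply: is_derive_eq; rewrite /GRing.scale /=; field.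
rewrite (_ : gdens = (Num.sqrt (2 * pi))^-1 *: (expR \o (- h))); last first.
  by apply/funext => y; rewrite /gdens /h /= !fctE /GRing.scale /=; congr (_ * expR _); ring.
apply: is_derive_eq; rewrite /GRing.scale /= /gdens /h !fctE /GRing.scale /=.
rewrite [2^-1 * _]mulrC; ring.
Qed.

Lemma gdens_continuous : continuous gdens.
Proof.
move=> x; apply: differentiable_continuous; apply/derivable1_diffP.
by have h := gdens_derive x; exact: ex_derive.
Qed.

(** Domination by the normal density of variance 2 imports its integrability:
    [|x|^m <= m! expR |x|], and [|x| - x^2 / 2 <= 1 - x^2 / 4] because [(|x| - 2)^2 >= 0]. *)
Lemma gdens_decay m : exists K : R, forall x, `|x| ^+ m * gdens x <= K * normal_pdf 0 (Num.sqrt 2) x.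
Proof.
have s2 : Num.sqrt 2 != 0 :> R by rewrite sqrtr_eq0 -ltNge ltr0n.
have pk := normal_peak_gt0 s2.
set P := normal_peak _ in pk; set c := (Num.sqrt (2 * pi : R))^-1.
exists (c * (m`!%:R * expR 1) / P) => x.
rewrite normal_pdfE //= -/P /normal_fun subr0 sqr_sqrtr ?ler0n //.
rewrite [_ * (P * _)]mulrA divfK ?gt_eqF // /gdens -/c [leLHS]mulrCA -[leRHS]mulrA.
rewrite ler_wpM2l // ?invr_ge0 ?sqrtr_ge0 //.
have f0 : 0 < m`!%:R :> R by rewrite ltr0n fact_gt0.
have h1 : `|x| ^+ m <= m`!%:R * expR `|x|.
  rewrite -ler_pdivrMl // mulrC; apply: le_trans (sum_exp_le m.+1 (normr_ge0 x)).
  rewrite big_nat_recr //= lerDr; apply: sumr_ge0 => i _; rewrite divr_ge0 ?exprn_ge0 //.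
apply: le_trans (ler_wpM2r (expR_ge0 _) h1) _.
rewrite -[leLHS]mulrA -[leRHS]mulrA ler_wpM2l ?(ltW f0) // -!expRD ler_expR.
have -> : x ^+ 2 = `|x| ^+ 2 by rewrite real_normK ?num_real.
have -> : 1 + - `|x| ^+ 2 / (2 *+ 2) = 1 - `|x| ^+ 2 / 4 :> R by rewrite -mulr_natr -natrM mulNr.
have := sqr_ge0 (`|x| - 2); nra.
Qed.

Lemma gdens_decay_cst m : exists2 K : R, 0 <= K & forall x, `|x| ^+ m * gdens x <= K.
Proof.
have [K HK] := gdens_decay m.
have s2 : Num.sqrt 2 != 0 :> R by rewrite sqrtr_eq0 -ltNge ltr0n.
exists (`|K| * normal_peak (Num.sqrt 2)) => [|x]; first by rewrite mulr_ge0 ?normal_peak_ge0.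
apply: le_trans (HK x) _; apply: (@le_trans _ _ (`|K| * normal_pdf 0 (Num.sqrt 2) x)).
  by rewrite ler_wpM2r ?normal_pdf_ge0 ?ler_norm.
by rewrite ler_wpM2l // normal_pdf_ub.
Qed.

(** A class closed under sums and products, on which [gint] is linear and monotone without separate
    integrability proofs. *)
Definition gtame f := measurable_fun [set: R] f /\ exists r, forall x, `|f x| <= r.[x].

Definition gint f : R := \int[leb]_x (f x * gdens x).

Lemma measurable_gdens : measurable_fun [set: R] gdens.
Proof. by apply: continuous_measurable_fun; exact: gdens_continuous. Qed.

Lemma integrable_mono m : leb.-integrable [set: R] (EFin \o (fun x => x ^+ m * gdens x)).
Proof.
have [K HK] := gdens_decay m.
have iK : leb.-integrable [set: R] (fun x => K%:E * (normal_pdf 0 (Num.sqrt 2) x)%:E)%E.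
  by apply: integrableZl => //; exact: integrable_normal_pdf.
apply: (le_integrable measurableT _ _ iK).
  apply/measurable_EFinP/measurable_funM; last exact: measurable_gdens.
  exact: measurable_funX.
move=> x _ /=; rewrite lee_fin normrM normrX (ger0_norm (gdens_ge0 x)).
  by apply: le_trans (HK x) (ler_norm _).
Qed.

Lemma integrable_poly p : leb.-integrable [set: R] (EFin \o (fun x => p.[x] * gdens x)).
Proof.
have : forall k, leb.-integrable [set: R] (EFin \o (fun x => p.[x] * x ^+ k * gdens x)).
  elim/poly_ind: p => [|p c IH] k.
    rewrite (_ : _ \o _ = cst 0%E); first exact: integrable0.
    by apply/funext => x /=; rewrite horner0 !mul0r.
  have := integrableD measurableT (IH k.+1) (integrableZl measurableT c (integrable_mono k)).
  congr (_.-integrable _ _); apply/funext => x /=.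
  rewrite -EFinM -EFinD; apply: (congr1 EFin).
  have key (y : R) : p.[y] * y ^+ k.+1 * gdens y + c * (y ^+ k * gdens y)
      = (p * 'X + c%:P).[y] * y ^+ k * gdens y.
    rewrite hornerD hornerM hornerX hornerC exprS.
    by move: (p.[y]) (y ^+ k) (gdens y) => u v w; ring.
  exact: key.
by move=> /(_ 0%N); congr (_.-integrable _ _); apply/funext => x /=; rewrite expr0 mulr1.
Qed.

Lemma gtame_int f : gtame f -> leb.-integrable [set: R] (EFin \o (fun x => f x * gdens x)).
Proof.
move=> [mf [r fr]].
apply: (le_integrable measurableT _ _ (integrable_poly r)).
  by apply/measurable_EFinP/measurable_funM => //; exact: measurable_gdens.
move=> x _ /=; rewrite lee_fin !normrM ler_wpM2r //.
by apply: le_trans (fr x) (ler_norm _).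
Qed.

Lemma gtameD f g : gtame f -> gtame g -> gtame (fun x => f x + g x).
Proof.
move=> [mf [r fr]] [mg [s gs]]; split; first exact: measurable_funD.
by exists (r + s) => x; rewrite hornerD (le_trans (ler_normD _ _)) // lerD.
Qed.

Lemma gtameM f g : gtame f -> gtame g -> gtame (fun x => f x * g x).
Proof.
move=> [mf [r fr]] [mg [s gs]]; split; first exact: measurable_funM.
by exists (r * s) => x; rewrite hornerM normrM ler_pM.
Qed.

Lemma gtame_poly p : gtame (horner p).
Proof.
split; first exact: measurable_poly.
exists (1 + p * p) => x; rewrite !hornerE -expr2.
have := sqr_ge0 (`|p.[x]| - 1); rewrite -[p.[x] ^+ 2]real_normK ?num_real //.
have := normr_ge0 p.[x]; nra.
Qed.

Lemma gtame_cst c : gtame (fun=> c).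
Proof. by have := gtame_poly c%:P; congr gtame; apply/funext => x; rewrite hornerC. Qed.

Lemma gtameB f g : gtame f -> gtame g -> gtame (fun x => f x - g x).
Proof.
move=> tf tg; have := gtameD tf (gtameM (gtame_cst (-1)) tg).
by congr gtame; apply/funext => x; rewrite mulN1r.
Qed.

Lemma gtame_bounded f (K : R) : measurable_fun [set: R] f -> (forall x, `|f x| <= K) -> gtame f.
Proof. by move=> mf fK; split => //; exists K%:P => x; rewrite hornerC. Qed.

Lemma gtame_indic (A : set R) : measurable A -> gtame \1_A.
Proof.
move=> mA; apply: (@gtame_bounded _ 1); first exact: measurable_indic.
by move=> x; rewrite indicE; case: (_ \in _); rewrite ?normr1 ?normr0.
Qed.

Lemma gtame_norm f : gtame f -> gtame (fun x => `|f x|).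
Proof.
move=> [mf [r fr]]; split; first by apply: measurableT_comp.
by exists r => x; rewrite normr_id.
Qed.

Lemma gintD f g : gtame f -> gtame g -> gint (fun x => f x + g x) = gint f + gint g.
Proof.
move=> tf tg; rewrite /gint -RintegralD ?gtame_int //.
by apply: eq_Rintegral => x _; rewrite mulrDl.
Qed.

Lemma gintZ c f : gtame f -> gint (fun x => c * f x) = c * gint f.
Proof.
move=> tf; rewrite /gint -RintegralZl ?gtame_int //.
by apply: eq_Rintegral => x _; rewrite mulrA.
Qed.

Lemma gintB f g : gtame f -> gtame g -> gint (fun x => f x - g x) = gint f - gint g.
Proof.
move=> tf tg; rewrite /gint -RintegralB ?gtame_int //.
by apply: eq_Rintegral => x _; rewrite mulrBl.
Qed.

Lemma gint_le f g : gtame f -> gtame g -> (forall x, f x <= g x) -> gint f <= gint g.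
Proof.
move=> tf tg fg; apply: le_Rintegral; rewrite ?gtame_int // => x _.
by rewrite ler_wpM2r // gdens_ge0.
Qed.

Lemma gint_ge0 f : (forall x, 0 <= f x) -> 0 <= gint f.
Proof. by move=> f0; apply: Rintegral_ge0 => x _; rewrite mulr_ge0 ?gdens_ge0. Qed.

Lemma gint_norm f : gtame f -> `|gint f| <= gint (fun x => `|f x|).
Proof.
move=> tf; have tn := gtame_norm tf.
rewrite ler_norml; apply/andP; split; last by apply: gint_le => // x; rewrite ler_norm.
rewrite -mulN1r -gintZ //; apply: gint_le => //; first exact: gtameM (gtame_cst _) tn.
by move=> x; rewrite mulN1r lerNl (le_trans (ler_norm _)) ?normrN.
Qed.

Lemma gint1 : gint (fun=> 1) = 1.
Proof.
rewrite /gint -[RHS]/(fine 1%E) -(integral_normal_pdf 0 (1 : R)).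
apply: eq_Rintegral => x _; rewrite mul1r normal_pdfE ?oner_neq0 //=.
rewrite /gdens /normal_peak /normal_fun subr0 expr1n; congr ((Num.sqrt _)^-1 * expR _).
  by rewrite mul1r mulr_natl.
by rewrite mulNr.
Qed.

End GaussianIntegral.

(** * Gaussian moments *)

Section GaussianMoments.
Variable R : realType.
Implicit Types (f g : R -> R) (x : R) (p r : {poly R}).
Local Notation leb := (@lebesgue_measure R).

Lemma gint_patch f (A : set R) : gint (fun x => f x * \1_A x) = \int[leb]_(x in A) (f x * gdens x).
Proof.
rewrite /gint [RHS]Rintegral_mkcond; apply: eq_Rintegral => x _.
by rewrite patch_indic /= mulrAC.
Qed.

Lemma gdens_integrable (A : set R) : measurable A -> leb.-integrable A (EFin \o @gdens R).
Proof.
move=> mA; apply: (@integrableS _ _ _ _ setT) => //.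
have := gtame_int (gtame_cst (1 : R)).
by congr (_.-integrable _ _); apply/funext => x /=; rewrite mul1r.
Qed.

Lemma gint_indic (a b : R) : gint \1_`]a, b[ =
  (Num.sqrt (2 * pi))^-1 * \int[leb]_(u in `[a, b]) expR (- (u ^+ 2 / 2)).
Proof.
have -> : gint \1_`]a, b[ = gint (fun x => 1 * \1_`]a, b[ x).
  by congr gint; apply/funext => x; rewrite mul1r.
rewrite gint_patch.
have c0 : Num.sqrt (2 * pi) != 0 :> R.
  by rewrite sqrtr_eq0 -ltNge mulr_gt0 ?pi_gt0.
rewrite (@eq_Rintegral _ _ _ leb _ (@gdens R)) => [|x _]; last by rewrite mul1r.
rewrite Rintegral_itv_obnd_cbnd; last exact: gdens_integrable.
rewrite Rintegral_itv_bndo_bndc; last exact: gdens_integrable.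
rewrite [X in _ = _ * X](@eq_Rintegral _ _ _ leb _ (fun u => Num.sqrt (2 * pi) * gdens u)); last first.
  by move=> x _; rewrite /gdens mulrA divff ?mul1r.
have iI : leb.-integrable `[a, b] (EFin \o @gdens R) by exact: gdens_integrable.
by rewrite (RintegralZl _ _ iI) // mulrA mulVf // mul1r.
Qed.

(** Integration by parts: the integrand is the derivative of [- x^m * gdens x]. On [[-N, N]] the
    boundary terms are [O(1/N)], and outside [1 <= x^2 / N] bounds the tail by [M / N]. *)
Lemma gint_mono_parts m : gint (horner ('X^(m.+1) - m%:R *: 'X^(m.-1) : {poly R})) = 0.
Proof.
set p : {poly R} := _ - _.
pose F x := - (x ^+ m * gdens x).
have dF (x : R) : is_derive x 1 F (p.[x] * gdens x).
  have dg := gdens_derive x; pose h : R -> R := @id R ^+ m.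
  have -> : F = - (h * @gdens R) by apply/funext => y; rewrite /F /h !fctE.
  apply: is_derive_eq; rewrite /h !fctE /GRing.scale /= /p hornerD hornerN hornerZ !hornerXn.
  by rewrite exprS; move: (gdens x) (x ^+ m) (x ^+ m.-1) => u v w; rewrite -mulr_natl; ring.
have tp := gtame_poly p.
pose M := gint (fun x => x ^+ 2 * `|p.[x]|).
have tM : gtame (fun x => x ^+ 2 * `|p.[x]|).
  apply: gtameM; last exact: gtame_norm.
  by have := gtame_poly ('X^2 : {poly R}); congr gtame; apply/funext => x; rewrite hornerXn.
have M0 : 0 <= M by apply: gint_ge0 => x; rewrite mulr_ge0 ?sqr_ge0.
have [K K0 HK] := @gdens_decay_cst R m.+1.
have main (n : nat) : `|gint (horner p)| <= (2 * K + M) / n.+1%:R.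
  set N : R := n.+1%:R; have N0 : 0 < N by rewrite ltr0n.
  have NN : - N < N by rewrite gtrN.
  have iA : gint (fun x => p.[x] * \1_`[- N, N] x) = F N - F (- N).
    rewrite gint_patch /Rintegral (@continuous_FTC2 _ _ F) //.
    - apply: continuous_subspaceT => x; apply: cvgM; first exact: continuous_horner.
      exact: gdens_continuous.
    - have cF : continuous F.
        move=> x; apply: differentiable_continuous; apply/derivable1_diffP.
        by have h := dF x; exact: ex_derive.
      split => [x _||]; first by have h := dF x; exact: ex_derive.
        by apply: cvg_at_right_filter; exact: cF.
      by apply: cvg_at_left_filter; exact: cF.
    by move=> x _; rewrite derive1E; have h := dF x; rewrite derive_val.
  have tA : gtame (fun x => p.[x] * \1_`[- N, N] x) by apply: gtameM => //; exact: gtame_indic.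
  have bF y : `|y| = N -> `|F y| <= K / N.
    move=> yN; rewrite ler_pdivlMr // normrN normrM normrX (ger0_norm (gdens_ge0 _)).
    by have := HK y; rewrite yN exprSr mulrAC.
  have h1 : `|gint (fun x => p.[x] * \1_`[- N, N] x)| <= 2 * K / N.
    rewrite iA; apply: le_trans (ler_normB _ _) _.
    have := bF N (ger0_norm (ltW N0)); have := bF (- N); rewrite normrN (ger0_norm (ltW N0)).
    by move=> /(_ erefl) h1 h2; rewrite -mulrA mulr_natl mulr2n lerD.
  have h2 : `|gint (horner p) - gint (fun x => p.[x] * \1_`[- N, N] x)| <= M / N.
    rewrite -gintB //; apply: le_trans (gint_norm (gtameB _ _)) _ => //.
    apply: (@le_trans _ _ (gint (fun x => N^-1 * (x ^+ 2 * `|p.[x]|)))); last first.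
      by rewrite gintZ // mulrC.
    apply: gint_le => [||x].
    - by apply: gtame_norm; exact: gtameB.
    - exact: gtameM (gtame_cst _) tM.
    rewrite indicE; have [xN|xN] := boolP (x \in _); last first.
      rewrite mulr0 subr0 mulrA ler_peMl // ler_pdivlMl // mulr1.
      have : N < `|x|.
        rewrite ltNge; apply: contra xN => xN; apply/mem_set; rewrite /= in_itv /=.
        by rewrite -ler_norml.
      rewrite -[x ^+ 2]real_normK ?num_real // => xN1.
      have N1 : 1 <= N by rewrite ler1n.
      by rewrite expr2; nra.
    rewrite mulr1 subrr normr0; apply: mulr_ge0; first by rewrite invr_ge0 (ltW N0).
    by apply: mulr_ge0; rewrite ?sqr_ge0.
  rewrite -[gint _](subrK (gint (fun x => p.[x] * \1_`[- N, N] x))).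
  by apply: le_trans (ler_normD _ _) _; rewrite mulrDl addrC lerD.
apply/eqP; rewrite -normr_le0; apply/ler_addgt0Pr => e e0; rewrite add0r.
pose n := Num.truncn ((2 * K + M) / e).
apply: le_trans (main n) _; rewrite ler_pdivrMr ?ltr0n // [e * _]mulrC -ler_pdivrMr //.
by rewrite ltW // truncnS_gt.
Qed.

Definition gmom m := gint (fun x : R => x ^+ m).

Lemma gmomE m : gmom m = gint (horner ('X^m : {poly R})).
Proof. by congr gint; apply/funext => x; rewrite hornerXn. Qed.

Lemma gmom0 : gmom 0 = 1.
Proof. by rewrite -[RHS](gint1 R); congr gint. Qed.

Lemma gmomS m : gmom m.+1 = m%:R * gmom m.-1.
Proof.
have := gint_mono_parts m; set a : {poly R} := 'X^(m.+1); set b : {poly R} := 'X^(m.-1).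
have -> : gint (horner (a - m%:R *: b)) = gint (fun x => a.[x] - m%:R * b.[x]).
  by congr gint; apply/funext => x; rewrite hornerD hornerN hornerZ.
have tb := gtame_poly b.
rewrite gintB; [|exact: gtame_poly|exact: gtameM (gtame_cst _) tb].
by rewrite gintZ // -!gmomE => /eqP; rewrite subr_eq0 => /eqP.
Qed.

Lemma gmom_double k : gmom k.*2 * (2 ^+ k * k`!%:R) = (k.*2)`!%:R.
Proof.
elim: k => [|k IH]; first by rewrite gmom0 expr0 fact0 !mulr1.
rewrite doubleS gmomS /= (factS k.*2.+1) (factS k.*2) (factS k) 3!natrM -IH exprS.
have -> : (k.*2.+2)%:R = 2 * k.+1%:R :> R by rewrite -natrM mul2n.
move: (gmom _) (k.*2.+1)%:R k.+1%:R (k`!%:R : R) (2 ^+ k : R) => g a b c d; ring.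
Qed.

Lemma gmom_odd k : gmom k.*2.+1 = 0.
Proof.
elim: k => [|k IH]; first by rewrite gmomS mul0r.
by rewrite doubleS gmomS /= IH mulr0.
Qed.

Lemma gint_poly p : gint (horner p) = \sum_(i < size p) p`_i * gmom i.
Proof.
have -> : gint (horner p) = gint (fun x => \sum_(i < size p) p`_i * x ^+ i).
  by congr gint; apply/funext => x; rewrite horner_coef.
have tm i : gtame (fun x : R => p`_i * x ^+ i).
  apply: gtameM; first exact: gtame_cst.
  by have := gtame_poly ('X^i : {poly R}); congr gtame; apply/funext => x; rewrite hornerXn.
suff : gtame (fun x => \sum_(i < size p) p`_i * x ^+ i) /\
  gint (fun x => \sum_(i < size p) p`_i * x ^+ i) = \sum_(i < size p) p`_i * gmom i by case.
elim: (size p) => [|n [IH1 IH2]].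
  rewrite big_ord0 (_ : (fun x => _) = fun=> 0).
    split; first exact: gtame_cst.
    by rewrite /gint (@eq_Rintegral _ _ _ leb _ (cst 0)) ?Rintegral_cst ?mul0r // => x _; rewrite mul0r.
  by apply/funext => x; rewrite big_ord0.
rewrite big_ord_recr /= (_ : (fun x => _) = fun x => (\sum_(i < n) p`_i * x ^+ i) + p`_n * x ^+ n).
  split; first exact: gtameD.
  rewrite gintD // IH2 gintZ //.
  by have := gtame_poly ('X^n : {poly R}); congr gtame; apply/funext => x; rewrite hornerXn.
by apply/funext => x; rewrite big_ord_recr.
Qed.

(* Dominated convergence: the two exceptional points carry no Gaussian mass. *)
Lemma gint_small (a b : R) (u : nat -> R -> R) : (forall n, measurable_fun [set: R] (u n)) ->
  (forall n x, 0 <= u n x <= 1) ->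
  (forall x, x != a -> x != b -> u n x @[n --> \oo] --> (0 : R)) ->
  forall e, 0 < e -> exists n, gint (u n) < e.
Proof.
move=> mu u01 u0 e e0.
have ab0 : leb [set a; b] = 0%E by apply: countable_lebesgue_measure0; apply: finite_set_countable; exact: finite_set2.
have mD : measurable [set a; b] by apply: measurableU; exact: measurable_set1.
have mf n : measurable_fun [set: R] (fun x => (u n x * gdens x)%:E).
  by apply/measurable_EFinP/measurable_funM => //; exact: measurable_gdens.
have := @dominated_convergence _ _ R leb setT measurableT
  (fun n x => (u n x * gdens x)%:E) (cst 0%E) (EFin \o @gdens R).
case.
- exact: mf.
- exact: measurable_cst.
- exists [set a; b]; split => // x /=; apply: contra_notP => /not_orP[xa xb] _.
  have h : u n x * gdens x @[n --> \oo] --> (0 : R).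
    by rewrite -[0](mul0r (gdens x)); apply: cvgMl; apply: u0; exact/eqP.
  by apply: cvg_EFin; [exact: nearW|exact: h].
- exact: gdens_integrable.
- apply: nearW => x n _ /=; rewrite lee_fin normrM (ger0_norm (gdens_ge0 _)).
  by have /andP[? ?] := u01 n x; rewrite ger0_norm // ler_piMl // gdens_ge0.
move=> _ _; rewrite integral0 => /fine_cvgP[_ /cvgrPdist_lt /(_ _ e0)].
case=> n _ /(_ n (leqnn n)) /=; rewrite sub0r normrN => h; exists n.
exact: le_lt_trans (ler_norm _) h.
Qed.
End GaussianMoments.

(** * Polynomial approximation in Gaussian mean square *)

Section PolyApprox.
Variable R : realType.
Implicit Types (f g : R -> R) (x : R) (p r : {poly R}).

(* [g] is within a polynomial error of small Gaussian L2 norm of a polynomial,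
   so that its Gaussian statistics are controlled by moments. *)
Definition papprox g := gtame g /\ forall e, 0 < e -> exists p r,
  (forall x, `|g x - p.[x]| <= r.[x]) /\ gint (horner (r * r)) <= e.

Lemma gtame_sqr f : gtame f -> gtame (fun x => f x ^+ 2).
Proof. by move=> tf; have := gtameM tf tf; congr gtame. Qed.

Lemma gint_polyM p r : gint (horner (p * r)) = gint (fun x => p.[x] * r.[x]).
Proof. by congr gint; apply/funext => x; rewrite hornerM. Qed.

Lemma sqr_le_normD (a b c : R) : `|a| <= `|b| + `|c| -> a ^+ 2 <= 2 * b ^+ 2 + 2 * c ^+ 2.
Proof.
rewrite -(real_normK (num_real a)) -(real_normK (num_real b)) -(real_normK (num_real c)).
move: (normr_ge0 a) (normr_ge0 b) (normr_ge0 c).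
move: `|a| `|b| `|c| => {}a {}b {}c a0 b0 c0 h.
apply: (@le_trans _ _ ((b + c) ^+ 2)); first by rewrite lerXn2r ?nnegrE ?addr_ge0.
by have := sqr_ge0 (b - c); rewrite !expr2; nra.
Qed.

(** Closure under limits: the approximant [t] and the majorant [u] of its error are themselves
    approximable, and a polynomial close to [u] bounds [u] up to its own error. *)
Lemma papprox_lim g : gtame g ->
  (forall e, 0 < e -> exists t u, [/\ papprox t, papprox u,
     forall x, `|g x - t x| <= u x & gint (fun x => u x ^+ 2) <= e]) -> papprox g.
Proof.
(* [18 = 6 + 9 + 3], the coefficients that arise from [(p2 + r2 + r1)^2] and
   [|p2| <= |u| + |r2|]. *)
move=> tg H; split => // e e0; have d0 : 0 < e / 18 by rewrite divr_gt0.
have [t [u [[_ pt] [tu pu] gt iu]]] := H _ d0.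
have [p1 [r1 [h1 i1]]] := pt _ d0; have [p2 [r2 [h2 i2]]] := pu _ d0.
exists p1, (p2 + r2 + r1); split => [x|].
  rewrite !hornerD -(subrK (t x) (g x)) -addrA; apply: le_trans (ler_normD _ _) _.
  apply: lerD => //; apply: le_trans (gt x) _.
  by have := h2 x; rewrite ler_distl => /andP[]; lra.
have tr (r : {poly R}) : gtame (fun x => r.[x] ^+ 2) by apply: gtame_sqr; exact: gtame_poly.
have tu2 := gtame_sqr tu.
have ir (r : {poly R}) : gint (horner (r * r)) = gint (fun x => r.[x] ^+ 2).
  by rewrite gint_polyM.
apply: (@le_trans _ _ (gint (fun x => 6 * u x ^+ 2 + 9 * r2.[x] ^+ 2 + 3 * r1.[x] ^+ 2))).
  apply: gint_le; first exact: gtame_poly.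
    by apply: gtameD; [apply: gtameD|]; apply: gtameM => //; exact: gtame_cst.
  move=> x; rewrite !hornerE /=.
  have h : `|p2.[x]| <= `|u x| + `|r2.[x]|.
    rewrite -[p2.[x]](subKr (u x)) (le_trans (ler_normB _ _)) // lerD2l.
    by rewrite (le_trans (h2 x)) ?ler_norm.
  have : p2.[x] ^+ 2 <= 2 * u x ^+ 2 + 2 * r2.[x] ^+ 2.
    exact: sqr_le_normD.
  move: (p2.[x]) (r2.[x]) (r1.[x]) (u x) => a b c d.
  have := sqr_ge0 (a - b); have := sqr_ge0 (a - c); have := sqr_ge0 (b - c).
  rewrite !expr2; nra.
rewrite gintD; [|by apply: gtameD; apply: gtameM => //; exact: gtame_cst|by apply: gtameM => //; exact: gtame_cst].
rewrite gintD; [|by apply: gtameM => //; exact: gtame_cst|by apply: gtameM => //; exact: gtame_cst].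
rewrite !gintZ //; move: i1 i2 iu; rewrite !ir.
move: (gint _) (gint _) (gint _) => a b c; lra.
Qed.

Lemma papprox_poly p : papprox (horner p).
Proof.
split => [|e e0]; first exact: gtame_poly.
exists p, 0; split => [x|]; first by rewrite subrr normr0 horner0.
by rewrite mul0r gint_poly size_poly0 big_ord0 ltW.
Qed.

Lemma papproxD f g : papprox f -> papprox g -> papprox (fun x => f x + g x).
Proof.
move=> [tf Hf] [tg Hg]; split => [|e e0]; first exact: gtameD.
have e4 : 0 < e / 4 by rewrite divr_gt0.
have [p1 [r1 [h1 i1]]] := Hf _ e4; have [p2 [r2 [h2 i2]]] := Hg _ e4.
exists (p1 + p2), (r1 + r2); split => [x|].
  rewrite !hornerD opprD addrACA; apply: le_trans (ler_normD _ _) _; exact: lerD.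
have t1 := gtame_poly (r1 * r1); have t2 := gtame_poly (r2 * r2).
apply: (@le_trans _ _ (gint (fun x => 2 * (r1 * r1).[x] + 2 * (r2 * r2).[x]))).
  apply: gint_le; first exact: gtame_poly.
    by apply: gtameD; apply: gtameM => //; exact: gtame_cst.
  move=> x; rewrite !hornerM hornerD; move: (r1.[x]) (r2.[x]) => a b.
  by have := sqr_ge0 (a - b); rewrite expr2; nra.
rewrite gintD; [|by apply: gtameM => //; exact: gtame_cst|by apply: gtameM => //; exact: gtame_cst].
by rewrite !gintZ //; lra.
Qed.

Lemma papproxZ c f : papprox f -> papprox (fun x => c * f x).
Proof.
move=> [tf Hf]; split => [|e e0]; first by apply: gtameM => //; exact: gtame_cst.
have [p [r [h i]]] := Hf (e / (1 + c ^+ 2)) (divr_gt0 e0 (ltr_pwDl ltr01 (sqr_ge0 c))).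
exists (c *: p), (`|c| *: r); split => [x|].
  by rewrite !hornerZ -mulrBr normrM ler_wpM2l.
have -> : horner (`|c| *: r * (`|c| *: r)) = (fun x => c ^+ 2 * (r * r).[x]).
  apply/funext => x; rewrite !hornerM !hornerZ -[c ^+ 2]real_normK ?num_real //.
  by rewrite mulrACA.
rewrite gintZ; last exact: gtame_poly.
move: i; rewrite ler_pdivlMr ?ltr_pwDl ?sqr_ge0 //.
have : 0 <= gint (horner (r * r)).
  by rewrite gint_polyM; apply: gint_ge0 => x; rewrite -expr2 sqr_ge0.
by move: (gint _) => y; rewrite mulrDr mulr1 [c ^+ 2 * _]mulrC; lra.
Qed.

Lemma fact_double k : ((k.*2)`! <= 4 ^ k * k`! ^ 2)%N.
Proof.
elim: k => [|k IH] //; rewrite doubleS (factS k.*2.+1) (factS k.*2) (factS k) expnS expnMn.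
have : (k.*2.+2 * k.*2.+1 <= 4 * k.+1 ^ 2)%N by nia.
move=> h; have := leq_mul h IH; lia.
Qed.

Lemma gmom_double_le k : gmom R k.*2 <= 2 ^+ k * k`!%:R.
Proof.
have K0 : 0 < 2 ^+ k * k`!%:R :> R by rewrite mulr_gt0 ?exprn_gt0 // ltr0n fact_gt0.
rewrite -(ler_pM2r K0) gmom_double -expr2 exprMn -exprM mulnC exprM.
by rewrite -!natrX -natrM ler_nat; apply: leq_trans (fact_double k) _.
Qed.

Lemma gtame_shift (m : R) k : gtame (fun x => (x - m) ^+ k).
Proof.
have := gtame_poly (('X - m%:P) ^+ k); congr gtame; apply/funext => x.
by rewrite horner_exp hornerXsubC.
Qed.

Lemma gint_shift_le (m : R) k :
  gint (fun x => (x - m) ^+ k.*2) <= 4 ^+ k * (2 ^+ k * k`!%:R + m ^+ k.*2).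
Proof.
have t0 := gtame_shift 0 k.*2; have tx : gtame (fun x : R => x ^+ k.*2).
  by move: t0; congr gtame; apply/funext => x; rewrite subr0.
apply: (@le_trans _ _ (gint (fun x => 4 ^+ k * x ^+ k.*2 + 4 ^+ k * m ^+ k.*2))).
  apply: gint_le; first exact: gtame_shift.
    by apply: gtameD; last exact: gtame_cst; apply: gtameM => //; exact: gtame_cst.
  move=> x; rewrite -mulrDr -!mul2n !exprM.
  have h : (x - m) ^+ 2 <= 4 * Num.max (x ^+ 2) (m ^+ 2).
    rewrite maxr_pMr // le_max; case: (lerP (x ^+ 2) (m ^+ 2)) => h.
      apply/orP; right; move: h; have := sqr_ge0 (x + m); have := sqr_ge0 (x - m).
      by rewrite !expr2; nra.
    apply/orP; left; move: h; have := sqr_ge0 (x + m); have := sqr_ge0 (x - m).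
    by rewrite !expr2; nra.
  apply: (@le_trans _ _ ((4 * Num.max (x ^+ 2) (m ^+ 2)) ^+ k)).
    by rewrite lerXn2r ?nnegrE ?sqr_ge0 // mulr_ge0 // le_max sqr_ge0.
  rewrite exprMn ler_wpM2l ?exprn_ge0 //.
  have a0 : 0 <= (x ^+ 2) ^+ k by rewrite exprn_ge0 ?sqr_ge0.
  have b0 : 0 <= (m ^+ 2) ^+ k by rewrite exprn_ge0 ?sqr_ge0.
  by case: (lerP (x ^+ 2) (m ^+ 2)) => _; lra.
rewrite gintD; [|by apply: gtameM => //; exact: gtame_cst|exact: gtame_cst].
rewrite gintZ //.
have -> : gint (fun=> 4 ^+ k * m ^+ k.*2) = 4 ^+ k * m ^+ k.*2 :> R.
  rewrite -[RHS]mulr1 -(gint1 R) -gintZ; last exact: gtame_cst.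
  by congr gint; apply/funext => x; rewrite mulr1.
rewrite -mulrDr ler_wpM2l ?exprn_ge0 // lerD2r; exact: gmom_double_le.
Qed.

Lemma gtame_cos (a m : R) : gtame (fun x => cos (a * (x - m))).
Proof.
apply: (@gtame_bounded _ _ 1) => [|x]; last exact: cos_max.
apply: measurable_realfun.continuous_measurable_fun => x.
apply: (@continuous_comp _ _ _ (fun x => a * (x - m)) cos); last exact: continuous_cos.
by apply: cvgMr; apply: cvgB; [exact: cvg_id|exact: cvg_cst].
Qed.

(** The Taylor remainder is at most [l^k / k!] with [l] affine and [k] even. Gaussian moments of
    order [2 k] are at most [2^k k!], so in the mean square one of the two factors [k!] in the
    denominator survives and beats every power. *)
Lemma papprox_cos (a m : R) : papprox (fun x => cos (a * (x - m))).
Proof.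
split => [|e e0]; first exact: gtame_cos.
have e2 : 0 < e / 2 by rewrite divr_gt0.
have /cvgrPdist_lt /(_ _ e2) [N1 _ H1] := @cvg_exp_coeff R (8 * a ^+ 2).
have /cvgrPdist_lt /(_ _ e2) [N2 _ H2] := @cvg_exp_coeff R (4 * a ^+ 2 * m ^+ 2).
pose n := (N1 + N2)%N; pose k := n.*2.
have {H1} H1 : (8 * a ^+ 2) ^+ k / k`!%:R < e / 2.
  have := H1 k; rewrite sub0r normrN /exp_coeff => /(_ _) h.
  by apply: le_lt_trans (ler_norm _) (h _); rewrite /= /k /n; lia.
have {H2} H2 : (4 * a ^+ 2 * m ^+ 2) ^+ k / k`!%:R < e / 2.
  have := H2 k; rewrite sub0r normrN /exp_coeff => /(_ _) h.
  by apply: le_lt_trans (ler_norm _) (h _); rewrite /= /k /n; lia.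
have [p Hp] := cos_taylor R n.
pose l : {poly R} := a%:P * ('X - m%:P).
have lE x : l.[x] = a * (x - m) by rewrite /l hornerM hornerC hornerXsubC.
exists (p \Po l), (k`!%:R^-1 *: l ^+ k); split => [x|].
  by rewrite horner_comp hornerZ horner_exp lE [leRHS]mulrC; exact: Hp.
have F0 : 0 < k`!%:R :> R by rewrite ltr0n fact_gt0.
have -> : horner (k`!%:R^-1 *: l ^+ k * (k`!%:R^-1 *: l ^+ k)) =
    (fun x => ((a ^+ 2) ^+ k / k`!%:R ^+ 2) * (x - m) ^+ k.*2).
  apply/funext => x; rewrite hornerM !hornerZ !horner_exp !lE -expr2 -exprM.
  rewrite !exprMn -!exprM muln2 -mul2n exprVn.
  move: (_ ^+ _) (_ ^+ _) (_^-1) => u v w; ring.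
rewrite gintZ; last exact: gtame_shift.
apply: (@le_trans _ _ ((8 * a ^+ 2) ^+ k / k`!%:R + (4 * a ^+ 2 * m ^+ 2) ^+ k / k`!%:R)); last first.
  by apply: ltW; lra.
have c0 : 0 <= (a ^+ 2) ^+ k / k`!%:R ^+ 2.
  by apply: divr_ge0; apply: exprn_ge0; [exact: sqr_ge0|exact: ltW].
apply: le_trans (ler_wpM2l c0 (gint_shift_le m k)) _.
have -> : m ^+ k.*2 = (m ^+ 2) ^+ k by rewrite -mul2n exprM.
have -> : (8 : R) = 4 * 2 by rewrite -natrM.
have f1 : 1 <= k`!%:R :> R by rewrite ler1n fact_gt0.
move: (a ^+ 2) (m ^+ 2) (sqr_ge0 a) (sqr_ge0 m) => A B A0 B0.
rewrite ![(_ * _) ^+ k]exprMn.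
have X0 : 0 <= 4 ^+ k * A ^+ k * B ^+ k.
  by apply: mulr_ge0; [apply: mulr_ge0|]; apply: exprn_ge0.
rewrite -mulrDl ler_pdivlMr //.
move: X0 F0 f1; move: (4 ^+ k) (2 ^+ k) (A ^+ k) (B ^+ k) (k`!%:R) => u v w z y X0 y0 y1.
have -> : w / y ^+ 2 * (u * (v * y + z)) * y = u * v * w + u * w * z / y.
  by field; rewrite gt_eqF.
by rewrite lerD2l ler_pdivrMr // ler_peMr.
Qed.

(** Powers of the cosine turn into sums of cosines by the addition formulas. The auxiliary frequency
    [l] is arbitrary so that the induction on the exponent closes. *)
Lemma papprox_cos_poly (a m : R) p : papprox (fun x => p.[cos (a * (x - m))]).
Proof.
have pc j : forall l : R, papprox (fun x => cos (a * (x - m)) ^+ j * cos (l * a * (x - m))).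
  elim: j => [|j IH] l.
    have := papprox_cos (l * a) m; congr papprox; apply/funext => x.
    by rewrite expr0 mul1r.
  have := papproxD (papproxZ (1 / 2) (IH (l + 1))) (papproxZ (1 / 2) (IH (l - 1))).
  congr papprox; apply/funext => x; rewrite exprSr.
  have -> : (l + 1) * a * (x - m) = l * a * (x - m) + a * (x - m) by ring.
  have -> : (l - 1) * a * (x - m) = l * a * (x - m) - a * (x - m) by ring.
  rewrite cosD cosB; move: (cos _) (cos _) (sin _) (sin _) => u v w z.
  by move: (u ^+ j) => y; field.
have : forall k, papprox (fun x => p.[cos (a * (x - m))] * cos (a * (x - m)) ^+ k).
  elim/poly_ind: p => [|p c IH] k.
    have := papprox_poly 0; congr papprox; apply/funext => x.
    by rewrite !horner0 mul0r.
  have := papproxD (IH k.+1) (papproxZ c (pc k 0)); congr papprox; apply/funext => x.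
  rewrite hornerD hornerM hornerX hornerC !mul0r cos0 mulr1 exprS.
  by move: (cos _) (p.[_]) => u v; move: (u ^+ k) => w; ring.
move=> /(_ 0%N); congr papprox; apply/funext => x; by rewrite expr0 mulr1.
Qed.
End PolyApprox.

(** * Indicators of intervals *)

Section IntervalApprox.
Variable R : realType.
Implicit Types (f g : R -> R) (x v : R) (p r : {poly R}).

Lemma bernoulli_ge (y : R) n : 0 <= y <= 1 -> 1 - n%:R * y <= (1 - y) ^+ n.
Proof.
move=> /andP[y0 y1]; elim: n => [|n IH]; first by rewrite mul0r subr0 expr0.
have h : (1 - y) * (1 - n%:R * y) <= (1 - y) ^+ n.+1 by rewrite exprS ler_wpM2l // subr_ge0.
apply: le_trans h; rewrite -natr1; have : 0 <= n%:R :> R by []. 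
have := mulr_ge0 y0 y0; move: (n%:R) => z; nra.
Qed.

Lemma bernoulli_pos (y : R) n : 0 <= y -> 1 + n%:R * y <= (1 + y) ^+ n.
Proof.
move=> y0; elim: n => [|n IH]; first by rewrite mul0r addr0 expr0.
have y1 : 0 <= 1 + y by rewrite addr_ge0.
have h : (1 + y) * (1 + n%:R * y) <= (1 + y) ^+ n.+1 by rewrite exprS ler_wpM2l.
apply: le_trans h; rewrite -natr1; have : 0 <= n%:R :> R by [].
have := mulr_ge0 y0 y0; move: (n%:R) => z; nra.
Qed.

(* The polynomials [(1 - v^n)^(2^n)] of Brosowski and Deutsch. *)
Lemma step_bound v n : 0 <= v <= 1 ->
  `|(v < 2^-1)%R%:R - (1 - v ^+ n) ^+ (2 ^ n)%N| <= (1 - (v - 2^-1) ^+ 2) ^+ n.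
Proof.
move=> /andP[v0 v1].
have vn0 : 0 <= v ^+ n by rewrite exprn_ge0.
have vn1 : v ^+ n <= 1 by rewrite exprn_ile1.
have s0 : 0 <= 1 - v ^+ n by rewrite subr_ge0.
have s1 : 1 - v ^+ n <= 1 by rewrite lerBlDr lerDl.
case: ltP => h /=.
  rewrite ger0_norm ?subr_ge0 ?exprn_ile1 //.
  have := @bernoulli_ge (v ^+ n) (2 ^ n); rewrite vn0 vn1 natrX -exprMn => /(_ isT) H.
  apply: (@le_trans _ _ ((2 * v) ^+ n)); first by lra.
  by rewrite lerXn2r ?nnegrE // ?expr2; nra.
rewrite sub0r normrN ger0_norm ?exprn_ge0 //.
have w0 : 0 <= 1 - (v - 2^-1) ^+ 2 by rewrite expr2; nra.
have p0 : 0 < (2 * v) ^+ n by rewrite exprn_gt0 //; lra.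
(* After multiplication by [(2 v)^n <= (1 + v^n)^(2^n)], the left side is at most
   [(1 - v^(2n))^(2^n) <= 1]. *)
rewrite -(ler_pM2r p0); apply: (@le_trans _ _ 1).
  apply: (@le_trans _ _ ((1 - v ^+ n) ^+ (2 ^ n)%N * (1 + v ^+ n) ^+ (2 ^ n)%N)).
    rewrite ler_wpM2l ?exprn_ge0 // exprMn -natrX.
    by apply: le_trans (bernoulli_pos (2 ^ n) vn0); rewrite lerDr.
  rewrite -exprMn; apply: exprn_ile1; first by apply: mulr_ge0 => //; apply: addr_ge0.
  by rewrite -subr_sqr expr1n lerBlDr lerDl sqr_ge0.
rewrite -exprMn exprn_ege1 //; set z := v - 2^-1.
have -> : v = 2^-1 + z by rewrite /z addrC subrK.
have z0 : 0 <= z by rewrite /z subr_ge0.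
have z1 : z <= 2^-1 by rewrite /z; lra.
by rewrite expr2; nra.
Qed.

Lemma gint_cst (c : R) : gint (fun=> c) = c.
Proof.
rewrite -[RHS]mulr1 -(gint1 R) -gintZ; last exact: gtame_cst.
by congr gint; apply/funext => x; rewrite mulr1.
Qed.

(** The step polynomials are composed with [v], an affine function of [cos (t (x - m))]. On the
    window [W], where [|t (x - m)| < 1], [v] is below 1/2 exactly on the interval, and [gint_small]
    makes the error there small. Outside the window the error is at most [1 <= t^2 (x - m)^2], whose
    Gaussian mean square is small for small [t]. *)
Lemma papprox_indic (a b : R) : a < b -> papprox \1_`]a, b[.
Proof.
move=> ab; apply: papprox_lim => [|e e0]; first exact: gtame_indic.
pose m := (a + b) / 2; pose h := (b - a) / 2.
have h0 : 0 < h by rewrite divr_gt0 ?subr_gt0.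
pose A2 := gint (fun x => (x - m) ^+ 2); pose A4 := gint (fun x => (x - m) ^+ 4).
have A20 : 0 <= A2 by apply: gint_ge0 => x; rewrite exprn_even_ge0.
have A40 : 0 <= A4 by apply: gint_ge0 => x; rewrite exprn_even_ge0.
(* Large enough for the window to contain the interval, for [t <= 1], and for the contribution
   [2 (t^2 A2 + t^4 A4)] of the tails to be at most [e / 3]. *)
pose T := 1 + h + 6 * (A2 + A4) / e; pose t := T^-1.
have q0 : 0 <= 6 * (A2 + A4) / e by rewrite divr_ge0 ?(ltW e0) // mulr_ge0 // addr_ge0.
have T1 : 1 < T by rewrite /T; lra.
have T0 : 0 < T by apply: lt_trans T1.
have t0 : 0 < t by rewrite invr_gt0.
have t1 : t <= 1 by rewrite invf_le1 // ltW.
have th : t * h < 1 by rewrite /t ltr_pdivrMl // mulr1 /T; lra.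
have tA : t * (A2 + A4) <= e / 6.
  rewrite /t ler_pdivrMl //; apply: (@le_trans _ _ (6 * (A2 + A4) / e * (e / 6))).
    by rewrite le_eqVlt; apply/orP; left; apply/eqP; field; rewrite gt_eqF.
  by rewrite ler_wpM2r ?divr_ge0 ?(ltW e0) // /T; lra.
pose C x := cos (t * (x - m)).
pose vp : {poly R} := (2^-1 + cos (t * h) / 4)%:P - 4^-1 *: 'X.
pose v x := vp.[C x].
have vE x : v x = 2^-1 + cos (t * h) / 4 - C x / 4.
  by rewrite /v hornerD hornerN hornerZ hornerC hornerX [4^-1 * _]mulrC.
have v01 x : 0 <= v x <= 1.
  have := cos_max (t * h); have := cos_max (t * (x - m)); rewrite vE /C !ler_norml.
  by move=> /andP[? ?] /andP[? ?]; apply/andP; split; lra.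
pose tp n : {poly R} := (1 - vp ^+ n) ^+ (2 ^ n)%N.
pose up n : {poly R} := (1 - (vp - (2^-1)%:P) ^+ 2) ^+ n.
pose tf n x := (tp n).[C x]; pose uf n x := (up n).[C x].
have tE n x : tf n x = (1 - v x ^+ n) ^+ (2 ^ n)%N.
  by rewrite /tf /tp horner_exp hornerD hornerN horner_exp hornerC.
have uE n x : uf n x = (1 - (v x - 2^-1) ^+ 2) ^+ n.
  by rewrite /uf /up horner_exp hornerD hornerN horner_exp hornerD hornerN !hornerC.
have z01 x : 0 <= 1 - (v x - 2^-1) ^+ 2 <= 1.
  have /andP[v0 v1] := v01 x; rewrite lerBlDr lerDl sqr_ge0 andbT subr_ge0 expr2.
  by move: (v x) v0 v1 => y y0 y1; nra.
have uf01 n x : 0 <= uf n x <= 1.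
  by have /andP[? ?] := z01 x; rewrite uE exprn_ge0 // exprn_ile1.
have pu n : papprox (uf n) by exact: papprox_cos_poly.
pose W : set R := [set` `]m - T, m + T[].
have WP x : (x \in W) = (`|t * (x - m)| < 1).
  rewrite normrM (gtr0_norm t0) /t ltr_pdivrMl // mulr1 ltr_distl.
  by apply/idP/idP => [/set_mem|xW]; [|apply/mem_set]; rewrite /W /= in_itv /=.
have [n Hn] : exists n, gint (fun x => uf n x * \1_W x) < e / 3.
  apply: (gint_small (a := a) (b := b)).
  - by move=> n; have [] := gtameM (pu n).1 (@gtame_indic R W (measurable_itv _)).
  - move=> n x; rewrite indicE; have /andP[? ?] := uf01 n x.
    by case: (_ \in _); rewrite ?mulr1 ?mulr0 ?lexx ?ler01 //; apply/andP.
  (* The majorant tends to 0 wherever [v x] is not 1/2; inside the window the value 1/2 is taken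
     only at [a] and [b]. *)
  - move=> x xa xb; rewrite indicE WP.
    case: ltP => xW /=; last first.
      by under eq_cvg do rewrite mulr0; exact: cvg_cst.
    under eq_cvg do rewrite mulr1 uE.
    apply: cvg_expr; have /andP[z0 z1] := z01 x; rewrite ger0_norm //.
    rewrite gtrBl lt0r sqr_ge0 andbT sqrf_eq0 vE.
    apply/negP => /eqP vx.
    have : C x = cos (t * h) by lra.
    rewrite /C -cos_norm => /cos_inj H.
    have : `|t * (x - m)| = t * h.
      have := pi_ge2 R => pi2.
      apply: H; rewrite in_itv /= ?normr_ge0 /=; first by lra.
      by rewrite ltW ?mulr_gt0 //=; lra.
    rewrite normrM (gtr0_norm t0) => /(mulfI (lt0r_neq0 t0)) /eqP.
    rewrite eqr_norml => /andP[/orP[] /eqP xE _].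
      by move: xb; rewrite (_ : x = b) ?eqxx // -(subrK m x) xE /h /m; field.
    by move: xa; rewrite (_ : x = a) ?eqxx // -(subrK m x) xE /h /m; field.
  by rewrite divr_gt0.
have tx2 : gtame (fun x => t ^+ 2 * (x - m) ^+ 2).
  by apply: gtameM (gtame_cst _) (gtame_shift _ _).
have offW x : x \notin W -> 1 <= t ^+ 2 * (x - m) ^+ 2.
  rewrite WP -leNgt -exprMn -[_ ^+ 2]real_normK ?num_real // => h1.
  by rewrite exprn_ege1.
exists (tf n), (fun x => uf n x + t ^+ 2 * (x - m) ^+ 2); split.
- exact: papprox_cos_poly.
- have := papproxD (pu n) (papproxZ (t ^+ 2) (papprox_poly (('X - m%:P) ^+ 2))).
  by congr papprox; apply/funext => x; rewrite horner_exp hornerXsubC.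
- move=> x; have sx : 0 <= t ^+ 2 * (x - m) ^+ 2 by rewrite mulr_ge0 ?sqr_ge0.
  have /andP[u0 u1] := uf01 n x.
  have t01 : 0 <= tf n x <= 1.
    have /andP[v0 v1] := v01 x; rewrite tE exprn_ge0 ?exprn_ile1 ?subr_ge0 ?exprn_ile1 //.
    by rewrite lerBlDr lerDl exprn_ge0.
  have [xW|xW] := boolP (x \in W); last first.
    apply: (@le_trans _ _ 1); last by apply: le_trans (offW _ xW) _; rewrite lerDr.
    rewrite indicE; move: t01 => /andP[? ?].
    by case: (_ \in _) => /=; rewrite ler_norml; apply/andP; split; lra.
  apply: (@le_trans _ _ (uf n x)); last by rewrite lerDl.
  rewrite uE tE -[\1__ x](_ : (v x < 2^-1)%R%:R = _); first exact: step_bound.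
  rewrite indicE; congr (nat_of_bool _)%:R.
  have -> : (v x < 2^-1) = (cos (t * h) < cos `|t * (x - m)|).
    by rewrite vE cos_norm /C; apply/idP/idP; lra.
  have pi2 := pi_ge2 R; move: xW; rewrite WP => xW.
  rewrite ltr_cos ?in_itv /= ?normr_ge0 /=; [|lra|by rewrite ltW ?mulr_gt0 //=; lra].
  rewrite normrM (gtr0_norm t0) ltr_pM2l // ltr_distl.
  have -> : m - h = a by rewrite /m /h; field.
  have -> : m + h = b by rewrite /m /h; field.
  by apply/idP/idP => [xab|/set_mem]; [apply/mem_set|]; rewrite /= in_itv /=.
have tt2 : t ^+ 2 <= t by rewrite expr2 ler_piMr // ltW.
have tt4 : t ^+ 4 <= t by rewrite (_ : t ^+ 4 = t * t ^+ 3) ?ler_piMr ?exprn_ile1 ?(ltW t0) // -exprS.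
have [tu _] := pu n; have ts := gtame_shift m.
have tW : gtame (fun x => uf n x * \1_W x) by exact: gtameM tu (@gtame_indic R W (measurable_itv _)).
apply: (@le_trans _ _ (gint (fun x => 2 * (uf n x * \1_W x) +
    (2 * t ^+ 2 * (x - m) ^+ 2 + 2 * t ^+ 4 * (x - m) ^+ 4)))).
  apply: gint_le.
  - by apply: gtame_sqr; apply: gtameD.
  - apply: gtameD; first exact: gtameM (gtame_cst _) tW.
    by apply: gtameD; apply: gtameM (gtame_cst _) (ts _).
  move=> x; have /andP[u0 u1] := uf01 n x.
  have sx : 0 <= t ^+ 2 * (x - m) ^+ 2 by rewrite mulr_ge0 ?sqr_ge0.
  have uu : uf n x ^+ 2 <= uf n x * \1_W x + t ^+ 2 * (x - m) ^+ 2.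
    rewrite indicE; have [xW|/offW xW] := boolP (x \in W).
      by rewrite mulr1 (@le_trans _ _ (uf n x)) ?lerDl // expr2 ler_piMr.
    by rewrite mulr0 add0r (le_trans _ xW) // exprn_ile1.
  have -> : 2 * t ^+ 4 * (x - m) ^+ 4 = 2 * (t ^+ 2 * (x - m) ^+ 2) ^+ 2.
    by move: (x - m) => y; ring.
  rewrite -[2 * t ^+ 2 * _]mulrA; move: (uf n x) (t ^+ 2 * _) uu => y z.
  by have := sqr_ge0 (y - z); rewrite !expr2; move: (_ * \1_W x) => k; nra.
rewrite gintD; [|exact: gtameM (gtame_cst _) tW|by apply: gtameD; apply: gtameM (gtame_cst _) (ts _)].
rewrite gintD; [|by apply: gtameM (gtame_cst _) (ts _)|by apply: gtameM (gtame_cst _) (ts _)].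
rewrite !gintZ // -/A2 -/A4; move: (gint _) Hn tA tt2 tt4 => I.
move: (t ^+ 2) (t ^+ 4) => t2 t4 *; nra.
Qed.
End IntervalApprox.

(** * From moments to weighted expectations *)

Section CentralLimit.
Variable R : realType.
Implicit Types (f g : R -> R) (x : R) (p r : {poly R}).

Definition mean (n : nat) (f : nat -> R) : R := n%:R^-1 * \sum_(k < n) f k.

Lemma meanD n (f g : nat -> R) : mean n (fun k => f k + g k) = mean n f + mean n g.
Proof. by rewrite /mean big_split mulrDr. Qed.

Lemma meanZ n c (f : nat -> R) : mean n (fun k => c * f k) = c * mean n f.
Proof. by rewrite /mean -mulr_sumr mulrCA. Qed.

Lemma eq_mean n (f g : nat -> R) : f =1 g -> mean n f = mean n g.
Proof. by move=> fg; rewrite /mean; congr (_ * _); apply: eq_bigr => i _. Qed.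

Lemma le_mean n (f g : nat -> R) : (forall k, f k <= g k) -> mean n f <= mean n g.
Proof. by move=> fg; rewrite ler_wpM2l ?invr_ge0 // ler_sum. Qed.

Lemma mean_norm n (f : nat -> R) : `|mean n f| <= mean n (fun k => `|f k|).
Proof.
rewrite normrM ger0_norm ?invr_ge0 // ler_wpM2l ?invr_ge0 //; exact: ler_norm_sum.
Qed.

(** Replaces Cauchy-Schwarz: [d] is chosen later to balance the two mean squares, which avoids
    square roots. *)
Lemma mean_AMGM n (f g : nat -> R) d : 0 < d ->
  mean n (fun k => `|f k| * `|g k|) <=
  d * mean n (fun k => f k ^+ 2) + d^-1 * mean n (fun k => g k ^+ 2).
Proof.
move=> d0; rewrite -!meanZ -meanD; apply: le_mean => k.
rewrite -(real_normK (num_real (f k))) -(real_normK (num_real (g k))).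
move: `|f k| `|g k| (normr_ge0 (f k)) (normr_ge0 (g k)) => u v u0 v0.
rewrite -(ler_pM2l d0) mulrDr [d * (d^-1 * _)]mulrA divff ?gt_eqF // mul1r.
have := sqr_ge0 (d * u - v); have := mulr_ge0 (mulr_ge0 (ltW d0) u0) v0.
by rewrite !expr2; nra.
Qed.

Lemma mean_poly n p (w X : nat -> R) : mean n (fun k => w k * p.[X k]) =
  \sum_(i < size p) p`_i * mean n (fun k => w k * X k ^+ i).
Proof.
rewrite (eq_mean _ (g := fun k => \sum_(i < size p) p`_i * (w k * X k ^+ i))); last first.
  by move=> k; rewrite horner_coef mulr_sumr; apply: eq_bigr => i _; rewrite mulrCA.
rewrite /mean exchange_big mulr_sumr; apply: eq_bigr => i _.
by rewrite -mulr_sumr mulrCA.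
Qed.

Lemma mean_poly_approx p (e : R) : 0 < e -> exists2 d : R, 0 < d &
  forall n (w X : nat -> R) (c : R), (forall m, (m < size p)%N ->
     `|mean n (fun k => w k * X k ^+ m) - c * gmom R m| <= d) ->
  `|mean n (fun k => w k * p.[X k]) - c * gint (horner p)| <= e.
Proof.
move=> e0; pose S : R := \sum_(i < size p) `|p`_i|.
have S0 : 0 <= S by apply: sumr_ge0.
exists (e / (1 + S)) => [|n w X c H]; first by rewrite divr_gt0 // ltr_pwDl.
rewrite mean_poly gint_poly mulr_sumr -sumrB.
apply: (@le_trans _ _ (S * (e / (1 + S)))); last first.
  by rewrite mulrA ler_pdivrMr ?ltr_pwDl // mulrDr mulr1 mulrC lerDr ltW.
apply: le_trans (ler_norm_sum _ _ _) _; rewrite mulr_suml; apply: ler_sum => i _.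
by rewrite [c * (_ * _)]mulrCA -mulrBr normrM ler_wpM2l //; apply: H.
Qed.

(** Moments control the weighted mean of [p(X)]. The error in replacing [g] by [p] is at most [s]
    times the mean of [w^2] plus [1/s] times that of [r(X)^2], which is again governed by moments.
    The sign of [w] never enters; [c] is its limiting total mass. Uniformity in [n], [w], [X] is
    what lets [q] vary. *)
Theorem weighted_clt g (e C : R) : papprox g -> 0 < e -> 0 < C ->
  exists N, exists2 d : R, 0 < d & forall n (w X : nat -> R) (c : R),
    `|c| <= 1 -> mean n (fun k => w k ^+ 2) <= C ->
    (forall m, (m < N)%N -> `|mean n (fun k => w k * X k ^+ m) - c * gmom R m| <= d) ->
    (forall m, (m < N)%N -> `|mean n (fun k => X k ^+ m) - gmom R m| <= d) ->
  `|mean n (fun k => w k * g (X k)) - c * gint g| <= e.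
Proof.
move=> [tg Hg] e0 C0.
(* [s C = e / 8] settles the weight. Then [dl] makes [2 dl / s] at most [e / 8], and makes the
   Gaussian mean of [r] small through [r <= e / 8 + (2 / e) r^2]. *)
pose s := e / (8 * C); have s0 : 0 < s by rewrite divr_gt0 // mulr_gt0.
pose dl := Num.min (e * s / 16) (e ^+ 2 / 64).
have dl0 : 0 < dl.
  rewrite lt_min; apply/andP; split; apply: divr_gt0 => //; first exact: mulr_gt0.
  by rewrite exprn_gt0.
have [p [r [h i]]] := Hg _ dl0.
have e4 : 0 < e / 4 by rewrite divr_gt0.
have [d1 d10 H1] := mean_poly_approx p e4.
have [d2 d20 H2] := mean_poly_approx (r * r) dl0.
exists (maxn (size p) (size (r * r))), (Num.min d1 d2); first by rewrite lt_min d10.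
move=> n w X c c1 wC Hw HX.
have tr := gtame_poly r; have tp := gtame_poly p.
have hp : `|mean n (fun k => w k * p.[X k]) - c * gint (horner p)| <= e / 4.
  apply: H1 => m mp; apply: le_trans (Hw m _) _; first by rewrite leq_max mp.
  by rewrite ge_min lexx.
have hr : mean n (fun k => r.[X k] ^+ 2) <= 2 * dl.
  have := H2 n (fun=> 1) X 1; rewrite !mul1r => /(_ _) h2.
  have : `|mean n (fun k => 1 * (r * r).[X k]) - gint (horner (r * r))| <= dl.
    apply: h2 => m mp; rewrite mul1r (eq_mean _ (g := fun k => X k ^+ m)); last by move=> k; rewrite mul1r.
    by apply: le_trans (HX m _) _; rewrite ?leq_max ?mp ?orbT // ge_min lexx orbT.
  rewrite (eq_mean _ (g := fun k => r.[X k] ^+ 2)); last by move=> k; rewrite mul1r hornerM.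
  by rewrite ler_distl => /andP[_]; lra.
have D1 : `|mean n (fun k => w k * g (X k)) - mean n (fun k => w k * p.[X k])| <= e / 4.
  have -> : mean n (fun k => w k * g (X k)) - mean n (fun k => w k * p.[X k])
     = mean n (fun k => w k * (g (X k) - p.[X k])).
    rewrite -[X in _ + X]mulN1r -meanZ -meanD; apply: eq_mean => k; ring.
  apply: le_trans (mean_norm _ _) _.
  apply: (@le_trans _ _ (mean n (fun k => `|w k| * `|r.[X k]|))).
    apply: le_mean => k; rewrite normrM ler_wpM2l //.
    exact: le_trans (h _) (ler_norm _).
  apply: le_trans (mean_AMGM _ _ _ s0) _.
  have a1 : s * mean n (fun k => w k ^+ 2) <= e / 8.
    by rewrite /s mulrAC ler_pdivrMr ?mulr_gt0 //; move: e0 wC; move: (mean _ _) => y; nra.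
  have a2 : s^-1 * mean n (fun k => r.[X k] ^+ 2) <= e / 8.
    rewrite ler_pdivrMl //; apply: le_trans hr _.
    have : dl <= e * s / 16 by rewrite ge_min lexx.
    by lra.
  lra.
have D2 : `|c * gint (horner p) - c * gint g| <= e / 4.
  rewrite -mulrBr normrM -[leRHS]mul1r ler_pM // -gintB //.
  apply: le_trans (gint_norm (gtameB tp tg)) _.
  apply: (@le_trans _ _ (gint (fun x => r.[x]))).
    by apply: gint_le => //; [exact/gtame_norm/gtameB|move=> x; rewrite distrC].
  have k0 : 0 < 4 / e by rewrite divr_gt0.
  apply: (@le_trans _ _ (gint (fun x => e / 8 + 2 / e * (r * r).[x]))).
    apply: gint_le => //.
      apply: gtameD; first exact: gtame_cst.
      by apply: gtameM (gtame_cst _) (gtame_poly _).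
    move=> x; rewrite hornerM; move: (r.[x]) => y.
    rewrite -(ler_pM2l e0) mulrDr [e * (2 / e * _)]mulrA.
    have -> : e * (2 / e) = 2 by field; rewrite gt_eqF.
    by have := sqr_ge0 (e / 4 - y); rewrite !expr2; nra.
  rewrite gintD; [|exact: gtame_cst|by apply: gtameM (gtame_cst _) (gtame_poly _)].
  rewrite gint_cst (gintZ _ (gtame_poly (r * r))).
  have : 2 / e * gint (horner (r * r)) <= 2 / e * dl by rewrite ler_pM2l // divr_gt0.
  have : 2 / e * dl <= 2 / e * (e ^+ 2 / 64).
    by rewrite ler_pM2l ?divr_gt0 // ge_min lexx orbT.
  have -> : 2 / e * (e ^+ 2 / 64) = e / 32 by field; rewrite gt_eqF.
  lra.
move: hp D1 D2; rewrite !ler_distl.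
by move=> /andP[? ?] /andP[? ?] /andP[? ?]; apply/andP; split; lra.
Qed.
End CentralLimit.

(** * Mertens-type bounds for sums over primes *)

Definition prime_interval (A B : nat) : seq nat := [seq p <- iota A.+1 (B - A) | prime p].

Lemma mem_prime_interval A B p : (p \in prime_interval A B) = [&& prime p, (A < p)%N & (p <= B)%N].
Proof. by rewrite mem_filter mem_iota; congr (_ && _); apply/idP/idP; lia. Qed.

Lemma prime_interval_prime A B : all prime (prime_interval A B).
Proof. exact: filter_all. Qed.

Lemma prime_interval_uniq A B : uniq (prime_interval A B).
Proof. by rewrite filter_uniq // iota_uniq. Qed.

Lemma prime_interval_cat A B C : (A <= B)%N -> (B <= C)%N ->
  prime_interval A C = prime_interval A B ++ prime_interval B C.
Proof.
move=> AB BC; have -> : prime_interval A C =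
    [seq p <- iota A.+1 (B - A) ++ iota B.+1 (C - B) | prime p].
  have e : (C - A = (B - A) + (C - B))%N by lia.
  by rewrite /prime_interval e iotaD addSn subnKC.
by rewrite filter_cat.
Qed.

Section Mertens.
Variable R : realType.
Local Notation s1 := (s1 R).
Local Notation s2 := (s2 R).
Local Notation slog := (slog R).

Lemma sum_uniq_sub (D E : seq nat) (F : nat -> R) : uniq D -> uniq E -> {subset D <= E} ->
  (forall n, n \in E -> 0 <= F n) -> \sum_(n <- D) F n <= \sum_(n <- E) F n.
Proof.
move=> uD uE DE F0; rewrite [leRHS](bigID (mem D)) /= -[leLHS]addr0 lerD //; last first.
  by rewrite big_seq_cond sumr_ge0 // => n /andP[nE _]; exact: F0.
rewrite -[leRHS]big_filter le_eqVlt; apply/orP; left; apply/eqP; apply: perm_big; apply: uniq_perm => //.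
  exact: filter_uniq.
by move=> n; rewrite mem_filter /=; apply/idP/andP => [nD|[]//]; split => //; exact: DE.
Qed.

Lemma sum_iota_recr m n (F : nat -> R) :
  \sum_(i <- iota m n.+1) F i = \sum_(i <- iota m n) F i + F (m + n)%N.
Proof. by rewrite -[n.+1]addn1 iotaD big_cat /= big_seq1. Qed.

Lemma s2_le A B : s2 (prime_interval A B) <= 1.
Proof.
have h N : \sum_(n <- iota 2 N) (n%:R^-1 : R) ^+ 2 <= 1 - N.+1%:R^-1.
  elim: N => [|N IH]; first by rewrite big_nil invr1 subrr.
  rewrite sum_iota_recr add2n; apply: le_trans (lerD IH (lexx _)) _.
  rewrite -!natr1; have n0 : 0 <= N%:R :> R by [].
  move: (N%:R) n0 => y y0; rewrite -subr_ge0.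
  have -> : 1 - (y + 1 + 1)^-1 - (1 - (y + 1)^-1 + (y + 1 + 1)^-1 ^+ 2) =
     ((y + 1) * (y + 1 + 1) ^+ 2)^-1.
    by field; rewrite !gt_eqF //; lra.
  by rewrite invr_ge0 mulr_ge0 ?sqr_ge0 //; lra.
apply: (@le_trans _ _ (\sum_(n <- iota 2 B) (n%:R^-1 : R) ^+ 2)); last first.
  by apply: le_trans (h B) _; rewrite lerBlDr lerDl invr_ge0.
apply: sum_uniq_sub; [exact: prime_interval_uniq|exact: iota_uniq| |by move=> n _; exact: sqr_ge0].
by move=> p; rewrite mem_prime_interval mem_iota => /and3P[/prime_gt1]; lia.
Qed.

Lemma s2_ge0 ps : 0 <= s2 ps.
Proof. by apply: sumr_ge0 => p _; rewrite sqr_ge0. Qed.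

Lemma s1_ge0 ps : 0 <= s1 ps.
Proof. by apply: sumr_ge0 => p _; rewrite invr_ge0. Qed.

Lemma prod_primes_dvd (ps : seq nat) (e : nat -> nat) n : all prime ps -> uniq ps ->
  (forall p, p \in ps -> p ^ e p %| n)%N -> (\prod_(p <- ps) p ^ e p %| n)%N.
Proof.
elim: ps => [|p ps IH] /=; first by rewrite big_nil dvd1n.
move=> /andP[pp aps] /andP[pps ups] h; rewrite big_cons Gauss_dvd.
  rewrite h ?inE ?eqxx //= IH // => r rps; apply: h; by rewrite inE rps orbT.
rewrite coprimeXl // big_seq; elim/big_ind: _ => [|a b ca cb|r rps]; rewrite ?coprimen1 ?coprimeMr ?ca //.
rewrite coprimeXr // prime_coprime // dvdn_prime2 ?(allP aps r rps) //.
by apply: contraNneq pps => ->.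
Qed.

Lemma fact_le_exp n : (n`! <= n ^ n)%N.
Proof.
elim: n => [//|n IH]; rewrite factS expnS leq_mul2l /=.
by case: n IH => [//|n] IH; apply: leq_trans IH _; rewrite leq_exp2r.
Qed.

(** Chebyshev's argument: the product of the [p ^ (N %/ p)] divides [N!], which is at most [N ^ N];
    and [N / p <= 2 (N %/ p)] for [p <= N]. *)
Lemma slog_le N : (0 < N)%N -> slog (prime_interval 0 N) <= 2 * ln N%:R.
Proof.
move=> N0; set ps := prime_interval 0 N; have NR : 0 < N%:R :> R by rewrite ltr0n.
have aps := prime_interval_prime 0 N; have ups := prime_interval_uniq 0 N.
have psP p : p \in ps -> prime p /\ (p <= N)%N.
  by rewrite mem_prime_interval => /and3P[].
have dv : (\prod_(p <- ps) p ^ (N %/ p) %| N`!)%N.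
  apply: prod_primes_dvd => // p /psP[pp pN].
  rewrite pfactor_dvdn ?fact_gt0 // logn_fact // big_ltn; last by rewrite ltnS.
  by rewrite expn1 leq_addr.
have h1 : \sum_(p <- ps) (N %/ p)%:R * ln p%:R <= N%:R * ln N%:R :> R.
  have -> : \sum_(p <- ps) (N %/ p)%:R * ln p%:R = ln (\prod_(p <- ps) p ^ (N %/ p))%N%:R :> R.
    have : all prime ps by []. elim: (ps) => [_|p s IH /= /andP[pp aps']].
      by rewrite !big_nil ln1.
    have p0 := prime_gt0 pp.
    have s0 : (0 < \prod_(j <- s) j ^ (N %/ j))%N.
      rewrite big_seq; apply: prodn_cond_gt0 => j js; rewrite expn_gt0 prime_gt0 //.
      exact: (allP aps').
    rewrite !big_cons IH // natrM lnM ?posrE ?ltr0n ?expn_gt0 ?p0 //.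
    by rewrite natrX lnXn ?ltr0n // mulr_natl.
  rewrite mulr_natl -lnXn // ler_ln ?posrE ?exprn_gt0 //.
    rewrite -natrX ler_nat; apply: leq_trans (fact_le_exp N).
    by apply: dvdn_leq dv; exact: fact_gt0.
  rewrite ltr0n big_seq; apply: prodn_cond_gt0 => j /psP[jp _].
  by rewrite expn_gt0 prime_gt0.
rewrite -(ler_pM2l NR); apply: (@le_trans _ _ (2 * \sum_(p <- ps) (N %/ p)%:R * ln p%:R)); last first.
  by rewrite mulrCA ler_pM2l.
rewrite /slog !mulr_sumr; apply: ler_sum_seq => p /psP[pp pN].
have p0 : 0 < p%:R :> R by rewrite ltr0n prime_gt0.
have lp : 0 <= ln p%:R :> R by rewrite ln_ge0 // ler1n prime_gt0.
rewrite mulrCA mulrC mulrA ler_wpM2r // ler_pdivrMr // -!natrM ler_nat.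
have := ltn_ceil N (prime_gt0 pp); have : (0 < N %/ p)%N by rewrite divn_gt0 ?prime_gt0.
by move: (N %/ p)%N => a a0; nia.
Qed.

Lemma expR_ge_geometric (x : R) B : 0 <= x -> x <= 2^-1 ->
  \sum_(0 <= a < B.+1) x ^+ a <= expR (x + 2 * x ^+ 2).
Proof.
move=> x0 x2; apply: (@le_trans _ _ (1 + x + 2 * x ^+ 2)); last by rewrite -addrA expR_ge1Dx.
have x1 : 0 < 1 - x by lra.
rewrite -(ler_pM2l x1); apply: (@le_trans _ _ 1); last by rewrite expr2; nra.
have -> : (1 - x) * \sum_(0 <= a < B.+1) x ^+ a = 1 - x ^+ B.+1.
  by rewrite big_mkord -[1 in RHS](expr1n _ B.+1) subrXX; congr (_ * _); apply: eq_bigr => i _; rewrite expr1n mul1r.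
by rewrite lerBlDr lerDl exprn_ge0.
Qed.

Lemma harmonic_ge_ln N : ln N.+1%:R <= \sum_(n <- iota 1 N) n%:R^-1 :> R.
Proof.
elim: N => [|N IH]; first by rewrite ln1 big_nil.
rewrite sum_iota_recr add1n.
apply: le_trans (lerD IH (lexx _)).
have n0 : 0 < N.+1%:R :> R by rewrite ltr0n.
rewrite -lerBlDl -ln_div ?posrE ?ltr0n //.
have -> : N.+2%:R / N.+1%:R = 1 + N.+1%:R^-1 :> R by rewrite -[N.+2%:R]natr1 mulrDl divff ?gt_eqF // mul1r.
by apply: le_ln1Dx; apply: (@lt_trans _ _ 0); rewrite ?ltrN10 ?invr_gt0.
Qed.

(** Euler: every [n <= N] is a product of primes up to [N], so the harmonic sum is at most the Euler
    product, itself at most [expR (s1 + 2 * s2)]. *)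
Lemma s1_ge N : (1 < N)%N -> ln (ln N%:R) - 2 <= s1 (prime_interval 0 N).
Proof.
move=> N1; set ps := prime_interval 0 N; have NR : 0 < N%:R :> R by rewrite ltr0n; lia.
have aps := prime_interval_prime 0 N; have ups := prime_interval_uniq 0 N.
have lN : 0 < ln N%:R :> R by rewrite ln_gt0 // ltr1n.
have h : ln N%:R <= expR (s1 ps + 2 * s2 ps).
  apply: (@le_trans _ _ (ln N.+1%:R)); first by rewrite ler_ln ?posrE ?ltr0n ?ler_nat //; lia.
  apply: le_trans (harmonic_ge_ln N) _.
  apply: (@le_trans _ _ (\sum_(n <- smooth N ps) n%:R^-1)).
    apply: sum_uniq_sub; [exact: iota_uniq|exact: uniq_smooth| |by move=> n _; rewrite invr_ge0].
    move=> n; rewrite mem_iota mem_smooth // => nN; have n0 : (0 < n)%N by lia.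
    rewrite n0 /=; apply/andP; split; apply/allP => p pn.
      rewrite mem_prime_interval; move: pn; rewrite mem_primes => /and3P[pp _ /dvdn_leq].
      by move=> /(_ n0) pn; rewrite pp prime_gt0 //=; lia.
    by apply: ltnW; apply: leq_trans (ltn_logl p n0) _; lia.
  rewrite sum_smooth //; last by rewrite invr1.
    rewrite /s1 /s2 mulr_sumr -big_split /= expR_sum.
    rewrite [leLHS]big_seq [leRHS]big_seq; apply: ler_prod => p pps.
    have pp := allP aps p pps; apply/andP; split.
      by apply: sumr_ge0 => a _; rewrite invr_ge0.
    under eq_bigr do rewrite natrX -exprVn.
    by apply: expR_ge_geometric; rewrite ?invr_ge0 // lef_pV2 ?posrE ?ltr0n ?prime_gt0 // ler_nat prime_gt1.
  by move=> m n m0 n0 _; rewrite natrM invfM.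
rewrite lerBlDr -[X in _ <= X]expRK ler_ln ?posrE ?expR_gt0 //.
by apply: le_trans h _; rewrite ler_expR lerD2l; have := s2_le 0 N; rewrite -/ps; lra.
Qed.

Lemma zeta_partial (t : R) M : 0 < t ->
  \sum_(n <- iota 1 M.+1) expR (- (1 + t) * ln n%:R) <= 1 + t^-1.
Proof.
move=> t0; apply: (@le_trans _ _ (1 + t^-1 * (1 - expR (- t * ln M.+1%:R)))); last first.
  by rewrite lerD2l ler_piMr ?invr_ge0 ?(ltW t0) // lerBlDr lerDl expR_ge0.
elim: M => [|M IH]; first by rewrite /= big_seq1 ln1 !mulr0 expR0 subrr mulr0 addr0.
rewrite sum_iota_recr add1n.
apply: le_trans (lerD IH (lexx _)) _; rewrite -addrA lerD2l -lerBrDl -mulrBr.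
rewrite -(ler_pM2l t0) [leRHS]mulrA divff ?gt_eqF // mul1r.
rewrite [leRHS](_ : _ = expR (- t * ln M.+1%:R) - expR (- t * ln M.+2%:R)); last by ring.
set n := M.+1; have n0 : 0 < n%:R :> R by rewrite ltr0n.
have m0 : 0 < n.+1%:R :> R by rewrite ltr0n.
set u := expR (- t * ln n.+1%:R); have u0 : 0 <= u by exact: expR_ge0.
have -> : expR (- (1 + t) * ln n.+1%:R) = u / n.+1%:R.
  by rewrite opprD mulrDl mulN1r expRD expRN lnK ?posrE // mulrC.
have -> : expR (- t * ln n%:R) = u * expR (t * (ln n.+1%:R - ln n%:R)).
  by rewrite -expRD; congr expR; ring.
have h : n.+1%:R^-1 <= ln n.+1%:R - ln n%:R :> R.
  rewrite -ln_div ?posrE // -[leRHS]opprK lerNr -lnV ?posrE ?divr_gt0 // invf_div.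
  have -> : n%:R / n.+1%:R = 1 + - n.+1%:R^-1 :> R.
    by rewrite -[n%:R](addrK 1) natr1 mulrBl divff ?gt_eqF // mul1r.
  by apply: le_ln1Dx; rewrite ltrN2 invf_lt1 // ltr1n.
rewrite -[X in _ <= _ - X]mulr1 -mulrBr mulrCA ler_wpM2l //.
rewrite lerBrDl; apply: le_trans (expR_ge1Dx _).
by rewrite lerD2l ler_pM2l.
Qed.

Lemma expR_le_1Dx (x : R) : 0 <= x -> expR (x - x ^+ 2) <= 1 + x.
Proof.
move=> x0; have h : 0 < 1 + (x ^+ 2 - x) by have := sqr_ge0 (2 * x - 1); rewrite !expr2; nra.
apply: (@le_trans _ _ (1 + (x ^+ 2 - x))^-1).
  rewrite -[x - _]opprB expRN lef_pV2 ?posrE ?expR_gt0 //.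
  by rewrite (_ : x ^+ 2 - x = - (x - x ^+ 2)) ?expR_ge1Dx // opprB.
rewrite -[leLHS]mul1r ler_pdivrMr // expr2.
by have := mulr_ge0 x0 (mulr_ge0 x0 x0); nra.
Qed.

(** Euler products at the exponent [1 + t] with [t = 1 / ln N]: there zeta is at most [1 + ln N].
    Moving back to the exponent 1 costs [t * slog <= 2], and the prime squares cost [s2 <= 1]. *)
Lemma s1_le N : (1 < N)%N -> s1 (prime_interval 0 N) <= ln (1 + ln N%:R) + 3.
Proof.
move=> N1; set ps := prime_interval 0 N; have NR : 0 < N%:R :> R by rewrite ltr0n; lia.
have aps := prime_interval_prime 0 N; have ups := prime_interval_uniq 0 N.
have lN : 0 < ln N%:R :> R by rewrite ln_gt0 // ltr1n.
pose t : R := (ln N%:R)^-1; have t0 : 0 < t by rewrite invr_gt0.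
pose z (n : nat) : R := expR (- (1 + t) * ln n%:R).
have z0 n : 0 <= z n by exact: expR_ge0.
have zle n : (0 < n)%N -> z n <= n%:R^-1.
  move=> n0; rewrite -[leRHS]lnK ?posrE ?invr_gt0 ?ltr0n // ler_expR lnV ?posrE ?ltr0n //.
  rewrite mulNr lerN2 ler_peMl ?lerDl ?(ltW t0) // ln_ge0 // ler1n; lia.
have zge n : (0 < n)%N -> n%:R^-1 - t * (ln n%:R / n%:R) <= z n.
  move=> n0; have nR : 0 < n%:R :> R by rewrite ltr0n.
  rewrite /z mulNr mulrDl mul1r opprD expRD expRN lnK ?posrE //.
  have -> : n%:R^-1 - t * (ln n%:R / n%:R) = n%:R^-1 * (1 + - (t * ln n%:R)) by ring.
  by rewrite ler_wpM2l ?invr_ge0 ?(ltW nR) // expR_ge1Dx.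
have h : expR (\sum_(p <- ps) (z p - z p ^+ 2)) <= 1 + ln N%:R.
  (* Squarefree integers suffice, since [expR (z - z^2) <= 1 + z]. *)
  apply: (@le_trans _ _ (\sum_(n <- smooth 1 ps) z n)).
    rewrite sum_smooth //; last by rewrite /z ln1 mulr0 expR0.
      rewrite expR_sum [leLHS]big_seq [leRHS]big_seq; apply: ler_prod => p pps.
      rewrite expR_ge0 /= big_nat_recl //= big_nat1 expn1 expn0.
      by apply: le_trans (expR_le_1Dx (z0 p)) _; rewrite lerD2r /z ln1 mulr0 expR0.
    by move=> m n m0 n0 _; rewrite /z natrM lnM ?posrE ?ltr0n // mulrDr expRD.
  (* The bound of [zeta_partial] is uniform in the length, so the list may be embedded in as long an
     interval as it needs. *)
  pose M := \max_(n <- smooth 1 ps) n.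
  apply: (@le_trans _ _ (\sum_(n <- iota 1 M.+1) z n)); last first.
    by apply: le_trans (zeta_partial M t0) _; rewrite /t invrK.
  apply: sum_uniq_sub; [exact: uniq_smooth|exact: iota_uniq| |by move=> n _].
  move=> n nD; rewrite mem_iota (posl_smooth aps nD) /= add1n ltnS.
  by apply: leq_trans (leqnSn _); exact: leq_bigmax_seq.
have l1 : 0 < 1 + ln N%:R :> R by rewrite addr_gt0.
have : \sum_(p <- ps) (z p - z p ^+ 2) <= ln (1 + ln N%:R).
  by rewrite -[X in X <= _]expRK ler_ln ?posrE ?expR_gt0.
move=> h0.
have h1 : s1 ps - t * slog ps - s2 ps <= \sum_(p <- ps) (z p - z p ^+ 2).
  rewrite /s1 /slog /s2 mulr_sumr -sumrB -sumrB; apply: ler_sum_seq => p pps.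
  have p0 : (0 < p)%N by rewrite prime_gt0 // (allP aps).
  have := zge p p0; have : z p ^+ 2 <= p%:R^-1 ^+ 2.
    by rewrite lerXn2r ?nnegrE ?invr_ge0 // zle.
  by lra.
have h2 : t * slog ps <= 2.
  by rewrite /t ler_pdivrMl // mulrC slog_le //; lia.
have := s2_le 0 N; rewrite -/ps; lra.
Qed.

Lemma s1_cat ps1 ps2 : s1 (ps1 ++ ps2) = s1 ps1 + s1 ps2.
Proof. by rewrite /s1 big_cat. Qed.

Lemma s1_interval_le A B : (1 < A)%N -> (A <= B)%N ->
  s1 (prime_interval A B) <= ln (1 + ln B%:R) - ln (ln A%:R) + 5.
Proof.
move=> A1 AB; have := s1_le (leq_trans A1 AB); have := s1_ge A1.
by rewrite (@prime_interval_cat 0 A B) // s1_cat; lra.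
Qed.
End Mertens.

Lemma prime_Omega_ge_logn p n : (0 < n)%N -> (logn p n <= prime_Omega n)%N.
Proof.
move=> n0; have [pn|] := boolP (p \in primes n); last first.
  by rewrite -logn_gt0 lt0n negbK => /eqP ->.
by rewrite /prime_Omega (bigD1_seq p) ?primes_uniq //= leq_addr.
Qed.

Lemma sum_growing_le (R : realType) (a : nat -> R) m : (forall j, 0 <= a j) ->
  (forall j, a j <= 4 / 5 * a j.+1) -> \sum_(0 <= j < m.+1) a j <= 5 * a m.
Proof.
move=> a0 aS; elim: m => [|m IH]; first by rewrite big_nat1 ler_peMl // ler1n.
rewrite big_nat_recr //=; apply: le_trans (lerD IH (lexx _)) _.
by have := aS m; lra.
Qed.

(** * The prime blocks and the length of the mollifier *)

Section Blocks.
Variables (R : realType) (c0 eta : R) (q : nat).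
Hypotheses (pq : prime q) (c0_ge0 : 0 <= c0) (eta0 : 0 < eta).
Local Notation th := (theta eta q).
Local Notation Lq := (ln q%:R : R).
Local Notation LL := (ln Lq).

Definition Yq (j : nat) : nat := Num.truncn (q%:R `^ th j).
Definition pblk (j : nat) : seq nat :=
  prime_interval (if j is i.+1 then Yq i else Num.truncn c0) (Yq j).
Definition blocks (i m : nat) : seq (nat * seq nat) := [seq (ell eta q j, pblk j) | j <- iota i m].

Let q0 : (0 < q)%N := prime_gt0 pq.
Let qR : 0 < q%:R :> R. Proof. by rewrite ltr0n. Qed.

Lemma powRqE (x : R) : q%:R `^ x = expR (x * Lq).
Proof. by rewrite /powR gt_eqF. Qed.

Lemma pblkP j p : prime p -> (p \in pblk j) <-> prime_range c0 eta q j p%:R.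
Proof.
move=> pp; rewrite mem_prime_interval pp /= /Yq truncn_ge_nat ?powR_ge0 //.
by case: j => [|j]; rewrite /prime_range /= in_itv /= truncn_lt_nat ?powR_ge0.
Qed.

(** The exponent cap in [smooth] follows from the bound on [prime_Omega], so the explicit list is
    the whole support. *)
Lemma mem_support j n :
  mollifier_support c0 eta q j n <-> n \in block (ell eta q j) (pblk j).
Proof.
rewrite /block mem_filter mem_smooth ?prime_interval_prime ?prime_interval_uniq //.
split=> [[n0 np nO]|/and4P[nO n0 /allP np _]].
  rewrite nO n0 /=; apply/andP; split; apply/allP => p.
    by rewrite mem_primes => /and3P[pp _ pn]; apply/(pblkP _ pp); exact: np.
  by move=> _; apply: leq_trans nO; exact: prime_Omega_ge_logn.
split => // p pp pn; apply/(pblkP _ pp); apply: np.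
by rewrite mem_primes pp n0.
Qed.

Lemma mollifier_factorE j k :
  mollifier_factor c0 eta q j (@dchar R q pq k) = @mpoly R q pq (block (ell eta q j) (pblk j)) k.
Proof.
rewrite /mollifier_factor (_ : mollifier_support c0 eta q j = [set` block (ell eta q j) (pblk j)]); last first.
  by apply/seteqP; split => n /= /mem_support.
rewrite -fsbig_seq //.
by apply: uniq_block; rewrite ?prime_interval_prime ?prime_interval_uniq.
Qed.


Lemma thetaS j : th j.+1 = expR 1 * th j.
Proof. by rewrite /theta -natr1 expRD; ring. Qed.

Hypothesis LL0 : 0 < LL.

Lemma th_gt0 j : 0 < th j.
Proof. by rewrite divr_gt0 ?exprn_gt0 // mulr_gt0 ?expR_gt0. Qed.

Lemma Lq_gt0 : 0 < Lq.
Proof. by rewrite ltNge; apply/negP => h; move: LL0; rewrite ln0 ?ltxx. Qed.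

Lemma th_leS j : th j <= th j.+1.
Proof. by rewrite thetaS ler_peMl ?(ltW (th_gt0 j)) // -[leLHS]expR0 ler_expR. Qed.

Lemma th_mono i j : (i <= j)%N -> th i <= th j.
Proof.
by move=> ij; apply: (@homo_leq _ th (fun x y => x <= y)) => //; [exact: le_trans|exact: th_leS].
Qed.

Lemma Yq_mono i j : (i <= j)%N -> (Yq i <= Yq j)%N.
Proof. by move=> ij; apply: le_truncn; rewrite !powRqE ler_expR ler_pM2r ?Lq_gt0 ?th_mono. Qed.

Hypothesis c0Y : (Num.truncn c0 <= Yq 0)%N.

Lemma flatten_blocks m : flatten (map snd (blocks 0 m.+1)) = prime_interval (Num.truncn c0) (Yq m).
Proof.
elim: m => [|m IH]; first by rewrite /= cats0.
rewrite /blocks -[m.+2]addn1 iotaD !map_cat flatten_cat -/(blocks 0 m.+1) IH /= cats0 add0n.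
have h1 : (Num.truncn c0 <= Yq m)%N by apply: leq_trans c0Y _; exact: Yq_mono.
exact: esym (prime_interval_cat h1 (Yq_mono (leqnSn m))).
Qed.

Variable J : nat.
Hypothesis thJ1 : th J <= 1.

Lemma th_le1 j : (j <= J)%N -> th j <= 1.
Proof. by move=> /th_mono/le_trans; apply. Qed.

Lemma ell_gt0 j : (j <= J)%N -> (0 < ell eta q j)%N.
Proof.
move=> jJ; rewrite muln_gt0 /= truncn_gt0 powRN invf_ge1 ?powR_gt0 ?th_gt0 //.
apply: (@le_trans _ _ (1 `^ (3 / 4))); last by rewrite powR1.
apply: ge0_ler_powR; rewrite ?nnegrE ?th_le1 //.
exact: ltW (th_gt0 j).
Qed.

Lemma wf_blocks_js m : (m <= J)%N -> wf_blocks (blocks 0 m.+1).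
Proof.
move=> mJ; split; rewrite ?flatten_blocks ?prime_interval_prime ?prime_interval_uniq //.
apply/allP => b /mapP[j]; rewrite mem_iota add0n => /andP[_ jm] -> /=.
by apply: ell_gt0; rewrite (leq_trans _ mJ).
Qed.

Lemma mpoly_mollD js k : wf_blocks js ->
  @mpoly R q pq (mollD js) k = \prod_(b <- js) @mpoly R q pq (block b.1 b.2) k.
Proof.
elim: js => [_|b js IH wf].
  by rewrite /mpoly big_seq1 big_nil mcoef1 /isq sqrtr1 invr1 mulr1 dchar_nat fchar1 mulr1.
have cp := coprimel_block_mollD wf; have [h1 h2 h3 h4 h5] := wf_blocks_cons wf.
by rewrite big_cons /= mpoly_prodl ?IH //; [exact: posl_block|exact: posl_mollD].
Qed.

Lemma mollifierE k : mollifier c0 eta q J (@dchar R q pq k) = @mpoly R q pq (mollD (blocks 0 J.+1)) k.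
Proof.
rewrite mpoly_mollD; last exact: wf_blocks_js.
rewrite /mollifier /blocks big_map /index_iota subn0; apply: eq_bigr => j _.
exact: mollifier_factorE.
Qed.

Lemma ell_le j : (ell eta q j)%:R * th j <= 2 * th j `^ 4^-1.
Proof.
have t0 := th_gt0 j; rewrite /ell natrM -mulrA ler_pM2l //.
apply: (@le_trans _ _ (th j `^ (- (3 / 4)) * th j)); last first.
  rewrite -[X in _ * X <= _](powRr1 (ltW t0)) -powRD; last by rewrite (gt_eqF t0) implybT.
  have -> : - (3 / 4) + 1 = 4^-1 :> R by field.
  exact: lexx.
by rewrite ler_pM2r // truncn_le powR_ge0.
Qed.

(** Far weaker than the true decay, but of the same shape as [ell_le], so that [sum_th4] also adds
    up the truncation losses. *)
Lemma two_ell_le j : (j <= J)%N -> 2 ^- ell eta q j <= th j `^ 4^-1.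
Proof.
move=> jJ; have t0 := th_gt0 j; have t1 := th_le1 jJ.
set x := th j `^ (- (3 / 4)); have x0 : 0 < x by rewrite powR_gt0.
apply: (@le_trans _ _ x^-1); last first.
  rewrite /x powRN invrK; apply: ger_powR; first by rewrite t0.
  by lra.
rewrite lef_pV2 ?posrE ?exprn_gt0 //; apply: le_trans (ltW (truncnS_gt x)) _.
rewrite /ell -natrX ler_nat; set n := Num.truncn _.
apply: (@leq_trans (2 ^ n)); first by rewrite ltn_expl.
by rewrite leq_exp2l //; lia.
Qed.

(** Consecutive [theta] differ by the factor [e], and [expR (1/4) >= 5/4]. *)
Lemma th4_step j : th j `^ 4^-1 <= 4 / 5 * th j.+1 `^ 4^-1.
Proof.
rewrite thetaS powRM ?expR_ge0 ?(ltW (th_gt0 j)) // mulrA ler_peMl ?powR_ge0 //.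
have -> : expR 1 `^ 4^-1 = expR 4^-1 :> R by rewrite -expRM mul1r.
have := expR_ge1Dx (4^-1 : R); lra.
Qed.

Lemma sum_th4 m : \sum_(0 <= j < m.+1) th j `^ 4^-1 <= 5 * th m `^ 4^-1.
Proof.
apply: (@sum_growing_le _ (fun j => th j `^ 4^-1)); last exact: th4_step.
by move=> j; exact: powR_ge0.
Qed.

Hypothesis thJsmall : th J `^ 4^-1 <= 1000^-1.

(** Block [j] contributes a factor at most [q ^ (ell_j theta_j) <= q ^ (2 theta_j ^ (1/4))]. The
    exponents grow geometrically and sum to at most [10 theta_J ^ (1/4)], which the bound [1000^-1]
    brings down to [1/100]. *)
Lemma mollD_length m n : (m <= J)%N -> n \in mollD (blocks 0 m.+1) -> n%:R <= q%:R `^ 100^-1 :> R.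
Proof.
move=> mJ nD; have wf := wf_blocks_js mJ.
pose Y (b : nat * seq nat) : R := \big[Num.max/1]_(p <- b.2) p%:R.
have Y1 b : 1 <= Y b by exact: bigmax_ge_id.
apply: (@le_trans _ _ (\prod_(b <- blocks 0 m.+1) Y b ^+ b.1)).
  apply: mollD_le => // b p _ pb.
  by rewrite /Y; exact: (le_bigmax_seq (1 : R) p xpredT (fun p : nat => p%:R : R) pb isT).
rewrite /blocks big_map /=.
apply: (@le_trans _ _ (\prod_(j <- iota 0 m.+1) expR (2 * th j `^ 4^-1 * Lq))).
  apply: ler_prod => j _; rewrite exprn_ge0 ?(le_trans ler01 (Y1 _)) //=.
  apply: (@le_trans _ _ ((q%:R `^ th j) ^+ ell eta q j)).
    rewrite lerXn2r ?nnegrE ?powR_ge0 ?(le_trans ler01 (Y1 _)) //.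
    rewrite /Y big_seq; apply: bigmax_le.
      by rewrite powRqE -[leLHS]expR0 ler_expR mulr_ge0 ?(ltW (th_gt0 j)) ?(ltW Lq_gt0).
    move=> p /=; rewrite mem_prime_interval => /and3P[_ _ pY].
    by apply: (@le_trans _ _ (Yq j)%:R); rewrite ?ler_nat // /Yq truncn_le powR_ge0.
  rewrite powRqE -expRM_natl ler_expR mulrA ler_pM2r ?Lq_gt0 //; exact: ell_le.
rewrite -expR_sum powRqE ler_expR -mulr_suml ler_pM2r ?Lq_gt0 //.
have h : th m `^ 4^-1 <= th J `^ 4^-1 by apply: ge0_ler_powR; rewrite ?nnegrE ?(ltW (th_gt0 _)) ?th_mono.
rewrite -mulr_sumr; move: (sum_th4 m) h thJsmall; rewrite /index_iota subn0.
by move: (\sum_(_ <- _) _) (th m `^ _) (th J `^ _) => x y z; lra.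
Qed.
End Blocks.

(** * Upper bounds for the mollified second moment *)

Section MollifiedBounds.
Variables (R : realType) (c0 eta : R) (q : nat).
Hypotheses (pq : prime q) (c0_ge0 : 0 <= c0) (eta0 : 0 < eta).
Local Notation th := (theta eta q).
Local Notation Lq := (ln q%:R : R).
Local Notation LL := (ln Lq).
Local Notation Cc := (Cc R).
Local Notation s1 := (s1 R).
Local Notation s2 := (s2 R).
Local Notation pb := (pblk c0 eta q).
Local Notation Yq := (Yq eta q).

Hypothesis LL0 : 0 < LL.
Hypothesis c0Y : (Num.truncn c0 <= Yq 0)%N.
Hypothesis thL : 2 <= th 0 * Lq.
Hypothesis Lq23 : 23 <= Lq.
Hypothesis ell0 : 2 ^- ell eta q 0 * expR ((Cc + 1) * (ln (1 + Lq) + 3)) <= 1.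
Hypothesis errq : 316 * (q%:R `^ 100^-1) ^+ 6 * isq q%:R <= 1 :> R.
Variable J : nat.
Hypothesis thJ1 : th J <= 1.
Hypothesis thJsmall : th J `^ 4^-1 <= 1000^-1.

Let q0 : (0 < q)%N := prime_gt0 pq.
Let qR : 0 < q%:R :> R. Proof. by rewrite ltr0n. Qed.
Let Lq0 : 0 < Lq. Proof. exact: Lq_gt0 LL0. Qed.

Lemma thL_ge2 j : 2 <= th j * Lq.
Proof.
apply: le_trans thL _; rewrite ler_pM2r //; exact: th_mono.
Qed.

Lemma ln_Yq_le j : ln (Yq j)%:R <= th j * Lq.
Proof.
case: (posnP (Yq j)) => [->|Y0]; first by rewrite ln0 // (le_trans _ (thL_ge2 j)).
rewrite -[leRHS]expRK ler_ln ?posrE ?ltr0n ?expR_gt0 // -(powRqE pq) /Yq truncn_le.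
exact: powR_ge0.
Qed.

Lemma Yq_gt1 j : (1 < Yq j)%N.
Proof.
rewrite truncn_gt_nat (powRqE pq); apply: le_trans (expR_ge1Dx _).
by have := thL_ge2 j; lra.
Qed.

Lemma ln_Yq_ge j : th j * Lq / 2 <= ln (Yq j)%:R.
Proof.
have Y0 : 0 < (Yq j)%:R :> R by rewrite ltr0n (ltn_trans _ (Yq_gt1 j)).
rewrite -[leLHS]expRK ler_ln ?posrE ?expR_gt0 //.
have := truncnS_gt (q%:R `^ th j : R); rewrite -/(Yq j) -natr1 (powRqE pq).
set x := expR (th j * Lq / 2).
have -> : expR (th j * Lq) = x ^+ 2 by rewrite -expRM_natl; congr expR; field.
have : 2 <= x by apply: le_trans (expR_ge1Dx _); have := thL_ge2 j; lra.
by rewrite expr2 => x2 xx; nra.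
Qed.

(** Across a block [ln q^theta] grows by the factor [e], so its logarithm grows by 1; the remainder
    of the 8 is rounding and the constant of [s1_interval_le]. *)
Lemma s1_block_le j : s1 (pb j.+1) <= 8.
Proof.
apply: le_trans (s1_interval_le R (Yq_gt1 j) (Yq_mono pq eta0 LL0 (leqnSn j))) _.
have t2 := thL_ge2 j; have tt : 0 < th j * Lq by lra.
have l1 : ln (1 + ln (Yq j.+1)%:R) <= ln (2 * (expR 1 * (th j * Lq))) :> R.
  have h := ln_Yq_le j.+1; have h0 := ln_Yq_ge j.+1; have t3 := thL_ge2 j.+1.
  have -> : expR 1 * (th j * Lq) = th j.+1 * Lq by rewrite thetaS mulrA.
  by rewrite ler_ln ?posrE; lra.
have l2 : ln (th j * Lq / 2) <= ln (ln (Yq j)%:R).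
  have h0 := ln_Yq_ge j; rewrite ler_ln ?posrE //; lra.
have e2 : ln 2 <= 1 :> R by have := @le_ln1Dx R 1; rewrite -[1 + 1]/(2 : R); apply; lra.
move: l1 l2 tt; move: (th j * Lq) => u l1 l2 u0.
have e3 : ln (2 * (expR 1 * u)) = ln 2 + (1 + ln u).
  rewrite lnM ?posrE ?ltr0n //; last by rewrite mulr_gt0 ?expR_gt0.
  by rewrite lnM ?posrE ?expR_gt0 // expRK.
move: l1 l2; rewrite e3 ln_div ?posrE ?ltr0n //.
by move: (ln (1 + _)) (ln (ln _)) (ln u) (ln 2) e2 => a b c d *; lra.
Qed.

(** Factoring out the Euler product moves the truncation loss into the exponent, where it can be
    summed over blocks. *)
Lemma Eblock_le l ps : Eblock R l ps <= expR (- s1 ps + Cc * s2 ps + 2 ^- l * expR ((Cc + 1) * s1 ps)).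
Proof.
rewrite [leRHS]expRD /Eblock; set A := expR (- s1 ps + _); set E := expR ((Cc + 1) * _).
have A0 : 0 <= A by exact: expR_ge0.
apply: (@le_trans _ _ (A * (1 + 2 ^- l * E))); last by rewrite ler_wpM2l // expR_ge1Dx.
rewrite mulrDr mulr1 lerD2l mulrCA ler_wpM2l ?invr_ge0 ?exprn_ge0 // /A /E -expRD ler_expR.
have -> : - s1 ps + Cc * s2 ps + (Cc + 1) * s1 ps = Cc * s2 ps + Cc * s1 ps by ring.
by rewrite lerDr mulr_ge0 ?expR_ge0 ?s2_ge0.
Qed.

Definition A0 : R := s1 (prime_interval 0 (Num.truncn c0)).
(** The truncation losses of all blocks: 1 for block 0, by [ell0], and a geometric series of sum at
    most 5 for the others. *)
Definition K3 : R := 1 + 5 * expR ((Cc + 1) * 8).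

Lemma sum_s1_blocks (F : nat -> R) m : \sum_(b <- blocks c0 eta q 0 m.+1) \sum_(p <- b.2) F p =
  \sum_(p <- prime_interval (Num.truncn c0) (Yq m)) F p.
Proof.
rewrite -(flatten_blocks pq eta0 LL0 c0Y m) big_flatten big_map; apply: eq_bigr => b _ //.
Qed.

Lemma A0_ge0 : 0 <= A0. Proof. exact: s1_ge0. Qed.

Lemma s1_pblk0_le : s1 (pb 0) <= ln (1 + Lq) + 3.
Proof.
apply: (@le_trans _ _ (s1 (prime_interval 0 (Yq 0)))).
  rewrite (@prime_interval_cat 0 (Num.truncn c0)) // s1_cat lerDr; exact: s1_ge0.
apply: le_trans (s1_le R (Yq_gt1 0)) _; rewrite lerD2r.
have h := ln_Yq_le 0; have h0 := ln_Yq_ge 0.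
have t1 : th 0 * Lq <= Lq by rewrite ler_piMl ?(ltW Lq0) // (le_trans (th_mono eta0 LL0 (leq0n J))).
by rewrite ler_ln ?posrE; have := thL_ge2 0; lra.
Qed.

(** By Mertens the Euler product is of order [1 / ln (Yq m)], hence [1 / (th m * ln q)]. The primes
    up to [c0], which no block contains, are accounted for by [A0]. *)
Lemma prod_Eblock_le m : (m <= J)%N ->
  \prod_(b <- blocks c0 eta q 0 m.+1) Eblock R b.1 b.2 <= expR (A0 + 4 + Cc + K3) / (th m * Lq).
Proof.
move=> mJ; have tL := thL_ge2 m; have tL0 : 0 < th m * Lq by lra.
apply: (@le_trans _ _ (\prod_(b <- blocks c0 eta q 0 m.+1)
   expR (- s1 b.2 + Cc * s2 b.2 + 2 ^- b.1 * expR ((Cc + 1) * s1 b.2)))).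
  by apply: ler_prod => b _; rewrite Eblock_le andbT addr_ge0 ?mulr_ge0 ?expR_ge0.
rewrite -expR_sum !big_split /= sumrN -mulr_sumr.
have e1 := sum_s1_blocks (fun p => p%:R^-1) m; have e2 := sum_s1_blocks (fun p => p%:R^-1 ^+ 2) m.
rewrite [X in - X]e1 [X in Cc * X]e2 {e1 e2}.
rewrite -/(s1 (prime_interval (Num.truncn c0) (Yq m))) -/(s2 (prime_interval (Num.truncn c0) (Yq m))).
have hs : ln (th m * Lq) - 1 - 2 - A0 <= s1 (prime_interval (Num.truncn c0) (Yq m)).
  have := s1_ge R (Yq_gt1 m); rewrite (@prime_interval_cat 0 (Num.truncn c0)) //; last first.
    by apply: leq_trans c0Y _; exact: Yq_mono.
  rewrite s1_cat -/A0.
  have : ln (th m * Lq / 2) <= ln (ln (Yq m)%:R).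
    have h0 := ln_Yq_ge m; rewrite ler_ln ?posrE //; lra.
  have : ln 2 <= 1 :> R by have := @le_ln1Dx R 1; rewrite -[1 + 1]/(2 : R); apply; lra.
  rewrite ln_div ?posrE //; move: (ln (th m * Lq)) (ln 2) (ln (ln _)) (s1 _) => a b c d; lra.
have h3 : \sum_(b <- blocks c0 eta q 0 m.+1) 2 ^- b.1 * expR ((Cc + 1) * s1 b.2) <= K3.
  rewrite /blocks big_map /= big_cons /K3 lerD //.
    apply: le_trans ell0; apply: ler_wpM2l; first by rewrite invr_ge0 exprn_ge0.
    rewrite ler_expR; apply: ler_wpM2l; last exact: s1_pblk0_le.
    by rewrite addr_ge0 ?expR_ge0.
  rewrite (iotaDl 1 0) big_map.
  apply: (@le_trans _ _ (\sum_(j <- iota 0 m) th j.+1 `^ 4^-1 * expR ((Cc + 1) * 8))).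
    apply: ler_sum_seq => j; rewrite mem_iota add0n add1n => /andP[_ jm].
    apply: ler_pM; rewrite ?invr_ge0 ?exprn_ge0 ?expR_ge0 //.
      exact: (two_ell_le pq c0_ge0 eta0 LL0 c0Y thJ1 (leq_trans jm mJ)).
    rewrite ler_expR; apply: ler_wpM2l; last exact: s1_block_le.
    by rewrite addr_ge0 ?expR_ge0.
  rewrite -mulr_suml ler_wpM2r ?expR_ge0 //.
  have := sum_th4 eta0 LL0 m; rewrite big_nat_recl //= /index_iota subn0.
  have := powR_ge0 (th 0) 4^-1.
  have : th m `^ 4^-1 <= th J `^ 4^-1.
    by apply: ge0_ler_powR; rewrite ?nnegrE ?(ltW (th_gt0 eta0 LL0 _)) ?th_mono.
  move: thJsmall; move: (th m `^ _) (th J `^ _) (th 0 `^ _) (\sum_(_ <- _) _) => x y z w; lra.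
rewrite -[th m * Lq in leRHS]lnK ?posrE // -expRN -expRD ler_expR.
have : Cc * s2 (prime_interval (Num.truncn c0) (Yq m)) <= Cc * 1.
  by rewrite ler_wpM2l ?expR_ge0 // s2_le.
move: hs h3; move: (\sum_(_ <- _) _) (s1 _) (Cc * s2 _) (ln (th m * Lq)) K3 => x y z w v.
lra.
Qed.

Definition K5 : R := (2 + 8 * Cc) * expR (A0 + 4 + Cc + K3) + 1.

(** The factor [ln q] in [hz_corr q 1 1] and in the sum of [slog] is cancelled by [prod_Eblock_le].
    For [m = J] this bounds the mean square of the weight; for [m = 0] it bounds that of [L M_0] by
    a power of [ln ln q], which the exceptional set can afford. *)
Theorem mollified_moment_le m : (m <= J)%N ->
  ravg q (fun k => Normc.normc (@Lhz R q pq k * @mpoly R q pq (mollD (blocks c0 eta q 0 m.+1)) k) ^+ 2)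
    <= K5 / th m.
Proof.
move=> mJ; have wf := wf_blocks_js pq eta0 LL0 c0Y thJ1 mJ.
have tm := th_gt0 eta0 LL0 m; have tm1 : th m <= 1 := th_le1 eta0 LL0 thJ1 mJ.
have X1 : 1 <= q%:R `^ 100^-1 :> R.
  by rewrite (powRqE pq) -[leLHS]expR0 ler_expR mulr_ge0 ?(ltW Lq0).
have Xq : q%:R `^ 100^-1 < q%:R :> R.
  rewrite (powRqE pq) -[ltRHS](lnK (x := q%:R)) ?posrE // ltr_expR gtr_pMl //; lra.
have := mollified_second_moment pq (uniq_mollD wf) (posl_mollD wf)
  (fun n => mollD_length pq eta0 LL0 c0Y thJ1 thJsmall mJ (n := n)) Xq X1.
have [b1 b2] := mollD_bounds R wf.
have pE := prod_Eblock_le mJ.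
move: b1 b2 pE; set P := \prod_(b <- _) _; set E := expR _; set V := hz_corr _ _ _ _ => b1 b2 pE H.
have V2 : V <= 2 * Lq by apply: le_trans (hz_corr11_le R q0) _; rewrite mulr_natl mulr2n lerD2l.
have V0 : 0 <= V by exact: hz_corr11_ge0.
have slogs : \sum_(b <- blocks c0 eta q 0 m.+1) 4 * Cc * slog R b.2 <= 8 * Cc * Lq.
  rewrite -mulr_sumr (sum_s1_blocks (fun p => ln p%:R / p%:R)).
  have C0 : 0 <= Cc by exact: expR_ge0.
  have -> : 8 * Cc * Lq = 4 * Cc * (2 * Lq) by ring.
  rewrite ler_wpM2l ?mulr_ge0 //.
  apply: (@le_trans _ _ (slog R (prime_interval 0 (Yq m)))).
    rewrite (@prime_interval_cat 0 (Num.truncn c0)) //; last first.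
      by apply: leq_trans c0Y _; exact: Yq_mono.
    rewrite /slog big_cat /= lerDr sumr_ge0 // => p _.
    case: p => [|p]; first by rewrite invr0 mulr0.
    by rewrite divr_ge0 // ln_ge0 // ler1n.
  apply: le_trans (slog_le R (ltnW (Yq_gt1 m))) _; rewrite ler_pM2l //.
  by apply: le_trans (ln_Yq_le m) _; rewrite ler_piMl // ltW.
have P0 : 0 <= P by apply: le_trans b1; exact: normr_ge0.
have c1 : V * `|ksum (mollD (blocks c0 eta q 0 m.+1)) (gker R)| <= 2 * Lq * P by apply: ler_pM.
have c2 := ler_wpM2r P0 slogs.
have c3 : (2 * Lq + 8 * Cc * Lq) * P <= (2 + 8 * Cc) * E / th m.
  have -> : (2 + 8 * Cc) * E / th m = (2 * Lq + 8 * Cc * Lq) * (E / (th m * Lq)).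
    by field; rewrite !gt_eqF.
  by rewrite ler_wpM2l // addr_ge0 ?mulr_ge0 ?expR_ge0 // ltW.
have c4 : 1 <= (th m)^-1 by rewrite invf_ge1.
have -> : K5 / th m = (2 + 8 * Cc) * E / th m + (th m)^-1 by rewrite /K5 -/E mulrDl mul1r.
apply: le_trans H _; apply: (@le_trans _ _ ((2 * Lq + 8 * Cc * Lq) * P + 1)); last by apply: lerD; [exact: c3|exact: c4].
have -> : (2 * Lq + 8 * Cc * Lq) * P = 2 * Lq * P + 8 * Cc * Lq * P by rewrite [LHS]mulrDl.
apply: lerD; last by apply: le_trans errq _.
apply: lerD; first exact: c1.
exact: le_trans b2 c2.
Qed.
End MollifiedBounds.

(** * Moments with short Dirichlet polynomials *)

Section DirichletPolynomials.
Variables (R : realType) (q : nat).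
Hypothesis pq : prime q.
Local Notation dchar := (@dchar R q pq).
Local Notation Lhz := (@Lhz R q pq).
Local Notation nc := Normc.normc.
Implicit Types A B : seq (R * nat).

(** A list of pairs of a coefficient and an integer, repetitions allowed, so that polynomials
    multiply by pairing entries without collecting equal integers. *)
Definition dpoly A (k : nat) : R[i] := \sum_(a <- A) (a.1 * isq a.2%:R)%:C * dchar k a.2%:Z.
Definition prodA A B : seq (R * nat) := [seq (a.1 * b.1, (a.2 * b.2)%N) | a <- A, b <- B].
Definition wfA A : bool := all (fun a => 0 < a.2 < q)%N A.
Definition dnorm A : R := \sum_(a <- A) `|a.1|.

Lemma dpolyM A B k : dpoly (prodA A B) k = dpoly A k * dpoly B k.
Proof.
rewrite /dpoly big_allpairs_dep mulr_suml; apply: eq_bigr => a _.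
rewrite mulr_sumr; apply: eq_bigr => b _.
rewrite dcharM natrM isqM ?ler0n // !realCM.
by move: (a.1%:C) (b.1%:C) ((isq a.2%:R)%:C) ((isq b.2%:R)%:C) (dchar k a.2) (dchar k b.2) => u v w x y z; ring.
Qed.

Lemma dpoly_mpoly (D : seq nat) k : @mpoly R q pq D k = dpoly [seq (mcoef R n, n) | n <- D] k.
Proof. by rewrite /dpoly big_map. Qed.

Lemma dnormM A B : dnorm (prodA A B) = dnorm A * dnorm B.
Proof.
rewrite /dnorm big_allpairs_dep mulr_suml; apply: eq_bigr => a _.
by rewrite mulr_sumr; apply: eq_bigr => b _; rewrite normrM.
Qed.

Lemma avg_bilinear A B (T : nat -> R[i]) :
  avg q (fun k => T k * dpoly A k * Num.conj (dpoly B k)) =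
  \sum_(a <- A) \sum_(b <- B) (a.1 * isq a.2%:R * (b.1 * isq b.2%:R))%:C *
    avg q (fun k => T k * dchar k a.2%:Z * Num.conj (dchar k b.2%:Z)).
Proof.
rewrite (@eq_avg R q _ (fun k => \sum_(a <- A) (a.1 * isq a.2%:R)%:C *
    (\sum_(b <- B) (b.1 * isq b.2%:R)%:C * (T k * dchar k a.2%:Z * Num.conj (dchar k b.2%:Z))))); last first.
  move=> k; rewrite /dpoly conjC_sum mulr_sumr mulr_suml; apply: eq_bigr => a _.
  rewrite !mulr_sumr; apply: eq_bigr => b _; rewrite conjCM conj_real.
  by move: ((a.1 * _)%:C) ((b.1 * _)%:C) (T k) (dchar k _) (Num.conj _) => u v w x y; ring.
rewrite avg_sum; apply: eq_bigr => a _; rewrite avg_sum mulr_sumr; apply: eq_bigr => b _.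
by rewrite mulrA -realCM.
Qed.

Lemma natF_inj m n : (0 < m < q)%N -> (0 < n < q)%N -> ((m%:R : 'F_q) == n%:R) = (m == n).
Proof.
move=> /andP[m0 mq] /andP[n0 nq]; apply/eqP/eqP => [|->//].
by move/(congr1 val); rewrite /= !val_Fp_nat // !modn_small.
Qed.

Lemma avg_dpoly2 A B : wfA A -> wfA B ->
  avg q (fun k => dpoly A k * Num.conj (dpoly B k)) =
  (\sum_(a <- A) \sum_(b <- B) (a.2 == b.2)%:R * (a.1 * b.1 / b.2%:R))%:C.
Proof.
move=> /allP wA /allP wB.
rewrite (@eq_avg R q _ (fun k => 1 * dpoly A k * Num.conj (dpoly B k))); last by move=> k; rewrite mul1r.
rewrite (avg_bilinear A B (fun=> 1)) realC_sum; apply: eq_big_seq => a aA; rewrite realC_sum.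
apply: eq_big_seq => b bB; have a0 := wA a aA; have b0 := wB b bB.
rewrite (@eq_avg R q _ (fun k => fchar R pq k a.2%:R * Num.conj (fchar R pq k b.2%:R))); last first.
  by move=> k; rewrite mul1r !dchar_nat.
rewrite avg_orth ?natF_neq0 // natF_inj //.
have -> : (a.2 == b.2)%:R = ((a.2 == b.2)%:R : R)%:C :> R[i] by rewrite rmorph_nat.
rewrite -realCM; congr (_%:C); case: eqP => [->|_]; last by rewrite mulr0 mul0r.
by rewrite mulr1 mul1r mulrACA -expr2 isq_sqr // ler0n.
Qed.

(** If [a] divides [b], then [isq a * isq b * isq (b / a) = 1 / b]. The factor [sqrt a] in the error
    of [first_moment] is cancelled by the coefficient [isq a]. *)
Lemma avg_Ldpoly A B : wfA A -> wfA B ->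
  `|avg q (fun k => Lhz k * dpoly A k * Num.conj (dpoly B k)) -
    (\sum_(a <- A) \sum_(b <- B) (a.2 %| b.2)%N%:R * (a.1 * b.1 / b.2%:R))%:C|
  <= (4 * dnorm A * dnorm B * isq q%:R)%:C.
Proof.
move=> /allP wA /allP wB; rewrite avg_bilinear realC_sum -sumrB.
have -> : 4 * dnorm A * dnorm B * isq q%:R = \sum_(a <- A) \sum_(b <- B) 4 * isq q%:R * (`|a.1| * `|b.1|).
  rewrite [RHS](eq_bigr (fun a => 4 * isq q%:R * (`|a.1| * dnorm B))); last first.
    by move=> a _; rewrite /dnorm !mulr_sumr.
  rewrite -mulr_sumr -mulr_suml -/(dnorm A).
  by move: (dnorm A) (dnorm B) (isq _) => u v w; ring.
rewrite realC_sum; apply: le_trans (ler_norm_sum _ _ _) _; apply: ler_sum_seq => a aA.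
rewrite !realC_sum -sumrB; apply: le_trans (ler_norm_sum _ _ _) _; apply: ler_sum_seq => b bB.
have a0 := wA a aA; have b0 := wB b bB; have /andP[a1 _] := a0; have /andP[b1 _] := b0.
have aR : 0 < a.2%:R :> R by rewrite ltr0n.
have bR : 0 < b.2%:R :> R by rewrite ltr0n.
have -> : (a.2 %| b.2)%N%:R * (a.1 * b.1 / b.2%:R) =
   a.1 * isq a.2%:R * (b.1 * isq b.2%:R) * (if (a.2 %| b.2)%N then isq ((b.2 %/ a.2)%:R : R) else 0).
  case: ifP => [/dvdnP[d dE]|_]; last by rewrite mulr0 mul0r.
  have d0 : (0 < d)%N by move: b1; rewrite dE muln_gt0 => /andP[].
  rewrite mul1r dE mulnK // natrM isqM ?ler0n //.
  have h1 := @isq_sqr R a.2%:R (ler0n _ _).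
  have h2 := @isq_sqr R d%:R (ler0n _ _); rewrite invfM -h1 -h2 !expr2.
  by move: (isq _) (isq _) => u v; ring.
set c : R := a.1 * isq a.2%:R * (b.1 * isq b.2%:R).
rewrite (realCM c) -mulrBr normrM normC_real.
apply: le_trans (ler_wpM2l _ (first_moment R pq a0 b0)) _.
  by rewrite realC_ge0 normr_ge0.
rewrite -realCM lecR /c !normrM !(ger0_norm (isq_ge0 _)).
have h : Num.sqrt a.2%:R * isq a.2%:R = 1 :> R by rewrite /isq divff // gt_eqF // sqrtr_gt0.
have hb : isq b.2%:R <= 1 :> R.
  by rewrite -[leRHS]invr1 -[X in _ <= X^-1]sqrtr1; apply: isq_le; rewrite ?ltr01 ?ler1n.
have -> : `|a.1| * isq a.2%:R * (`|b.1| * isq b.2%:R) * (4 * Num.sqrt a.2%:R * isq q%:R) =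
  (Num.sqrt a.2%:R * isq a.2%:R) * isq b.2%:R * (4 * isq q%:R * (`|a.1| * `|b.1|)) by ring.
rewrite h mul1r ler_piMl //.
by rewrite !mulr_ge0 ?isq_ge0.
Qed.
End DirichletPolynomials.

(** * Sums over integers with a given number of prime factors *)

Section OmegaSums.
Variable (F : fieldType).
Implicit Types (f : nat -> F) (ps : seq nat).

Definition SOm B f j ps : F := \sum_(n <- smooth B ps | prime_Omega n == j) f n.

Lemma SOm_cons B f j p ps : prime p -> all prime ps -> p \notin ps -> (j <= B)%N ->
  (forall a n, (a <= B)%N -> n \in smooth B ps -> f (p ^ a * n)%N = f (p ^ a)%N * f n) ->
  SOm B f j (p :: ps) = \sum_(0 <= a < j.+1) f (p ^ a)%N * SOm B f (j - a)%N ps.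
Proof.
move=> pp aps pps jB fM; rewrite /SOm big_mkcond /= sum_prodl sum_powl.
rewrite (big_cat_nat _ (n := j.+1)) //= [X in _ + X]big1_seq ?addr0; last first.
  move=> a; rewrite mem_index_iota /= => /andP[ja _]; apply: big1_seq => n /= nD.
  have n0 := posl_smooth aps nD.
  rewrite prime_OmegaM ?expn_gt0 ?(prime_gt0 pp) // prime_OmegaX //.
  by case: eqP => // e; move: ja; rewrite -e; lia.
apply: eq_big_nat => a /andP[_ aj]; rewrite mulr_sumr [RHS]big_mkcond.
apply: eq_big_seq => n nD; have n0 := posl_smooth aps nD.
rewrite prime_OmegaM ?expn_gt0 ?(prime_gt0 pp) // prime_OmegaX //.
have -> : (a + prime_Omega n == j)%N = (prime_Omega n == (j - a)%N) by apply/eqP/eqP; lia.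
have aB : (a <= B)%N by apply: leq_trans jB; rewrite -ltnS.
by case: ifP => // _; rewrite fM.
Qed.

Lemma SOm_nil B f j : SOm B f j [::] = (j == 0%N)%:R * f 1%N.
Proof.
rewrite /SOm big_mkcond big_seq1 prime_Omega1 eq_sym.
by case: eqP; rewrite ?mul1r ?mul0r.
Qed.
End OmegaSums.

Section PowerSums.
Variable (R : realType).
Implicit Types (ps : seq nat).

(* Multinomial theorem: [P^j / j!] as a sum over integers with [j] prime factors. *)
Lemma SOm_nu (al : nat -> R[i]) B j ps : al 1%N = 1 -> (forall m n, al (m * n)%N = al m * al n) ->
  all prime ps -> uniq ps -> (j <= B)%N ->
  SOm B (fun n => (nu R n)%:C * al n) j ps = (\sum_(p <- ps) al p) ^+ j / j`!%:R.
Proof.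
move=> al1 alM; elim: ps j => [|p ps IH] j /=.
  rewrite SOm_nil al1 nu1 !mulr1 big_nil expr0n => _ _ _; case: j => [|j]; first by rewrite divr1.
  by rewrite mul0r.
move=> /andP[pp aps] /andP[pps ups] jB; rewrite SOm_cons //; last first.
  move=> a n aB nD; have n0 := posl_smooth aps nD.
  rewrite nuM ?expn_gt0 ?(prime_gt0 pp) //; last first.
    by apply: (coprimel_powl_smooth pp aps pps _ nD); apply/powlP; exists a.
  by rewrite alM realCM mulrACA.
rewrite big_cons addrC exprDn mulr_suml big_mkord; apply: eq_bigr => a _.
have aj : (a <= j)%N by rewrite -ltnS.
rewrite IH // ?(leq_trans (leq_subr _ _)) // nuX //.
have -> : al (p ^ a)%N = al p ^+ a.
  by elim: (nat_of_ord a) => [|b IHb]; rewrite ?expr0 // expnS alM IHb exprS.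
have -> : ((a`!%:R)^-1 : R)%:C = (a`!%:R)^-1 :> R[i] by rewrite fmorphV /= rmorph_nat.
rewrite -mulr_natr -(bin_fact aj) !natrM.
have f1 : a`!%:R != 0 :> R[i] by rewrite pnatr_eq0 -lt0n fact_gt0.
have f2 : ((j - a)`!)%N%:R != 0 :> R[i] by rewrite pnatr_eq0 -lt0n fact_gt0.
have f3 : 'C(j, a)%:R != 0 :> R[i] by rewrite pnatr_eq0 -lt0n bin_gt0.
by field; rewrite f1 f2 f3.
Qed.
End PowerSums.

(** * Absolute moments of the prime sum *)

Section SquareSums.
Variable (R : realType).
Implicit Types (ps : seq nat).
Local Notation s1 := (s1 R).
Local Notation s2 := (s2 R).

Lemma SOm_recip B j ps : all prime ps -> uniq ps -> (j <= B)%N ->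
  SOm B (fun n => nu R n / n%:R) j ps = s1 ps ^+ j / j`!%:R.
Proof.
move=> aps ups jB; apply: (@complexI R).
have := @SOm_nu R (fun n => (n%:R^-1 : R)%:C) B j ps.
rewrite invr1 => /(_ erefl) H.
have -> : (SOm B (fun n => nu R n / n%:R) j ps)%:C = SOm B (fun n => (nu R n)%:C * (n%:R^-1 : R)%:C) j ps.
  by rewrite /SOm realC_sum; apply: eq_bigr => n _; exact: realCM.
rewrite H // => [|m n]; last by rewrite natrM invfM realCM.
rewrite /s1 -realC_sum realCM rmorphXn fmorphV /= rmorph_nat //.
Qed.

Lemma pow_ge_1Dx (s x : R) n : 0 <= s -> 0 <= x -> s ^+ n.+1 + n.+1%:R * x * s ^+ n <= (s + x) ^+ n.+1.
Proof.
move=> s0 x0; elim: n => [|n IH]; first by rewrite !expr1 expr0 mul1r mulr1.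
have h := ler_wpM2l (addr_ge0 s0 x0) IH; rewrite -exprS in h; apply: le_trans h.
have : 0 <= n%:R :> R by []. have := exprn_ge0 n s0.
rewrite -!natr1 !exprS; move: (s ^+ n) (n%:R) => u v u0 v0.
have := mulr_ge0 (mulr_ge0 x0 x0) u0; have := mulr_ge0 (mulr_ge0 (mulr_ge0 x0 x0) u0) v0; nra.
Qed.

Lemma pow_le_2Dx (s x : R) n : 0 <= s -> 0 <= x -> (s + x) ^+ n.+2 <=
  s ^+ n.+2 + n.+2%:R * x * s ^+ n.+1 + n.+2%:R * n.+1%:R * x ^+ 2 * (s + x) ^+ n.
Proof.
move=> s0 x0; elim: n => [|n IH]; first by rewrite expr0 !expr1 !expr2; nra.
have h := ler_wpM2l (addr_ge0 s0 x0) IH; rewrite -exprS in h; apply: le_trans h _.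
have t : s ^+ n.+1 <= (s + x) ^+ n.+1 by rewrite lerXn2r ?nnegrE ?addr_ge0 // lerDl.
have n0 : 0 <= n%:R :> R by [].
have := mulr_ge0 x0 x0 => xx; have u0 := exprn_ge0 n.+1 s0.
move: t u0; rewrite -!natr1 [s ^+ n.+3]exprS [s ^+ n.+2]exprS [(s + x) ^+ n.+1]exprS.
move: (s ^+ n.+1) ((s + x) ^+ n) (n%:R) n0 => u w v v0 t u0; rewrite -subr_ge0.
rewrite [X in 0 <= X](_ : _ = x * x * (v + 2) * (2 * ((s + x) * w) - u)); last by ring.
by apply: mulr_ge0; [apply: mulr_ge0 => //; lra|lra].
Qed.

(** [j! * U2] is the absolute moment of order [2 j] of the prime sum ([umoment]). As [nu] is 1 on
    squarefree integers, [U2] differs from [s1 ^+ j] only through repeated primes. *)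
Definition U2 B j ps : R := j`!%:R * SOm B (fun n => nu R n ^+ 2 / n%:R) j ps.

Lemma SOm_ge0 B (f : nat -> R) j ps : (forall n, 0 <= f n) -> 0 <= SOm B f j ps.
Proof. by move=> f0; apply: sumr_ge0. Qed.

Lemma sq_ge0 n : 0 <= nu R n ^+ 2 / n%:R.
Proof. by rewrite divr_ge0 ?sqr_ge0. Qed.

Lemma sq_mul B p ps a n : prime p -> all prime ps -> p \notin ps -> (a <= B)%N -> n \in smooth B ps ->
  nu R (p ^ a * n)%N ^+ 2 / (p ^ a * n)%:R = nu R (p ^ a)%N ^+ 2 / (p ^ a)%:R * (nu R n ^+ 2 / n%:R).
Proof.
move=> pp aps pps aB nD; have n0 := posl_smooth aps nD.
rewrite nuM ?expn_gt0 ?(prime_gt0 pp) //; last first.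
  by apply: (coprimel_powl_smooth pp aps pps _ nD); apply/powlP; exists a.
by rewrite exprMn natrM invfM mulrACA.
Qed.

Lemma U2_0 B ps : all prime ps -> uniq ps -> U2 B 0 ps = 1.
Proof.
rewrite /U2 mul1r; elim: ps => [|p ps IH] /=; first by rewrite SOm_nil nu1 expr1n divr1 mulr1.
move=> /andP[pp aps] /andP[pps ups]; rewrite SOm_cons //; last by move=> a n; exact: sq_mul.
by rewrite big_nat1 expn0 nu1 expr1n divr1 mul1r IH.
Qed.

Lemma U2_1 B ps : (0 < B)%N -> all prime ps -> uniq ps -> U2 B 1 ps = s1 ps.
Proof.
move=> B0; elim: ps => [|p ps IH] /=.
  by rewrite /U2 SOm_nil mul0r mulr0 /s1 big_nil.
move=> /andP[pp aps] /andP[pps ups]; rewrite /U2 SOm_cons //; last by move=> a n; exact: sq_mul.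
rewrite big_nat_recl //= big_nat1 expn0 expn1 nu1 expr1n divr1 !mul1r subn0.
have := U2_0 B aps ups; rewrite /U2 mul1r => ->.
have := IH aps ups; rewrite /U2 mul1r => ->.
have := nuX R 1 pp; rewrite expn1 invr1 => ->.
by rewrite expr1n mul1r mulr1 /s1 big_cons addrC.
Qed.

Lemma U2_ge B j p ps : (j.+1 <= B)%N -> all prime (p :: ps) -> uniq (p :: ps) ->
  U2 B j.+1 ps + j.+1%:R * p%:R^-1 * U2 B j ps <= U2 B j.+1 (p :: ps).
Proof.
move=> jB /= /andP[pp aps] /andP[pps ups]; rewrite /U2 (SOm_cons pp aps pps jB); last first.
  by move=> a n; exact: sq_mul.
rewrite big_nat_recl //= big_nat_recl //= expn0 expn1 nu1 expr1n divr1 mul1r subn0 subSS subn0.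
have := nuX R 1 pp; rewrite expn1 invr1 => ->; rewrite expr1n mul1r.
rewrite factS natrM; set T := \sum_(_ <= _ < _) _.
have T0 : 0 <= T by apply: sumr_ge0 => a _; rewrite mulr_ge0 ?sq_ge0 // SOm_ge0 // => n; exact: sq_ge0.
set A := SOm _ _ _ _; set C := SOm _ _ _ _.
have -> : j.+1%:R * j`!%:R * (A + (p%:R^-1 * C + T)) =
  j.+1%:R * j`!%:R * A + j.+1%:R * p%:R^-1 * (j`!%:R * C) + j.+1%:R * j`!%:R * T.
  by move: (p%:R^-1) (j.+1%:R) (j`!%:R) => u v w; ring.
by rewrite lerDl mulr_ge0.
Qed.

(** Induction on the primes: a new prime with reciprocal [x] gains at least [(n+2) x U2(n+1)] by
    [U2_ge], and [pow_le_2Dx] expands [(s1 + x)^(n+2)] to second order. The terms in [x^2]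
    accumulate in [s2]. *)
Lemma U2_lower B n ps : (n.+2 <= B)%N -> all prime ps -> uniq ps ->
  s1 ps ^+ n.+2 - n.+2%:R * n.+1%:R * s2 ps * s1 ps ^+ n <= U2 B n.+2 ps.
Proof.
elim: ps n => [|p ps IH] n nB.
  by rewrite /U2 SOm_nil mul0r mulr0 /s1 /s2 !big_nil expr0n mulr0 mul0r subr0.
move=> aps ups; have := U2_ge nB aps ups; apply: le_trans.
have [/andP[pp aps'] /andP[pps ups']] := (aps, ups).
set x := p%:R^-1; have x0 : 0 <= x :> R by rewrite invr_ge0.
have -> : s1 (p :: ps) = s1 ps + x by rewrite /s1 big_cons addrC.
have -> : s2 (p :: ps) = s2 ps + x ^+ 2 by rewrite /s2 big_cons addrC.
have s0 := s1_ge0 R ps; have z0 := s2_ge0 R ps.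
have h1 := pow_le_2Dx n s0 x0; have h2 := IH n nB aps' ups'.
have N0 : 0 <= n%:R :> R by [].
(* The order below is needed too; for [n = 0] it is given by the exact value [U2_1] and not by the
   induction. *)
case: n nB h1 h2 N0 => [|n] nB h1 h2 N0.
  have B0 : (0 < B)%N by apply: leq_trans nB.
  move: h1 h2; rewrite (U2_1 B0 aps' ups') !expr0 !expr1 !mulr1; nra.
have h3 := IH n (ltnW nB) aps' ups'.
have h4 := pow_ge_1Dx n s0 x0.
have c0 : 0 <= n.+3%:R * x by rewrite mulr_ge0.
have h5 := ler_wpM2l c0 h3.
have d0 : 0 <= n.+3%:R * n.+2%:R * s2 ps by rewrite !mulr_ge0.
have h6 := ler_wpM2l d0 h4.
move: h1 h2 h5 h6; rewrite -[n.+3%:R]natr1 -[n.+2%:R]natr1.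
move: (U2 B n.+3 ps) (U2 B n.+2 ps) (s1 ps ^+ n.+3) (s1 ps ^+ n.+2) (s1 ps ^+ n.+1) (s1 ps ^+ n).
move: ((s1 ps + x) ^+ n.+3) ((s1 ps + x) ^+ n.+1) (s2 ps) (n.+1%:R) => w3 w1 z v a3 a2 s3 s2' s1' s0'.
move=> h1 h2 h5 h6; lra.
Qed.
End SquareSums.

(** * Cancellation of the off-diagonal terms *)

Section OffDiagonal.
Variable (R : realType).
Local Notation s1 := (s1 R).
Local Notation s2 := (s2 R).
Local Notation nu := (@nu R).
Local Notation mcoef := (@mcoef R).

(** Bounds the sum of [(-1)^a / a!] over [a <= v], the local divisor sum of the mollifier
    coefficients. It is 1 for [v = 0] and exactly 0 for [v = 1]; for larger [v] the trivial bound
    [expR 1] is used. *)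
Definition cE (v : nat) : R := if v == 0%N then 1 else if v == 1%N then 0 else expR 1.

Lemma cE_ge0 v : 0 <= cE v.
Proof. by rewrite /cE; case: ifP => // _; case: ifP => // _; exact: expR_ge0. Qed.

Lemma local_divisor_sum p l m : prime p -> (0 < l)%N -> (0 < m)%N ->
  `|\sum_(0 <= a < l.+1) mcoef (p ^ a)%N * (p ^ a %| m)%N%:R| <= cE (logn p m).
Proof.
move=> pp l0 m0; set v := logn p m.
have E : \sum_(0 <= a < l.+1) mcoef (p ^ a)%N * (p ^ a %| m)%N%:R =
    \sum_(0 <= a < l.+1) (-1) ^+ a / a`!%:R * (a <= v)%N%:R.
  by apply: eq_bigr => a _; rewrite mcoefX // pfactor_dvdn.
rewrite E /cE {E}; case: eqP => [->|v0].
  rewrite big_nat_recl //= big1 => [|a _]; last by rewrite mulr0.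
  by rewrite expr0 fact0 divr1 mulr1 addr0 normr1.
case: eqP => [->|v1].
  case: l l0 => // l _; rewrite big_nat_recl //= big_nat_recl //= big1 => [|a _]; last by rewrite mulr0.
  by rewrite expr0 expr1 !divr1 !mulr1 addr0 subrr normr0.
apply: (@le_trans _ _ (\sum_(0 <= a < l.+1) (1 : R) ^+ a / a`!%:R)); last first.
  exact: (sum_exp_le _ ler01).
apply: le_trans (ler_norm_sum _ _ _) _; apply: ler_sum => a _.
rewrite !normrM normrX normrN1 normfV normr_nat ger0_norm // ler_piMr ?divr_ge0 //.
by case: (_ <= _)%N.
Qed.

Section Fixed.
Variables (ps : seq nat) (l : nat) (js : seq (nat * seq nat)).
Hypothesis wf : wf_blocks ((l, ps) :: js).
Hypothesis s2ps : s2 ps <= 1.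
Let D := mollD ((l, ps) :: js).

Let aps : all prime ps. Proof. by have [] := wf_blocks_cons wf. Qed.
Let ups : uniq ps. Proof. by have [] := wf_blocks_cons wf. Qed.
Let l0 : (0 < l)%N. Proof. by have [] := wf_blocks_cons wf. Qed.
Let wfjs : wf_blocks js. Proof. by have [] := wf_blocks_cons wf. Qed.

Definition gdiv (m : nat) : R := \sum_(n <- mollD ((l, ps) :: js)) mcoef n * (n %| m)%N%:R.
Definition Gf (m : nat) : R := \prod_(p <- ps) cE (logn p m).

Lemma Gf_ge0 m : 0 <= Gf m.
Proof. by apply: prodr_ge0 => p _; exact: cE_ge0. Qed.

Lemma gdiv_mult m : multiplicative (fun n => mcoef n * (n %| m)%N%:R).
Proof.
move=> a b a0 b0 ab; rewrite /= (@mcoefM R) // Gauss_dvd // -mulnb natrM.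
by rewrite mulrACA.
Qed.

(** The divisors of [m] involve only primes of the first block and at most [l] of them. So the later
    blocks contribute only the integer 1, the truncation is invisible, and the divisor sum is a
    product of local ones. *)
Lemma gdiv_le m : (0 < m)%N -> {subset primes m <= ps} -> (prime_Omega m <= l)%N -> `|gdiv m| <= Gf m.
Proof.
move=> m0 mps mO; rewrite /gdiv /=.
rewrite (sum_prodl_mult (gdiv_mult m) (posl_block aps) (posl_mollD wfjs) (coprimel_block_mollD wf)).
have [h1 h2 h3 h4 h5] := wf_blocks_cons wf.
have one_in : 1%N \in mollD js.
  elim: (js) wfjs => [|b js' IH] wf'; first by rewrite inE.
  have [g1 g2 g3 g4 g5] := wf_blocks_cons wf'.
  apply/prodlP; exists 1%N, 1%N; rewrite IH //; split => //.
  rewrite mem_filter prime_Omega1 /= mem_smooth //=; apply/allP => p _.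
  by rewrite logn1.
have -> : \sum_(n <- mollD js) mcoef n * (n %| m)%N%:R = 1.
  rewrite (bigD1_seq 1%N) ?uniq_mollD //= mcoef1 dvd1n mulr1 big1_seq ?addr0 //.
  move=> n /andP[n1 nD]; have n0 := posl_mollD wfjs nD.
  suff -> : (n %| m)%N = false by rewrite mulr0.
  apply/negP => nm; have : (1 < n)%N by rewrite ltn_neqAle eq_sym n1.
  move=> /pdiv_prime pp; have pn : pdiv n \in primes n by rewrite mem_primes pp n0 pdiv_dvd.
  apply: (h5 (pdiv n)); last exact: mollD_primes wfjs nD _ pn.
  by apply: mps; rewrite mem_primes pp m0 (dvdn_trans (pdiv_dvd n)).
rewrite mulr1.
have -> : \sum_(n <- block l ps) mcoef n * (n %| m)%N%:R = \sum_(n <- smooth l ps) mcoef n * (n %| m)%N%:R.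
  rewrite big_filter [RHS](bigID (fun n => (prime_Omega n <= l)%N)) /=.
  rewrite [X in _ = _ + X]big1_seq ?addr0 // => n /andP[nO nD]; have n0 := posl_smooth aps nD.
  case: (boolP (n %| m)%N) => [nm|_]; last by rewrite mulr0.
  case/negP: nO; apply: leq_trans mO; move: nm m0 => /dvdnP[d ->]; rewrite muln_gt0 => /andP[d0 _].
  by rewrite prime_OmegaM // leq_addl.
rewrite (sum_smooth l aps ups (gdiv_mult m)); last by rewrite mcoef1 dvd1n mulr1.
rewrite normr_prod /Gf [leLHS]big_seq [leRHS]big_seq; apply: ler_prod => p pps.
by rewrite normr_ge0 /=; apply: local_divisor_sum => //; exact: (allP aps).
Qed.

Lemma gdiv1 : gdiv 1 = 1.
Proof.
rewrite /gdiv (bigD1_seq 1%N) ?uniq_mollD //=; last first.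
  apply/prodlP; exists 1%N, 1%N; split => //.
    rewrite mem_filter prime_Omega1 /= mem_smooth //=; apply/allP => p _; by rewrite logn1.
  elim: (js) wfjs => [|b js' IH] wf'; first by rewrite inE.
  have [g1 g2 g3 g4 g5] := wf_blocks_cons wf'.
  apply/prodlP; exists 1%N, 1%N; rewrite IH //; split => //.
  rewrite mem_filter prime_Omega1 /= mem_smooth //=; apply/allP => p _.
  by rewrite logn1.
rewrite mcoef1 mulr1 big1 ?addr0 // => n n1; rewrite dvdn1 (negbTE n1) mulr0 //.
Qed.

Lemma Gf_mult : multiplicative (fun n => Gf n / n%:R).
Proof.
move=> a b a0 b0 ab; rewrite /Gf natrM invfM mulrACA -big_split /=; congr (_ * _).
apply: eq_bigr => p _; rewrite lognM //.
have : (logn p a == 0)%N || (logn p b == 0)%N.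
  have [pa|] := boolP (p \in primes a); last by rewrite -logn_gt0 lt0n negbK => ->.
  apply/orP; right; rewrite -leqn0 leqNgt logn_gt0; apply/negP => pb.
  move: pa pb; rewrite !mem_primes => /and3P[pp _ pa] /and3P[_ _ pb].
  have : (p %| gcdn a b)%N by rewrite dvdn_gcd pa.
  by rewrite (eqP ab) dvdn1 => /eqP p1; rewrite p1 in pp.
by case/orP => /eqP ->; rewrite ?add0n ?addn0 /cE /= ?mul1r ?mulr1.
Qed.

Definition KG : R := expR (2 * expR 1).

(** As [cE 1 = 0], each local factor is [1 + O(p^-2)] with no term in [1/p]; the total is controlled
    by [s2 <= 1]. *)
Lemma sum_Gf_le B : \sum_(m <- smooth B ps) Gf m / m%:R <= KG.
Proof.
have G1 : Gf 1 / 1%:R = 1.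
  by rewrite divr1 /Gf big1 // => p _; rewrite logn1.
rewrite (sum_smooth B aps ups Gf_mult G1).
apply: (@le_trans _ _ (\prod_(p <- ps) expR (2 * expR 1 * p%:R^-1 ^+ 2))).
  rewrite [leLHS]big_seq [leRHS]big_seq; apply: ler_prod => p pps.
  have pp := allP aps p pps; have p2 : 2 <= p%:R :> R by rewrite ler_nat prime_gt1.
  apply/andP; split; first by apply: sumr_ge0 => a _; rewrite divr_ge0 ?Gf_ge0.
  have GX a : Gf (p ^ a) / (p ^ a)%:R = cE a * p%:R^-1 ^+ a.
    rewrite natrX exprVn; congr (_ / _); rewrite /Gf (bigD1_seq p) //= lognX logn_prime // eqxx muln1.
    rewrite big1_seq ?mulr1 // => r /andP[rp rps].
    by rewrite lognX logn_prime ?(allP aps) // (negbTE rp) muln0.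
  rewrite (eq_bigr _ (fun a _ => GX a)).
  set x : R := p%:R^-1; have x0 : 0 <= x by rewrite invr_ge0.
  have x2 : x <= 2^-1 by rewrite lef_pV2 ?posrE //; lra.
  apply: le_trans (expR_ge1Dx _).
  case: B => [|B].
    by rewrite big_nat1 /cE /= mul1r expr0 lerDl mulr_ge0 ?sqr_ge0 // mulr_ge0 ?expR_ge0.
  rewrite big_nat_recl //= big_nat_recl //= {1 2}/cE /= mul0r add0r expr0 mulr1 lerD2l.
  have -> : \sum_(0 <= i < B) cE i.+2 * x ^+ i.+2 = expR 1 * x ^+ 2 * \sum_(0 <= i < B) x ^+ i.
    rewrite mulr_sumr; apply: eq_bigr => i _; rewrite /cE /= -mulrA -exprD.
    by congr (_ * x ^+ _).
  have hS : \sum_(0 <= i < B) x ^+ i <= 2.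
    have h1 : 0 < 1 - x by lra.
    rewrite -(ler_pM2l h1); apply: (@le_trans _ _ 1); last by lra.
    have -> : (1 - x) * \sum_(0 <= a < B) x ^+ a = 1 - x ^+ B.
      rewrite big_mkord -[1 in RHS](expr1n _ B) subrXX; congr (_ * _); apply: eq_bigr => i _.
      by rewrite expr1n mul1r.
    by rewrite lerBlDr lerDl exprn_ge0.
  have e0 : 0 <= expR 1 * x ^+ 2 by rewrite mulr_ge0 ?expR_ge0 ?sqr_ge0.
  by apply: le_trans (ler_wpM2l e0 hS) _; rewrite mulrC mulrA.
rewrite -expR_sum -mulr_sumr /KG ler_expR ler_piMr // mulr_ge0 ?expR_ge0 //.
Qed.

Definition SL B j : seq nat := [seq n <- smooth B ps | prime_Omega n == j].

Lemma SL_pos B j n : n \in SL B j -> (0 < n)%N.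
Proof. by rewrite mem_filter => /andP[_ /(posl_smooth aps)]. Qed.

Lemma offdiag_e B k r e : e \in SL B k ->
  \sum_(d <- SL B r | (e %| d)%N) Gf (d %/ e) / d%:R <= KG / e%:R.
Proof.
move=> eS; have e0 := SL_pos eS; have eR : 0 < e%:R :> R by rewrite ltr0n.
apply: (@le_trans _ _ ((\sum_(m <- [seq (d %/ e)%N | d <- SL B r & (e %| d)%N]) Gf m / m%:R) / e%:R)).
  rewrite big_map big_filter mulr_suml le_eqVlt; apply/orP; left; apply/eqP.
  apply: eq_bigr => d /dvdnP[c ->]; rewrite mulnK // natrM invfM mulrA //.
rewrite ler_pM2r ?invr_gt0 //; apply: le_trans (sum_Gf_le B).
apply: sum_uniq_sub.
- rewrite map_inj_in_uniq ?filter_uniq ?uniq_smooth // => c d.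
  rewrite !mem_filter => /andP[/dvdnP[c' ->] _] /andP[/dvdnP[d' ->] _].
  by rewrite !mulnK // => ->.
- exact: uniq_smooth.
- move=> m /mapP[d]; rewrite mem_filter mem_filter => /and3P[ed _ dS] ->.
  have d0 := posl_smooth aps dS; move: dS; rewrite !mem_smooth // => /and3P[_ /allP dp /allP dB].
  have q0 : (0 < d %/ e)%N by rewrite divn_gt0 // dvdn_leq.
  have qd : (d %/ e %| d)%N by apply/dvdnP; exists e; rewrite mulnC divnK.
  rewrite q0 /=; apply/andP; split; apply/allP => p.
    rewrite mem_primes => /and3P[pp _ pd]; apply: dp.
    by rewrite mem_primes pp d0 (dvdn_trans pd qd).
  move=> /dB; apply: leq_trans; exact: dvdn_leq_log.
- by move=> m _; rewrite divr_ge0 ?Gf_ge0.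
Qed.

(** Only [d = c * e] contributes, with inner sum [gdiv c]. The case [c = 1] is the diagonal. A
    larger [c] forces [k < r], and the sum over [c] is then bounded by [KG] uniformly in the primes,
    so that only the sum over [e] still grows. *)
Theorem offdiag_bound B k r : (k <= B)%N -> (r <= l)%N ->
  `|\sum_(e <- SL B k) \sum_(d <- SL B r)
      (nu e * nu d / d%:R) * (\sum_(n <- mollD ((l, ps) :: js)) mcoef n * (n * e %| d)%N%:R) -
    \sum_(e <- SL B k) \sum_(d <- SL B r) (e == d)%:R * (nu e * nu d / d%:R)|
  <= (k < r)%N%:R * KG * (s1 ps ^+ k / k`!%:R).
Proof.
move=> kB rl; have dR d : 0 <= d%:R :> R by [].
have term e d : e \in SL B k -> d \in SL B r ->
  `|(nu e * nu d / d%:R) * (\sum_(n <- mollD ((l, ps) :: js)) mcoef n * (n * e %| d)%N%:R) -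
    (e == d)%:R * (nu e * nu d / d%:R)| <= (k < r)%N%:R * nu e * (if (e %| d)%N then Gf (d %/ e) / d%:R else 0).
  move=> eS dS; have e0 := SL_pos eS; have d0 := SL_pos dS.
  move: eS dS; rewrite !mem_filter => /andP[/eqP eO eS] /andP[/eqP dO dS].
  case: (boolP (e %| d)%N) => [/dvdnP[c dE]|ned]; last first.
    rewrite big1 => [|n _]; last first.
      have -> : (n * e %| d)%N = false; last by rewrite mulr0.
      by apply: contraNF ned; exact: dvdn_trans (dvdn_mull _ _).
    have -> : (e == d) = false by apply: contraNF ned => /eqP ->.
    by rewrite !mulr0 mul0r subrr normr0.
  have c0 : (0 < c)%N by move: d0; rewrite dE muln_gt0 => /andP[].
  have -> : \sum_(n <- mollD ((l, ps) :: js)) mcoef n * (n * e %| d)%N%:R = gdiv c.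
    by apply: eq_bigr => n _; rewrite dE dvdn_pmul2r.
  have [c1|c1] := eqVneq c 1%N.
    have -> : e = d by rewrite dE c1 mul1n.
    rewrite eqxx c1 gdiv1 mulr1 mul1r subrr normr0 !mulr_ge0 ?nu_ge0 //.
    exact: Gf_ge0.
  have cO : (0 < prime_Omega c)%N.
    apply: leq_trans (prime_Omega_ge_logn (pdiv c) c0).
    by rewrite logn_gt0 mem_primes pdiv_prime ?c0 ?pdiv_dvd // ltn_neqAle eq_sym c1.
  have OE : prime_Omega d = (prime_Omega c + prime_Omega e)%N by rewrite dE prime_OmegaM.
  have kr : (k < r)%N by rewrite -dO -eO OE; lia.
  have -> : (e == d) = false by apply/eqP => ed; move: kr; rewrite -dO -eO ed ltnn.
  rewrite kr mul0r subr0 dE mulnK // mul1r -dE normrM normrM normfV normrM.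
  rewrite (ger0_norm (nu_ge0 _ _)) (ger0_norm (nu_ge0 _ _)) (ger0_norm (dR d)).
  have gle : `|gdiv c| <= Gf c.
    apply: gdiv_le => //; last by apply: leq_trans rl; rewrite -dO OE leq_addr.
    move=> p; rewrite mem_primes => /and3P[pp _ pc]; move: dS; rewrite mem_smooth // => /and3P[_ /allP h _].
    by apply: h; rewrite mem_primes pp d0 dE dvdn_mulr.
  rewrite -!mulrA ler_wpM2l ?nu_ge0 //; apply: (@le_trans _ _ (1 * (d%:R^-1 * Gf c))).
    apply: ler_pM; rewrite ?nu_ge0 ?nu_le1 ?mulr_ge0 ?invr_ge0 //.
    by rewrite ler_wpM2l ?invr_ge0.
  by rewrite mul1r mulrC.
rewrite -sumrB; apply: le_trans (ler_norm_sum _ _ _) _.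
apply: (@le_trans _ _ (\sum_(e <- SL B k) (k < r)%N%:R * nu e * (KG / e%:R))).
  apply: ler_sum_seq => e eS; rewrite -sumrB; apply: le_trans (ler_norm_sum _ _ _) _.
  apply: (@le_trans _ _ (\sum_(d <- SL B r) (k < r)%N%:R * nu e * (if (e %| d)%N then Gf (d %/ e) / d%:R else 0))).
    by apply: ler_sum_seq => d dS; exact: term.
  rewrite -mulr_sumr -big_mkcond /=; apply: ler_wpM2l; first by rewrite mulr_ge0 ?nu_ge0.
  exact: offdiag_e eS.
rewrite -(SOm_recip R aps ups kB) /SOm mulr_sumr /SL big_filter le_eqVlt; apply/orP; left; apply/eqP.
by apply: eq_bigr => e _; move: (nu e) (e%:R^-1) => u v; ring.
Qed.
End Fixed.
End OffDiagonal.

(** * Moments of the prime sum, with and without the weight *)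

Section PrimeSumMoments.
Variables (R : realType) (q : nat).
Hypothesis pq : prime q.
Local Notation dchar := (@dchar R q pq).
Local Notation Lhz := (@Lhz R q pq).
Local Notation mpoly := (@mpoly R q pq).
Local Notation dpoly := (@dpoly R q pq).
Variables (ps : seq nat) (l : nat) (js : seq (nat * seq nat)) (X Y : R) (N : nat).
Hypothesis wf : wf_blocks ((l, ps) :: js).
Hypothesis s2ps : s2 R ps <= 1.
Hypothesis DX : forall n, n \in mollD ((l, ps) :: js) -> n%:R <= X.
Hypothesis Y1 : 1 <= Y.
Hypothesis psY : forall p, p \in ps -> p%:R <= Y.
Hypothesis YX : Y ^+ N <= X.
Hypothesis Xq : X * X < q%:R.
Hypothesis Nl : (N <= l)%N.
Let D := mollD ((l, ps) :: js).

Let aps : all prime ps. Proof. by have [] := wf_blocks_cons wf. Qed.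
Let ups : uniq ps. Proof. by have [] := wf_blocks_cons wf. Qed.
Let X1 : 1 <= X. Proof. by apply: le_trans YX; exact: exprn_ege1. Qed.

Definition Psum (k : nat) : R[i] := \sum_(p <- ps) (isq (p%:R : R))%:C * dchar k p%:Z.
Definition nA (j : nat) : seq (R * nat) := [seq (nu R n, n) | n <- SL ps l j].
Definition mA : seq (R * nat) := [seq (mcoef R n, n) | n <- mollD ((l, ps) :: js)].

Lemma isq1 : isq (1 : R) = 1.
Proof. by rewrite /isq sqrtr1 invr1. Qed.

Lemma Psum_pow k j : (j <= l)%N -> Psum k ^+ j = j`!%:R * dpoly (nA j) k.
Proof.
move=> jl; have := @SOm_nu R (fun n => (isq (n%:R : R))%:C * dchar k n%:Z) l j ps.
rewrite isq1 mul1r dchar_nat fchar1 => /(_ erefl) H.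
have : SOm l (fun n => (nu R n)%:C * ((isq (n%:R : R))%:C * dchar k n%:Z)) j ps =
    Psum k ^+ j / j`!%:R.
  apply: H => // m n; rewrite dcharM natrM isqM ?ler0n // realCM.
  by rewrite mulrACA.
have f0 : j`!%:R != 0 :> R[i] by rewrite pnatr_eq0 -lt0n fact_gt0.
move=> e; have -> : Psum k ^+ j = j`!%:R * (Psum k ^+ j / j`!%:R) by rewrite mulrC divfK.
rewrite -e; congr (_ * _); rewrite /SOm [RHS]big_map /SL big_filter.
by apply: eq_bigr => n _; rewrite mulrA -realCM.
Qed.

Lemma SL_le j n : (j <= N)%N -> n \in SL ps l j -> n%:R <= X.
Proof.
move=> jN; rewrite mem_filter => /andP[/eqP nO nS].
apply: le_trans (smooth_le aps Y1 psY nS) _; rewrite nO.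
by apply: le_trans YX; exact: ler_weXn2l.
Qed.

Lemma SLq j n : (j <= N)%N -> n \in SL ps l j -> (0 < n < q)%N.
Proof.
move=> jN nS; rewrite (SL_pos wf nS) -(ltr_nat R) (le_lt_trans (SL_le jN nS)) //.
by apply: le_lt_trans Xq; rewrite ler_peMl // (le_trans ler01).
Qed.

Lemma wf_nA j : (j <= N)%N -> wfA q (nA j).
Proof. by move=> jN; apply/allP => a /mapP[n nS ->]; exact: SLq jN nS. Qed.

Lemma wf_mnA j : (j <= N)%N -> wfA q (prodA mA (nA j)).
Proof.
move=> jN; apply/allP => a /allpairsP[[u v] /= [/mapP[n nD ->] /mapP[e eS ->] ->]] /=.
rewrite muln_gt0 (posl_mollD wf nD) (SL_pos wf eS) /= -(ltr_nat R) natrM.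
apply: le_lt_trans Xq; apply: ler_pM => //; [exact: DX|exact: SL_le jN eS].
Qed.

Lemma dnorm_le (c : nat -> R) (E : seq nat) : uniq E -> posl E -> (forall n, n \in E -> n%:R <= X) ->
  (forall n, `|c n| <= 1) -> dnorm [seq (c n, n) | n <- E] <= X.
Proof.
move=> uE pE EX c1; rewrite /dnorm big_map /=.
apply: (@le_trans _ _ (size E)%:R).
  rewrite -sum1_size natr_sum; apply: ler_sum => n _; exact: c1.
by have [//|->] := size_le uE pE EX; rewrite (le_trans ler01).
Qed.

Lemma dnorm_nA j : (j <= N)%N -> dnorm (nA j) <= X.
Proof.
move=> jN; apply: dnorm_le; first by rewrite filter_uniq ?uniq_smooth.
- by move=> n nS; have /andP[] := SLq jN nS.
- by move=> n nS; exact: SL_le nS.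
- by move=> n; rewrite ger0_norm ?nu_ge0 ?nu_le1.
Qed.

Lemma dnorm_mA : dnorm mA <= X.
Proof.
apply: dnorm_le; [exact: uniq_mollD|exact: posl_mollD|exact: DX|].
by move=> n; rewrite normr_mcoef nu_le1.
Qed.

Let W k := Lhz k * mpoly (mollD ((l, ps) :: js)) k.

(** All integers in question stay below [q], so orthogonality modulo [q] is equality of integers,
    and equal integers have equally many prime factors. *)
Lemma umoment a b : (a <= N)%N -> (b <= N)%N ->
  avg q (fun k => Psum k ^+ a * Num.conj (Psum k ^+ b)) =
  ((a == b)%N%:R * (a`!%:R * U2 R l a ps))%:C.
Proof.
move=> aN bN; have al := leq_trans aN Nl; have bl := leq_trans bN Nl.
rewrite (@eq_avg R q _ (fun k => (a`!%:R * b`!%:R) * (dpoly (nA a) k * Num.conj (dpoly (nA b) k)))); last first.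
  move=> k; rewrite !Psum_pow // conjCM conjC_nat.
  by move: (dpoly _ _) (Num.conj _) => u v; ring.
rewrite /avg -mulr_sumr mulrCA -/(avg q (fun k => dpoly (nA a) k * Num.conj (dpoly (nA b) k))).
rewrite avg_dpoly2 ?wf_nA //.
have -> : (a`!%:R * b`!%:R : R[i]) = (a`!%:R * b`!%:R : R)%:C by rewrite realCM !rmorph_nat.
rewrite -realCM; congr (_%:C); rewrite /nA big_map.
under eq_bigr do rewrite big_map /=.
have [ab|ab] := eqVneq a b; last first.
  rewrite mul0r big1_seq ?mulr0 // => e; rewrite mem_filter => /andP[_ /andP[/eqP eO _]].
  rewrite big1_seq // => d; rewrite mem_filter => /andP[_ /andP[/eqP dO _]].
  by case: eqP => [ed|_]; rewrite ?mul0r //; case/eqP: ab; rewrite -eO -dO ed.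
rewrite -ab mul1r /U2 -!mulrA; congr (_ * (_ * _)).
rewrite /SOm -[RHS]big_filter -/(SL ps l a); apply: eq_big_seq => e eS.
rewrite (bigD1_seq e) ?filter_uniq ?uniq_smooth //= eqxx mul1r big1 ?addr0 ?expr2 //.
by move=> d; rewrite eq_sym => /negbTE ->; rewrite mul0r.
Qed.

(** The main term is the unweighted moment. The off-diagonal error has size [s1^a] with [a < b],
    smaller by [s1^((b-a)/2)] than the natural size [s1^((a+b)/2)]; the rest is a power of [X] over
    [sqrt q]. *)
Lemma wmoment a b : (a <= N)%N -> (b <= N)%N ->
  `|avg q (fun k => W k * Psum k ^+ a * Num.conj (Psum k ^+ b)) -
    ((a == b)%N%:R * (a`!%:R * U2 R l a ps))%:C| <=
  ((a < b)%N%:R * b`!%:R * KG R * s1 R ps ^+ a + a`!%:R * b`!%:R * (4 * X ^+ 3 * isq q%:R))%:C.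
Proof.
move=> aN bN; have al := leq_trans aN Nl; have bl := leq_trans bN Nl.
set F : R := a`!%:R * b`!%:R.
have F0 : 0 <= F by rewrite mulr_ge0.
have FC : (a`!%:R * b`!%:R : R[i]) = F%:C by rewrite realCM !rmorph_nat.
rewrite -umoment //.
pose T k := Lhz k * dpoly (prodA mA (nA a)) k * Num.conj (dpoly (nA b) k).
have -> : avg q (fun k => W k * Psum k ^+ a * Num.conj (Psum k ^+ b)) = F%:C * avg q T.
  rewrite -FC (@eq_avg R q _ (fun k => (a`!%:R * b`!%:R) * T k)); last first.
    move=> k; rewrite /W /T !Psum_pow // conjCM conjC_nat dpolyM dpoly_mpoly -/mA.
    by move: (dpoly _ _) (Num.conj _) (Lhz k) (dpoly _ _) => u v w x; ring.
  by rewrite /avg -mulr_sumr mulrCA.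
have -> : avg q (fun k => Psum k ^+ a * Num.conj (Psum k ^+ b)) =
    F%:C * avg q (fun k => dpoly (nA a) k * Num.conj (dpoly (nA b) k)).
  rewrite -FC (@eq_avg R q _ (fun k => (a`!%:R * b`!%:R) * (dpoly (nA a) k * Num.conj (dpoly (nA b) k)))).
    by rewrite /avg -mulr_sumr mulrCA.
  move=> k; rewrite !Psum_pow // conjCM conjC_nat.
  by move: (dpoly _ _) (Num.conj _) => u v; ring.
rewrite -mulrBr normrM normC_real (ger0_norm F0).
have hL := avg_Ldpoly pq (wf_mnA aN) (wf_nA bN).
rewrite -/T in hL; rewrite avg_dpoly2 ?wf_nA //.
move: hL; set S1 := \sum_(_ <- prodA _ _) _; set S2 := \sum_(_ <- nA a) _ => hL.
have S12 : `|S1 - S2| <= (a < b)%N%:R * KG R * (s1 R ps ^+ a / a`!%:R).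
  have := offdiag_bound wf s2ps al bl.
  congr (`|_ - _| <= _); last first.
    by rewrite /S2 big_map; apply: eq_bigr => e _; rewrite big_map.
  rewrite /S1 big_allpairs_dep /mA big_map /nA.
  under [RHS]eq_bigr do rewrite big_map.
  rewrite [RHS]exchange_big /=; apply: eq_bigr => e _.
  under [RHS]eq_bigr do rewrite big_map.
  rewrite [RHS]exchange_big /=; apply: eq_bigr => d _.
  rewrite mulr_sumr; apply: eq_bigr => n _ /=.
  by move: (mcoef R n) (nu R e) (nu R d) (d%:R^-1) => u v w x; ring.
have dn : 4 * dnorm (prodA mA (nA a)) * dnorm (nA b) * isq q%:R <= 4 * X ^+ 3 * isq q%:R.
  rewrite dnormM ler_wpM2r ?isq_ge0 // -mulrA ler_pM2l //.
  have X0 : 0 <= X by apply: le_trans X1.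
  have n0 A : 0 <= @dnorm R A by apply: sumr_ge0.
  by rewrite (_ : X ^+ 3 = X * X * X) ?ler_pM ?mulr_ge0 ?dnorm_mA ?dnorm_nA // !exprS expr0; ring.
have key : `|avg q T - S2%:C| <= ((a < b)%N%:R * KG R * (s1 R ps ^+ a / a`!%:R) + 4 * X ^+ 3 * isq q%:R)%:C.
  have -> : avg q T - S2%:C = (avg q T - S1%:C) + (S1 - S2)%:C.
    by rewrite realCB addrA subrK.
  apply: le_trans (ler_normD _ _) _; rewrite normC_real addrC realCD lerD //.
    by rewrite lecR.
  by apply: le_trans hL _; rewrite lecR.
apply: le_trans (ler_wpM2l _ key) _; first by rewrite realC_ge0.
rewrite -realCM lecR mulrDr lerD2r le_eqVlt; apply/orP; left; apply/eqP.
have f0 : a`!%:R != 0 :> R by rewrite pnatr_eq0 -lt0n fact_gt0.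
by rewrite /F; move: (s1 R ps ^+ a) (KG R) (b`!%:R) => u v w; field.
Qed.
End PrimeSumMoments.

Section ReIm.
Variables (R : realType) (q : nat).
Local Notation nc := Normc.normc.

Lemma Re_scale (x : R) (z : R[i]) : complex.Re (x%:C * z) = x * complex.Re z.
Proof. by case: z => a b /=; rewrite mul0r subr0. Qed.

Lemma Im_scale (x : R) (z : R[i]) : complex.Im (x%:C * z) = x * complex.Im z.
Proof. by case: z => a b /=; rewrite mul0r addr0. Qed.

Lemma Re_sum n (f : nat -> R[i]) : complex.Re (\sum_(k < n) f k) = \sum_(k < n) complex.Re (f k).
Proof.
elim: n => [|n IH]; first by rewrite !big_ord0.
by rewrite !big_ord_recr /= -IH; case: (\sum_(_ < n) _) => a b; case: (f n).
Qed.

Lemma Im_sum n (f : nat -> R[i]) : complex.Im (\sum_(k < n) f k) = \sum_(k < n) complex.Im (f k).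
Proof.
elim: n => [|n IH]; first by rewrite !big_ord0.
by rewrite !big_ord_recr /= -IH; case: (\sum_(_ < n) _) => a b; case: (f n).
Qed.

Let invC n : (n%:R : R[i])^-1 = ((n%:R : R)^-1)%:C.
Proof. by rewrite fmorphV /= rmorph_nat. Qed.

Lemma Re_avg f : complex.Re (avg q f) = mean q.-1 (fun k => complex.Re (f k)) :> R.
Proof. by rewrite /avg invC Re_scale Re_sum. Qed.

Lemma Im_avg f : complex.Im (avg q f) = mean q.-1 (fun k => complex.Im (f k)) :> R.
Proof. by rewrite /avg invC Im_scale Im_sum. Qed.

Lemma Re_le_nc (z : R[i]) : `|complex.Re z| <= nc z.
Proof. by case: z => a b /=; rewrite -sqrtr_sqr ler_sqrt ?lerDl ?sqr_ge0 // addr_ge0 ?sqr_ge0. Qed.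

Lemma Im_le_nc (z : R[i]) : `|complex.Im z| <= nc z.
Proof. by case: z => a b /=; rewrite -sqrtr_sqr ler_sqrt ?lerDr ?sqr_ge0 // addr_ge0 ?sqr_ge0. Qed.

Lemma ReIm_close (z : R[i]) (M e : R) : `|z - M%:C| <= e%:C ->
  `|complex.Re z - M| <= e /\ `|complex.Im z| <= e.
Proof.
rewrite normC_nc lecR => h; split.
  by apply: le_trans h; apply: le_trans (Re_le_nc _); case: z.
by apply: le_trans h; apply: le_trans (Im_le_nc _); case: z => a b /=; rewrite subr0.
Qed.

Lemma Re_half (z : R[i]) : (complex.Re z)%:C = (2^-1 : R)%:C * (z + Num.conj z).
Proof.
case: z => a b; have -> : Num.conj (a +i* b) = a -i* b by [].
by apply/eqP; rewrite eq_complex /=; apply/andP; split; apply/eqP; field.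
Qed.
End ReIm.

(** * Comparison with Gaussian moments *)

Section RealMoments.
Variables (R : realType) (q : nat).
Hypothesis pq : prime q.
Local Notation Lhz := (@Lhz R q pq).
Local Notation mpoly := (@mpoly R q pq).
Variables (ps : seq nat) (l : nat) (js : seq (nat * seq nat)) (X Y : R) (N : nat).
Hypothesis wf : wf_blocks ((l, ps) :: js).
Hypothesis s2ps : s2 R ps <= 1.
Hypothesis DX : forall n, n \in mollD ((l, ps) :: js) -> n%:R <= X.
Hypothesis Y1 : 1 <= Y.
Hypothesis psY : forall p, p \in ps -> p%:R <= Y.
Hypothesis YX : Y ^+ N <= X.
Hypothesis Xq : X * X < q%:R.
Hypothesis Nl : (N <= l)%N.
Let s : R := s1 R ps.
Hypothesis s1ps : 1 <= s.
Let sg : R := Num.sqrt s.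
Let P k := Psum R pq ps k.
Let W k := Lhz k * mpoly (mollD ((l, ps) :: js)) k.
Definition rP (k : nat) : R := complex.Re (Psum R pq ps k).

Let aps : all prime ps. Proof. by have [] := wf_blocks_cons wf. Qed.
Let ups : uniq ps. Proof. by have [] := wf_blocks_cons wf. Qed.
Let sg1 : 1 <= sg. Proof. by rewrite -sqrtr1 ler_sqrt // (le_trans ler01). Qed.
Let sg0 : 0 < sg. Proof. exact: lt_le_trans sg1. Qed.
Let sg2 : sg ^+ 2 = s. Proof. by rewrite sqr_sqrtr // (le_trans ler01). Qed.

Definition CN : R := N`!%:R * (KG R + N%:R * N%:R).
Definition eN : R := N`!%:R * N`!%:R * (4 * X ^+ 3 * isq q%:R).

Lemma U2_upper a : (a <= l)%N -> U2 R l a ps <= s ^+ a.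
Proof.
move=> al; have f0 : a`!%:R != 0 :> R by rewrite pnatr_eq0 -lt0n fact_gt0.
have -> : s ^+ a = a`!%:R * (s ^+ a / a`!%:R) by rewrite mulrCA divff // mulr1.
rewrite /U2 ler_wpM2l // -(SOm_recip R aps ups al); apply: ler_sum => n _.
by rewrite ler_wpM2r ?invr_ge0 // expr2 ler_piMl ?nu_ge0 ?nu_le1.
Qed.

Let fact_leN a : (a <= N)%N -> a`!%:R <= N`!%:R :> R.
Proof. by move=> aN; rewrite ler_nat -(bin_fact aN) mulnCA leq_pmulr // muln_gt0 bin_gt0 aN fact_gt0. Qed.

Let sg_pow a m : (a < m)%N -> sg ^+ a <= sg ^+ m / sg.
Proof. by move=> am; rewrite ler_pdivlMr // -exprSr; apply: ler_weXn2l. Qed.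

(** Every deviation is smaller than [s^(m/2)] by at least [sqrt s]: off the diagonal because
    [2 a < m], on it because [U2] deviates from [s^a] only at order [s^(a-2)]. *)
Lemma main_close a b m : (a + b = m)%N -> (m <= N)%N ->
  `|(a == b)%N%:R * (a`!%:R * U2 R l a ps) - (a == b)%N%:R * (a`!%:R * s ^+ a)| +
   (a < b)%N%:R * b`!%:R * KG R * s ^+ a <= CN * (sg ^+ m / sg).
Proof.
move=> abm mN; have aN : (a <= N)%N by rewrite (leq_trans _ mN) // -abm leq_addr.
have bN : (b <= N)%N by rewrite (leq_trans _ mN) // -abm leq_addl.
rewrite /CN; have : 0 <= KG R by exact: expR_ge0.
move: (KG R) => K K0.
have r0 : 0 <= sg ^+ m / sg by apply: divr_ge0; rewrite ?exprn_ge0 // ltW.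
have NN : 0 <= N`!%:R :> R by [].
have sgE k : s ^+ k = sg ^+ (2 * k) by rewrite exprM sg2.
have q0 : 0 <= K + N%:R * N%:R by apply: addr_ge0; [exact: K0|apply: mulr_ge0; exact: ler0n].
have tot0 : 0 <= N`!%:R * (K + N%:R * N%:R) * (sg ^+ m / sg).
  by apply: mulr_ge0; [apply: mulr_ge0; [exact: ler0n|exact: q0]|exact: r0].
have [ab|ab] := eqVneq a b; last first.
  rewrite !mul0r subrr normr0 add0r; case: (ltnP a b) => lab; last first.
    by rewrite !mul0r; exact: tot0.
  have am : (2 * a < m)%N by move: abm lab; clear; lia.
  rewrite mul1r sgE; have h := sg_pow am.
  apply: (@le_trans _ _ (N`!%:R * K * (sg ^+ m / sg))).
    apply: ler_pM; [|apply: exprn_ge0; exact: ltW| |exact: h].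
      by apply: mulr_ge0; [exact: ler0n|exact: K0].
    by apply: ler_wpM2r; [exact: K0|exact: fact_leN].
  apply: ler_wpM2r; [exact: r0|apply: ler_wpM2l; [exact: NN|]].
  by rewrite lerDl; apply: mulr_ge0; exact: ler0n.
rewrite -ab ltnn !mul0r addr0 !mul1r -mulrBr normrM (ger0_norm (ler0n _ _)).
have := U2_upper (leq_trans aN Nl).
case: a abm aN ab => [|[|a]] abm aN ab hU.
- by rewrite (U2_0 R l aps ups) expr0 subrr normr0 mulr0; exact: tot0.
- by rewrite (U2_1 R (leq_trans aN Nl) aps ups) expr1 subrr normr0 mulr0; exact: tot0.
have hl := U2_lower R (leq_trans aN Nl) aps ups.
have h : `|U2 R l a.+2 ps - s ^+ a.+2| <= N%:R * N%:R * (sg ^+ m / sg).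
  rewrite distrC ger0_norm ?subr_ge0 //.
  apply: (@le_trans _ _ (a.+2%:R * a.+1%:R * s2 R ps * s ^+ a)).
    by move: hl; rewrite -/s; move: (U2 _ _ _ _) (s ^+ a.+2) (_ * s ^+ a) => x y z; lra.
  rewrite sgE; apply: ler_pM; [|apply: exprn_ge0; exact: ltW| |by apply: sg_pow; move: abm ab; clear; lia].
    by apply: mulr_ge0; [apply: mulr_ge0; exact: ler0n|exact: s2_ge0].
  rewrite -[leRHS]mulr1; apply: ler_pM; [apply: mulr_ge0; exact: ler0n|exact: s2_ge0| |exact: s2ps].
  by rewrite -!natrM ler_nat; apply: leq_mul; [exact: aN|exact: ltnW].
apply: (@le_trans _ _ (N`!%:R * (N%:R * N%:R * (sg ^+ m / sg)))).
  by apply: ler_pM; [exact: ler0n|exact: normr_ge0|exact: fact_leN|exact: h].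
rewrite mulrA; apply: ler_wpM2r; [exact: r0|apply: ler_wpM2l; [exact: NN|]].
by rewrite lerDr; exact: K0.
Qed.

(** The mixed moments of a complex Gaussian variable of variance [s]. *)
Let T2 a b : R := (a == b)%N%:R * (a`!%:R * s ^+ a).

Lemma wmoment_close a b m : (a + b = m)%N -> (m <= N)%N ->
  `|avg q (fun k => W k * (P k ^+ a * Num.conj (P k ^+ b))) - (T2 a b)%:C| <=
  (CN * (sg ^+ m / sg) + eN)%:C.
Proof.
move=> abm mN; have aN : (a <= N)%N by rewrite (leq_trans _ mN) // -abm leq_addr.
have bN : (b <= N)%N by rewrite (leq_trans _ mN) // -abm leq_addl.
have H := wmoment pq wf s2ps DX Y1 psY YX Xq Nl aN bN.
have M := main_close abm mN.
rewrite (@eq_avg R q _ (fun k => W k * P k ^+ a * Num.conj (P k ^+ b))); last by move=> k; rewrite mulrA.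
rewrite -[X in `|X|](subrKA ((a == b)%N%:R * (a`!%:R * U2 R l a ps))%:C).
apply: le_trans (ler_normD _ _) _; rewrite -realCB normC_real.
apply: le_trans (lerD H (lexx _)) _; rewrite -realCD lecR.
apply: le_trans (_ : _ <= CN * (sg ^+ m / sg) + a`!%:R * b`!%:R * (4 * X ^+ 3 * isq q%:R)) _.
  move: M; rewrite /T2 -/s; move: `|_| (_ * KG R * s ^+ a) (_ * (4 * _ * _)) => u v w; lra.
rewrite lerD2l /eN ler_wpM2r // ?ler_pM ?fact_leN //.
by rewrite !mulr_ge0 ?isq_ge0 ?exprn_ge0 // (le_trans _ YX) ?exprn_ge0 ?(le_trans ler01 Y1).
Qed.

Lemma umoment_close a b m : (a + b = m)%N -> (m <= N)%N ->
  `|avg q (fun k => P k ^+ a * Num.conj (P k ^+ b)) - (T2 a b)%:C| <= (CN * (sg ^+ m / sg))%:C.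
Proof.
move=> abm mN; have aN : (a <= N)%N by rewrite (leq_trans _ mN) // -abm leq_addr.
have bN : (b <= N)%N by rewrite (leq_trans _ mN) // -abm leq_addl.
rewrite (umoment pq wf Y1 psY YX Xq Nl aN bN) -realCB normC_real lecR.
apply: le_trans (main_close abm mN); rewrite /T2 lerDl mulr_ge0 ?exprn_ge0 //; last first.
  exact: le_trans ler01 s1ps.
by rewrite !mulr_ge0 ?expR_ge0.
Qed.

Definition Mm (m : nat) : R := \sum_(j < m.+1) (2 ^- m * 'C(m, j)%:R) * ((m - j == j)%N%:R * ((m - j)`!%:R * s ^+ (m - j))).

Lemma rP_pow m k : (rP k ^+ m)%:C = \sum_(j < m.+1) (2 ^- m * 'C(m, j)%:R : R)%:C * (P k ^+ (m - j) * Num.conj (P k ^+ j)).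
Proof.
rewrite rmorphXn /= Re_half exprMn exprDn mulr_sumr; apply: eq_bigr => j _.
have -> : (2 ^- m * 'C(m, j)%:R : R)%:C = (2^-1 : R)%:C ^+ m * 'C(m, j)%:R.
  by rewrite realCM rmorph_nat -exprVn rmorphXn.
have -> : Num.conj (P k ^+ j) = Num.conj (P k) ^+ j by rewrite rmorphXn.
by rewrite -[_ *+ 'C(m, j)]mulr_natl mulrA.
Qed.

Let binsum m : \sum_(j < m.+1) (2 ^- m * 'C(m, j)%:R) = 1 :> R.
Proof.
have e : 2 ^+ m = \sum_(j < m.+1) 'C(m, j)%:R :> R.
  by rewrite -[2]/(1 + 1) exprDn; apply: eq_bigr => j _; rewrite !expr1n mulr1.
by rewrite -mulr_sumr -e mulVf // expf_neq0 // pnatr_eq0.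
Qed.

(** The real part is half the sum of [P] and its conjugate. The binomial coefficients divided by
    [2^m] sum to 1, so the error of the mixed moments is not amplified. *)
Lemma mix_close (V : nat -> R[i]) (m : nat) (e : R) :
  (forall a b, (a + b = m)%N -> `|avg q (fun k => V k * (P k ^+ a * Num.conj (P k ^+ b))) - (T2 a b)%:C| <= e%:C) ->
  `|avg q (fun k => V k * (rP k ^+ m)%:C) - (Mm m)%:C| <= e%:C.
Proof.
move=> H; rewrite (@eq_avg R q _ (fun k => \sum_(j < m.+1) (2 ^- m * 'C(m, j)%:R : R)%:C * (V k * (P k ^+ (m - j) * Num.conj (P k ^+ j))))); last first.
  by move=> k; rewrite rP_pow mulr_sumr; apply: eq_bigr => j _; rewrite mulrCA.
rewrite (@avg_sum R q _ _ _ _ (fun (j : 'I_m.+1) k => V k * (P k ^+ (m - j) * Num.conj (P k ^+ j)))).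
have eE : e%:C = \sum_(j < m.+1) (2 ^- m * 'C(m, j)%:R * e : R)%:C.
  by rewrite -realC_sum -mulr_suml binsum mul1r.
rewrite /Mm realC_sum -sumrB {}eE.
apply: le_trans (ler_norm_sum _ _ _) _; apply: ler_sum => j _.
set c : R := 2 ^- m * 'C(m, j)%:R.
have c0 : 0 <= c by apply: mulr_ge0; rewrite ?invr_ge0 ?exprn_ge0.
rewrite [X in _ - X]realCM -mulrBr normrM normC_real (ger0_norm c0).
rewrite [leRHS]realCM; apply: ler_wpM2l; first by rewrite realC_ge0.
by apply: H; rewrite subnK // -ltnS.
Qed.

(** The real part of a complex Gaussian of variance [s] is a real Gaussian of variance [s / 2]. Only
    the central binomial term survives, and none does for odd [m]. *)
Lemma Mm_gmom m : Mm m = gmom R m * Num.sqrt (s / 2) ^+ m.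
Proof.
have s20 : 0 <= s / 2 by rewrite divr_ge0 // (le_trans ler01).
have [k [mE|mE]] : exists k, m = k.*2 \/ m = k.*2.+1.
- by exists m./2; have h := odd_double_half m; case: (odd m) h => h; [right|left]; rewrite -{1}h.
  rewrite {m}mE.
  have kk : (k < k.*2.+1)%N by clear; lia.
  rewrite /Mm (bigD1 (Ordinal kk)) //= big1 ?addr0; last first.
    move=> j jk; have -> : (k.*2 - j == j)%N = false; last by rewrite mul0r mulr0.
    apply/eqP => e; case/eqP: jk; apply: val_inj => /=; by move: (ltn_ord j) e; clear; lia.
  have -> : (k.*2 - k = k)%N by clear; lia.
  have tE : Num.sqrt (s / 2) ^+ k.*2 = s ^+ k / 2 ^+ k by rewrite -mul2n exprM sqr_sqrtr // expr_div_n.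
  have t2 : 2 ^- k.*2 = (2 ^+ k * 2 ^+ k)^-1 :> R by rewrite -addnn exprD.
  have f0 : k`!%:R != 0 :> R by rewrite pnatr_eq0 -lt0n fact_gt0.
  have p0 : 2 ^+ k != 0 :> R by rewrite expf_neq0 // pnatr_eq0.
  have k2 : (k <= k.*2)%N by rewrite -addnn leq_addr.
  have b' : 'C(k.*2, k)%:R * (k`!%:R * k`!%:R) = (k.*2)`!%:R :> R.
    rewrite -!natrM -(bin_fact k2); congr (_ * (_ * _`!))%N%:R; clear; lia.
  have b2 : 'C(k.*2, k)%:R = (k.*2)`!%:R / (k`!%:R * k`!%:R) :> R.
    by rewrite -b' mulfK // mulf_neq0.
  rewrite eqxx mul1r tE t2 b2 -(gmom_double R k).
  move: (gmom R _) (2 ^+ k) (k`!%:R) f0 p0 (s ^+ k) => u v w w0 v0 z.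
  by field; rewrite v0 w0.
rewrite {m}mE gmom_odd mul0r /Mm big1 // => j _.
have -> : (k.*2.+1 - j == j)%N = false by apply/eqP; clear; lia.
by rewrite mul0r mulr0.
Qed.
End RealMoments.

(** * Stability under small perturbations *)

Section Stability.
Variable R : realType.

Lemma gdens_le1 (x : R) : gdens x <= 1.
Proof.
rewrite /gdens -[leRHS]mulr1; apply: ler_pM; rewrite ?invr_ge0 ?sqrtr_ge0 ?expR_ge0 //.
  have h : 1 <= 2 * pi :> R by have := pi_ge2 R; lra.
  rewrite invf_le1 ?sqrtr_gt0; last by apply: lt_le_trans h.
  by rewrite -[leLHS]sqrtr1; apply: ler_wsqrtr.
by rewrite -[leRHS]expR0 ler_expR oppr_le0 divr_ge0 // sqr_ge0.
Qed.

Lemma gint_indic_le (a b : R) : a <= b -> gint \1_`]a, b[ <= b - a.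
Proof.
move=> ab; have mI : measurable (`]a, b[ : set R) by exact: measurable_itv.
have M : lebesgue_measure (`]a, b[%classic : set R) = (if a < b then (b - a)%:E else 0%E).
  by rewrite lebesgue_measure_itv /= lte_fin EFinB.
have -> : gint \1_`]a, b[ = \int[@lebesgue_measure R]_(x in `]a, b[) gdens x.
  rewrite -[LHS](_ : gint (fun x => 1 * \1_`]a, b[ x) = _); last first.
    by congr gint; apply/funext => x; rewrite mul1r.
  by rewrite gint_patch; apply: eq_Rintegral => x _; rewrite mul1r.
apply: (@le_trans _ _ (\int[@lebesgue_measure R]_(x in `]a, b[) (cst 1 x))).
  apply: le_Rintegral => //; first exact: gdens_integrable.
    apply/integrableP; split; first by apply/measurable_EFinP; exact: measurable_cst.
    rewrite (eq_integral (cst 1%:E)); last by move=> x _; rewrite /= normr1.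
    rewrite integral_cst // mul1e.
    have h : (lebesgue_measure (`]a, b[%classic : set R) < +oo)%E by rewrite M; case: ifP => _; rewrite ltry.
    exact: h.
  by move=> x _; exact: gdens_le1.
rewrite /Rintegral (eq_integral (cst 1%:E)) // integral_cst // mul1e.
have h : fine (lebesgue_measure (`]a, b[%classic : set R)) <= b - a.
  by rewrite M; case: ifP => _ //=; rewrite subr_ge0.
exact: h.
Qed.

Lemma indic_itvE (a b x : R) : \1_(`]a, b[ : set R) x = ((a < x) && (x < b))%:R :> R.
Proof.
rewrite indicE; congr (nat_of_bool _)%:R; apply/idP/idP => [/set_mem|h]; first by rewrite /= in_itv.
by apply/mem_set; rewrite /= in_itv.
Qed.

(** An endpoint can separate points at distance at most [k] only if it is within [k] of [x]; the
    half-width [2 k] leaves room for strict inequalities. *)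
Lemma indic_diff (a b k x y : R) : 0 < k ->
  `|\1_(`]a, b[ : set R) x - \1_(`]a, b[ : set R) y| <=
  (k < `|x - y|)%R%:R + \1_(`]a - 2 * k, a + 2 * k[ : set R) x + \1_(`]b - 2 * k, b + 2 * k[ : set R) x :> R.
Proof.
move=> k0; rewrite !indic_itvE; case: (ltP k `|x - y|) => [_|xy].
  apply: (@le_trans _ _ 1); last by rewrite -addrA lerDl addr_ge0.
  by case: (_ && _); case: (_ && _); rewrite ?subrr ?subr0 ?sub0r ?normrN ?normr1 ?normr0.
move: xy; rewrite ler_norml => /andP[h1 h2]; rewrite add0r.
case: (ltP a x) => ax; case: (ltP x b) => xb; case: (ltP a y) => ay; case: (ltP y b) => yb;
  rewrite /= ?subrr ?subr0 ?sub0r ?normrN ?normr1 ?normr0 ?addr_ge0 //.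
all: try (have -> : (a - 2 * k < x) && (x < a + 2 * k) by apply/andP; split; lra); rewrite ?lerDl //.
all: try (have -> : (b - 2 * k < x) && (x < b + 2 * k) by apply/andP; split; lra); rewrite ?lerDr //.
Qed.

(** Passing from [X] to [Y] changes the indicator only where they differ by more than [k], a set of
    small [w]-mass by hypothesis, or where [X] is near [a] or [b]. These windows have small mass by
    the unweighted limit law for [X], hence small [w]-mass by [mean_AMGM]. The majorant [w] of [|v|]
    lets [v] be a real or an imaginary part. *)
Theorem stable_clt (a b e C : R) : a < b -> 0 < e -> 0 < C ->
  exists N, exists2 d : R, 0 < d & exists2 k : R, 0 < k &
  forall n (v w X Y : nat -> R) (c : R), `|c| <= 1 -> (forall j, `|v j| <= w j) ->
    mean n (fun j => w j ^+ 2) <= C ->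
    (forall m, (m < N)%N -> `|mean n (fun j => v j * X j ^+ m) - c * gmom R m| <= d) ->
    (forall m, (m < N)%N -> `|mean n (fun j => X j ^+ m) - gmom R m| <= d) ->
    mean n (fun j => w j * (k < `|X j - Y j|)%R%:R) <= d ->
  `|mean n (fun j => v j * \1_`]a, b[ (Y j)) - c * gint \1_`]a, b[ | <= e.
Proof.
move=> ab e0 C0.
(* Windows of length [4 k = f] have mass at most [2 f]; with [f = t e / 16] the two halves of
   [mean_AMGM] are at most [e / 8] each. *)
pose t := e / (8 * C); have t0 : 0 < t by rewrite divr_gt0 // mulr_gt0.
pose f := t * e / 16; have f0 : 0 < f by rewrite divr_gt0 // mulr_gt0.
pose k := f / 4; have k0 : 0 < k by rewrite divr_gt0.
have e4 : 0 < e / 4 by rewrite divr_gt0.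
have ka : a - 2 * k < a + 2 * k by lra.
have kb : b - 2 * k < b + 2 * k by lra.
have [N1 [d1 d10 H1]] := weighted_clt (papprox_indic ab) e4 C0.
have [N2 [d2 d20 H2]] := weighted_clt (papprox_indic ka) f0 ltr01.
have [N3 [d3 d30 H3]] := weighted_clt (papprox_indic kb) f0 ltr01.
exists (maxn N1 (maxn N2 N3)), (Num.min (Num.min d1 (e / 4)) (Num.min d2 d3)).
  by rewrite !lt_min d10 d20 d30 e4.
exists k => // n v w X Y c c1 vw wC Hv HX HY.
have w0 j : 0 <= w j by apply: le_trans (vw j).
have vC : mean n (fun j => v j ^+ 2) <= C.
  apply: le_trans wC; apply: le_mean => j.
  by rewrite -(real_normK (num_real (v j))) lerXn2r ?nnegrE.
have h1 : `|mean n (fun j => v j * \1_`]a, b[ (X j)) - c * gint \1_`]a, b[ | <= e / 4.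
  apply: H1 => // m mN.
    by apply: le_trans (Hv m _) _; rewrite ?leq_max ?mN // !ge_min lexx.
  by apply: le_trans (HX m _) _; rewrite ?leq_max ?mN // !ge_min lexx.
have m1 : mean n (fun=> 1 ^+ 2 : R) <= 1.
  rewrite /mean; case: n {HY Hv HX h1 vC wC} => [|n]; first by rewrite invr0 mul0r.
  by under eq_bigr do rewrite expr1n; rewrite big_const_ord iter_addr addr0 mulVf // pnatr_eq0.
have hJ (u : R) NN dd : 0 < dd -> Num.min (Num.min d1 (e / 4)) (Num.min d2 d3) <= dd ->
   (NN <= maxn N1 (maxn N2 N3))%N ->
   (forall n (w X : nat -> R) (c : R), `|c| <= 1 -> mean n (fun k => w k ^+ 2) <= 1 ->
    (forall m, (m < NN)%N -> `|mean n (fun k => w k * X k ^+ m) - c * gmom R m| <= dd) ->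
    (forall m, (m < NN)%N -> `|mean n (fun k => X k ^+ m) - gmom R m| <= dd) ->
     `|mean n (fun j => w j * \1_`]u - 2 * k, u + 2 * k[ (X j)) - c * gint \1_`]u - 2 * k, u + 2 * k[ | <= f) ->
   mean n (fun j => \1_`]u - 2 * k, u + 2 * k[ (X j)) <= 2 * f.
  move=> dd0 ddle NNle H.
  have := H n (fun=> 1) X 1; rewrite normr1 => /(_ (lexx _) m1).
  have HX' m : (m < NN)%N -> `|mean n (fun j => X j ^+ m) - gmom R m| <= dd.
    by move=> mN; apply: le_trans (HX m _) ddle; exact: leq_trans mN NNle.
  have HX1 m : (m < NN)%N -> `|mean n (fun j => 1 * X j ^+ m) - 1 * gmom R m| <= dd.
    move=> mN; rewrite mul1r (eq_mean _ (g := fun j => X j ^+ m)); first exact: HX'.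
    by move=> j; rewrite mul1r.
  move=> /(_ HX1 HX'); rewrite mul1r (eq_mean _ (g := fun j => \1_`]u - 2 * k, u + 2 * k[ (X j))); last first.
    by move=> j; rewrite mul1r.
  have uk : u - 2 * k <= u + 2 * k by lra.
  have := gint_indic_le uk; rewrite ler_distl => g1 /andP[_ g2].
  by apply: le_trans g2 _; move: g1; rewrite /k; lra.
have hJa := hJ a N2 d2 d20; have hJb := hJ b N3 d3 d30.
have {hJa} ha := hJa ltac:(by rewrite !ge_min lexx !orbT) ltac:(by rewrite !leq_max leqnn !orbT) H2.
have {hJb} hb := hJb ltac:(by rewrite !ge_min lexx !orbT) ltac:(by rewrite !leq_max leqnn !orbT) H3.
have hw (J : set R) : mean n (fun j => \1_J (X j)) <= 2 * f ->
    mean n (fun j => w j * \1_J (X j)) <= e / 4.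
  move=> hJJ; apply: (@le_trans _ _ (mean n (fun j => `|w j| * `|\1_J (X j) : R|))).
    by apply: le_mean => j; rewrite -normrM ler_norm.
  apply: le_trans (mean_AMGM _ _ _ t0) _.
  have p1 : t * mean n (fun j => w j ^+ 2) <= e / 8.
    apply: le_trans (ler_wpM2l (ltW t0) wC) _; rewrite /t le_eqVlt; apply/orP; left; apply/eqP.
    by field; rewrite gt_eqF.
  have p2 : t^-1 * mean n (fun j => (\1_J (X j) : R) ^+ 2) <= e / 8.
    rewrite (eq_mean _ (g := fun j => \1_J (X j))); last first.
      by move=> j; rewrite indicE; case: (_ \in _); rewrite ?expr1n ?expr0n.
    rewrite ler_pdivrMl //; apply: le_trans hJJ _; rewrite /f; lra.
  lra.
have D : `|mean n (fun j => v j * \1_`]a, b[ (Y j)) - mean n (fun j => v j * \1_`]a, b[ (X j))|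
   <= mean n (fun j => w j * (k < `|X j - Y j|)%R%:R) +
      mean n (fun j => w j * \1_`]a - 2 * k, a + 2 * k[ (X j)) +
      mean n (fun j => w j * \1_`]b - 2 * k, b + 2 * k[ (X j)).
  rewrite -!meanD; apply: (@le_trans _ _ (mean n (fun j => `|v j * (\1_`]a, b[ (X j) - \1_`]a, b[ (Y j))|))).
    rewrite distrC -[X in _ - X]mul1r -mulNr -meanZ -meanD; apply: le_trans (mean_norm _ _) _.
    by apply: le_mean => j; rewrite mulN1r -mulrBr.
  apply: le_mean => j; rewrite normrM -!mulrDr; apply: ler_pM => //; exact: indic_diff.
have wa := hw _ ha; have wb := hw _ hb.
have bad : mean n (fun j => w j * (k < `|X j - Y j|)%R%:R) <= e / 4.
  by apply: le_trans HY _; rewrite !ge_min lexx !orbT.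
move: h1 D; rewrite !ler_norml => /andP[? ?] /andP[? ?]; apply/andP; split; lra.
Qed.
End Stability.

(** * Truncated exponentials *)

Section TruncatedExp.
Variable R : realType.
Local Notation nc := (@Normc.normc R).

Definition texp (l : nat) (z : R[i]) : R[i] := \sum_(a < l.+1) z ^+ a / a`!%:R.

(* Rankin's trick: terms of degree at least [m] are inflated by [8^(n-m)]. *)
Lemma exp_tail (y : R) m : `|expR y - \sum_(0 <= n < m) y ^+ n / n`!%:R| <= 8 ^- m * expR (8 * `|y|).
Proof.
have e8 : (0 : R) < 8 by [].
have fin M : (m <= M)%N -> `|\sum_(0 <= n < M) y ^+ n / n`!%:R - \sum_(0 <= n < m) y ^+ n / n`!%:R|
    <= 8 ^- m * expR (8 * `|y|).
  move=> mM.
  have -> : \sum_(0 <= n < M) y ^+ n / n`!%:R = \sum_(0 <= n < m) y ^+ n / n`!%:R + \sum_(m <= n < M) y ^+ n / n`!%:R :> R.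
    by rewrite (big_cat_nat (n := m)).
  rewrite addrAC subrr add0r.
  apply: le_trans (ler_norm_sum _ _ _) _.
  apply: (@le_trans _ _ (\sum_(m <= n < M) 8 ^- m * ((8 * `|y|) ^+ n / n`!%:R))).
    rewrite big_nat_cond [leRHS]big_nat_cond; apply: ler_sum => n /andP[/andP[mn _] _].
    rewrite normrM normrX normfV normr_nat exprMn -mulrA [leRHS]mulrA ler_peMl //.
    rewrite mulrC ler_pdivlMr ?exprn_gt0 // mul1r; apply: ler_weXn2l => //.
    by rewrite ler1n.
  rewrite -mulr_sumr ler_wpM2l ?invr_ge0 ?exprn_ge0 //.
  have y8 : 0 <= 8 * `|y| by rewrite mulr_ge0.
  apply: le_trans (sum_exp_le M y8); rewrite [leRHS](big_cat_nat (n := m)) //= lerDr.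
  by apply: sumr_ge0 => n _; rewrite divr_ge0 ?exprn_ge0.
apply/ler_addgt0Pr => e e0.
have cv : (series (exp_coeff y)) n @[n --> \oo] --> expR y.
  by rewrite /expR; exact: is_cvg_series_exp_coeff.
move/cvgrPdist_lt: cv => /(_ _ e0) [M _ HM].
have := HM (maxn m M) (leq_maxr _ _); rewrite /series /= => h.
have := fin (maxn m M) (leq_maxl _ _) => h2.
rewrite -(subrKA (\sum_(0 <= n < maxn m M) y ^+ n / n`!%:R)).
apply: le_trans (ler_normD _ _) _; rewrite addrC; apply: lerD => //; exact: ltW.
Qed.

Lemma nc_triangle (I : Type) (s : seq I) (F : I -> R[i]) : nc (\sum_(i <- s) F i) <= \sum_(i <- s) nc (F i).
Proof.
rewrite -lecR -normC_nc realC_sum; apply: le_trans (ler_norm_sum _ _ _) _.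
by apply: ler_sum => i _; rewrite normC_nc.
Qed.

Lemma ncM (x y : R[i]) : nc (x * y) = nc x * nc y.
Proof. by apply: (@complexI R); rewrite realCM -!normC_nc normrM. Qed.

Lemma triangular_sum (F : nat -> nat -> R[i]) l :
  \sum_(n < l.+1) \sum_(a < n.+1) F a (n - a)%N =
  \sum_(a < l.+1) \sum_(b < l.+1) (a + b <= l)%N%:R * F a b.
Proof.
under [LHS]eq_bigr => n _ do rewrite (big_ord_widen_cond l.+1 xpredT (fun a => F a (n - a)%N)) ?ltn_ord //.
rewrite (exchange_big_dep xpredT) //=; apply: eq_bigr => a _.
rewrite -(big_mkord (fun n => (a < n.+1)%N) (fun n => F a (n - a)%N)).
have -> : \sum_(b < l.+1) (a + b <= l)%N%:R * F a b = \sum_(0 <= b < (l.+1 - a)%N) F a b.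
  have al : (l.+1 - a <= l.+1)%N by rewrite leq_subr.
  rewrite -(big_mkord xpredT (fun b => (a + b <= l)%N%:R * F a b)) (big_cat_nat (n := (l.+1 - a)%N)) //=.
  have -> : \sum_(l.+1 - a <= b < l.+1) (a + b <= l)%N%:R * F a b = 0.
    rewrite big_nat_cond big1 // => b /andP[/andP[bl _] _].
    have -> : (a + b <= l)%N = false by move: bl (ltn_ord a); clear; lia.
    by rewrite mul0r.
  rewrite addr0 big_nat_cond [RHS]big_nat_cond; apply: eq_bigr => b /andP[/andP[_ bl] _].
  have -> : (a + b <= l)%N by move: bl; clear; lia.
  by rewrite mul1r.
have al : (a <= l.+1)%N by exact: ltnW.
rewrite (big_cat_nat (n := a)) //= big_nat_cond big1 ?add0r => [|n /andP[/andP[_ na] h]]; last first.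
  by move: na h; clear; lia.
rewrite -{1}[nat_of_ord a]add0n big_addn big_nat_cond [RHS]big_nat_cond.
apply: eq_big => [n|n _]; first by rewrite andbT ltnS leq_addl andbT.
by rewrite addnK.
Qed.

(** Both [|texp l z|^2] and the exponential of [2 Re z], the sum of [z] and its conjugate, contain
    the products of terms of degrees [a] and [b] with [a + b <= l]. What either has beyond these is
    bounded by Rankin's trick with base 8. *)
Lemma texp_sqr l z : `|nc (texp l z) ^+ 2 - expR (2 * complex.Re z)| <=
  2 * (8 ^- l * expR (16 * nc z)).
Proof.
pose r := nc z; have r0 : 0 <= r by exact: normc_ge0.
pose F a b : R[i] := (z ^+ a / a`!%:R) * (Num.conj z ^+ b / b`!%:R).
have facC n : (n`!%:R : R[i]) != 0 by rewrite pnatr_eq0 -lt0n fact_gt0.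
have ncF a b : nc (F a b) = (r ^+ a / a`!%:R) * (r ^+ b / b`!%:R).
  apply: (@complexI R); rewrite -normC_nc normrM !normrM !normfV !normrX norm_conjC !normr_nat normC_nc.
  by rewrite !realCM !rmorphXn !fmorphV /= !rmorph_nat.
have e1 : (nc (texp l z) ^+ 2)%:C = \sum_(a < l.+1) \sum_(b < l.+1) F a b.
  rewrite nc_sqr /texp conjC_sum mulr_suml; apply: eq_bigr => a _.
  rewrite mulr_sumr; apply: eq_bigr => b _; rewrite /F conjCM fmorphV /= conjC_nat.
  by rewrite rmorphXn.
pose y := 2 * complex.Re z.
have yE : y%:C = z + Num.conj z.
  by rewrite /y realCM Re_half mulrA -realCM mulfV // mul1r.
have e2 : (\sum_(0 <= n < l.+1) y ^+ n / n`!%:R)%:C = \sum_(a < l.+1) \sum_(b < l.+1) (a + b <= l)%N%:R * F a b.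
  rewrite -triangular_sum big_mkord realC_sum; apply: eq_bigr => n _.
  rewrite realCM rmorphXn /= yE fmorphV /= rmorph_nat exprDn mulr_suml.
  rewrite (reindex_inj rev_ord_inj) /=; apply: eq_bigr => a _; rewrite /F.
  have an : (a <= n)%N by rewrite -ltnS.
  rewrite subSS subKn // -mulr_natr -(bin_fact an) -{1}(bin_sub an) !natrM.
  have f3 : 'C(n, n - a)%:R != 0 :> R[i] by rewrite pnatr_eq0 -lt0n bin_gt0 leq_subr.
  have f1 := facC a; have f2 := facC (n - a)%N.
  move: (z ^+ _) (Num.conj z ^+ _) (a`!%:R : R[i]) ((n - a)`!%:R : R[i]) ('C(n, n - a)%:R : R[i]) f1 f2 f3.
  by move=> A B u v c u0 v0 c0; field; rewrite u0 v0 c0.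
have e3 : `|nc (texp l z) ^+ 2 - \sum_(0 <= n < l.+1) y ^+ n / n`!%:R| <= 8 ^- l * expR (16 * r).
  rewrite -lecR -normC_real realCB e1 e2 -sumrB normC_nc lecR.
  apply: le_trans (nc_triangle _ _) _.
  apply: (@le_trans _ _ (\sum_(a < l.+1) \sum_(b < l.+1) 8 ^- l * (((8 * r) ^+ a / a`!%:R) * ((8 * r) ^+ b / b`!%:R)))).
    apply: ler_sum => a _; rewrite -sumrB; apply: le_trans (nc_triangle _ _) _; apply: ler_sum => b _.
    have p0 n : 0 <= r ^+ n / n`!%:R by rewrite divr_ge0 ?exprn_ge0.
    have p8 n : 0 <= (8 * r) ^+ n / n`!%:R by rewrite divr_ge0 ?exprn_ge0 ?mulr_ge0.
    case: (leqP (a + b) l) => ab.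
      rewrite mul1r subrr (_ : nc 0 = 0); last by apply: (@complexI R); rewrite -normC_nc normr0.
      by rewrite mulr_ge0 ?invr_ge0 ?exprn_ge0 // mulr_ge0.
    rewrite mul0r subr0 ncF !exprMn.
    have -> : 8 ^- l * (8 ^+ a * r ^+ a / a`!%:R * (8 ^+ b * r ^+ b / b`!%:R)) =
       (8 ^+ (a + b) / 8 ^+ l) * (r ^+ a / a`!%:R * (r ^+ b / b`!%:R)) :> R.
      rewrite exprD; move: (8 ^+ l : R)^-1 (8 ^+ a : R) (8 ^+ b : R) (r ^+ a) (r ^+ b) (a`!%:R : R)^-1 (b`!%:R : R)^-1.
      by move=> t1 t2 t3 t4 t5 t6 t7; ring.
    apply: ler_peMl; first by rewrite mulr_ge0.
    rewrite ler_pdivlMr ?exprn_gt0 // mul1r.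
    by apply: ler_weXn2l; [rewrite ler1n|exact: ltnW].
  under eq_bigr do rewrite -mulr_sumr.
  rewrite -mulr_sumr ler_wpM2l ?invr_ge0 ?exprn_ge0 //.
  have r8 : 0 <= 8 * r by rewrite mulr_ge0.
  have := sum2_exp_le l.+1 r8; rewrite big_mkord; under eq_bigr do rewrite big_mkord.
  by rewrite (_ : 8 * r + 8 * r = 16 * r) //; ring.
have e4 : `|expR y - \sum_(0 <= n < l.+1) y ^+ n / n`!%:R| <= 8 ^- l * expR (16 * r).
  apply: le_trans (exp_tail y l.+1) _; apply: ler_pM; rewrite ?invr_ge0 ?exprn_ge0 ?expR_ge0 //.
    by rewrite lef_pV2 ?posrE ?exprn_gt0 //; apply: ler_weXn2l; [rewrite ler1n|exact: leqnSn].
  rewrite ler_expR normrM ger0_norm //; have := Re_le_nc z; rewrite -/r; lra.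
move: e3 e4; rewrite -/y; move: (\sum_(_ <= _ < _) _) (8 ^- l * _) (expR y) => S B E.
by rewrite !ler_norml => /andP[? ?] /andP[? ?]; apply/andP; split; lra.
Qed.

(** [32 |z| <= l] gives [expR (18 |z|) <= expR (9/16) ^+ l <= 4 ^+ l]. As
    [expR (2 Re z) >= expR (-2 |z|)] and [4 * 4^l <= 8^l] for [l >= 2], the error in [texp_sqr] is
    at most half of [expR (2 Re z)]. *)
Lemma ln_texp l z : (1 < l)%N -> 32 * nc z <= l%:R -> `|ln (nc (texp l z)) - complex.Re z| <= 1 /\ 0 < nc (texp l z).
Proof.
move=> l1 zl; pose x := complex.Re z; pose E := expR (2 * x).
have r0 : 0 <= nc z by exact: normc_ge0.
have xr : `|x| <= nc z by exact: Re_le_nc.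
have E0 : 0 < E by exact: expR_gt0.
have q4 : expR (9 / 16) <= 4 :> R.
  have := @expR_ge1Dx R (- (9 / 16)); have := expR_gt0 (9 / 16 : R); have := expRxMexpNx_1 (9 / 16 : R).
  by move: (expR _) (expR _) => u v; nra.
have key : 2 * (8 ^- l * expR (16 * nc z)) <= E / 2.
  have h1 : expR (18 * nc z) <= 4 ^+ l.
    apply: (@le_trans _ _ (expR (9 / 16) ^+ l)); last by rewrite lerXn2r ?nnegrE ?expR_ge0.
    by rewrite -expRM_natr ler_expR; lra.
  have h2 : expR (16 * nc z) <= E * 4 ^+ l.
    rewrite -ler_pdivrMl // -expRN -expRD; apply: le_trans h1; rewrite ler_expR.
    by move: xr; rewrite ler_norml => /andP[]; lra.
  have h3 : 4 * 4 ^+ l <= 8 ^+ l :> R.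
    have -> : (8 : R) = 2 * 4 by rewrite -natrM.
    rewrite exprMn ler_pM2r ?exprn_gt0 //; have -> : (4 : R) = 2 ^+ 2 by rewrite -natrX.
    by apply: ler_weXn2l => //; rewrite ler1n.
  have P8 : 0 < 8 ^+ l :> R by rewrite exprn_gt0.
  rewrite mulrCA ler_pdivrMl //.
  move: h2 h3; move: (expR _) (4 ^+ l) (8 ^+ l) E0 => u v w E0 h2 h3.
  by have := ler_wpM2l (ltW E0) h3; lra.
have := texp_sqr l z; rewrite -/x -/E; set n := nc (texp l z).
have n0 : 0 <= n by exact: normc_ge0.
rewrite ler_norml => /andP[g1 g2].
have n2lo : E / 2 <= n ^+ 2 by lra.
have n2hi : n ^+ 2 <= 2 * E by lra.
have np : 0 < n.
  by rewrite lt0r n0 andbT; apply/eqP => nz; move: n2lo; rewrite nz expr0n /=; lra.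
split => //.
have l2 : ln 2 <= 1 :> R by have := @le_ln1Dx R 1; rewrite -[1 + 1]/(2 : R); apply; lra.
have a1 : ln (E / 2) <= ln (n ^+ 2) by rewrite ler_ln ?posrE ?exprn_gt0 //; lra.
have a2 : ln (n ^+ 2) <= ln (2 * E) by rewrite ler_ln ?posrE ?exprn_gt0 //; lra.
move: a1 a2; rewrite ln_div ?posrE // lnM ?posrE // lnXn // /E expRK mulr2n.
by move: (ln n) (ln 2) l2 => u v; rewrite ler_norml => *; apply/andP; split; lra.
Qed.
End TruncatedExp.

(** * Mollifier blocks as truncated exponentials *)

Section BlockExponential.
Variables (R : realType) (q : nat).
Hypothesis pq : prime q.
Local Notation nc := (@Normc.normc R).

(** The multinomial theorem [SOm_nu], degree by degree: [nu] supplies the multinomial coefficients,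
    and the Liouville sign turns the prime sum into its negative. *)
Lemma mpoly_block_texp l ps k : all prime ps -> uniq ps ->
  @mpoly R q pq (block l ps) k = texp l (- Psum R pq ps k).
Proof.
move=> aps ups; pose F n : R[i] := (mcoef R n * isq n%:R)%:C * dchar R pq k n%:Z.
have -> : @mpoly R q pq (block l ps) k = \sum_(j < l.+1) \sum_(n <- smooth l ps | prime_Omega n == j) F n.
  rewrite /mpoly /block big_filter -/F.
  under [RHS]eq_bigr do rewrite big_mkcond.
  rewrite exchange_big /= big_mkcond; apply: eq_bigr => n _; rewrite -big_mkcond /=.
  case: (leqP (prime_Omega n) l) => nl.
    rewrite (big_pred1 (Ordinal (n:=l.+1) (m:=prime_Omega n) nl)) //.
  rewrite big_pred0 // => j; apply/negbTE/eqP => e; move: nl (ltn_ord j); rewrite e; clear; lia.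
apply: eq_bigr => j _; have jl : (j <= l)%N by rewrite -ltnS.
have H := @SOm_nu R (fun n => (isq (n%:R : R))%:C * dchar R pq k n%:Z) l j ps.
rewrite isq1 mul1r dchar_nat fchar1 in H.
have {}H := H erefl _ aps ups jl.
rewrite [- Psum _ _ _ _]/(- _) exprNn -mulrA.
have -> : Psum R pq ps k ^+ j / j`!%:R =
    SOm l (fun n => (nu R n)%:C * ((isq (n%:R : R))%:C * dchar R pq k n%:Z)) j ps.
  rewrite H // => m n; rewrite dcharM natrM isqM ?ler0n // realCM.
  by rewrite mulrACA.
rewrite /SOm mulr_sumr; apply: eq_bigr => n /eqP nj.
have -> : (-1) ^+ j = ((-1) ^+ j : R)%:C :> R[i] by rewrite rmorphXn /= rmorphN1.
by rewrite /F /mcoef /liouville nj !mulrA -!realCM.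
Qed.

Lemma sum_nu_mollD js : wf_blocks js ->
  \sum_(n <- mollD js) nu R n / n%:R <= expR (\sum_(b <- js) s1 R b.2).
Proof.
have um : multiplicative (fun n => nu R n / n%:R).
  by move=> m n m0 n0 c; rewrite nuM // natrM invfM mulrACA.
elim: js => [_|b js IH wf] /=; first by rewrite big_seq1 nu1 divr1 big_nil expR0.
have [ab ub b0 wf' _] := wf_blocks_cons wf.
rewrite (sum_prodl_mult um (posl_block ab) (posl_mollD wf') (coprimel_block_mollD wf)).
rewrite big_cons expRD; apply: ler_pM; try by apply: sumr_ge0 => n _; rewrite divr_ge0 ?nu_ge0.
  rewrite /block big_filter; apply: (@le_trans _ _ (\sum_(n <- smooth b.1 b.2) nu R n / n%:R)).
    rewrite big_mkcond; apply: ler_sum => n _; case: ifP => // _.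
    by rewrite divr_ge0 ?nu_ge0.
  rewrite (sum_smooth b.1 ab ub um) ?nu1 ?divr1 // /s1 expR_sum.
  rewrite big_seq [leRHS]big_seq; apply: ler_prod => p pb.
  have pp := allP ab p pb.
  have x0 : 0 <= p%:R^-1 :> R by rewrite invr_ge0.
  apply/andP; split; first by apply: sumr_ge0 => n _; rewrite divr_ge0 ?nu_ge0.
  apply: le_trans (sum_exp_le b.1.+1 x0); apply: ler_sum => a _.
  by rewrite nuX // natrX mulrC exprVn.
exact: IH.
Qed.

(** Orthogonality leaves the diagonal, where [nu^2 <= nu] gives a comparison with an Euler product
    of exponential series. *)
Lemma mpoly_moment_le js : wf_blocks js -> (forall n, n \in mollD js -> (n < q)%N) ->
  ravg q (fun k => nc (@mpoly R q pq (mollD js) k) ^+ 2) <= expR (\sum_(b <- js) s1 R b.2).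
Proof.
move=> wf nq; apply: le_trans (sum_nu_mollD wf).
pose A := [seq (mcoef R n, n) | n <- mollD js].
have wA : wfA q A.
  by apply/allP => _ /mapP[n nD ->] /=; rewrite (posl_mollD wf nD) nq.
have := avg_dpoly2 pq wA wA.
rewrite (@eq_avg R q _ (fun k => (nc (@mpoly R q pq (mollD js) k) ^+ 2)%:C)); last first.
  by move=> k; rewrite nc_sqr dpoly_mpoly.
rewrite -ravgC => /complexI ->.
rewrite /A big_map big_seq [leRHS]big_seq; apply: ler_sum => n nD; rewrite big_map /=.
rewrite (bigD1_seq n) ?uniq_mollD //= eqxx mul1r big1 ?addr0; last first.
  by move=> m; rewrite eq_sym => /negbTE ->; rewrite mul0r.
rewrite ler_wpM2r // -expr2 -(real_normK (num_real _)) normr_mcoef expr2.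
by rewrite ler_piMl ?nu_ge0 // nu_le1.
Qed.
End BlockExponential.

(** * Exceptional characters *)

Section BadEvent.
Variable R : realType.

(** Let [E = expR (- dl)]. If [w = L m0 m1] and [m1] lie in [[E, 1/E]] and [P <= T], then
    [ln L = ln w - ln m0 - ln m1] is within [2 dl + 1] of [x] and the indicator vanishes. Every way
    to violate this bounds [w] by [E] or [1/T] times quantities whose means are under control. *)
Lemma bad_pointwise (L m0 m1 P x T dl k sg : R) : 0 <= L -> 0 <= m0 -> 0 <= m1 -> 0 <= P ->
  0 < T -> 0 < sg -> 0 <= dl -> 2 * dl + 1 <= k * sg ->
  (P <= T -> 0 < m0 /\ `|ln m0 + x| <= 1) ->
  L * m0 * m1 * (k < `|x / sg - ln L / sg|)%R%:R <=
  expR (- dl) * (2 * (L * m0 * m1) ^+ 2 + (m1 ^+ 2 + ((L * m0) ^+ 2 + 2))) +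
  T^-1 * ((L * m0 * m1) ^+ 2 + P ^+ 2).
Proof.
move=> L0 m00 m10 P0 T0 s0 d0 ks H.
set E := expR (- dl); have E0 : 0 < E by exact: expR_gt0.
have E1 : E <= 1 by rewrite -[leRHS]expR0 ler_expR oppr_le0.
have Ti : 0 < T^-1 by rewrite invr_gt0.
set v := L * m0; set w := v * m1.
have v0 : 0 <= v by exact: mulr_ge0.
have w0 : 0 <= w by exact: mulr_ge0.
have pA : 0 <= T^-1 * (w ^+ 2 + P ^+ 2) by rewrite mulr_ge0 ?(ltW Ti) // addr_ge0 ?sqr_ge0.
have pB : 0 <= E * (2 * w ^+ 2 + (m1 ^+ 2 + (v ^+ 2 + 2))).
  by rewrite mulr_ge0 ?(ltW E0) // !addr_ge0 ?mulr_ge0 ?sqr_ge0.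
case: (ltP k _) => [bad|_]; last by rewrite mulr0 addr_ge0.
rewrite mulr1; case: (ltP T P) => TP.
  apply: ler_wpDl => //; rewrite mulrC ler_pdivlMr //.
  have := ler_wpM2l w0 (ltW TP); have := sqr_ge0 (w - P); nra.
have Emon a : 0 <= a -> a <= 2 * w ^+ 2 + (m1 ^+ 2 + (v ^+ 2 + 2)) ->
    w <= E * a -> w <= E * (2 * w ^+ 2 + (m1 ^+ 2 + (v ^+ 2 + 2))) + T^-1 * (w ^+ 2 + P ^+ 2).
  move=> a0 ab wa; apply: ler_wpDr => //; apply: le_trans wa _.
  by apply: ler_wpM2l => //; exact: ltW.
have sw := sqr_ge0 w; have sm := sqr_ge0 m1; have sv := sqr_ge0 v.
case: (ltP w E) => wE; first by apply: (Emon 1) => //; rewrite ?mulr1 ?(ltW wE) //; lra.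
case: (ltP 1 (E * w)) => wE'.
  apply: (Emon (w ^+ 2)) => //; first lra.
  by rewrite expr2 mulrA ler_peMl // ltW.
(* Here [w = v m1 <= E v], and this is the reason why the mean square of [L m0] alone enters the
   bound. *)
case: (ltP m1 E) => mE.
  apply: (Emon (v ^+ 2 + 1)); [lra|lra|].
  have : v <= v ^+ 2 + 1 by have := sqr_ge0 (v - 1); nra.
  move=> h; apply: (@le_trans _ _ (E * v)); last by apply: ler_wpM2l => //; exact: ltW.
  by rewrite /w mulrC; apply: ler_wpM2r => //; exact: ltW.
case: (ltP 1 (E * m1)) => mE'.
  apply: (Emon (w * m1)); first exact: mulr_ge0.
    by have := sqr_ge0 (w - m1); nra.
  by rewrite [w * _]mulrC mulrA ler_peMl // ltW.
have [m0p lnm] := H TP.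
have wp : 0 < w by exact: lt_le_trans wE.
have mp : 0 < m1 by exact: lt_le_trans mE.
have Lp : 0 < L.
  by rewrite lt0r L0 andbT; apply/eqP => z; move: wp; rewrite /w /v z !mul0r ltxx.
have lw : ln w = ln L + ln m0 + ln m1 by rewrite /w /v !lnM ?posrE // mulr_gt0.
have lnE : ln E = - dl by rewrite expRK.
have h1 : - dl <= ln w by rewrite -lnE ler_ln.
have h2 : - dl <= ln m1 by rewrite -lnE ler_ln.
have h3 : - dl + ln w <= 0 by rewrite -lnE -lnM ?posrE //; exact: ln_le0.
have h4 : - dl + ln m1 <= 0 by rewrite -lnE -lnM ?posrE //; exact: ln_le0.
move: bad; rewrite -mulrBl normrM (gtr0_norm (x := sg^-1)) ?invr_gt0 // ltr_pdivlMr //.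
move: lnm h1 h2 h3 h4; rewrite lw; move: (ln L) (ln m0) (ln m1) (k * sg) ks => a b c z kz.
rewrite ler_norml => /andP[? ?] ? ? ? ?; rewrite ltNge => /negP[]; rewrite ler_norml; apply/andP; split; lra.
Qed.

Lemma mean_cst_le n (c : R) : 0 <= c -> mean n (fun=> c) <= c.
Proof.
move=> c0; rewrite /mean; case: n => [|n]; first by rewrite invr0 mul0r.
by rewrite big_const_ord iter_addr addr0 -[c *+ _]mulr_natl mulKf // pnatr_eq0.
Qed.

Lemma bad_mean n (L m0 m1 P x : nat -> R) (T dl k sg Cw C1 C0 CP : R) :
  (forall j, 0 <= L j) -> (forall j, 0 <= m0 j) -> (forall j, 0 <= m1 j) -> (forall j, 0 <= P j) ->
  0 < T -> 0 < sg -> 0 <= dl -> 2 * dl + 1 <= k * sg ->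
  (forall j, P j <= T -> 0 < m0 j /\ `|ln (m0 j) + x j| <= 1) ->
  mean n (fun j => (L j * m0 j * m1 j) ^+ 2) <= Cw -> mean n (fun j => m1 j ^+ 2) <= C1 ->
  mean n (fun j => (L j * m0 j) ^+ 2) <= C0 -> mean n (fun j => P j ^+ 2) <= CP ->
  mean n (fun j => L j * m0 j * m1 j * (k < `|x j / sg - ln (L j) / sg|)%R%:R) <=
  expR (- dl) * (2 * Cw + (C1 + (C0 + 2))) + T^-1 * (Cw + CP).
Proof.
move=> L0 m00 m10 P0 T0 s0 d0 ks H hw h1 h0 hP.
apply: le_trans (le_mean _ (fun j => bad_pointwise (L0 j) (m00 j) (m10 j) (P0 j) T0 s0 d0 ks (H j))) _.
rewrite (meanD n (fun j => expR (- dl) * _) (fun j => T^-1 * _)) !meanZ.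
rewrite (meanD n (fun j => 2 * _) (fun j => m1 j ^+ 2 + _)) meanZ.
rewrite (meanD n (fun j => m1 j ^+ 2) (fun j => _ + 2)) (meanD n (fun j => (L j * m0 j) ^+ 2) (fun=> 2)).
rewrite (meanD n (fun j => (L j * m0 j * m1 j) ^+ 2) (fun j => P j ^+ 2)).
have h2 := @mean_cst_le n 2 (ler0n _ _).
apply: lerD; apply: ler_wpM2l; rewrite ?invr_ge0 ?(ltW T0) ?expR_ge0 //; lra.
Qed.
End BadEvent.

(** * Estimates at a fixed modulus *)

Section AtModulus.
Variables (R : realType) (c0 eta : R) (q : nat).
Hypotheses (pq : prime q) (c0_ge0 : 0 <= c0) (eta0 : 0 < eta).
Local Notation th := (theta eta q).
Local Notation Lq := (ln q%:R : R).
Local Notation LL := (ln Lq).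
Local Notation nc := (@Normc.normc R).
Local Notation Lhz := (@Lhz R q pq).
Local Notation mpoly := (@mpoly R q pq).
Local Notation Yq := (Yq eta q).
Hypothesis LL2 : 2 <= LL.
Hypothesis c0Y : (Num.truncn c0 <= Yq 0)%N.
Hypothesis thL : 2 <= th 0 * Lq.
Hypothesis Lq23 : 23 <= Lq.
Hypothesis ell0 : 2 ^- ell eta q 0 * expR ((Cc R + 1) * (ln (1 + Lq) + 3)) <= 1.
Hypothesis errq : 316 * (q%:R `^ 100^-1) ^+ 6 * isq q%:R <= 1 :> R.
Variable J : nat.
Hypothesis thJ1 : th J <= 1.
Hypothesis thJsmall : th J `^ 4^-1 <= 1000^-1.
Variable N : nat.
Hypothesis N0 : (0 < N)%N.
Hypothesis NT : N%:R * th 0 <= 100^-1.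
Local Notation l := (ell eta q 0).
Local Notation ps := (pblk c0 eta q 0).
Local Notation js := (blocks c0 eta q 1 J).
Hypothesis Nl : (N <= l)%N.
Hypothesis s_ge1 : 1 <= s1 R ps.
Hypothesis s_leLL : s1 R ps <= LL.
Let s := s1 R ps.
Let sg : R := Num.sqrt (LL / 2).
Let X : R := q%:R `^ 100^-1.
Let Y : R := q%:R `^ th 0.

Definition Wq k : R[i] := Lhz k * mpoly (mollD (blocks c0 eta q 0 J.+1)) k.
Definition Xv k : R := rP R pq ps k / Num.sqrt (LL / 2).
Definition Yv k : R := ln (nc (Lhz k)) / Num.sqrt (LL / 2).

Let LL0 : 0 < LL. Proof. exact: lt_le_trans LL2. Qed.
Let q0 : (0 < q)%N := prime_gt0 pq.
Let Lq0 : 0 < Lq. Proof. exact: lt_le_trans Lq23. Qed.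
Let wf : wf_blocks ((l, ps) :: js). Proof. exact: (wf_blocks_js pq eta0 LL0 c0Y thJ1 (leqnn J)). Qed.
Let s2ps : s2 R ps <= 1. Proof. exact: s2_le. Qed.
Let DX n : n \in mollD ((l, ps) :: js) -> n%:R <= X.
Proof. exact: (mollD_length pq eta0 LL0 c0Y thJ1 thJsmall (leqnn J)). Qed.
Let Y1 : 1 <= Y.
Proof. by rewrite /Y (powRqE pq) -[leLHS]expR0 ler_expR; apply: le_trans thL. Qed.
Let psY p : p \in ps -> p%:R <= Y.
Proof.
rewrite mem_prime_interval => /and3P[_ _ pY]; apply: (@le_trans _ _ (Yq 0)%:R); first by rewrite ler_nat.
by rewrite /Yq truncn_le powR_ge0.
Qed.
Let YX : Y ^+ N <= X.
Proof.
rewrite /Y /X !(powRqE pq) -expRM_natl ler_expR mulrA.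
by apply: ler_wpM2r; [exact: ltW|exact: NT].
Qed.
Let Xq : X * X < q%:R.
Proof.
rewrite /X (powRqE pq) -expRD -[ltRHS](lnK (x := q%:R)) ?posrE ?ltr0n // ltr_expR.
by move: Lq0; move: (Lq) => u ?; lra.
Qed.
Let X1 : 1 <= X. Proof. by apply: le_trans YX; exact: exprn_ege1. Qed.
Let aps : all prime ps. Proof. by have [] := wf_blocks_cons wf. Qed.
Let ups : uniq ps. Proof. by have [] := wf_blocks_cons wf. Qed.
Let wf' : wf_blocks js. Proof. by have [] := wf_blocks_cons wf. Qed.
Let l0 : (0 < l)%N. Proof. by have [] := wf_blocks_cons wf. Qed.
Let sg1 : 1 <= sg. Proof. by rewrite -[leLHS]sqrtr1; apply: ler_wsqrtr; rewrite ler_pdivlMr // mul1r. Qed.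
Let sg0 : 0 < sg. Proof. exact: lt_le_trans sg1. Qed.
Let sg2 : sg ^+ 2 = LL / 2. Proof. by rewrite sqr_sqrtr // divr_ge0 // ltW. Qed.

Lemma mean_Wq2 : mean q.-1 (fun k => nc (Wq k) ^+ 2) <= K5 c0 / th J.
Proof. exact: (mollified_moment_le pq c0_ge0 eta0 LL0 c0Y thL Lq23 ell0 errq thJ1 thJsmall (leqnn J)). Qed.

Let WE k : nc (Wq k) = nc (Lhz k) * nc (mpoly (block l ps) k) * nc (mpoly (mollD js) k).
Proof.
rewrite -!ncM /Wq -mulrA; congr (nc (_ * _)).
exact: (mpoly_prodl R pq k (posl_block aps) (posl_mollD wf') (coprimel_block_mollD wf)).
Qed.

Let mean_Lm0 : mean q.-1 (fun k => (nc (Lhz k) * nc (mpoly (block l ps) k)) ^+ 2) <= K5 c0 / th 0.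
Proof.
apply: le_trans (mollified_moment_le pq c0_ge0 eta0 LL0 c0Y thL Lq23 ell0 errq thJ1 thJsmall (leq0n J)).
rewrite le_eqVlt; apply/orP; left; apply/eqP; apply: eq_mean => k.
rewrite (mpoly_mollD R pq k (wf_blocks_js pq eta0 LL0 c0Y thJ1 (leq0n J))) big_seq1.
by rewrite ncM.
Qed.

(** The primes of the blocks [1..J] lie between about [q ^ (th 0)] and [q], so their reciprocals sum
    to at most [- ln (th 0) + O(1)]. *)
Let mean_m1 : mean q.-1 (fun k => nc (mpoly (mollD js) k) ^+ 2) <= 4 * expR 5 / th 0.
Proof.
have t0 : 0 < th 0 := th_gt0 eta0 LL0 0.
have nq n : n \in mollD js -> (n < q)%N.
  move=> nD; rewrite -(ltr_nat R); apply: le_lt_trans (DX _) _; last first.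
    by apply: le_lt_trans Xq; apply: ler_peMr => //; exact: le_trans X1.
  apply/prodlP; exists 1%N, n; split => //; last by rewrite mul1n.
  rewrite /block mem_filter prime_Omega1 /= mem_smooth //= ; apply/allP => p _; by rewrite logn1.
have Y0Y : (Yq 0 <= Yq J)%N := Yq_mono pq eta0 LL0 (leq0n J).
apply: le_trans (mpoly_moment_le R pq wf' nq) _.
have -> : \sum_(b <- js) s1 R b.2 = s1 R (prime_interval (Yq 0) (Yq J)).
  have := sum_s1_blocks pq eta0 LL0 c0Y (fun p => p%:R^-1 : R) J.
  rewrite (prime_interval_cat c0Y Y0Y) big_cat /= => /eqP.
  by rewrite [X in X == _]big_cons (inj_eq (addrI _)) => /eqP.
have h1 := s1_interval_le R (Yq_gt1 pq eta0 LL0 thL 0) Y0Y.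
have h2 := ln_Yq_le pq eta0 LL0 thL J; have h3 := ln_Yq_ge pq eta0 LL0 thL 0.
have tLp : 0 < th 0 * Lq / 2 by rewrite divr_gt0 // mulr_gt0.
have Lp : 0 < 1 + Lq by rewrite addr_gt0.
apply: le_trans (_ : _ <= expR (ln (1 + Lq) - ln (th 0 * Lq / 2) + 5)) _.
  rewrite ler_expR; apply: le_trans h1 _.
  have g0 : 0 <= ln (Yq J)%:R :> R by rewrite ln_ge0 // ler1n (ltn_trans _ (Yq_gt1 pq eta0 LL0 thL J)).
  have g1 : ln (1 + ln (Yq J)%:R) <= ln (1 + Lq).
    have p1 : 0 < 1 + ln (Yq J)%:R :> R by exact: ltr_pwDl.
    have p2 : ln (Yq J)%:R <= Lq by apply: le_trans h2 _; apply: ler_piMl; [exact: ltW|].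
    by rewrite ler_ln ?posrE // lerD2l.
  have g2 : ln (th 0 * Lq / 2) <= ln (ln (Yq 0)%:R).
    by rewrite ler_ln ?posrE //; exact: lt_le_trans h3.
  by apply: lerD => //; apply: lerD => //; rewrite lerN2.
rewrite expRD expRD expRN !lnK ?posrE //.
have -> : 4 * expR 5 / th 0 = 2 * Lq / (th 0 * Lq / 2) * expR 5.
  by move: (expR 5) Lq0 t0 => e; move: (Lq) (th 0) => u v u0 v0; field; rewrite !gt_eqF.
apply: ler_wpM2r; first exact: expR_ge0.
apply: ler_wpM2r; first by rewrite invr_ge0 ltW.
by rewrite mulr_natl mulr2n lerD2r (le_trans _ Lq23) // ler1n.
Qed.

Let mean_P2 : mean q.-1 (fun k => nc (Psum R pq ps k) ^+ 2) = s.
Proof.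
have := umoment pq wf Y1 psY YX Xq Nl N0 N0.
rewrite (@eq_avg R q _ (fun k => (nc (Psum R pq ps k) ^+ 2)%:C)); last by move=> k; rewrite nc_sqr !expr1.
by rewrite -ravgC => /complexI; rewrite U2_1 // eqxx (_ : 1`! = 1%N) // !mul1r.
Qed.

(** [bad_mean] with [T = l / 32], the range in which [ln_texp] makes [ln |M_0|] equal to [- Re P] up
    to 1. *)
Lemma mean_bad_le kp dl : 0 <= dl -> 2 * dl + 1 <= kp * Num.sqrt (LL / 2) ->
  mean q.-1 (fun k => nc (Wq k) * (kp < `|Xv k - Yv k|)%R%:R) <=
  expR (- dl) * (2 * (K5 c0 / th J) + (4 * expR 5 / th 0 + (K5 c0 / th 0 + 2))) +
  (l%:R / 32)^-1 * (K5 c0 / th J + LL).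
Proof.
move=> d0 dk; have l1 : (1 < l)%N by move: l0; rewrite /ell; clear; lia.
rewrite (eq_mean _ (g := fun k => nc (Lhz k) * nc (mpoly (block l ps) k) * nc (mpoly (mollD js) k) *
  (kp < `|rP R pq ps k / sg - ln (nc (Lhz k)) / sg|)%R%:R)); last by move=> k; rewrite WE.
apply: (@bad_mean R q.-1 _ _ _ (fun k => nc (Psum R pq ps k))) => //; try by move=> k; exact: normc_ge0.
- by rewrite divr_gt0 // ltr0n.
- move=> k; rewrite ler_pdivlMr // => Pl; rewrite (mpoly_block_texp R pq l k aps ups).
  have ncN (z : R[i]) : nc (- z) = nc z by apply: (@complexI R); rewrite -!normC_nc normrN.
  have := @ln_texp R l (- Psum R pq ps k) l1; rewrite ncN mulrC => /(_ Pl)[h1 h2]; split => //.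
  by move: h1; rewrite /rP; case: (Psum _ _ _ _) => x y /=; rewrite opprK.
- by rewrite -(eq_mean _ (f := fun k => nc (Wq k) ^+ 2)); [exact: mean_Wq2|move=> k; rewrite WE].
- by rewrite mean_P2.
Qed.

(** In this order: the arithmetic error relative to the standard deviation, the error of the twisted
    first moments, and the change of variance from [s1 / 2] to [ln ln q / 2]. *)
Definition moment_error : R := CN R N * 2 ^+ N / Num.sqrt (s1 R ps) + eN q (q%:R `^ 100^-1 : R) N +
  (\sum_(m < N.+1) `|gmom R m|) * (N%:R * (1 - s1 R ps / LL)).

Let CN0 : 0 <= CN R N.
Proof. by rewrite /CN mulr_ge0 // addr_ge0 ?mulr_ge0 ?expR_ge0. Qed.
Let eN0 : 0 <= eN q X N.
Proof. by rewrite /eN !mulr_ge0 ?isq_ge0 ?exprn_ge0 ?(le_trans ler01 X1). Qed.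
Let sLL : s / LL <= 1. Proof. by rewrite ler_pdivrMr // mul1r. Qed.

Let scale_err m (A : R) : (m <= N)%N -> `|A| <= CN R N * (Num.sqrt s ^+ m / Num.sqrt s) + eN q X N ->
  `|A / sg ^+ m| <= CN R N * 2 ^+ N / Num.sqrt s + eN q X N.
Proof.
move=> mN hA; have sm : 1 <= sg ^+ m by exact: exprn_ege1.
have sm0 : 0 < sg ^+ m by exact: lt_le_trans sm.
have r0 : 0 < Num.sqrt s by rewrite sqrtr_gt0; exact: lt_le_trans s_ge1.
rewrite normrM normfV (gtr0_norm sm0) ler_pdivrMr //; apply: le_trans hA _; rewrite mulrDl; apply: lerD.
  have -> : CN R N * 2 ^+ N / Num.sqrt s * sg ^+ m = CN R N * (2 ^+ N * sg ^+ m / Num.sqrt s).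
    by move: (CN R N) (2 ^+ N) (Num.sqrt s)^-1 (sg ^+ m) => x y z t; ring.
  apply: ler_wpM2l => //; apply: ler_wpM2r; first by rewrite invr_ge0 ltW.
  apply: (@le_trans _ _ ((2 * sg) ^+ m)).
    rewrite lerXn2r ?nnegrE ?(ltW r0) ?mulr_ge0 ?(ltW sg0) //.
    rewrite -(ger0_norm (x := 2 * sg)) ?mulr_ge0 ?(ltW sg0) // -sqrtr_sqr; apply: ler_wsqrtr.
    have -> : (2 * sg) ^+ 2 = 2 * LL by rewrite exprMn sg2; move: (LL) => z; field.
    by apply: le_trans s_leLL _; apply: ler_peMl; [exact: ltW|rewrite ler1n].
  rewrite exprMn; apply: ler_wpM2r; first exact: ltW.
  by apply: ler_weXn2l => //; rewrite ler1n.
by apply: ler_peMr.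
Qed.

(** With [r] the ratio of the two standard deviations, [1 - r^m <= m (1 - r) <= m (1 - r^2)]. *)
Let gmom_err m : (m <= N)%N -> `|Mm R ps m / sg ^+ m - gmom R m| <=
  (\sum_(m < N.+1) `|gmom R m|) * (N%:R * (1 - s / LL)).
Proof.
move=> mN; pose r := Num.sqrt (s / 2) / sg.
have s0 : 0 <= s by exact: le_trans s_ge1.
have r0 : 0 <= r by rewrite divr_ge0 ?sqrtr_ge0 ?(ltW sg0).
have r2 : r ^+ 2 = s / LL.
  rewrite /r expr_div_n sg2 sqr_sqrtr ?divr_ge0 //.
  by move: LL0; move: (LL) s => u v u0; field; rewrite gt_eqF.
have r1 : r <= 1 by rewrite -(@expr_le1 _ 2) // r2.
have rm j : 1 - r ^+ j <= j%:R * (1 - r).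
  elim: j => [|j IH]; first by rewrite expr0 subrr mul0r.
  have p1 : r ^+ j <= 1 by exact: exprn_ile1.
  have p0 : 0 <= r ^+ j by exact: exprn_ge0.
  rewrite exprS -natr1; move: (r ^+ j) IH p1 p0 => z IH p1 p0; nra.
have -> : Mm R ps m / sg ^+ m - gmom R m = - (gmom R m * (1 - r ^+ m)).
  rewrite (Mm_gmom s_ge1) /r expr_div_n -/s.
  by move: (gmom R m) (Num.sqrt _ ^+ m) (sg ^+ m)^-1 => x y z; ring.
have rm1 : r ^+ m <= 1 by exact: exprn_ile1.
rewrite normrN normrM (ger0_norm (x := 1 - _)) ?subr_ge0 //.
apply: ler_pM => //; first by rewrite subr_ge0.
  have mN' : (m < N.+1)%N by [].
  by rewrite (bigD1 (Ordinal mN')) //= lerDl; apply: sumr_ge0.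
apply: le_trans (rm m) _; apply: ler_pM => //; rewrite ?subr_ge0 ?ler_nat // -r2.
by rewrite lerD2l lerN2 expr2; apply: ler_piMl.
Qed.

Let tot_err m A : (m <= N)%N -> `|A - Mm R ps m| <= CN R N * (Num.sqrt s ^+ m / Num.sqrt s) + eN q X N ->
  `|A / sg ^+ m - gmom R m| <= moment_error.
Proof.
move=> mN hA; rewrite -(subrKA (Mm R ps m / sg ^+ m)) -mulrBl.
by apply: le_trans (ler_normD _ _) _; apply: lerD; [exact: scale_err|exact: gmom_err].
Qed.

Let mean_div m (v : nat -> R) : mean q.-1 (fun k => v k * Xv k ^+ m) =
  mean q.-1 (fun k => v k * rP R pq ps k ^+ m) / sg ^+ m.
Proof.
rewrite [RHS]mulrC -meanZ; apply: eq_mean => k; rewrite /Xv expr_div_n -/sg.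
by move: (rP _ _ _ _ ^+ m) (sg ^+ m)^-1 => x y; ring.
Qed.

Lemma weighted_moments m : (m <= N)%N ->
  `|mean q.-1 (fun k => complex.Re (Wq k) * Xv k ^+ m) - gmom R m| <= moment_error /\
  `|mean q.-1 (fun k => complex.Im (Wq k) * Xv k ^+ m)| <= moment_error.
Proof.
move=> mN.
have H := mix_close (fun a b ab => wmoment_close pq wf s2ps DX Y1 psY YX Xq Nl s_ge1 ab mN).
have [h1 h2] := ReIm_close H.
have eR : complex.Re (avg q (fun k => Wq k * (rP R pq ps k ^+ m)%:C)) =
    mean q.-1 (fun k => complex.Re (Wq k) * rP R pq ps k ^+ m).
  by rewrite Re_avg; apply: eq_mean => k; rewrite mulrC Re_scale mulrC.
have eI : complex.Im (avg q (fun k => Wq k * (rP R pq ps k ^+ m)%:C)) =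
    mean q.-1 (fun k => complex.Im (Wq k) * rP R pq ps k ^+ m).
  by rewrite Im_avg; apply: eq_mean => k; rewrite mulrC Im_scale mulrC.
split; rewrite mean_div; first by apply: tot_err => //; rewrite -eR.
apply: (@le_trans _ _ (CN R N * 2 ^+ N / Num.sqrt s + eN q X N)).
  by apply: scale_err => //; rewrite -eI.
rewrite /moment_error -/s lerDl; apply: mulr_ge0; first exact: sumr_ge0.
by rewrite mulr_ge0 // subr_ge0.
Qed.

Lemma unweighted_moments m : (m <= N)%N ->
  `|mean q.-1 (fun k => Xv k ^+ m) - gmom R m| <= moment_error.
Proof.
move=> mN.
have U a b (ab : (a + b)%N = m) : `|avg q (fun k => (fun=> 1) k * (Psum R pq ps k ^+ a * Num.conj (Psum R pq ps k ^+ b))) -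
    ((a == b)%:R * (a`!%:R * s1 R ps ^+ a))%:C| <= (CN R N * (Num.sqrt (s1 R ps) ^+ m / Num.sqrt (s1 R ps)))%:C.
  rewrite (@eq_avg R q _ (fun k => Psum R pq ps k ^+ a * Num.conj (Psum R pq ps k ^+ b))); last by move=> k; rewrite mul1r.
  exact: (umoment_close pq wf s2ps Y1 psY YX Xq Nl s_ge1 ab mN).
have [h1 _] := ReIm_close (mix_close U).
rewrite (eq_mean _ (g := fun k => 1 * Xv k ^+ m)); last by move=> k; rewrite mul1r.
rewrite (mean_div m (fun=> 1)); apply: tot_err => //.
apply: (@le_trans _ _ (CN R N * (Num.sqrt s ^+ m / Num.sqrt s))); last by rewrite lerDl.
apply: le_trans h1; rewrite Re_avg le_eqVlt; apply/orP; left; apply/eqP; congr (`|_ - _|).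
by apply: eq_mean => k; rewrite !mul1r.
Qed.
End AtModulus.

(** * Numerical conditions for large moduli *)

Section Regime.
Variable R : realType.

Lemma expR_ge_monomial (x : R) n : 0 <= x -> x ^+ n <= n`!%:R * expR x.
Proof.
move=> x0; rewrite mulrC -ler_pdivrMr ?ltr0n ?fact_gt0 //.
apply: le_trans (sum_exp_le n.+1 x0); rewrite big_nat_recr //= lerDr.
by apply: sumr_ge0 => i _; rewrite divr_ge0 ?exprn_ge0.
Qed.

Lemma ln_le_2sqrt (x : R) : 0 < x -> ln x <= 2 * Num.sqrt x.
Proof.
move=> x0; have r0 : 0 < Num.sqrt x by rewrite sqrtr_gt0.
have -> : ln x = 2 * ln (Num.sqrt x) by rewrite -{1}(sqr_sqrtr (ltW x0)) lnXn // [RHS]mulr_natl.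
rewrite ler_pM2l //.
by have := ln_sublinear r0; move/ltW.
Qed.

Lemma summands_le (a b c d e f g h L : R) : 0 <= a -> 0 <= b -> 0 <= c -> 0 <= d -> 0 <= e -> 0 <= f ->
  0 <= g -> 0 <= h -> a + b + c + d + e + f + g + h <= L ->
  [/\ a <= L, b <= L, c <= L & d <= L] /\ [/\ e <= L, f <= L, g <= L & h <= L].
Proof. by move=> *; split; split; lra. Qed.

Lemma expR_half_le2 : expR (2^-1) <= 2 :> R.
Proof.
have := @expR_ge1Dx R (- 2^-1); have := expRxMexpNx_1 (2^-1 : R); have := expR_gt0 (2^-1 : R).
by move: (expR _) (expR _) => u v; nra.
Qed.

(** Collects the requirements of the fixed-modulus estimates. [A] is a free large constant: [rg_sA],
    [rg_eN] and [rg_dev] make the three parts of [moment_error] small. *)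
Record regime (c0 eta A : R) (q N : nat) : Prop := Regime {
  rg_LL : 800 <= ln (ln q%:R : R);
  rg_A : A <= ln (ln q%:R : R);
  rg_c0Y : (Num.truncn c0 <= Yq eta q 0)%N;
  rg_thL : 2 <= theta eta q 0 * ln q%:R;
  rg_Lq : 800 <= ln q%:R :> R;
  rg_ell : 2 ^- ell eta q 0 * expR ((Cc R + 1) * (ln (1 + ln q%:R) + 3)) <= 1;
  rg_err : 316 * (q%:R `^ 100^-1) ^+ 6 * isq q%:R <= 1 :> R;
  rg_NT : N%:R * theta eta q 0 <= 100^-1;
  rg_Nl : (N <= ell eta q 0)%N;
  rg_s1 : 1 <= s1 R (pblk c0 eta q 0);
  rg_sA : A <= s1 R (pblk c0 eta q 0);
  rg_sle : s1 R (pblk c0 eta q 0) <= ln (ln q%:R : R);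
  rg_dev : A * (ln (ln q%:R : R) - s1 R (pblk c0 eta q 0)) <= ln (ln q%:R : R);
  rg_ell3 : ln (ln q%:R : R) ^+ 3 <= (ell eta q 0)%:R;
  rg_eN : A * eN q (q%:R `^ 100^-1 : R) N <= 1 }.

Lemma isq_expE (q : nat) : (0 < q)%N -> isq (q%:R : R) = expR (- (ln q%:R / 2)).
Proof.
move=> q0; rewrite /isq expRN; congr (_^-1).
have -> : q%:R = expR (ln q%:R / 2) ^+ 2 :> R.
  by rewrite -expRM_natl mulrCA mulfV // mulr1 lnK // posrE ltr0n.
by rewrite sqrtr_sqr ger0_norm ?expR_ge0 // !lnXn ?expR_gt0 // expRK mulr2n; congr expR; field.
Qed.

Lemma eventually_regime (c0 eta A : R) (N : nat) : 0 <= c0 -> 0 < eta -> eta <= 1 -> 2 <= A ->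
  exists Lam, forall q, prime q -> Lam <= ln (ln q%:R : R) -> regime c0 eta A q N.
Proof.
move=> c00 eta0 eta1 A2.
pose t1 := (c0 + 2) / eta; pose t2 := `|ln (eta / 2)|; pose f : R := N`!%:R * N`!%:R.
have t10 : 0 <= t1 by rewrite divr_ge0 ?(ltW eta0) // addr_ge0.
have t20 : 0 <= t2 by exact: normr_ge0.
have f0 : 0 <= f by exact: mulr_ge0.
have A00 : 0 <= A0 c0 by exact: A0_ge0.
have C0 : 1 <= Cc R := Cc_ge1 R.
have e30 : 0 < expR 3 :> R by exact: expR_gt0.
have A0' : 0 <= A by apply: le_trans A2.
have a1 : 0 <= A * (2 + A0 c0 + t2) by rewrite mulr_ge0 // !addr_ge0.
have a2 : 0 <= A ^+ 2 by exact: sqr_ge0.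
have a3 : 0 <= f * A by exact: mulr_ge0.
have n0 : 0 <= N%:R :> R by [].
(* One nonnegative summand per requirement, extracted by [summands_le]. [5040 = 7!] comes from
   [LL^7 <= 7! expR LL], which makes [th 0 * ln q] large. *)
exists (800 + 5040 * t1 + 8 * (Cc R + 1) + 100 * N%:R + 2 * expR 3 + 2 * (A * (2 + A0 c0 + t2)) +
  400 * A ^+ 2 + 9 * (f * A)) => q pq.
set LL := ln (ln q%:R : R); set Lq : R := ln q%:R => big.
have [[b1 b2 b3 b4] [b5 b6 b7 b8]] := summands_le (ler0n R 800) (mulr_ge0 (ler0n R 5040) t10)
  (mulr_ge0 (ler0n R 8) (addr_ge0 (le_trans ler01 C0) ler01)) (mulr_ge0 (ler0n R 100) n0)
  (mulr_ge0 (ler0n R 2) (ltW e30)) (mulr_ge0 (ler0n R 2) a1) (mulr_ge0 (ler0n R 400) a2)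
  (mulr_ge0 (ler0n R 9) a3) big.
move: big => _.
have L0 : 0 < LL by apply: lt_le_trans b1; rewrite ltr0n.
have LL0 : 0 < ln (ln q%:R : R) := L0.
have Lq0 : 0 < Lq.
  by rewrite ltNge; apply/negP => h; move: L0; rewrite /LL ln0 ?ltxx.
have LqE : Lq = expR LL by rewrite lnK // posrE.
have e0 : 0 < expR LL by exact: expR_gt0.
have Le : LL <= expR LL by apply: le_trans (expR_ge1Dx _); rewrite lerDr.
have q0 := prime_gt0 pq.
have th0 : theta eta q 0 = eta / LL ^+ 5 by rewrite /theta expR0 mulr1.
have P5 : 0 < LL ^+ 5 by exact: exprn_gt0.
have P4 : 0 < LL ^+ 4 by exact: exprn_gt0.
have P3 : 0 < LL ^+ 3 by exact: exprn_gt0.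
have L1 : 1 <= LL by apply: le_trans b1; rewrite ler1n.
have p45 : LL ^+ 5 = LL * LL ^+ 4 by rewrite exprS.
have p34 : LL ^+ 4 = LL * LL ^+ 3 by rewrite exprS.
have p23 : LL ^+ 3 = LL * LL ^+ 2 by rewrite exprS.
have P2 : LL <= LL ^+ 2 by rewrite expr2; exact: ler_peMl (ltW L0) L1.
have P23 : LL ^+ 2 <= LL ^+ 3 by rewrite p23; apply: ler_peMl => //; exact: sqr_ge0.
have P34 : LL ^+ 3 <= LL ^+ 4 by rewrite p34; apply: ler_peMl => //; exact: ltW.
have tLq : theta eta q 0 * Lq = eta * expR LL / LL ^+ 5 by rewrite th0 LqE mulrAC.
have big1 : c0 + 2 <= theta eta q 0 * Lq.
  rewrite tLq ler_pdivlMr //.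
  have m7 : LL ^+ 7 <= 5040 * expR LL.
    have := expR_ge_monomial 7 (ltW L0); suff -> : 7`! = 5040%N by []; by [].
  have h : t1 * LL ^+ 6 <= expR LL.
    have p7 : LL ^+ 7 = LL * LL ^+ 6 by rewrite exprS.
    have P6 : 0 <= LL ^+ 6 by exact: exprn_ge0 (ltW L0).
    have p5040 : 0 < 5040 :> R by rewrite ltr0n.
    rewrite -(ler_pM2l p5040) mulrA; apply: le_trans m7; rewrite p7; exact: ler_wpM2r.
  have h5 : t1 * LL ^+ 5 <= expR LL.
    apply: le_trans h; apply: ler_wpM2l => //; rewrite exprS; apply: ler_peMl => //; exact: ltW.
  have := ler_wpM2l (ltW eta0) h5; have -> : eta * (t1 * LL ^+ 5) = (c0 + 2) * LL ^+ 5; last by [].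
  by rewrite /t1 mulrA (mulrC eta) divfK // gt_eqF.
have thL : 2 <= theta eta q 0 * Lq by apply: le_trans big1; rewrite lerDr.
have pE (x : R) : q%:R `^ x = expR (x * Lq) := powRqE pq x.
have th4 : theta eta q 0 <= (LL ^+ 4)^-1.
  rewrite th0 ler_pdivrMr // p45 mulrCA mulVf ?gt_eqF // mulr1; exact: le_trans eta1 L1.
have th00 : 0 < theta eta q 0 := th_gt0 eta0 LL0 0.
have ellx : LL ^+ 3 <= (ell eta q 0)%:R.
  rewrite /ell; set x := theta eta q 0 `^ (- (3 / 4)).
  have xge : LL ^+ 3 <= x.
    rewrite /x /powR gt_eqF // -{1}(lnK (x := LL)) ?posrE // -expRM_natl ler_expR.
    have : ln (theta eta q 0) <= - (4 * ln LL).
      have -> : - (4 * ln LL) = ln (LL ^+ 4)^-1 by rewrite lnV ?posrE // lnXn // mulr_natl.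
      by rewrite ler_ln ?posrE ?invr_gt0.
    by move: (ln (theta _ _ _)) (ln LL); clear => u v; lra.
  have := truncnS_gt x; rewrite -natr1 natrM.
  by move: xge b1 P2 P23; move: (LL ^+ 3) (LL ^+ 2) ((Num.truncn x)%:R : R) (x) (LL); clear => *; lra.
have c0Y : (Num.truncn c0 <= Yq eta q 0)%N.
  rewrite /Yq truncn_ge_nat ?powR_ge0 // pE; apply: (@le_trans _ _ c0); first by rewrite truncn_le.
  apply: le_trans (expR_ge1Dx _); apply: (@le_trans _ _ (c0 + 2)); first by rewrite lerDl.
  by apply: le_trans big1 _; rewrite lerDr.
have LLq : LL <= Lq by rewrite LqE.
have Lq800 : 800 <= Lq by exact: le_trans b1 LLq.
have eXi : (q%:R `^ 100^-1 : R) = expR (100^-1 * Lq) by exact: pE.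
have ee : ln (1 + Lq) <= LL + 1.
  rewrite -[leRHS]expRK ler_ln ?posrE ?expR_gt0 //; last by rewrite addr_gt0.
  rewrite LqE expRD; apply: (@le_trans _ _ (expR LL * 2)).
    by rewrite [leRHS]mulr_natr mulr2n lerD2r (le_trans L1).
  by apply: ler_wpM2l; [exact: ltW|exact: expR_ge1Dx].
have elle : 2 ^- ell eta q 0 * expR ((Cc R + 1) * (ln (1 + Lq) + 3)) <= 1.
  rewrite mulrC ler_pdivrMr ?exprn_gt0 // mul1r.
  apply: (@le_trans _ _ (expR (2^-1) ^+ ell eta q 0)); last first.
    by apply: lerXn2r; rewrite ?nnegrE ?expR_ge0 //; exact: expR_half_le2.
  rewrite -expRM_natl ler_expR; apply: (@le_trans _ _ ((Cc R + 1) * (LL + 4))).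
    apply: ler_wpM2l; first by rewrite addr_ge0 // (le_trans ler01).
    by move: ee; move: (ln (1 + Lq)) (LL); clear => *; lra.
  have : (Cc R + 1) * (LL + 4) <= LL / 8 * (2 * LL).
    by apply: ler_pM; move: b3 C0 b1; move: (Cc R) (LL); clear => *; lra.
  move: ellx P23; have -> : LL / 8 * (2 * LL) = LL ^+ 2 / 4 by rewrite expr2; move: (LL) => z; field.
  have := sqr_ge0 LL; move: ((Cc R + 1) * (LL + 4)) (LL ^+ 3) (LL ^+ 2) ((ell _ _ _)%:R : R).
  by clear => *; lra.
have Y1 := Yq_gt1 pq eta0 LL0 thL 0.
have lY1 := ln_Yq_le pq eta0 LL0 thL 0; have lY2 := ln_Yq_ge pq eta0 LL0 thL 0.
have s_up : s1 R (pblk c0 eta q 0) <= LL.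
  have := s1_le R Y1; rewrite (prime_interval_cat (leq0n _) c0Y) s1_cat.
  have := s1_ge0 R (prime_interval 0 (Num.truncn c0)) => h0 h1.
  have h2 : ln (1 + ln (Yq eta q 0)%:R) <= LL - 3 :> R.
    rewrite -[leRHS]expRK ler_ln ?posrE ?expR_gt0 //; last first.
      by apply: ltr_pwDl => //; rewrite ln_ge0 // ler1n ltnW.
    have h3 : theta eta q 0 * Lq <= expR LL / LL ^+ 4.
      by rewrite LqE mulrC; apply: ler_wpM2l => //; exact: ltW.
    have h4 : expR LL / LL ^+ 4 <= expR LL / (2 * expR 3).
      apply: ler_wpM2l; first exact: ltW.
      rewrite lef_pV2 ?posrE ?mulr_gt0 //; apply: le_trans b5 _; apply: le_trans P2 _.
      exact: le_trans P23 P34.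
    have h5 : 1 <= expR LL / (2 * expR 3) by rewrite ler_pdivlMr ?mulr_gt0 // mul1r; exact: le_trans b5 Le.
    have h6 : expR (LL - 3) = 2 * (expR LL / (2 * expR 3)).
      by rewrite expRB; field; rewrite gt_eqF.
    have z := le_trans lY1 (le_trans h3 h4).
    rewrite h6 [leRHS]mulr_natl mulr2n; exact: lerD h5 z.
  rewrite /pblk /=; apply: (@le_trans _ _ (ln (1 + ln (Yq eta q 0)%:R) + 3)); last by rewrite -lerBrDr.
  by apply: le_trans h1; rewrite lerDr.
have dev : A * (LL - s1 R (pblk c0 eta q 0)) <= LL.
  have := s1_ge R Y1; rewrite (prime_interval_cat (leq0n _) c0Y) s1_cat -/(A0 c0) => h1.
  have h2 : ln (eta / 2) + LL - 5 * ln LL <= ln (ln (Yq eta q 0)%:R).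
    have -> : ln (eta / 2) + LL - 5 * ln LL = ln (theta eta q 0 * Lq / 2).
      have -> : theta eta q 0 * Lq / 2 = (eta / 2) * expR LL * (LL ^+ 5)^-1.
        by rewrite tLq; move: (expR LL) (LL ^+ 5)^-1 => u v; field.
      have -> : ln (eta / 2 * expR LL * (LL ^+ 5)^-1) = ln (eta / 2 * expR LL) + ln (LL ^+ 5)^-1.
        by rewrite lnM ?posrE ?invr_gt0 ?mulr_gt0 ?divr_gt0.
      have -> : ln (eta / 2 * expR LL) = ln (eta / 2) + LL by rewrite lnM ?posrE ?divr_gt0 // expRK.
      by rewrite lnV ?posrE // lnXn // mulr_natl.
    have : 0 < theta eta q 0 * Lq / 2 by rewrite divr_gt0 // mulr_gt0.
    by move=> h; rewrite ler_ln ?posrE //; exact: lt_le_trans lY2.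
  have h3 : - t2 <= ln (eta / 2) by rewrite /t2 lerNl -normrN ler_norm.
  (* The power of [ln ln q] in [th 0] causes a deficit [5 ln LL <= 10 sqrt LL]; with
     [400 A^2 <= LL], [A] times this is at most [LL / 2]. *)
  have h4 := ln_le_2sqrt L0.
  have r0 : 0 <= Num.sqrt LL by exact: sqrtr_ge0.
  have r2 : Num.sqrt LL ^+ 2 = LL by rewrite sqr_sqrtr // ltW.
  have r20 : 20 * A <= Num.sqrt LL.
    rewrite -[leLHS]ger0_norm ?mulr_ge0 // -sqrtr_sqr; apply: ler_wsqrtr.
    by rewrite exprMn -natrX; apply: le_trans b7; rewrite ler_wpM2r.
  have h5 : A * (10 * Num.sqrt LL) <= LL / 2.
    by have := ler_wpM2r r0 r20; rewrite -expr2 r2; move: (Num.sqrt LL) (LL); clear => *; lra.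
  have h6 : LL - s1 R (pblk c0 eta q 0) <= (2 + A0 c0 + t2) + 10 * Num.sqrt LL.
    move: h1 h2 h3 h4; rewrite /pblk /=.
    move: (ln LL) (Num.sqrt LL) (ln (eta / 2)) (ln (ln (Yq eta q 0)%:R)) (s1 R (prime_interval _ (Yq _ _ _))) (A0 c0) (t2) (LL).
    by clear => *; lra.
  apply: le_trans (ler_wpM2l A0' h6) _; rewrite mulrDr.
  by move: b6 h5; move: (A * (2 + A0 c0 + t2)) (A * (10 * Num.sqrt LL)) (LL); clear => *; lra.
have s_half : LL / 2 <= s1 R (pblk c0 eta q 0).
  have h : 0 <= LL - s1 R (pblk c0 eta q 0) by rewrite subr_ge0.
  have := le_trans (ler_wpM2r h A2) dev; move: (s1 _ _) (LL); clear => *; lra.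
have A400 : 2 * A <= 400 * A ^+ 2 by rewrite expr2; move: A2; clear => *; nra.
have AL2 : 2 * A <= LL := le_trans A400 b7.
have AL : A <= LL by move: AL2 A0'; move: (LL); clear => *; lra.
have sA : A <= s1 R (pblk c0 eta q 0) by move: AL2 s_half; move: (s1 _ _) (LL); clear => *; lra.
have sone : 1 <= s1 R (pblk c0 eta q 0) by apply: le_trans sA; apply: le_trans A2; rewrite ler1n.
have err : 316 * (q%:R `^ 100^-1) ^+ 6 * isq q%:R <= 1 :> R.
  rewrite isq_expE // eXi -/Lq.
  (* [6/100 - 1/2 = - 11/25]: lengths up to [q^(1/100)] leave a negative power of [q]. *)
  have e : expR (100^-1 * Lq) ^+ 6 * expR (- (Lq / 2)) = (expR (11 / 25 * Lq))^-1.
    by rewrite -expRM_natl -expRD -expRN; congr expR; move: (Lq) => z; field.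
  rewrite -mulrA e ler_pdivrMr ?expR_gt0 // mul1r; apply: le_trans (expR_ge1Dx _).
  by move: Lq800; move: (Lq); clear => *; lra.
have NT : N%:R * theta eta q 0 <= 100^-1.
  apply: le_trans (ler_wpM2l n0 th4) _; rewrite ler_pdivrMr //.
  by move: P34 P23 P2 b4; move: (LL ^+ 4) (LL ^+ 3) (LL ^+ 2) (N%:R : R) (LL); clear => *; lra.
have Nl : (N <= ell eta q 0)%N.
  rewrite -(ler_nat R); apply: le_trans ellx.
  by move: P23 P2 b4 n0; move: (LL ^+ 3) (LL ^+ 2) (N%:R : R) (LL); clear => *; lra.
have eN1 : A * eN q (q%:R `^ 100^-1 : R) N <= 1.
  rewrite /eN isq_expE // eXi -/f -/Lq.
  have e : expR (100^-1 * Lq) ^+ 3 * expR (- (Lq / 2)) = (expR (47 / 100 * Lq))^-1.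
    by rewrite -expRM_natl -expRD -expRN; congr expR; move: (Lq) => z; field.
  have -> : A * (f * (4 * expR (100^-1 * Lq) ^+ 3 * expR (- (Lq / 2)))) = 4 * (f * A) / expR (47 / 100 * Lq).
    by rewrite -e; move: (expR (100^-1 * Lq) ^+ 3) (expR (- (Lq / 2))) (f) => x y z; ring.
  rewrite ler_pdivrMr ?expR_gt0 // mul1r; apply: le_trans (expR_ge1Dx _).
  by move: b8 LLq L0; move: (f * A) (Lq) (LL); clear => *; lra.
by split.
Qed.
End Regime.

(** * Smallness of the error terms *)

Section ErrorTerms.
Variable R : realType.
Local Notation nc := (@Normc.normc R).

Lemma moment_error_small (cn g nn d : R) : 0 <= cn -> 0 <= g -> 0 <= nn -> 0 < d ->
  exists2 A : R, 2 <= A & forall s LL en B : R, A <= B -> 1 <= s -> B <= s -> s <= LL ->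
    B * (LL - s) <= LL -> B * en <= 1 ->
  cn / Num.sqrt s + en + g * (nn * (1 - s / LL)) <= d.
Proof.
move=> cn0 g0 nn0 d0; pose t := 3 * cn / d; pose t2 := 3 * (g * nn) / d.
have t0 : 0 <= t by rewrite divr_ge0 ?(ltW d0) // mulr_ge0.
have t20 : 0 <= t2 by rewrite divr_ge0 ?(ltW d0) // !mulr_ge0.
have d30 : 0 <= 3 / d by rewrite divr_ge0 // ltW.
have tt0 := sqr_ge0 t.
exists (2 + t ^+ 2 + 3 / d + t2) => [|s LL en B AB s1 Bs sL dev en1].
  by move: tt0 d30 t20; move: (t ^+ 2) (3 / d) (t2); clear => *; lra.
have [B1 B2 B3 B0] : [/\ t ^+ 2 <= B, 3 / d <= B, t2 <= B & 0 < B].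
  by move: tt0 d30 t20 AB; move: (t ^+ 2) (3 / d) (t2); clear => *; split; lra.
have s0 : 0 < s by exact: lt_le_trans s1.
have L0 : 0 < LL by exact: lt_le_trans sL.
have r0 : 0 < Num.sqrt s by rewrite sqrtr_gt0.
have p1 : cn / Num.sqrt s <= d / 3.
  rewrite ler_pdivrMr //; have -> : cn = d / 3 * t by rewrite /t; field; rewrite gt_eqF.
  apply: ler_wpM2l; first by rewrite divr_ge0 // ltW.
  by rewrite -[leLHS]ger0_norm // -sqrtr_sqr; apply: ler_wsqrtr; exact: le_trans B1 Bs.
have p2 : en <= d / 3.
  case: (ltP en 0) => [e|e]; first by apply: (le_trans (ltW e)); rewrite divr_ge0 // ltW.
  have := le_trans (ler_wpM2r e B2) en1; rewrite mulrAC ler_pdivrMr // mul1r.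
  by move: d0; clear => *; lra.
pose x := 1 - s / LL.
have x0 : 0 <= x by rewrite subr_ge0 ler_pdivrMr // mul1r.
have Bx : B * x <= 1.
  have -> : B * x = B * (LL - s) / LL by rewrite /x; field; rewrite gt_eqF.
  by rewrite ler_pdivrMr // mul1r.
have p3 : g * (nn * x) <= d / 3.
  have -> : g * (nn * x) = d / 3 * (t2 * x) by rewrite /t2; field; rewrite gt_eqF.
  rewrite -[leRHS]mulr1; apply: ler_wpM2l; first by rewrite divr_ge0 // ltW.
  by apply: le_trans Bx; exact: ler_wpM2r.
by move: p1 p2 p3; rewrite -/x; move: (cn / _) (g * _); clear => *; lra.
Qed.

(** Exponent 12 because [bad_error_small] compares [LL^6] with an exponential in a multiple of
    [sqrt LL]. *)
Lemma pow12_le_expR : exists2 F : R, 0 < F & forall x : R, 0 <= x -> x ^+ 12 <= F * expR x.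
Proof.
suff h n : exists2 F : R, 0 < F & forall x : R, 0 <= x -> x ^+ n <= F * expR x by exact: h.
by exists n`!%:R => [|x x0]; [rewrite ltr0n fact_gt0|exact: expR_ge_monomial].
Qed.

(** [dl] is taken as large as allowed, of order [sqrt LL], so that [expR (- dl)] beats the power
    [LL^5] due to [1 / th 0]; and [l >= LL^3] beats the variance, of size [LL]. *)
Lemma bad_error_small (kp C c1 d : R) : 0 < kp -> 0 <= C -> 0 <= c1 -> 0 < d ->
  exists2 A : R, 0 <= A & forall LL l B1 B2 : R, 800 <= LL -> A <= LL -> LL ^+ 3 <= l ->
    B1 <= c1 * LL ^+ 5 -> 0 <= B2 -> B2 <= C + LL ->
  exists dl, [/\ 0 <= dl, 2 * dl + 1 <= kp * Num.sqrt (LL / 2)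
    & expR (- dl) * B1 + (l / 32)^-1 * B2 <= d].
Proof.
move=> kp0 C0 c10 d0; have [F F0 HF] := pow12_le_expR.
pose H := F * 64 * (4 / kp) ^+ 12.
have H0 : 0 <= H.
  by apply: mulr_ge0; [apply: mulr_ge0; [exact: ltW|exact: ler0n]|apply: exprn_ge0; rewrite divr_ge0 // ltW].
pose M := c1 * H + 32 * (C + 1).
have M0 : 0 <= M by apply: addr_ge0; apply: mulr_ge0 => //; rewrite addr_ge0.
have k20 : 0 <= (2 / kp) ^+ 2 by exact: sqr_ge0.
have Md : 0 <= M / d by rewrite divr_ge0 // ltW.
exists (2 * (2 / kp) ^+ 2 + M / d) => [|LL l B1 B2 L800 AL l3 hB1 B20 hB2].
  by rewrite addr_ge0 // mulr_ge0.
have [q1 q2] : 2 * (2 / kp) ^+ 2 <= LL /\ M / d <= LL.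
  by move: k20 Md AL; move: ((2 / kp) ^+ 2) (M / d); clear => *; split; lra.
have L0 : 0 < LL by apply: lt_le_trans L800; rewrite ltr0n.
have L1 : 1 <= LL by apply: le_trans L800; rewrite ler1n.
pose sg := Num.sqrt (LL / 2).
have sg2 : sg ^+ 2 = LL / 2 by rewrite sqr_sqrtr // divr_ge0 // ltW.
have ksg : 2 <= kp * sg.
  rewrite -ler_pdivrMl // mulrC -[leLHS]ger0_norm; last by rewrite divr_ge0 // ltW.
  by rewrite -sqrtr_sqr; apply: ler_wsqrtr; rewrite ler_pdivlMr // [leLHS]mulrC; exact: q1.
pose y := kp * sg / 4; pose dl := (kp * sg - 1) / 2.
have y0 : 0 <= y by rewrite divr_ge0 // (le_trans _ ksg).
have ydl : y <= dl by rewrite /y /dl; move: ksg; move: (kp * sg); clear => *; lra.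
exists dl; split; first exact: le_trans ydl.
  by rewrite /dl -/sg; move: (kp * sg) => z; lra.
have E0 : 0 < expR dl by exact: expR_gt0.
have L6 : LL ^+ 6 <= H * expR dl.
  have -> : LL ^+ 6 = 64 * (4 / kp) ^+ 12 * y ^+ 12.
    have -> : y ^+ 12 = (kp / 4) ^+ 12 * (LL / 2) ^+ 6.
      by rewrite -sg2 -exprM -exprMn /y mulrAC.
    have e1 : (4 / kp) ^+ 12 * (kp / 4) ^+ 12 = 1.
      by rewrite -exprMn -[RHS](expr1n _ 12); congr (_ ^+ _); field; rewrite gt_eqF.
    have e2 : 64 * (LL / 2) ^+ 6 = LL ^+ 6.
      by rewrite expr_div_n; have -> : (2 : R) ^+ 6 = 64; [rewrite -natrX|rewrite mulrCA mulfV ?mulr1].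
    move: e1 e2; move: ((4 / kp) ^+ 12) ((kp / 4) ^+ 12) ((LL / 2) ^+ 6) (LL ^+ 6); clear => u v w z e1 <-.
    by rewrite mulrA -(mulrA 64) e1 mulr1.
  have := le_trans (HF y y0) (ler_wpM2l (ltW F0) (_ : expR y <= expR dl)).
  rewrite ler_expR => /(_ ydl) h; rewrite /H.
  have p0 : 0 <= 64 * (4 / kp) ^+ 12 by apply: mulr_ge0 => //; apply: exprn_ge0; rewrite divr_ge0 // ltW.
  have := ler_wpM2l p0 h; move: ((4 / kp) ^+ 12) (y ^+ 12) (expR dl); clear => u v w.
  by have -> : 64 * u * (F * w) = F * 64 * u * w by ring.
have r1 : expR (- dl) * B1 <= c1 * H / LL.
  apply: (@le_trans _ _ (expR (- dl) * (c1 * LL ^+ 5))); first by apply: ler_wpM2l; [exact: expR_ge0|].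
  rewrite expRN ler_pdivlMr //.
  have -> : (expR dl)^-1 * (c1 * LL ^+ 5) * LL = c1 * LL ^+ 6 / expR dl.
    by rewrite [LL ^+ 6]exprSr; move: (LL ^+ 5) (expR dl)^-1 => u v; ring.
  by rewrite ler_pdivrMr // -mulrA; apply: ler_wpM2l.
have P3 : 0 < LL ^+ 3 by exact: exprn_gt0.
have l0 : 0 < l by exact: lt_le_trans l3.
have r2 : (l / 32)^-1 * B2 <= 32 * (C + 1) / LL.
  rewrite invf_div mulrAC ler_pdivrMr // mulrAC ler_pdivlMr //.
  have h1 : B2 <= (C + 1) * LL.
    by apply: le_trans hB2 _; rewrite mulrDl mul1r lerD2r; exact: ler_peMr.
  have h2 : LL * LL <= l.
    apply: le_trans l3; rewrite exprS expr2; apply: ler_wpM2l; first exact: ltW.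
    by apply: ler_peMl => //; exact: ltW.
  rewrite -!mulrA; apply: ler_wpM2l => //.
  apply: (@le_trans _ _ ((C + 1) * LL * LL)); first by apply: ler_wpM2r; [exact: ltW|].
  by rewrite -mulrA; apply: ler_wpM2l => //; rewrite addr_ge0.
apply: le_trans (lerD r1 r2) _; rewrite -mulrDl -/M ler_pdivrMr // mulrC.
by rewrite -ler_pdivrMr.
Qed.

Lemma ncD (x y : R[i]) : nc (x + y) <= nc x + nc y.
Proof. by rewrite -lecR realCD -!normC_nc ler_normD. Qed.

Lemma ncB (x y : R[i]) : nc (x - y) = nc (y - x).
Proof. by apply: (@complexI R); rewrite -!normC_nc distrC. Qed.

Lemma nc_real (x : R) : nc x%:C = `|x|.
Proof. by apply: (@complexI R); rewrite -normC_nc normC_real. Qed.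

Lemma nc_le_ReIm (z : R[i]) : nc z <= `|complex.Re z| + `|complex.Im z|.
Proof.
case: z => a b /=; have p : 0 <= `|a| + `|b| by rewrite addr_ge0.
rewrite -[leRHS]ger0_norm // -sqrtr_sqr; apply: ler_wsqrtr.
rewrite -(real_normK (num_real a)) -(real_normK (num_real b)).
by have := normr_ge0 a; have := normr_ge0 b; move: `|a| `|b|; clear => u v *; nra.
Qed.

(** Normalization by a total weight close to 1, which therefore has modulus at least 1/2. *)
Lemma ratio_close (num den : R[i]) (G u e : R) : nc (num - G%:C) <= u -> nc (den - 1) <= u ->
  u <= 2^-1 -> 2 * (1 + `|G|) * u <= e -> nc (den^-1 * num - G%:C) <= e.
Proof.
move=> h1 h2 u2 ue.
have d1 : 2^-1 <= nc den.
  have := ncD (den - (den - 1)) (den - 1).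
  have -> : den - (den - 1) = (1 : R)%:C by rewrite opprB addrCA subrr addr0.
  rewrite nc_real normr1 => _; have := ncD den (1 - den); rewrite addrC subrK.
  have -> : nc 1 = 1 by have := nc_real 1; rewrite normr1.
  by rewrite (ncB 1); move: h2 u2; move: (nc den) (nc _); clear => *; lra.
have dp : 0 < nc den by apply: lt_le_trans d1; rewrite invr_gt0.
have dn : den != 0.
  by apply/eqP => z; move: dp; rewrite z; have := nc_real 0; rewrite normr0 => ->; rewrite ltxx.
have -> : den^-1 * num - G%:C = den^-1 * ((num - G%:C) + G%:C * (1 - den)) by field.
have nv : nc den^-1 = (nc den)^-1.
  apply: (mulIf (lt0r_neq0 dp)); rewrite mulVf ?gt_eqF // -ncM mulVf //.
  by have := nc_real 1; rewrite normr1.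
rewrite ncM nv mulrC ler_pdivrMr //.
have e0 : 0 <= e.
  by apply: le_trans ue; rewrite !mulr_ge0 ?addr_ge0 // (le_trans _ h1) // normc_ge0.
apply: (@le_trans _ _ ((1 + `|G|) * u)); last first.
  apply: (@le_trans _ _ (e * 2^-1)); last exact: ler_wpM2l.
  by move: ue; rewrite -mulrA; move: ((1 + `|G|) * u); clear => *; lra.
apply: le_trans (ncD _ _) _; rewrite mulrDl mul1r; apply: lerD => //.
by rewrite ncM nc_real (ncB 1); apply: ler_wpM2l.
Qed.

Lemma le_three (p w r i e : R) : p <= r + i -> w <= e -> r <= e -> i <= e -> p + w <= 3 * e.
Proof. by move=> *; lra. Qed.

Lemma cvgC_eps (I : Type) (F : set_system I) (FF : Filter F) (u : I -> R[i]) (l : R[i]) :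
  (forall e : R, 0 < e -> \forall i \near F, nc (u i - l) <= e) ->
  (u i : R[i]^o) @[i --> F] --> (l : R[i]^o).
Proof.
move=> H; apply/cvgrPdist_le => e e0.
have eE : e = (complex.Re e)%:C.
  by move: e0; rewrite ltcE /= => /andP[/eqP + _]; case: (e) => a b /= ->.
have re0 : 0 < complex.Re e by move: e0; rewrite ltcE /= => /andP[].
near=> i; rewrite distrC normC_nc eE lecR; near: i; exact: H.
Unshelve. all: by end_near. Qed.
End ErrorTerms.

(** * The weighted measure in terms of averages *)

Section MeasureAtModulus.
Variables (R : realType) (q : nat).
Hypothesis pq : prime q.
Local Notation nc := (@Normc.normc R).
Local Notation dchar := (@dchar R q pq).

Lemma sum_primitive (S : set (int -> R[i])) (f : (int -> R[i]) -> R[i]) :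
  \sum_(chi \in primitive_characters q `&` S) f chi =
  \sum_(k <- iota 1 q.-1.-1 | dchar k \in S) f (dchar k).
Proof.
have kE k : (k \in iota 1 q.-1.-1) = (0 < k < q.-1)%N.
  by rewrite mem_iota; apply/idP/idP; clear; lia.
rewrite (_ : primitive_characters q `&` S =
    [set` [seq chi <- [seq dchar k | k <- iota 1 q.-1.-1] | chi \in S]]); last first.
  rewrite (primitive_charactersE R pq); apply/seteqP; split => chi /=.
    move=> [[k /= kk <-] Sk]; rewrite mem_filter; apply/andP; split; first exact/mem_set.
    by apply/mapP; exists k => //; rewrite kE.
  rewrite mem_filter => /andP[/set_mem Sc /mapP[k kk ck]]; split => //.
  by exists k; rewrite -?ck //=; rewrite -kE.
rewrite -fsbig_seq; first by rewrite big_filter big_map.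
rewrite filter_uniq // map_inj_in_uniq ?iota_uniq // => j k; rewrite !kE => /andP[_ jq] /andP[_ kq].
by apply: dchar_inj; rewrite inE.
Qed.

(** Separates the principal character [k = 0], which [avg] includes and the measure excludes. *)
Lemma avg_split (f : nat -> R[i]) :
  (q.-1%:R)^-1 * \sum_(k <- iota 1 q.-1.-1) f k = avg q f - (q.-1%:R)^-1 * f 0%N.
Proof.
have n0 : (0 < q.-1)%N by have := prime_gt1 pq; clear; lia.
rewrite /avg -mulrBr; congr (_ * _).
rewrite -(big_mkord xpredT f) big_ltn // addrAC subrr add0r /index_iota.
by rewrite subn1.
Qed.

Variables (c0 eta : R) (J : nat).
Hypotheses (c0_ge0 : 0 <= c0) (eta0 : 0 < eta) (LL0 : 0 < ln (ln q%:R : R)).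
Hypothesis c0Y : (Num.truncn c0 <= Yq eta q 0)%N.
Hypothesis thJ1 : theta eta q J <= 1.
Local Notation W := (@Wq R c0 eta q pq J).
Local Notation Yv := (@Yv R q pq).
Variables (a b : R).
Local Notation ind := (fun k => \1_`]a, b[ (Yv k) : R).

Let weightE k : (0 < k < q.-1)%N -> weight c0 eta q J (dchar k) = W k.
Proof. by move=> kq; rewrite /weight (dirichlet_LE R pq kq) (mollifierE pq c0_ge0 eta0 LL0 c0Y thJ1). Qed.

(** [Yv] uses [ln 0 = 0] where the event has [lne 0 = -oo]; at a zero of [L] the weight vanishes, so
    both sides are 0 there. *)
Let event_term k : (0 < k < q.-1)%N ->
  (if dchar k \in central_value_event q a b then weight c0 eta q J (dchar k) else 0) = W k * (ind k)%:C.
Proof.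
move=> kq; rewrite weightE //.
have [L0|L0] := eqVneq (nc (@Lhz R q pq k)) 0.
  have -> : W k = 0.
    have z : @Lhz R q pq k = 0 by apply/eqP; rewrite -normr_eq0 normC_nc L0.
    by rewrite /Wq z mul0r.
  by rewrite mul0r if_same.
have Lp : 0 < nc (@Lhz R q pq k) by rewrite lt0r L0 normc_ge0.
have ev : (dchar k \in central_value_event q a b) = (a < Yv k) && (Yv k < b).
  have pk : primitive_characters q (dchar k) by rewrite (primitive_charactersE R pq); exists k.
  have [[ch _] np] := pk.
  have e : (lne (nc (dirichlet_L 2^-1 (dchar k)))%:E * ((Num.sqrt (ln (ln q%:R) / 2))^-1)%:E)%E = (Yv k)%:E.
    by rewrite (dirichlet_LE R pq kq) lne_EFin // -EFinM.
  apply/idP/idP => [/set_mem[_ _]|h]; first by rewrite /= e !lte_fin.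
  by apply/mem_set; split => //=; rewrite e !lte_fin.
rewrite ev indic_itvE; case: (_ && _); first by rewrite mulr1.
by rewrite mulr0.
Qed.

(** The three errors in [3 * e] are the real part, the imaginary part and the principal character.
    Numerator and denominator are treated alike, with limits [G] and 1. *)
Lemma measure_close (G e d : R) : 3 * e <= 2^-1 -> 2 * (1 + `|G|) * (3 * e) <= d ->
  `|mean q.-1 (fun k => complex.Re (W k) * ind k) - G| <= e -> `|mean q.-1 (fun k => complex.Im (W k) * ind k)| <= e ->
  `|mean q.-1 (fun k => complex.Re (W k)) - 1| <= e -> `|mean q.-1 (fun k => complex.Im (W k))| <= e ->
  nc (W 0%N) <= e * q.-1%:R ->
  nc (weighted_measure c0 eta q J (central_value_event q a b) - G%:C) <= d.
Proof.
move=> e2 ed hR hI gR gI h0.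
have n0 : 0 < q.-1%:R :> R by rewrite ltr0n; have := prime_gt1 pq; clear; lia.
have nC : (q.-1%:R : R[i])^-1 = ((q.-1%:R : R)^-1)%:C by rewrite fmorphV /= rmorph_nat.
have numE : \sum_(chi \in primitive_characters q `&` central_value_event q a b) weight c0 eta q J chi =
    \sum_(k <- iota 1 q.-1.-1) W k * (ind k)%:C.
  rewrite sum_primitive big_mkcond; apply: eq_big_seq => k; rewrite mem_iota => kk.
  by apply: event_term; move: kk; clear; lia.
have denE : total_weight c0 eta q J = \sum_(k <- iota 1 q.-1.-1) W k.
  rewrite /total_weight -(setIT (primitive_characters q)) sum_primitive.
  rewrite big_seq_cond [RHS]big_seq; apply: eq_big => [k|k /andP[kk _]]; first by rewrite in_setT andbT.
  by apply: weightE; move: kk; rewrite mem_iota; clear; lia.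
have c1 : (q.-1%:R : R[i])^-1 != 0 by rewrite nC; apply/eqP => /(@complexI R _ 0)/eqP; rewrite gt_eqF // invr_gt0.
have -> : weighted_measure c0 eta q J (central_value_event q a b) =
    ((q.-1%:R)^-1 * \sum_(k <- iota 1 q.-1.-1) W k)^-1 * ((q.-1%:R)^-1 * \sum_(k <- iota 1 q.-1.-1) W k * (ind k)%:C).
  by rewrite /weighted_measure numE denE invfM mulrACA mulVf // mul1r.
have t0 (x : R) : 0 <= x -> x <= 1 -> nc ((q.-1%:R)^-1 * (W 0%N * x%:C)) <= e.
  move=> x0 x1; rewrite nC ncM (ncM (W 0%N)) !nc_real (ger0_norm x0) ger0_norm ?invr_ge0 ?(ltW n0) //.
  rewrite mulrC ler_pdivrMr //; apply: le_trans h0.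
  by apply: ler_piMr => //; exact: normc_ge0.
have close (V : nat -> R[i]) (x g : R) : nc ((q.-1%:R)^-1 * V 0%N) <= e ->
    `|mean q.-1 (fun k => complex.Re (V k)) - g| <= e -> `|mean q.-1 (fun k => complex.Im (V k))| <= e ->
    nc ((q.-1%:R)^-1 * \sum_(k <- iota 1 q.-1.-1) V k - g%:C) <= 3 * e.
  move=> v0 vR vI; rewrite avg_split addrAC; apply: le_trans (ncD _ _) _.
  have -> : nc (- ((q.-1%:R)^-1 * V 0%N)) = nc ((q.-1%:R)^-1 * V 0%N).
    by apply: (@complexI R); rewrite -!normC_nc normrN.
  have p := nc_le_ReIm (avg q V - g%:C).
  have pR : complex.Re (avg q V - g%:C) = mean q.-1 (fun k => complex.Re (V k)) - g.
    by rewrite -Re_avg; case: (avg q V).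
  have pI : complex.Im (avg q V - g%:C) = mean q.-1 (fun k => complex.Im (V k)).
    by rewrite -Im_avg; case: (avg q V) => x1 y1 /=; rewrite subr0.
  rewrite pR pI in p; exact: le_three p v0 vR vI.
apply: ratio_close e2 ed.
  apply: (close (fun k => W k * (ind k)%:C) 0).
  - by apply: t0; rewrite indic_itvE; case: (_ && _).
  - by rewrite (eq_mean _ (g := fun k => complex.Re (W k) * ind k)) // => k; rewrite mulrC Re_scale mulrC.
  - by rewrite (eq_mean _ (g := fun k => complex.Im (W k) * ind k)) // => k; rewrite mulrC Im_scale mulrC.
rewrite -[X in _ - X]/((1 : R)%:C); apply: (close W 0 1) => //.
by have := t0 1 ler01 (lexx _); rewrite mulr1.
Qed.
End MeasureAtModulus.

(** * Choice of the constants and conclusion *)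

Theorem theorem1p2 (R : realType) :
  exists C0 : R, forall c0 : R, C0 <= c0 ->
  exists2 eta0 : R, 0 < eta0 & forall eta : R, 0 < eta -> eta <= eta0 ->
  forall J : nat -> nat,
    (\forall q \near primes_to_infinity,
       eta <= theta eta q (J q) <= expR 1 * eta) ->
  forall a b : R, a < b ->
    (weighted_measure c0 eta q (J q) (central_value_event q a b) : R[i]^o)
      @[q --> primes_to_infinity]
    --> (((Num.sqrt (2 * pi))^-1 *
          \int[lebesgue_measure]_(u in `[a, b]) expR (- (u ^+ 2 / 2)))%:C
          : R[i]^o).
Proof.
(* Primes up to [c0] enter only through the constant [A0]. [tau] is the bound on [theta_J ^ (1/4)]
   required by [mollD_length]. *)
exists 0 => c0 c00; pose tau : R := 1000^-1.
have tau0 : 0 < tau by rewrite invr_gt0 ltr0n.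
have tau1 : tau <= 1 by rewrite invf_le1 ?ltr0n ?ler1n.
have t41 : tau ^+ 4 <= 1 by apply: exprn_ile1 => //; exact: ltW.
(* Since [theta_J <= e * eta], this choice gives [theta_J <= tau ^+ 4]. *)
exists (expR (-1) * tau ^+ 4); first by rewrite mulr_gt0 ?expR_gt0 ?exprn_gt0.
move=> eta eta0 etale J HJ a b ab; rewrite -gint_indic; set G := gint _.
have FF : Filter primes_to_infinity by exact: within_filter.
apply: (cvgC_eps FF) => e0 e00.
have eta1 : eta <= 1.
  apply: (le_trans etale); rewrite -[leRHS]mulr1; apply: ler_pM => //; rewrite ?expR_ge0 ?exprn_ge0 ?(ltW tau0) //.
have K0 : 0 < K5 c0.
  by rewrite /K5 ltr_wpDl // mulr_ge0 ?expR_ge0 // addr_ge0 // mulr_ge0 // expR_ge0.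
(* Bounds the mean square of the weight for all large [q], because [theta_J >= eta]. *)
pose C := K5 c0 / eta; have C0 : 0 < C by exact: divr_gt0.
have G1 : 0 < 6 * (1 + `|G|) by rewrite mulr_gt0 // ltr_pwDl.
(* Dictated by [measure_close]: [3 e <= 1/2] and [6 (1 + |G|) e <= e0]. *)
pose e := Num.min 6^-1 (e0 / (6 * (1 + `|G|))).
have ep : 0 < e by rewrite lt_min invr_gt0 divr_gt0 // ltr0n.
have e3 : 3 * e <= 2^-1.
  have h : e <= 6^-1 by rewrite ge_min lexx.
  by move: h; move: (e); clear => *; lra.
have e4 : 2 * (1 + `|G|) * (3 * e) <= e0.
  have -> : 2 * (1 + `|G|) * (3 * e) = e * (6 * (1 + `|G|)) by move: (`|G|) (e) => x y; ring.
  by rewrite -ler_pdivlMr // ge_min lexx orbT.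
have [N0 [d d0 [kp kp0 H]]] := stable_clt ab ep C0.
(* At least 1, so that the mean square of the prime sum is covered as well; [d'] serves both
   [stable_clt] and the total mass. *)
pose N := maxn N0 1; pose d' := Num.min d e.
have Npos : (0 < N)%N by rewrite /N leq_max orbT.
have d'0 : 0 < d' by rewrite lt_min d0 ep.
have d'd : d' <= d by rewrite ge_min lexx.
have d'e : d' <= e by rewrite ge_min lexx orbT.
have cn0 : 0 <= CN R N * 2 ^+ N.
  by rewrite mulr_ge0 ?exprn_ge0 // /CN mulr_ge0 // addr_ge0 ?mulr_ge0 ?expR_ge0.
have g0 : 0 <= \sum_(m < N.+1) `|gmom R m| by exact: sumr_ge0.
have [A1 A12 HA1] := moment_error_small cn0 g0 (ler0n R N) d'0.
pose c1 := 2 * C + 4 * expR 5 / eta + C + 2.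
have c10 : 0 <= c1.
  by rewrite /c1 !addr_ge0 ?mulr_ge0 ?expR_ge0 ?invr_ge0 ?(ltW C0) ?(ltW eta0) // (ltW K0).
have [A2 A20 HA2] := bad_error_small kp0 (ltW C0) c10 d'0.
have A2' : 2 <= A1 + A2 by rewrite ler_wpDr.
have [Lam HL] := eventually_regime N c00 eta0 eta1 A2'.
case: HJ => NJ _ HJ.
(* Thresholds for the condition on [J], for [ln ln q >= Lam], and for [q - 1 >= C / e^2], which
   disposes of the principal character. *)
exists (maxn NJ (maxn (Num.truncn (expR (expR Lam))).+1 (Num.truncn (C / e ^+ 2)).+2)) => // q /=.
rewrite !geq_max => /and3P[q1 q2 q3] pq; have /andP[thlo thhi] := HJ q q1 pq.
have hq : expR (expR Lam) <= q%:R.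
  by apply: ltW; apply: lt_le_trans (truncnS_gt _) _; rewrite ler_nat.
have h1 : expR Lam <= ln q%:R.
  by rewrite -[leLHS]expRK ler_ln ?posrE ?expR_gt0 // (lt_le_trans (expR_gt0 _) hq).
have h2 : Lam <= ln (ln q%:R).
  by rewrite -[leLHS]expRK ler_ln ?posrE ?expR_gt0 // (lt_le_trans (expR_gt0 _) h1).
have rg := HL q pq h2.
have L800 := rg_LL rg.
have LL2 : 2 <= ln (ln q%:R : R) by apply: le_trans L800; rewrite ler_nat.
have LL0 : 0 < ln (ln q%:R : R) by apply: lt_le_trans LL2.
have Lq23 : 23 <= ln q%:R :> R by apply: le_trans (rg_Lq rg); rewrite ler_nat.
have thJp : 0 < theta eta q (J q) by exact: lt_le_trans thlo.
have thJ4 : theta eta q (J q) <= tau ^+ 4.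
  apply: (le_trans thhi); have := ler_wpM2l (expR_ge0 1) etale.
  by rewrite mulrA -expRD subrr expR0 mul1r.
have thJ1 : theta eta q (J q) <= 1 by exact: le_trans t41.
have thJs : theta eta q (J q) `^ 4^-1 <= 1000^-1.
  rewrite -/tau /powR gt_eqF // -[leRHS](lnK (x := tau)) ?posrE // ler_expR.
  have : ln (theta eta q (J q)) <= ln (tau ^+ 4) by rewrite ler_ln ?posrE ?exprn_gt0.
  by rewrite lnXn // -mulr_natl; move: (ln (theta _ _ _)) (ln tau); clear => *; lra.
have KJ : K5 c0 / theta eta q (J q) <= C.
  by apply: ler_wpM2l; [exact: ltW|rewrite lef_pV2 ?posrE].
have KJ0 : 0 <= K5 c0 / theta eta q (J q) by rewrite divr_ge0 // ltW.
have ME : moment_error c0 eta q N <= d'.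
  apply: (HA1 _ _ _ (A1 + A2)); rewrite ?lerDl //.
  - exact: rg_s1 rg.
  - exact: rg_sA rg.
  - exact: rg_sle rg.
  - exact: rg_dev rg.
  - exact: rg_eN rg.
have A2L : A2 <= ln (ln q%:R : R).
  by apply: le_trans (rg_A rg); rewrite lerDr; exact: le_trans A12.
have P1 : 1 <= ln (ln q%:R : R) ^+ 5.
  by apply: exprn_ege1; apply: le_trans LL2; rewrite ler1n.
have hB1 : 2 * (K5 c0 / theta eta q (J q)) + (4 * expR 5 / theta eta q 0 + (K5 c0 / theta eta q 0 + 2))
    <= c1 * ln (ln q%:R : R) ^+ 5.
  have thV (x : R) : x / theta eta q 0 = x / eta * ln (ln q%:R : R) ^+ 5.
    by rewrite /theta expR0 mulr1 invf_div mulrA mulrAC.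
  rewrite !thV -/C /c1.
  have CP : C <= C * ln (ln q%:R : R) ^+ 5 by apply: ler_peMr => //; exact: ltW.
  move: KJ CP P1; move: (K5 c0 / theta _ _ _) (C) (4 * expR 5 / eta) (ln (ln q%:R : R) ^+ 5).
  by clear => k c x p *; lra.
have [dl [dl0 dl1 Hdl]] := HA2 _ _ _ _ L800 A2L (rg_ell3 rg) hB1
  (addr_ge0 KJ0 (ltW LL0)) (lerD KJ (lexx _)).
have bad := le_trans (mean_bad_le pq c00 eta0 LL2 (rg_c0Y rg) (rg_thL rg) Lq23 (rg_ell rg) (rg_err rg)
  thJ1 thJs Npos (rg_NT rg) (rg_Nl rg) (rg_sle rg) dl0 dl1) (le_trans Hdl d'd).
have wC := le_trans (mean_Wq2 pq c00 eta0 LL2 (rg_c0Y rg) (rg_thL rg) Lq23 (rg_ell rg) (rg_err rg) thJ1 thJs) KJ.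
have WM m : (m <= N)%N -> _ := @weighted_moments R c0 eta q pq eta0 LL2 (rg_c0Y rg) (rg_thL rg) Lq23 _ thJ1 thJs N
  (rg_NT rg) (rg_Nl rg) (rg_s1 rg) (rg_sle rg) m.
have UM m : (m <= N)%N -> _ := @unweighted_moments R c0 eta q pq eta0 LL2 (rg_c0Y rg) (rg_thL rg) Lq23 _ thJ1 N
  (rg_NT rg) (rg_Nl rg) (rg_s1 rg) (rg_sle rg) m.
have mN m : (m < N0)%N -> (m <= N)%N by move=> h; apply: (leq_trans (ltnW h)); rewrite leq_max leqnn.
have UMd m : (m < N0)%N -> `|mean q.-1 (fun k => Xv c0 eta pq k ^+ m) - gmom R m| <= d.
  by move=> h; apply: le_trans (UM m (mN m h)) (le_trans ME d'd).
pose W := Wq c0 eta pq (J q).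
(* The limiting mass is [c = 1] here and [c = 0] for the imaginary part; the majorant is the modulus
   of the weight in both cases. *)
have hR : `|mean q.-1 (fun k => complex.Re (W k) * \1_`]a, b[ (Yv R pq k)) - G| <= e.
  have := H q.-1 (fun k => complex.Re (W k)) (fun k => Normc.normc (W k)) (Xv c0 eta pq) (Yv R pq) 1.
  rewrite mul1r; apply => //; first by rewrite normr1.
    by move=> k; exact: Re_le_nc.
  move=> m h; rewrite mul1r; have [w1 _] := WM m (mN m h).
  exact: le_trans w1 (le_trans ME d'd).
have hI : `|mean q.-1 (fun k => complex.Im (W k) * \1_`]a, b[ (Yv R pq k))| <= e.
  have := H q.-1 (fun k => complex.Im (W k)) (fun k => Normc.normc (W k)) (Xv c0 eta pq) (Yv R pq) 0.
  rewrite mul0r subr0; apply => //; first by rewrite normr0.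
    by move=> k; exact: Im_le_nc.
  move=> m h; rewrite mul0r subr0; have [_ w2] := WM m (mN m h).
  exact: le_trans w2 (le_trans ME d'd).
(* The moment of order 0 is the total weight. *)
have [g1 g2] := WM 0%N (leq0n _).
have gR : `|mean q.-1 (fun k => complex.Re (W k)) - 1| <= e.
  apply: le_trans (le_trans ME d'e); apply: le_trans g1; rewrite gmom0 le_eqVlt; apply/orP; left; apply/eqP.
  by congr (`|_ - _|); apply: eq_mean => k; rewrite expr0 mulr1.
have gI : `|mean q.-1 (fun k => complex.Im (W k))| <= e.
  apply: le_trans (le_trans ME d'e); apply: le_trans g2; rewrite le_eqVlt; apply/orP; left; apply/eqP.
  by congr (`|_|); apply: eq_mean => k; rewrite expr0 mulr1.
have n1 : (0 < q.-1)%N by have := prime_gt1 pq; clear; lia.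
have n0 : 0 < q.-1%:R :> R by rewrite ltr0n.
have MC := measure_close c00 eta0 LL0 (rg_c0Y rg) thJ1 e3 e4 hR hI gR gI.
suff h0 : Normc.normc (W 0%N) <= e * q.-1%:R.
  have h3 := MC h0.
  first [exact: h3 | refine h3 | (move: h3; rewrite /weighted_measure /total_weight => h3; exact h3)].
(* A single term of the mean square: [|W 0|^2 <= (q - 1) C <= (e (q - 1))^2]. *)
rewrite -(ler_pXn2r (n := 2)) ?nnegrE ?normc_ge0 ?mulr_ge0 ?(ltW ep) //.
move: wC; rewrite /mean ler_pdivrMl // => wC.
apply: (@le_trans _ _ (q.-1%:R * C)).
  apply: le_trans wC; rewrite (bigD1 (Ordinal n1)) //= lerDl.
  by apply: sumr_ge0 => k _; exact: sqr_ge0.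
have Cq : C / e ^+ 2 <= q.-1%:R.
  apply: ltW; apply: lt_le_trans (truncnS_gt _) _; rewrite ler_nat.
  by move: q3; move: (Num.truncn _) => t; clear; lia.
move: Cq; rewrite ler_pdivrMr ?exprn_gt0 // => Cq.
rewrite exprMn [leRHS]mulrC expr2 -mulrA; apply: ler_wpM2l; [exact: ltW|].
exact: Cq.
Qed.
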